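(* Let $B$ be a maximal Blaschke product with critical set $\mathcal{C}$. Then $$\lim_{z\to\zeta}\left(1-|z|^2\right)\frac{|B'(z)|}{1-|B(z)|^2}=1$$ (limit over $z\in\mathbb{D}$) for every $\zeta\in\partial\mathbb{D}\setminus\overline{\mathcal{C}}$.
   Context: Let $\mathbb{D}=\{z\in\mathbb{C}:|z|<1\}$ and let $H^{\infty}$ be the space of bounded analytic functions on $\mathbb{D}$ with the sup norm $\|\cdot\|_\infty$. Sequences of points in $\mathbb{D}$ may be empty, finite or infinite, and are regarded as sets of points with multiplicities. A nonconstant $f\in H^\infty$ has critical set $\mathcal{C}$ if the zeros of $f'$ are precisely the points of the sequence $\mathcal{C}$, counting multiplicities. A sequence $\mathcal{C}$ in $\mathbb{D}$ is an $H^{\infty}$ critical set if it is the critical set of some nonconstant $f\in H^{\infty}$. For an $H^\infty$ critical set $\mathcal{C}$, let $\mathcal{F}_{\mathcal{C}}$ be the set of all $f\in H^{\infty}$ such that $f'$ vanishes at every point of $\mathcal{C}$ to at least the prescribed multiplicity, and let $N$ be the number of times $0$ appears in $\mathcal{C}$. The extremal problem $\max\{\operatorname{Re} f^{(N+1)}(0): f\in\mathcal{F}_{\mathcal{C}},\ \|f\|_\infty\le 1\}$ has a unique solution $B_{\mathcal{C}}$; it is a Blaschke product with critical set $\mathcal{C}$. A maximal Blaschke product with critical set $\mathcal{C}$ is any function of the form $T\circ B_{\mathcal{C}}$ with $T$ a conformal automorphism of $\mathbb{D}$. $\overline{\mathcal{C}}$ is the closure of $\mathcal{C}$ in $\mathbb{C}$.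 *)

(* Defs.v *)
From Stdlib Require Import Reals.
From Coquelicot Require Import Coquelicot.

Open Scope R_scope.

Definition unit_disk (z : C) : Prop := Cmod z < 1.

(* Functions on the disk are represented by total functions C -> C; their
   values outside the disk play no role. *)
Definition holomorphic (f : C -> C) : Prop :=
  forall z : C, unit_disk z -> @ex_derive C_AbsRing C_NormedModule f z.

Definition C_derive_n (n : nat) (f : C -> C) : C -> C := Nat.iter n C_derive f.

Definition sup_norm (f : C -> C) : Rbar :=
  Lub_Rbar (fun x : R => exists z : C, unit_disk z /\ x = Cmod (f z)).

Definition Hinfty (f : C -> C) : Prop :=
  holomorphic f /\ Rbar_lt (sup_norm f) p_infty.

Definition nonconstant (f : C -> C) : Prop :=
  exists z w : C, unit_disk z /\ unit_disk w /\ f z <> f w.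

Definition vanishes_to_order (g : C -> C) (z : C) (n : nat) : Prop :=
  forall k : nat, (k < n)%nat -> C_derive_n k g z = 0.

(* For n = 0 this says g z <> 0. *)
Definition has_order (g : C -> C) (z : C) (n : nat) : Prop :=
  vanishes_to_order g z n /\ C_derive_n n g z <> 0.

(* A sequence of points, regarded as a set of points with multiplicities, is
   given by its multiplicity function: c z is the number of times that z
   occurs. *)
Definition multiset : Type := C -> nat.

Definition support (c : multiset) (z : C) : Prop := (0 < c z)%nat.

Definition in_disk (c : multiset) : Prop :=
  forall z : C, support c z -> unit_disk z.

Definition has_critical_set (f : C -> C) (c : multiset) : Prop :=
  in_disk c /\ forall z : C, unit_disk z -> has_order (C_derive f) z (c z).

Definition Hinfty_critical_set (c : multiset) : Prop :=
  exists f : C -> C, Hinfty f /\ nonconstant f /\ has_critical_set f c.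

Definition F_class (c : multiset) (f : C -> C) : Prop :=
  Hinfty f /\
  forall z : C, unit_disk z -> vanishes_to_order (C_derive f) z (c z).

(* b solves the problem max Re f^(N+1)(0), f in F_class c, ||f|| <= 1, where
   N = c 0 is the multiplicity of the origin. *)
Definition extremal (c : multiset) (b : C -> C) : Prop :=
  F_class c b /\ Rbar_le (sup_norm b) 1 /\
  forall f : C -> C, F_class c f -> Rbar_le (sup_norm f) 1 ->
    Re (C_derive_n (S (c 0)) f 0) <= Re (C_derive_n (S (c 0)) b 0).

Definition disk_automorphism (T : C -> C) : Prop :=
  holomorphic T /\
  (forall z : C, unit_disk z -> unit_disk (T z)) /\
  (forall z w : C, unit_disk z -> unit_disk w -> T z = T w -> z = w) /\
  (forall w : C, unit_disk w -> exists z : C, unit_disk z /\ T z = w).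

Definition maximal_Blaschke_product (c : multiset) (B : C -> C) : Prop :=
  Hinfty_critical_set c /\
  exists b T : C -> C, extremal c b /\ disk_automorphism T /\
    forall z : C, unit_disk z -> B z = T (b z).

Definition closure (A : C -> Prop) (z : C) : Prop :=
  forall P : C -> Prop, locally z P -> exists w : C, P w /\ A w.

(* Main.v *)
(* Write lambda_f = |f'| / (1 - |f|^2). By the Schwarz-Pick lemma, (1 - |z|^2) lambda_B(z) <= 1,
   and lambda_B = lambda_b when B = T o b with T an automorphism and b extremal; what is needed
   is a lower bound for (1 - |z|^2) lambda_b(z) which tends to 1 at zeta.

   Let b_n be finite Blaschke products, fixing 0, whose critical points form a finite part of C
   containing all points with |z| <= r_n, where r_n -> 1. Their Schwarz-Pick quotient tends to 1 at the circle, so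
   Ahlfors' lemma gives lambda_f <= lambda_{b_n} for every competitor f. A normal family
   argument gives a limit of the b_n which is itself a competitor and whose density dominates
   all others, so equality must hold at 0 for the extremal b, and b is a rotation of the limit.

   Cut off a small cap of the disk at zeta, free of critical points, by a chord with end points
   xi_1, xi_2, and put psi = exp(-K sum_i (xi_i + z) / (xi_i - z)). On the chord,
   |psi| <= (1 - |z|^2) lambda_{b_n}: here lambda_{b_n} >= |f'| / M for the given function f with
   critical set C and |f| <= M, and Harnack's inequality for log |f'| on disks tangent at the xi_i
   bounds |f'| from below. Ahlfors' lemma, with weight |psi|, extends this inequality to the cap.
   It passes to the limit, and |psi| -> 1 at zeta.

   The finite Blaschke products are obtained by a continuity method: the derivative of
   z q^* / q, with q^* the reciprocal polynomial of q, has a numerator quadratic in q, whose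
   differential is onto because a finite Blaschke product fixing 0 is determined up to a
   rotation by its critical points, again by Ahlfors' lemma. *)

Require Import Defs.
From Stdlib Require Import Arith Cantor Reals List Lra Lia Classical ClassicalEpsilon.
From Coquelicot Require Import Coquelicot.

Open Scope R_scope.

(** * Complex differentiability *)

(** Ahlfors' comparison asks that the Schwarz-Pick quotient of the dominating function tend to 1 at
    the whole circle. For b this is close to what has to be proved; finite Blaschke products have it
    outright. So every comparison is made with the b_n, with constants independent of n, and only
    inequalities pass to the limit. As densities vanish at critical points, derivatives are written
    P F and P G with a common factor P, and F is compared with G; the maximum principle is applied
    to holomorphic functions alone. In the cap the competitor is the identity map, whose density
    1/(1 - |z|^2) is the largest possible. The weight pays for the loss on the chord: near xi_i
    Harnack's inequality costs a multiple of 1/|z - xi_i| in the exponent, which is the size of the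
    Poisson kernel of xi_i along the chord. At zeta the same kernels vanish linearly, which gives a
    rate 1 - A |z - zeta|. In the continuity method n + 1 complex coefficients face 2n + 1 real node
    values; one gauge condition, which removes the rotations, makes the dimensions equal. *)

Definition is_cderiv (f : C -> C) (z l : C) : Prop :=
  forall eps : R, 0 < eps -> exists d : R, 0 < d /\
    forall w : C, Cmod (w - z) < d ->
      Cmod (f w - f z - l * (w - z)) <= eps * Cmod (w - z).

Definition ccont (f : C -> C) (z : C) : Prop :=
  forall eps : R, 0 < eps -> exists d : R, 0 < d /\
    forall w : C, Cmod (w - z) < d -> Cmod (f w - f z) < eps.

Lemma Cmod_sym (a b : C) : Cmod (a - b) = Cmod (b - a).
Proof. rewrite <- Cmod_opp. f_equal. ring. Qed.

Lemma Cmod_minus_le (a b : C) : Cmod (a - b) <= Cmod a + Cmod b.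
Proof.
  replace (a - b)%C with (a + - b)%C by ring.
  rewrite <- (Cmod_opp b). apply Cmod_triangle.
Qed.

Lemma Cmod_rtriangle (a b : C) : Cmod a - Cmod b <= Cmod (a - b).
Proof.
  assert (H := Cmod_triangle (a - b) b).
  replace (a - b + b)%C with a in H by ring. lra.
Qed.

Lemma Cmod_rtriangle_abs (a b : C) : Rabs (Cmod a - Cmod b) <= Cmod (a - b).
Proof.
  apply Rabs_le. generalize (Cmod_rtriangle a b) (Cmod_rtriangle b a).
  rewrite (Cmod_sym b a). lra.
Qed.

Lemma Cmod_dist_tri (a b c : C) : Cmod (a - c) <= Cmod (a - b) + Cmod (b - c).
Proof.
  replace (a - c)%C with ((a - b) + (b - c))%C by ring. apply Cmod_triangle.
Qed.

Lemma Cminus_eq0 (a b : C) : (a - b)%C = 0 -> a = b.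
Proof. apply Ceq_minus. Qed.

Lemma Cmod_minus_pos (a b : C) : a <> b -> 0 < Cmod (a - b).
Proof. intros H. apply Cmod_gt_0. intros H0; apply H. now apply Cminus_eq0. Qed.

Lemma Cmod_le0 (a : C) : Cmod a <= 0 -> a = 0.
Proof. intros H. apply Cmod_eq_0. generalize (Cmod_ge_0 a); lra. Qed.

Lemma Cmod_eps0 (a : C) : (forall e, 0 < e -> Cmod a <= e) -> a = 0.
Proof.
  intros H. apply Cmod_le0. apply Rnot_lt_le. intros H0.
  generalize (H (Cmod a / 2)); lra.
Qed.

Lemma ccont_ext_loc (f g : C -> C) (z : C) (r : R) : 0 < r ->
  (forall w, Cmod (w - z) < r -> f w = g w) -> ccont f z -> ccont g z.
Proof.
  intros Hr He Hf e He0. destruct (Hf e He0) as [d [Hd H]].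
  exists (Rmin d r). split; [now apply Rmin_pos|].
  intros w Hw. rewrite <- !He.
  - apply H. eapply Rlt_le_trans; [exact Hw|apply Rmin_l].
  - replace (z - z)%C with (RtoC 0) by ring. now rewrite Cmod_0.
  - eapply Rlt_le_trans; [exact Hw|apply Rmin_r].
Qed.

Lemma ccont_const (k z : C) : ccont (fun _ => k) z.
Proof.
  intros e He. exists 1. split; [lra|]. intros w _.
  replace (k - k)%C with (RtoC 0) by ring. now rewrite Cmod_0.
Qed.

Lemma ccont_id (z : C) : ccont (fun w => w) z.
Proof. intros e He. exists e. split; auto. Qed.

Lemma ccont_plus (f g : C -> C) (z : C) :
  ccont f z -> ccont g z -> ccont (fun w => f w + g w)%C z.
Proof.
  intros Hf Hg e He. destruct (Hf (e/2)) as [d1 [Hd1 H1]]; [lra|].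
  destruct (Hg (e/2)) as [d2 [Hd2 H2]]; [lra|].
  exists (Rmin d1 d2). split; [now apply Rmin_pos|]. intros w Hw.
  generalize (H1 w) (H2 w) (Rmin_l d1 d2) (Rmin_r d1 d2). intros A B ? ?.
  specialize (A ltac:(lra)). specialize (B ltac:(lra)).
  replace (f w + g w - (f z + g z))%C with ((f w - f z) + (g w - g z))%C by ring.
  generalize (Cmod_triangle (f w - f z) (g w - g z)). lra.
Qed.

Lemma ccont_mult (f g : C -> C) (z : C) :
  ccont f z -> ccont g z -> ccont (fun w => f w * g w)%C z.
Proof.
  intros Hf Hg e He.
  set (A := Cmod (f z)). set (B := Cmod (g z)).
  assert (HA : 0 <= A) by apply Cmod_ge_0. assert (HB : 0 <= B) by apply Cmod_ge_0.
  set (k := Rmin 1 (e / (A + B + 1))).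
  assert (Hk : 0 < k).
  { apply Rmin_pos; [lra|]. apply Rdiv_lt_0_compat; lra. }
  destruct (Hf k Hk) as [d1 [Hd1 H1]]. destruct (Hg k Hk) as [d2 [Hd2 H2]].
  exists (Rmin d1 d2). split; [now apply Rmin_pos|]. intros w Hw.
  generalize (H1 w) (H2 w) (Rmin_l d1 d2) (Rmin_r d1 d2). intros U V ? ?.
  specialize (U ltac:(lra)). specialize (V ltac:(lra)).
  replace (f w * g w - f z * g z)%C
    with ((f w - f z) * (g w - g z) + f z * (g w - g z) + (f w - f z) * g z)%C by ring.
  eapply Rle_lt_trans; [apply Cmod_triangle|].
  eapply Rle_lt_trans; [apply Rplus_le_compat_r, Cmod_triangle|].
  rewrite !Cmod_mult. fold A B.
  generalize (Cmod_ge_0 (f w - f z)) (Cmod_ge_0 (g w - g z)). intros.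
  assert (k <= 1) by apply Rmin_l.
  assert (k * (A + B + 1) <= e).
  { replace e with (e / (A + B + 1) * (A + B + 1)) at 1 by (field; lra).
    apply Rmult_le_compat_r; [lra|apply Rmin_r]. }
  assert (Cmod (f w - f z) * Cmod (g w - g z) < k * 1).
  { apply Rle_lt_trans with (Cmod (f w - f z) * 1).
    apply Rmult_le_compat_l; lra. lra. }
  assert (A * Cmod (g w - g z) <= A * k) by (apply Rmult_le_compat_l; lra).
  assert (Cmod (f w - f z) * B <= k * B) by (apply Rmult_le_compat_r; lra).
  nra.
Qed.

Lemma ccont_comp (f g : C -> C) (z : C) :
  ccont f z -> ccont g (f z) -> ccont (fun w => g (f w)) z.
Proof.
  intros Hf Hg e He. destruct (Hg e He) as [d [Hd H]].
  destruct (Hf d Hd) as [d' [Hd' H']]. exists d'. split; auto.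
Qed.

Lemma ccont_inv_id (z : C) : z <> 0 -> ccont Cinv z.
Proof.
  intros Hz e He. assert (Hp : 0 < Cmod z) by now apply Cmod_gt_0.
  set (A := Cmod z) in *.
  exists (Rmin (A/2) (e * (A * A / 4))). split.
  { apply Rmin_pos; [lra|]. apply Rmult_lt_0_compat; nra. }
  intros w Hw.
  generalize (Rmin_l (A/2) (e * (A * A / 4))) (Rmin_r (A/2) (e * (A * A / 4))); intros.
  assert (Hw2 : A / 2 < Cmod w).
  { generalize (Cmod_rtriangle z w). rewrite Cmod_sym. fold A. lra. }
  assert (w <> 0) by (apply Cmod_gt_0; lra).
  replace (/ w - / z)%C with ((z - w) * / (w * z))%C by (field; auto).
  rewrite Cmod_mult, Cmod_inv, Cmod_mult by now apply Cmult_neq_0.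
  fold A. rewrite Cmod_sym.
  apply Rmult_lt_reg_r with (Cmod w * A); [nra|].
  rewrite Rmult_assoc, Rinv_l by (apply Rmult_integral_contrapositive_currified; lra).
  assert (A * A / 2 < Cmod w * A) by nra. nra.
Qed.

Lemma ccont_inv (f : C -> C) (z : C) :
  ccont f z -> f z <> 0 -> ccont (fun w => / f w)%C z.
Proof. intros Hf Hz. apply (ccont_comp f Cinv); auto. now apply ccont_inv_id. Qed.

Lemma ccont_opp (f : C -> C) (z : C) : ccont f z -> ccont (fun w => - f w)%C z.
Proof.
  intros Hf. apply ccont_ext_loc with (f := fun w => (RtoC (-1) * f w)%C) (r := 1); [lra| |].
  { intros; ring. } apply ccont_mult; auto. apply ccont_const.
Qed.

Lemma ccont_minus (f g : C -> C) (z : C) :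
  ccont f z -> ccont g z -> ccont (fun w => f w - g w)%C z.
Proof. intros Hf Hg. unfold Cminus. apply ccont_plus; auto. now apply ccont_opp. Qed.

Lemma ccont_div (f g : C -> C) (z : C) :
  ccont f z -> ccont g z -> g z <> 0 -> ccont (fun w => f w / g w)%C z.
Proof. intros. unfold Cdiv. apply ccont_mult; auto. now apply ccont_inv. Qed.

(** Carathéodory's form of differentiability: the difference quotient, completed by [l] at [z], is
    continuous there. The product, chain and inverse rules become algebra on the factors [p]. *)
Lemma is_cderiv_quot (f : C -> C) (z l : C) :
  is_cderiv f z l <->
  exists p : C -> C, p z = l /\ ccont p z /\ forall w, (f w - f z = p w * (w - z))%C.
Proof.
  split.
  - intros H.
    exists (fun w => if Ceq_dec w z then l else (f w - f z) / (w - z))%C.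
    split; [|split].
    + destruct (Ceq_dec z z); congruence.
    + intros e He. destruct (H (e/2)) as [d [Hd Hw]]; [lra|].
      exists d. split; auto. intros w Hwd.
      destruct (Ceq_dec z z) as [_|n]; [|congruence].
      destruct (Ceq_dec w z) as [E|E].
      * replace (l - l)%C with (RtoC 0) by ring. now rewrite Cmod_0.
      * assert (P := Cmod_minus_pos _ _ E).
        assert (w - z <> 0)%C by now apply Cmod_gt_0.
        replace ((f w - f z) / (w - z) - l)%C
          with ((f w - f z - l * (w - z)) / (w - z))%C by (field; auto).
        rewrite Cmod_div by auto.
        apply Rmult_lt_reg_r with (Cmod (w - z)); auto.
        unfold Rdiv. rewrite Rmult_assoc, Rinv_l by lra.
        specialize (Hw w Hwd). nra.
    + intros w. destruct (Ceq_dec w z) as [->|E]; [ring|].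
      field. intros H0. apply E. now apply Cminus_eq0.
  - intros [p [Hp [Hc Hw]]] e He. destruct (Hc e He) as [d [Hd H]].
    exists d. split; auto. intros w Hwd.
    replace (f w - f z - l * (w - z))%C with ((p w - p z) * (w - z))%C.
    + rewrite Cmod_mult. apply Rmult_le_compat_r; [apply Cmod_ge_0|].
      left. now apply H.
    + rewrite Hw, Hp. ring.
Qed.

Lemma is_cderiv_cont (f : C -> C) (z l : C) : is_cderiv f z l -> ccont f z.
Proof.
  intros H. apply is_cderiv_quot in H. destruct H as [p [Hp [Hc Hw]]].
  apply ccont_ext_loc with (f := fun w => (f z + p w * (w - z))%C) (r := 1); [lra| |].
  { intros w _. rewrite <- Hw. ring. }
  apply ccont_plus; [apply ccont_const|]. apply ccont_mult; auto.
  apply ccont_minus; [apply ccont_id|apply ccont_const].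
Qed.

Lemma is_cderiv_ext_loc (f g : C -> C) (z l : C) (r : R) : 0 < r ->
  (forall w, Cmod (w - z) < r -> f w = g w) -> is_cderiv f z l -> is_cderiv g z l.
Proof.
  intros Hr He Hf e He0. destruct (Hf e He0) as [d [Hd H]].
  exists (Rmin d r). split; [now apply Rmin_pos|].
  intros w Hw. rewrite <- !He.
  - apply H. eapply Rlt_le_trans; [exact Hw|apply Rmin_l].
  - replace (z - z)%C with (RtoC 0) by ring. now rewrite Cmod_0.
  - eapply Rlt_le_trans; [exact Hw|apply Rmin_r].
Qed.

Lemma is_cderiv_const (k z : C) : is_cderiv (fun _ => k) z 0.
Proof.
  apply is_cderiv_quot. exists (fun _ => RtoC 0). split; [|split]; auto.
  apply ccont_const. intros; ring.
Qed.

Lemma is_cderiv_id (z : C) : is_cderiv (fun w => w) z 1.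
Proof.
  apply is_cderiv_quot. exists (fun _ => RtoC 1). split; [|split]; auto.
  apply ccont_const. intros; ring.
Qed.

Lemma is_cderiv_plus (f g : C -> C) (z l m : C) :
  is_cderiv f z l -> is_cderiv g z m -> is_cderiv (fun w => f w + g w)%C z (l + m).
Proof.
  intros Hf Hg. apply is_cderiv_quot in Hf, Hg. apply is_cderiv_quot.
  destruct Hf as [p [Hp [Hc Hw]]], Hg as [q [Hq [Hd Hv]]].
  exists (fun w => p w + q w)%C. split; [now rewrite Hp, Hq|split].
  - now apply ccont_plus.
  - intros w. transitivity ((f w - f z) + (g w - g z))%C; [ring|].
    rewrite Hw, Hv. ring.
Qed.

Lemma is_cderiv_mult (f g : C -> C) (z l m : C) :
  is_cderiv f z l -> is_cderiv g z m ->
  is_cderiv (fun w => f w * g w)%C z (l * g z + f z * m).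
Proof.
  intros Hf Hg. assert (Hgc := is_cderiv_cont _ _ _ Hg).
  apply is_cderiv_quot in Hf, Hg. apply is_cderiv_quot.
  destruct Hf as [p [Hp [Hc Hw]]], Hg as [q [Hq [Hd Hv]]].
  exists (fun w => p w * g w + f z * q w)%C. split; [now rewrite Hp, Hq|split].
  - apply ccont_plus; apply ccont_mult; auto. apply ccont_const.
  - intros w. transitivity ((f w - f z) * g w + f z * (g w - g z))%C; [ring|].
    rewrite Hw, Hv. ring.
Qed.

Lemma is_cderiv_comp (f g : C -> C) (z l m : C) :
  is_cderiv f z l -> is_cderiv g (f z) m -> is_cderiv (fun w => g (f w)) z (m * l).
Proof.
  intros Hf Hg. assert (Hfc := is_cderiv_cont _ _ _ Hf).
  apply is_cderiv_quot in Hf, Hg. apply is_cderiv_quot.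
  destruct Hf as [p [Hp [Hc Hw]]], Hg as [q [Hq [Hd Hv]]].
  exists (fun w => q (f w) * p w)%C. split; [now rewrite Hp, Hq|split].
  - apply ccont_mult; auto. now apply (ccont_comp f q).
  - intros w. rewrite Hv, Hw. ring.
Qed.

Lemma is_cderiv_inv (f : C -> C) (z l : C) :
  is_cderiv f z l -> f z <> 0 -> is_cderiv (fun w => / f w)%C z (- l / (f z * f z)).
Proof.
  intros Hf Hz.
  replace (- l / (f z * f z))%C with ((- / (f z * f z)) * l)%C by (field; auto).
  apply (is_cderiv_comp f Cinv); auto.
  generalize (f z) Hz. clear. intros z Hz.
  assert (Hp : 0 < Cmod z) by now apply Cmod_gt_0.
  apply is_cderiv_ext_loc with (f := fun w => (/ z + (- / ((if Ceq_dec w 0 then 1 else w) * z)) * (w - z))%C)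
     (r := Cmod z); auto.
  { intros w Hw. destruct (Ceq_dec w 0) as [->|E].
    - exfalso. replace (0 - z)%C with (- z)%C in Hw by ring. rewrite Cmod_opp in Hw. lra.
    - field. auto. }
  apply is_cderiv_quot. exists (fun w => (- / ((if Ceq_dec w 0 then 1 else w) * z))%C).
  split; [|split].
  - destruct (Ceq_dec z 0); [congruence|auto].
  - apply ccont_opp. apply ccont_inv.
    + apply ccont_mult; [|apply ccont_const].
      apply ccont_ext_loc with (f := fun w => w) (r := Cmod z); auto.
      2: apply ccont_id. intros w Hw. destruct (Ceq_dec w 0) as [->|E]; auto.
      exfalso. replace (0 - z)%C with (- z)%C in Hw by ring. rewrite Cmod_opp in Hw. lra.
    + destruct (Ceq_dec z 0); [congruence|]. now apply Cmult_neq_0.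
  - intros w. ring.
Qed.

Lemma is_cderiv_eq (f : C -> C) (z l m : C) : is_cderiv f z l -> l = m -> is_cderiv f z m.
Proof. now intros H <-. Qed.

Lemma is_cderiv_opp (f : C -> C) (z l : C) :
  is_cderiv f z l -> is_cderiv (fun w => - f w)%C z (- l).
Proof.
  intros H. apply is_cderiv_ext_loc with (f := fun w => (RtoC (-1) * f w)%C) (r := 1); [lra| |].
  { intros; ring. }
  eapply is_cderiv_eq. apply is_cderiv_mult; [apply is_cderiv_const|exact H]. cbv beta; ring.
Qed.

Lemma is_cderiv_minus (f g : C -> C) (z l m : C) :
  is_cderiv f z l -> is_cderiv g z m -> is_cderiv (fun w => f w - g w)%C z (l - m).
Proof. intros Hf Hg. unfold Cminus. apply is_cderiv_plus; auto. now apply is_cderiv_opp. Qed.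

Lemma is_cderiv_div (f g : C -> C) (z l m : C) :
  is_cderiv f z l -> is_cderiv g z m -> g z <> 0 ->
  is_cderiv (fun w => f w / g w)%C z ((l * g z - f z * m) / (g z * g z)).
Proof.
  intros Hf Hg Hz. unfold Cdiv at 1. eapply is_cderiv_eq.
  apply is_cderiv_mult; [exact Hf|]. apply is_cderiv_inv; [exact Hg|auto]. cbv beta; field; auto.
Qed.

Lemma is_cderiv_unique (f : C -> C) (z l m : C) : is_cderiv f z l -> is_cderiv f z m -> l = m.
Proof.
  intros H1 H2. apply Cminus_eq0, Cmod_eps0. intros e He.
  destruct (H1 (e/2)) as [d1 [Hd1 A1]]; [lra|]. destruct (H2 (e/2)) as [d2 [Hd2 A2]]; [lra|].
  set (h := Rmin d1 d2 / 2).
  assert (Hh : 0 < h). { assert (0 < Rmin d1 d2) by now apply Rmin_pos. unfold h; lra. }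
  assert (E : (z + RtoC h - z = RtoC h)%C) by ring.
  assert (Eh : Cmod (RtoC h) = h) by (rewrite Cmod_R, Rabs_right; lra).
  assert (h < d1) by (generalize (Rmin_l d1 d2); unfold h in *; lra).
  assert (h < d2) by (generalize (Rmin_r d1 d2); unfold h in *; lra).
  specialize (A1 (z + RtoC h)%C). specialize (A2 (z + RtoC h)%C).
  rewrite E, Eh in A1, A2. specialize (A1 ltac:(lra)). specialize (A2 ltac:(lra)).
  assert (B : Cmod ((l - m) * RtoC h) <= e * h).
  { replace ((l - m) * RtoC h)%C with ((f (z + RtoC h)%C - f z - m * RtoC h) - (f (z + RtoC h)%C - f z - l * RtoC h))%C by ring.
    generalize (Cmod_minus_le (f (z + RtoC h)%C - f z - m * RtoC h) (f (z + RtoC h)%C - f z - l * RtoC h)). lra. }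
  rewrite Cmod_mult, Eh in B. nra.
Qed.

Lemma is_cderiv_is_derive (f : C -> C) (z l : C) :
  is_cderiv f z l <-> @is_derive C_AbsRing C_NormedModule f z l.
Proof.
  split.
  - intros H. split; [apply is_linear_scal_l|].
    intros x Hx. apply (is_filter_lim_locally_unique (V := AbsRing_NormedModule C_AbsRing)) in Hx.
    simpl in Hx. subst x. intros e.
    destruct (H (pos e) (cond_pos e)) as [d [Hd Hw]].
    exists (mkposreal d Hd). intros w Hball.
    change (Cmod (w - z) < d) in Hball.
    specialize (Hw w Hball).
    change (Cmod ((f w - f z) - (w - z) * l) <= e * Cmod (w - z)).
    replace (f w - f z - (w - z) * l)%C with (f w - f z - l * (w - z))%C by ring. exact Hw.
  - intros [_ H] e He. specialize (H z (fun P HP => HP) (mkposreal e He)).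
    destruct H as [d Hd]. exists (pos d). split; [apply cond_pos|].
    intros w Hw. specialize (Hd w Hw).
    change (Cmod ((f w - f z) - (w - z) * l) <= e * Cmod (w - z)) in Hd.
    replace (f w - f z - l * (w - z))%C with (f w - f z - (w - z) * l)%C by ring. exact Hd.
Qed.

Lemma is_cderiv_C_derive (f : C -> C) (z l : C) : is_cderiv f z l -> C_derive f z = l.
Proof. intros H. apply is_C_derive_unique. now apply is_cderiv_is_derive. Qed.

(** * Sequences, subsequences and maxima on compact sets *)

Definition cvg_seq (u : nat -> C) (l : C) : Prop :=
  forall e : R, 0 < e -> exists n0 : nat, forall n, (n0 <= n)%nat -> Cmod (u n - l) < e.

Definition extraction (phi : nat -> nat) : Prop := forall n, (phi n < phi (S n))%nat.

Lemma extraction_lt (phi : nat -> nat) : extraction phi ->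
  forall n m, (n < m)%nat -> (phi n < phi m)%nat.
Proof.
  intros H n m Hnm. induction Hnm; [apply H|]. eapply Nat.lt_trans; [exact IHHnm|apply H].
Qed.

Lemma extraction_ge (phi : nat -> nat) : extraction phi -> forall n, (n <= phi n)%nat.
Proof. intros H n. induction n; [lia|]. specialize (H n). lia. Qed.

Lemma extraction_comp (phi psi : nat -> nat) :
  extraction phi -> extraction psi -> extraction (fun n => phi (psi n)).
Proof. intros H1 H2 n. apply extraction_lt; auto. Qed.

Lemma choose_extraction (P : nat -> nat -> Prop) :
  (forall n N : nat, exists p, (N <= p)%nat /\ P n p) ->
  exists phi, extraction phi /\ forall n, P n (phi n).
Proof.
  intros H.
  assert (S : forall n N, {p : nat | (N <= p)%nat /\ P n p}).
  { intros n N. apply constructive_indefinite_description, H. }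
  set (phi := fix phi n := match n with
     | O => proj1_sig (S O O) | Datatypes.S m => proj1_sig (S n (Datatypes.S (phi m))) end).
  exists phi. split.
  - intros n. simpl. destruct (S (Datatypes.S n) (Datatypes.S (phi n))) as [p Hp]. simpl. lia.
  - intros [|n]; simpl.
    + destruct (S O O) as [p Hp]. exact (proj2 Hp).
    + destruct (S (Datatypes.S n) (Datatypes.S (phi n))) as [p Hp]. exact (proj2 Hp).
Qed.

Lemma real_bw (u : nat -> R) (M : R) : (forall n, Rabs (u n) <= M) ->
  exists phi l, extraction phi /\
    forall e, 0 < e -> exists N, forall n, (N <= n)%nat -> Rabs (u (phi n) - l) < e.
Proof.
  intros HM.
  destruct (Bolzano_Weierstrass u (fun x => - M <= x <= M)) as [l Hl].
  { apply compact_P3. }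
  { intros n. specialize (HM n). now apply Rabs_le_between in HM. }
  destruct (choose_extraction (fun n p => Rabs (u p - l) < / (INR n + 1))) as [phi [Hphi Hu]].
  { intros n N. assert (Hp : 0 < / (INR n + 1)).
    { apply Rinv_0_lt_compat. generalize (pos_INR n); lra. }
    destruct (Hl (disc l (mkposreal _ Hp)) N) as [p [Hp1 Hp2]].
    { exists (mkposreal _ Hp). intros x Hx. exact Hx. }
    exists p. split; auto. }
  exists phi, l. split; auto. intros e He.
  destruct (archimed_cor1 e He) as [N [HN HN0]]. exists N. intros n Hn.
  eapply Rlt_trans; [apply Hu|]. eapply Rle_lt_trans; [|exact HN].
  apply Rinv_le_contravar; [now apply lt_0_INR|]. apply le_INR in Hn. lra.
Qed.

Lemma complex_bw (u : nat -> C) (M : R) : (forall n, Cmod (u n) <= M) ->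
  exists phi l, extraction phi /\ cvg_seq (fun n => u (phi n)) l.
Proof.
  intros HM.
  destruct (real_bw (fun n => fst (u n)) M) as [p1 [l1 [E1 H1]]].
  { intros n. eapply Rle_trans; [|apply (HM n)]. eapply Rle_trans; [|apply Rmax_Cmod]. apply Rmax_l. }
  destruct (real_bw (fun n => snd (u (p1 n))) M) as [p2 [l2 [E2 H2]]].
  { intros n. eapply Rle_trans; [|apply (HM (p1 n))]. eapply Rle_trans; [|apply Rmax_Cmod]. apply Rmax_r. }
  exists (fun n => p1 (p2 n)), (l1, l2). split; [now apply extraction_comp|].
  intros e He. destruct (H1 (e/2)) as [N1 HN1]; [lra|]. destruct (H2 (e/2)) as [N2 HN2]; [lra|].
  exists (max N1 N2). intros n Hn.
  eapply Rle_lt_trans; [apply Cmod_2Rmax|].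
  assert (Rmax (Rabs (fst (u (p1 (p2 n)) - (l1, l2))%C)) (Rabs (snd (u (p1 (p2 n)) - (l1, l2))%C)) < e / 2).
  { apply Rmax_lub_lt; simpl.
    - apply HN1. generalize (extraction_ge p2 E2 n); lia.
    - apply HN2. lia. }
  assert (sqrt 2 < 2).
  { rewrite <- (sqrt_square 2) at 2 by lra. apply sqrt_lt_1; lra. }
  assert (0 <= sqrt 2) by apply sqrt_pos.
  assert (0 <= Rmax (Rabs (fst (u (p1 (p2 n)) - (l1, l2))%C)) (Rabs (snd (u (p1 (p2 n)) - (l1, l2))%C))).
  { eapply Rle_trans; [apply Rabs_pos|apply Rmax_l]. }
  nra.
Qed.

(** Cantor's diagonal: along [E k] the coordinates below [k] converge, each [E (S k)] is a
    subsequence of [E k], and from index [k] on the diagonal [E n n] is a subsequence of [E k]. *)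
Lemma diagonal_extraction (u : nat -> nat -> C) (M : nat -> R) :
  (forall n k, Cmod (u n k) <= M k) ->
  exists phi, extraction phi /\ forall k, exists l, cvg_seq (fun n => u (phi n) k) l.
Proof.
  intros HM.
  assert (S : forall (k : nat) (E : nat -> nat),
    {p : nat -> nat | extraction p /\ exists l, cvg_seq (fun n => u (E (p n)) k) l}).
  { intros k E. apply constructive_indefinite_description.
    destruct (complex_bw (fun n => u (E n) k) (M k)) as [p [l [H1 H2]]]; eauto. }
  set (E := fix E k := match k with
     | O => fun n : nat => n | Datatypes.S m => fun n => E m (proj1_sig (S m (E m)) n) end).
  assert (HE : forall k, extraction (E k)).
  { induction k; simpl; [intros n; lia|].
    apply (extraction_comp (E k)); auto. destruct (S k (E k)) as [p Hp]. exact (proj1 Hp). }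
  assert (Hsub : forall k j, exists q, extraction q /\ forall n, E (j + k)%nat n = E k (q n)).
  { intros k j. induction j as [|j [q [Hq Hqe]]].
    - exists (fun n => n). split; [intros n; lia|auto].
    - simpl. destruct (S (j + k)%nat (E (j + k)%nat)) as [p Hp']. simpl. assert (Hp := proj1 Hp').
      exists (fun n => q (p n)). split; [now apply extraction_comp|]. intros n. apply Hqe. }
  exists (fun n => E n n). split.
  - intros n. apply Nat.lt_le_trans with (E n (Datatypes.S n)).
    + apply extraction_lt; auto.
    + simpl. destruct (S n (E n)) as [p Hp']. simpl. assert (Hp := proj1 Hp').
      assert (G := extraction_ge p Hp (Datatypes.S n)).
      destruct (Nat.eq_dec (p (Datatypes.S n)) (Datatypes.S n)) as [->|]; [lia|].
      apply Nat.lt_le_incl. apply extraction_lt; auto. lia.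
  - intros k.
    assert (Hk : exists l, cvg_seq (fun n => u (E (Datatypes.S k) n) k) l).
    { simpl. destruct (S k (E k)) as [p Hp]. exact (proj2 Hp). }
    destruct Hk as [l Hl]. exists l. intros e He. destruct (Hl e He) as [N HN].
    exists (max N (Datatypes.S k)). intros n Hn.
    destruct (Hsub (Datatypes.S k) (n - Datatypes.S k)%nat) as [q [Hq Hqe]].
    replace (n - Datatypes.S k + Datatypes.S k)%nat with n in Hqe by lia.
    rewrite Hqe. apply HN. generalize (extraction_ge q Hq n). lia.
Qed.

Lemma Cmod_RtoC_minus (a b : R) : Cmod (RtoC a - RtoC b) = Rabs (a - b).
Proof. rewrite <- RtoC_minus. apply Cmod_R. Qed.

Lemma ccont_Cmod (f : C -> C) (z : C) : ccont f z -> ccont (fun w => RtoC (Cmod (f w))) z.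
Proof.
  intros H e He. destruct (H e He) as [d [Hd Hw]]. exists d. split; auto. intros w Hwd.
  rewrite Cmod_RtoC_minus. eapply Rle_lt_trans; [apply Cmod_rtriangle_abs|auto].
Qed.

Lemma ccont_Re (f : C -> C) (z : C) : ccont f z -> ccont (fun w => RtoC (Re (f w))) z.
Proof.
  intros H e He. destruct (H e He) as [d [Hd Hw]]. exists d. split; auto. intros w Hwd.
  rewrite Cmod_RtoC_minus. eapply Rle_lt_trans; [|apply (Hw w Hwd)].
  replace (Re (f w) - Re (f z)) with (Re (f w - f z)%C) by (unfold Cminus, Rminus; now rewrite re_plus, re_opp).
  apply re_le_Cmod.
Qed.

(** Composing with [atan] gives a bounded set of values, so that a supremum exists before [u] is
    known to be bounded. A maximizing sequence then has a limit point in [K], where continuity shows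
    that the supremum is attained. *)
Lemma max_on_compact (K : C -> Prop) (u : C -> R) (M : R) :
  (forall z, K z -> Cmod z <= M) ->
  (forall l, (forall e, 0 < e -> exists z, K z /\ Cmod (z - l) < e) -> K l) ->
  (exists z, K z) -> (forall z, K z -> ccont (fun w => RtoC (u w)) z) ->
  exists z0, K z0 /\ forall w, K w -> u w <= u z0.
Proof.
  intros HM Hcl [zz Hzz] Hc.
  set (E := fun x => exists z, K z /\ x = atan (u z)).
  destruct (completeness E) as [s [Hs1 Hs2]].
  { exists (PI/2). intros x [z [_ ->]]. left. apply atan_bound. }
  { exists (atan (u zz)), zz. auto. }
  assert (Hseq : forall n : nat, exists z, K z /\ s - / (INR n + 1) < atan (u z)).
  { intros n. apply NNPP. intros Hn.
    assert (Hp : 0 < / (INR n + 1)). { apply Rinv_0_lt_compat. generalize (pos_INR n); lra. }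
    assert (s <= s - / (INR n + 1)); [|lra].
    apply Hs2. intros x [z [Hz ->]]. apply Rnot_lt_le. intros Hx. apply Hn. eauto. }
  set (zs := fun n => proj1_sig (constructive_indefinite_description _ (Hseq n))).
  assert (Hzs : forall n, K (zs n) /\ s - / (INR n + 1) < atan (u (zs n))).
  { intros n. exact (proj2_sig (constructive_indefinite_description _ (Hseq n))). }
  destruct (complex_bw zs M) as [phi [l [Hphi Hl]]].
  { intros n. apply HM, Hzs. }
  assert (Kl : K l).
  { apply Hcl. intros e He. destruct (Hl e He) as [N HN]. exists (zs (phi N)). split; [apply Hzs|auto]. }
  exists l. split; auto.
  assert (Hsl : s <= atan (u l)).
  { apply Rnot_lt_le. intros Hlt.
    assert (Hat : continuity_pt atan (u l)).
    { apply derivable_continuous_pt, derivable_pt_atan. }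
    destruct (Hat ((s - atan (u l)) / 2)) as [a [Ha Hax]]; [lra|].
    destruct (Hc l Kl a Ha) as [d [Hd Hw]].
    destruct (Hl d Hd) as [N1 HN1].
    destruct (archimed_cor1 ((s - atan (u l)) / 2)) as [N2 [HN2 HN20]]; [lra|].
    set (n := max N1 N2). specialize (HN1 n ltac:(unfold n; lia)).
    specialize (Hw _ HN1). rewrite Cmod_RtoC_minus in Hw.
    destruct (Hzs (phi n)) as [_ Hn].
    assert (/ (INR (phi n) + 1) < / INR N2 \/ / (INR (phi n) + 1) = / INR N2 \/ / (INR (phi n) + 1) <= / INR N2).
    { right; right. apply Rinv_le_contravar; [now apply lt_0_INR|].
      assert (N2 <= phi n)%nat by (generalize (extraction_ge phi Hphi n); unfold n; lia).
      apply le_INR in H. lra. }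
    assert (Hb : Rabs (atan (u (zs (phi n))) - atan (u l)) < (s - atan (u l)) / 2).
    { destruct (Req_dec (u (zs (phi n))) (u l)) as [->|Hne].
      - rewrite Rminus_diag. rewrite Rabs_R0. lra.
      - apply (Hax (u (zs (phi n)))). split; [split; [exact I|congruence]|exact Hw]. }
    apply Rabs_def2 in Hb. lra. }
  intros w Hw. apply Rnot_lt_le. intros Hlt. apply atan_increasing in Hlt.
  assert (atan (u w) <= s); [|lra]. apply Hs1. exists w. auto.
Qed.

(** * Cauchy's formula *)

Definition rcont (g : R -> C) (t : R) : Prop :=
  @continuous R_UniformSpace C_UniformSpace g t.

Lemma rcont_intro (g : R -> C) (t : R) :
  (forall e, 0 < e -> exists d, 0 < d /\ forall s, Rabs (s - t) < d -> Cmod (g s - g t) < e) ->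
  rcont g t.
Proof.
  intros H P [e He]. destruct (H e (cond_pos e)) as [d [Hd Hs]].
  exists (mkposreal d Hd). intros s Hst. apply He.
  apply C_NormedModule_mixin_compat1. apply Hs. exact Hst.
Qed.

Lemma rcont_elim (g : R -> C) (t : R) : rcont g t ->
  forall e, 0 < e -> exists d, 0 < d /\ forall s, Rabs (s - t) < d -> Cmod (g s - g t) < e.
Proof.
  intros H e He.
  assert (Hs2 : 0 < sqrt 2) by (apply sqrt_lt_R0; lra).
  assert (He' : 0 < e / sqrt 2) by (apply Rdiv_lt_0_compat; auto).
  destruct (H (fun w => ball (g t) (mkposreal _ He') w)) as [d Hd].
  { now exists (mkposreal _ He'). }
  exists (pos d). split; [apply cond_pos|]. intros s Hs. specialize (Hd s Hs).
  apply (C_NormedModule_mixin_compat2 (g t) (g s)) in Hd. simpl in Hd.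
  replace (sqrt 2 * (e / sqrt 2)) with e in Hd by (field; lra). exact Hd.
Qed.

Lemma rcont_comp (f : C -> C) (g : R -> C) (t : R) :
  rcont g t -> ccont f (g t) -> rcont (fun s => f (g s)) t.
Proof.
  intros Hg Hf. apply rcont_intro. intros e He. destruct (Hf e He) as [d [Hd H]].
  destruct (rcont_elim _ _ Hg d Hd) as [d' [Hd' H']]. exists d'. split; auto.
Qed.

Lemma rcont_const (k : C) (t : R) : rcont (fun _ => k) t.
Proof. apply continuous_const. Qed.

Lemma rcont_plus (f g : R -> C) (t : R) :
  rcont f t -> rcont g t -> rcont (fun s => f s + g s)%C t.
Proof. intros Hf Hg. exact (continuous_plus (V := C_R_NormedModule) f g t Hf Hg). Qed.

Lemma rcont_opp (f : R -> C) (t : R) : rcont f t -> rcont (fun s => - f s)%C t.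
Proof. intros Hf. exact (continuous_opp (V := C_R_NormedModule) f t Hf). Qed.

Lemma rcont_minus (f g : R -> C) (t : R) :
  rcont f t -> rcont g t -> rcont (fun s => f s - g s)%C t.
Proof. intros Hf Hg. apply rcont_plus; auto. now apply rcont_opp. Qed.

Lemma rcont_pair (f g : R -> R) (t : R) :
  continuity_pt f t -> continuity_pt g t -> rcont (fun s => (f s, g s)) t.
Proof.
  intros Hf Hg. apply continuity_pt_filterlim in Hf, Hg.
  intros P [e He].
  assert (A : locally t (fun s => ball (f t) e (f s))) by (apply Hf; now exists e).
  assert (B : locally t (fun s => ball (g t) e (g s))) by (apply Hg; now exists e).
  unfold filtermap. apply (filter_imp _ _ (fun s H => He (f s, g s) (conj (proj1 H) (proj2 H)))).
  exact (filter_and _ _ A B).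
Qed.

Lemma rcont_fst (f : R -> C) (t : R) : rcont f t -> continuous (fun s => fst (f s)) t.
Proof.
  intros H. apply (continuous_comp f (fun p : R * R => fst p)); auto. apply continuous_fst.
Qed.

Lemma rcont_snd (f : R -> C) (t : R) : rcont f t -> continuous (fun s => snd (f s)) t.
Proof.
  intros H. apply (continuous_comp f (fun p : R * R => snd p)); auto. apply continuous_snd.
Qed.

Lemma rcont_mult (f g : R -> C) (t : R) :
  rcont f t -> rcont g t -> rcont (fun s => f s * g s)%C t.
Proof.
  intros Hf Hg.
  assert (A := rcont_fst _ _ Hf). assert (B := rcont_snd _ _ Hf).
  assert (A' := rcont_fst _ _ Hg). assert (B' := rcont_snd _ _ Hg).
  unfold Cmult. apply rcont_pair; apply continuity_pt_filterlim.
  - apply (continuous_minus (V := R_NormedModule) (fun s => fst (f s) * fst (g s)) (fun s => snd (f s) * snd (g s)));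
      now apply (continuous_mult (K := R_AbsRing)).
  - apply (continuous_plus (V := R_NormedModule) (fun s => fst (f s) * snd (g s)) (fun s => snd (f s) * fst (g s)));
      now apply (continuous_mult (K := R_AbsRing)).
Qed.

Definition CInt (f : R -> C) (a b : R) : C := @RInt C_R_CompleteNormedModule f a b.

Definition is_CInt (f : R -> C) (a b : R) (l : C) : Prop := @is_RInt C_R_NormedModule f a b l.

Lemma CInt_unique (f : R -> C) (a b : R) (l : C) : is_CInt f a b l -> CInt f a b = l.
Proof. intros H. exact (@is_RInt_unique C_R_CompleteNormedModule f a b l H). Qed.

Lemma CInt_correct (f : R -> C) (a b : R) :
  (forall t, Rmin a b <= t <= Rmax a b -> rcont f t) -> is_CInt f a b (CInt f a b).
Proof.
  intros H. apply (@RInt_correct C_R_CompleteNormedModule).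
  apply (@ex_RInt_continuous C_R_CompleteNormedModule). exact H.
Qed.

Lemma is_CInt_plus (f g : R -> C) (a b : R) (l m : C) :
  is_CInt f a b l -> is_CInt g a b m -> is_CInt (fun t => f t + g t)%C a b (l + m)%C.
Proof. intros H1 H2. exact (@is_RInt_plus C_R_NormedModule f g a b l m H1 H2). Qed.

Lemma is_CInt_opp (f : R -> C) (a b : R) (l : C) :
  is_CInt f a b l -> is_CInt (fun t => - f t)%C a b (- l)%C.
Proof. intros H1. exact (@is_RInt_opp C_R_NormedModule f a b l H1). Qed.

Lemma is_CInt_minus (f g : R -> C) (a b : R) (l m : C) :
  is_CInt f a b l -> is_CInt g a b m -> is_CInt (fun t => f t - g t)%C a b (l - m)%C.
Proof. intros H1 H2. apply is_CInt_plus; auto. now apply is_CInt_opp. Qed.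

Lemma is_CInt_pair (f : R -> C) (a b u v : R) :
  is_RInt (fun t => fst (f t)) a b u -> is_RInt (fun t => snd (f t)) a b v ->
  is_CInt f a b (u, v).
Proof. intros H1 H2. exact (is_RInt_fct_extend_pair f a b u v H1 H2). Qed.

Lemma is_CInt_fst (f : R -> C) (a b : R) (l : C) :
  is_CInt f a b l -> is_RInt (fun t => fst (f t)) a b (fst l).
Proof. intros H. exact (is_RInt_fct_extend_fst f a b l H). Qed.

Lemma is_CInt_snd (f : R -> C) (a b : R) (l : C) :
  is_CInt f a b l -> is_RInt (fun t => snd (f t)) a b (snd l).
Proof. intros H. exact (is_RInt_fct_extend_snd f a b l H). Qed.

Lemma is_CInt_scal (k : C) (f : R -> C) (a b : R) (l : C) :
  is_CInt f a b l -> is_CInt (fun t => k * f t)%C a b (k * l)%C.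
Proof.
  intros H. assert (A := is_CInt_fst _ _ _ _ H). assert (B := is_CInt_snd _ _ _ _ H).
  unfold Cmult at 2. apply is_CInt_pair; simpl.
  - apply (is_RInt_minus (V := R_NormedModule)); now apply (is_RInt_scal (V := R_NormedModule)).
  - apply (is_RInt_plus (V := R_NormedModule)); now apply (is_RInt_scal (V := R_NormedModule)).
Qed.

Lemma is_CInt_ext (f g : R -> C) (a b : R) (l : C) :
  (forall t, Rmin a b < t < Rmax a b -> f t = g t) -> is_CInt f a b l -> is_CInt g a b l.
Proof. intros H1 H2. exact (@is_RInt_ext C_R_NormedModule f g a b l H1 H2). Qed.

Lemma is_CInt_eq (f : R -> C) (a b : R) (l m : C) : is_CInt f a b l -> l = m -> is_CInt f a b m.
Proof. now intros H <-. Qed.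

Lemma is_CInt_const (k : C) (a b : R) : is_CInt (fun _ => k) a b (RtoC (b - a) * k)%C.
Proof. rewrite <- scal_R_Cmult. exact (@is_RInt_const C_R_NormedModule a b k). Qed.

Lemma is_CInt_Chasles (f : R -> C) (a b c : R) (l m : C) :
  is_CInt f a b l -> is_CInt f b c m -> is_CInt f a c (l + m)%C.
Proof. intros H1 H2. exact (@is_RInt_Chasles C_R_NormedModule f a b c l m H1 H2). Qed.

Lemma C_R_norm (z : C) : @norm R_AbsRing C_R_NormedModule z = Cmod z.
Proof.
  unfold Cmod. change (@norm R_AbsRing C_R_NormedModule z) with (sqrt (Rabs (fst z) ^ 2 + Rabs (snd z) ^ 2)).
  now rewrite !pow2_abs.
Qed.

Lemma is_CInt_bound (f : R -> C) (a b M : R) (l : C) : a <= b ->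
  (forall t, a <= t <= b -> Cmod (f t) <= M) -> is_CInt f a b l -> Cmod l <= (b - a) * M.
Proof.
  intros Hab HM H. rewrite <- C_R_norm.
  apply (norm_RInt_le (V := C_R_NormedModule) f (fun _ => M) a b l); auto.
  - intros t Ht. rewrite C_R_norm. auto.
  - exact (@is_RInt_const R_NormedModule a b M).
Qed.

Definition cis (t : R) : C := (cos t, sin t).

Lemma Cmod_cis (t : R) : Cmod (cis t) = 1.
Proof.
  unfold Cmod, cis; simpl. rewrite !Rmult_1_r.
  replace (cos t * cos t + sin t * sin t) with 1; [apply sqrt_1|].
  generalize (sin2_cos2 t). unfold Rsqr. lra.
Qed.

Lemma cis_neq_0 (t : R) : cis t <> 0.
Proof. apply Cmod_gt_0. rewrite Cmod_cis. lra. Qed.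

Lemma rcont_cis (t : R) : rcont cis t.
Proof. apply rcont_pair; [apply continuity_cos|apply continuity_sin]. Qed.

Lemma is_CInt_cis (a b : R) : is_CInt (fun t => Ci * cis t)%C a b (cis b - cis a)%C.
Proof.
  apply is_CInt_pair; simpl.
  - apply (is_RInt_ext (fun t => - sin t)). { intros t _. change (- sin t = 0 * cos t - 1 * sin t). ring. }
    apply (is_RInt_derive (V := R_CompleteNormedModule) cos).
    + intros x _. apply is_derive_Reals, derivable_pt_lim_cos.
    + intros x _. apply (continuous_opp (V := R_NormedModule)). apply continuity_pt_filterlim, continuity_sin.
  - apply (is_RInt_ext cos). { intros t _. change (cos t = 0 * sin t + 1 * cos t). ring. }
    apply (is_RInt_derive (V := R_CompleteNormedModule) sin).
    + intros x _. apply is_derive_Reals, derivable_pt_lim_sin.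
    + intros x _. apply continuity_pt_filterlim, continuity_cos.
Qed.

Lemma is_CInt_exp (a b : R) : is_CInt (fun t => RtoC (exp t)) a b (RtoC (exp b - exp a)).
Proof.
  apply is_CInt_pair; simpl.
  - apply (is_RInt_derive (V := R_CompleteNormedModule) exp).
    + intros x _. apply is_derive_Reals, derivable_pt_lim_exp.
    + intros x _. apply continuity_pt_filterlim, derivable_continuous_pt, derivable_pt_exp.
  - apply (is_RInt_ext (fun t => 0)); auto.
    assert (H := @is_RInt_const R_NormedModule a b 0).
    change (is_RInt (fun _ => 0) a b ((b - a) * 0)) in H. now rewrite Rmult_0_r in H.
Qed.

Lemma rcont_exp (t : R) : rcont (fun s => RtoC (exp s)) t.
Proof.
  apply rcont_pair; [apply derivable_continuous_pt, derivable_pt_exp|].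
  apply continuity_const. now intros ? ?.
Qed.

Lemma nested_limit (x : nat -> R) (W : R) : 0 <= W ->
  (forall n, x n <= x (S n) <= x n + W * (/2)^(S n)) ->
  exists l, forall n, x n <= l <= x n + W * (/2)^n.
Proof.
  intros HW Hx.
  assert (Hm : forall n m, x n <= x (m + n)%nat <= x n + W * ((/2)^n - (/2)^(m+n))).
  { intros n m. induction m as [|m IH]; simpl.
    - split; [lra|]. replace (W * ((/2)^n - (/2)^n)) with 0 by ring. lra.
    - destruct (Hx (m + n)%nat) as [H1 H2]. simpl in H2.
      assert (W * (/2 * (/2)^(m+n)) = W * (/2)^(m+n) - W * (/2 * (/2)^(m+n))) by field.
      nra. }
  assert (Hp : forall n, 0 < (/2)^n) by (intros n; apply pow_lt; lra).
  destruct (completeness (fun y => exists n, y = x n)) as [l [H1 H2]].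
  { exists (x O + W). intros y [n ->]. destruct (Hm O n) as [_ H]. simpl in H.
    replace (n + 0)%nat with n in H by lia. specialize (Hp n). nra. }
  { exists (x O), O. auto. }
  exists l. intros n. split; [apply H1; now exists n|].
  apply H2. intros y [m ->]. destruct (le_lt_dec n m) as [L|L].
  - destruct (Hm n (m - n)%nat) as [_ H]. replace (m - n + n)%nat with m in H by lia.
    specialize (Hp m). nra.
  - destruct (Hm m (n - m)%nat) as [H _]. replace (n - m + m)%nat with n in H by lia.
    specialize (Hp n). nra.
Qed.

(** Goursat's argument for any quantity additive under quartering: [J x y s] plays the boundary
    integral over the rectangle with corner (x, y) and sides s W, s H. Some quarter always keeps a
    fourth of the modulus, so along nested rectangles |J| is at least |J a c 1| s^2, against the
    o(s^2) bound at their common point. *)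
Lemma bisection (J : R -> R -> R -> C) (a c W H : R) : 0 < W -> 0 < H ->
  (forall x y s, 0 < s -> a <= x -> x + s * W <= a + W -> c <= y -> y + s * H <= c + H ->
     J x y s = (J x y (s/2)%R + J (x + s/2 * W)%R y (s/2)%R + J x (y + s/2 * H)%R (s/2)%R
                + J (x + s/2 * W)%R (y + s/2 * H)%R (s/2)%R)%C) ->
  (forall x0 y0 e, a <= x0 <= a + W -> c <= y0 <= c + H -> 0 < e ->
     exists d, 0 < d /\ forall x y s, 0 < s < d -> a <= x -> x + s * W <= a + W ->
       c <= y -> y + s * H <= c + H ->
       x <= x0 <= x + s * W -> y <= y0 <= y + s * H -> Cmod (J x y s) <= e * s ^ 2) ->
  J a c 1 = 0.
Proof.
  intros HW HH Hadd Hloc. apply NNPP. intros HJ.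
  assert (Hpos := proj1 (Cmod_gt_0 _) HJ). set (A := Cmod (J a c 1)) in *.
  assert (Hp : forall n, 0 < (/2)^n) by (intros n; apply pow_lt; lra).
  set (Inv := fun (n : nat) (p : R * R) =>
     a <= fst p /\ fst p + (/2)^n * W <= a + W /\ c <= snd p /\ snd p + (/2)^n * H <= c + H /\
     A * ((/2)^n)^2 <= Cmod (J (fst p) (snd p) ((/2)^n))).
  assert (Hstep : forall n p, Inv n p -> exists q, Inv (S n) q /\
     fst p <= fst q <= fst p + W * (/2)^(S n) /\ snd p <= snd q <= snd p + H * (/2)^(S n)).
  { intros n [x y] [I1 [I2 [I3 [I4 I5]]]]. unfold fst, snd in *.
    specialize (Hp n). set (s := (/2)^n) in *.
    assert (Es : (/2)^(S n) = s / 2) by (simpl; unfold s; field).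
    assert (Hs := Hadd x y s Hp I1 I2 I3 I4).
    assert (T : Cmod (J x y s) <= Cmod (J x y (s/2)%R) + Cmod (J (x + s/2 * W)%R y (s/2)%R)
       + Cmod (J x (y + s/2 * H)%R (s/2)%R) + Cmod (J (x + s/2 * W)%R (y + s/2 * H)%R (s/2)%R)).
    { rewrite Hs. eapply Rle_trans; [apply Cmod_triangle|]. apply Rplus_le_compat_r.
      eapply Rle_trans; [apply Cmod_triangle|]. apply Rplus_le_compat_r. apply Cmod_triangle. }
    assert (D : A * (s/2)^2 <= Cmod (J x y (s/2)%R) \/ A * (s/2)^2 <= Cmod (J (x + s/2 * W)%R y (s/2)%R)
      \/ A * (s/2)^2 <= Cmod (J x (y + s/2 * H)%R (s/2)%R)
      \/ A * (s/2)^2 <= Cmod (J (x + s/2 * W)%R (y + s/2 * H)%R (s/2)%R)).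
    { apply NNPP. intros N. apply not_or_and in N. destruct N as [N1 N]. apply not_or_and in N.
      destruct N as [N2 N]. apply not_or_and in N. destruct N as [N3 N4]. nra. }
    unfold Inv. rewrite Es.
    assert (0 < s * W) by now apply Rmult_lt_0_compat.
    assert (0 < s * H) by now apply Rmult_lt_0_compat.
    destruct D as [D|[D|[D|D]]].
    - exists (x, y). simpl fst; simpl snd. repeat split; try lra; auto.
    - exists (x + s/2 * W, y). simpl fst; simpl snd. repeat split; try lra; auto.
    - exists (x, y + s/2 * H). simpl fst; simpl snd. repeat split; try lra; auto.
    - exists (x + s/2 * W, y + s/2 * H). simpl fst; simpl snd. repeat split; try lra; auto. }
  assert (I0 : Inv O (a, c)).
  { unfold Inv. simpl. repeat split; try lra. unfold A. lra. }
  set (nxt := fun n (p : {p | Inv n p}) => constructive_indefinite_description _ (Hstep n _ (proj2_sig p))).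
  set (sq := fix sq n : {p | Inv n p} := match n return {p | Inv n p} with
     | O => exist _ _ I0
     | S m => exist _ (proj1_sig (nxt m (sq m))) (proj1 (proj2_sig (nxt m (sq m)))) end).
  destruct (nested_limit (fun n => fst (proj1_sig (sq n))) W) as [x0 Hx0]; [lra| |].
  { intros n. simpl sq. simpl proj1_sig. apply (proj1 (proj2 (proj2_sig (nxt n (sq n))))). }
  destruct (nested_limit (fun n => snd (proj1_sig (sq n))) H) as [y0 Hy0]; [lra| |].
  { intros n. simpl sq. simpl proj1_sig. apply (proj2 (proj2 (proj2_sig (nxt n (sq n))))). }
  destruct (Hloc x0 y0 (A/2)) as [d [Hd Hj]]; try lra.
  { specialize (Hx0 O). simpl in Hx0. lra. }
  { specialize (Hy0 O). simpl in Hy0. lra. }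
  destruct (pow_lt_1_zero (/2)) with (y := d) as [n Hn]; [rewrite Rabs_right; lra|lra|].
  specialize (Hn n (le_n n)). rewrite Rabs_right in Hn by (left; apply Hp).
  destruct (proj2_sig (sq n)) as [J1 [J2 [J3 [J4 J5]]]].
  specialize (Hx0 n). specialize (Hy0 n). specialize (Hp n).
  specialize (Hj (fst (proj1_sig (sq n))) (snd (proj1_sig (sq n))) ((/2)^n)).
  assert (Cmod (J (fst (proj1_sig (sq n))) (snd (proj1_sig (sq n))) ((/ 2) ^ n)) <= A / 2 * ((/2)^n)^2).
  { apply Hj; auto; simpl fst in *; lra. }
  assert (0 < ((/2)^n)^2) by (apply pow_lt; auto). nra.
Qed.

Definition holo_on (a : C) (r : R) (f : C -> C) : Prop :=
  forall w : C, Cmod (w - a) < r -> exists l, is_cderiv f w l.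

Lemma cis_lipschitz (x y : R) : Cmod (cis x - cis y) <= Rabs (x - y).
Proof.
  assert (H : forall a b, a <= b -> Cmod (cis b - cis a) <= b - a).
  { intros a b Hab. assert (B := is_CInt_bound (fun t => Ci * cis t)%C a b 1 (cis b - cis a)%C Hab). rewrite Rmult_1_r in B.
    apply (fun P => B P (is_CInt_cis a b)). intros t _. rewrite Cmod_mult, Cmod_Ci, Cmod_cis. lra. }
  destruct (Rle_lt_dec x y) as [L|L].
  - rewrite Cmod_sym, Rabs_left1 by lra. generalize (H x y L). lra.
  - rewrite Rabs_right by lra. apply H. lra.
Qed.

Lemma exp_lipschitz (x y : R) : x <= 0 -> y <= 0 -> Rabs (exp x - exp y) <= Rabs (x - y).
Proof.
  assert (H : forall a b, a <= b -> b <= 0 -> 0 <= exp b - exp a <= b - a).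
  { intros a b Hab Hb. split.
    - destruct Hab as [Hab| ->]; [|lra]. apply exp_increasing in Hab. lra.
    - assert (E : exp a = exp b * exp (a - b)) by (rewrite <- exp_plus; f_equal; ring).
      generalize (exp_ineq1_le (a - b)). intros.
      assert (exp b <= 1). { rewrite <- exp_0. destruct Hb as [Hb| ->]; [left; now apply exp_increasing|lra]. }
      generalize (exp_pos b). intros. rewrite E. nra. }
  intros Hx Hy. destruct (Rle_lt_dec x y) as [L|L].
  - generalize (H x y L Hy). intros. rewrite !Rabs_left1; lra.
  - generalize (H y x (Rlt_le _ _ L) Hx). intros. rewrite !Rabs_right; lra.
Qed.

Section Cauchy.
Variables (f : C -> C) (a z : C) (R1 R0 : R).
Hypothesis Hf : holo_on a R1 f.
Hypothesis HR0 : 0 < R0.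
Hypothesis HR1 : R0 < R1.
Hypothesis Hz : Cmod (z - a) < R0.
(** Logarithmic polar coordinates about [z]: for x from 0 to minus infinity, [H x t] contracts the
    circle of radius [R0] about [a] to the point [z]. The function [k] below is the logarithmic
    derivative of [dl], so that the t-derivative of [H] is [k] times its x-derivative; [k] is also
    the Cauchy kernel pulled back to the circle. *)
Let dl (t : R) : C := (a - z + RtoC R0 * cis t)%C.

Let H (x t : R) : C := (z + RtoC (exp x) * dl t)%C.

Let k (t : R) : C := (Ci * RtoC R0 * cis t / dl t)%C.

Let F (x t : R) : C := f (H x t).

Let K := R0 / (R0 - Cmod (z - a)).

Let CmodR0 (t : R) : Cmod (RtoC R0 * cis t) = R0.
Proof. rewrite Cmod_mult, Cmod_R, Cmod_cis, Rabs_right; lra. Qed.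

Let dl_ge (t : R) : R0 - Cmod (z - a) <= Cmod (dl t).
Proof.
  unfold dl. replace (a - z + RtoC R0 * cis t)%C with (RtoC R0 * cis t - (z - a))%C by ring.
  rewrite <- (CmodR0 t) at 1. apply Cmod_rtriangle.
Qed.

Let dl_le (t : R) : Cmod (dl t) <= 2 * R0.
Proof.
  unfold dl. replace (a - z + RtoC R0 * cis t)%C with (RtoC R0 * cis t - (z - a))%C by ring.
  generalize (Cmod_minus_le (RtoC R0 * cis t) (z - a)). rewrite CmodR0. lra.
Qed.

Let dl_neq (t : R) : dl t <> 0.
Proof. apply Cmod_gt_0. generalize (dl_ge t). lra. Qed.

Let k_le (t : R) : Cmod (k t) <= K.
Proof.
  unfold k, K. replace (Ci * RtoC R0 * cis t)%C with (Ci * (RtoC R0 * cis t))%C by ring.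
  rewrite Cmod_div, Cmod_mult, Cmod_Ci, CmodR0 by auto. generalize (dl_ge t). intros.
  unfold Rdiv. rewrite Rmult_1_l. apply Rmult_le_compat_l; [lra|]. apply Rinv_le_contravar; lra.
Qed.

Let K_pos : 0 < K.
Proof. unfold K. apply Rdiv_lt_0_compat; lra. Qed.

Let exp_le1 (x : R) : x <= 0 -> 0 < exp x <= 1.
Proof.
  intros Hx. split; [apply exp_pos|]. rewrite <- exp_0.
  destruct Hx as [Hx| ->]; [left; now apply exp_increasing|lra].
Qed.

Let H_in (x t : R) : x <= 0 -> Cmod (H x t - a) < R1.
Proof.
  intros Hx. assert (E := exp_le1 x Hx).
  assert (EQ : (H x t - a)%C = (RtoC (1 - exp x) * (z - a) + RtoC (exp x) * (RtoC R0 * cis t))%C).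
  { unfold H, dl. rewrite RtoC_minus. ring. }
  rewrite EQ. eapply Rle_lt_trans; [apply Cmod_triangle|].
  rewrite (Cmod_mult (RtoC (1 - exp x))), (Cmod_mult (RtoC (exp x))), CmodR0, !Cmod_R.
  rewrite !Rabs_right by lra. nra.
Qed.

Let rc_dl (t : R) : rcont dl t.
Proof. unfold dl. apply rcont_plus; [apply rcont_const|]. apply rcont_mult; [apply rcont_const|apply rcont_cis]. Qed.

Let rc_k (t : R) : rcont k t.
Proof.
  unfold k, Cdiv. apply rcont_mult.
  - apply rcont_mult; [apply rcont_const|apply rcont_cis].
  - apply (rcont_comp Cinv dl); auto. apply ccont_inv_id, dl_neq.
Qed.

Let f_cont (x t : R) : x <= 0 -> ccont f (H x t).
Proof. intros Hx. destruct (Hf (H x t) (H_in x t Hx)) as [l Hl]. eapply is_cderiv_cont, Hl. Qed.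

Let rc_F2 (x t : R) : x <= 0 -> rcont (F x) t.
Proof.
  intros Hx. unfold F. apply (rcont_comp f (H x)); [|auto].
  apply rcont_plus; [apply rcont_const|]. apply rcont_mult; [apply rcont_const|apply rc_dl].
Qed.

Let rc_F1 (x t : R) : x <= 0 -> rcont (fun y => F y t) x.
Proof.
  intros Hx. unfold F. apply (rcont_comp f (fun y => H y t)); [|auto].
  apply rcont_plus; [apply rcont_const|]. apply rcont_mult; [apply rcont_exp|apply rcont_const].
Qed.

(** For smooth [F] the integrals of [A1] in t and of [A2] in x would be the two iterated integrals
    of the t-derivative of [F], which is [k] times the x-derivative. [Rect] is their difference, and
    its vanishing is Goursat's theorem in these coordinates; no continuity of the derivative of [f]
    is assumed. *)
Let A1 (x1 x2 : R) (t : R) : C := (k t * (F x2 t - F x1 t))%C.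

Let A2 (y1 y2 : R) (x : R) : C := (F x y2 - F x y1)%C.

Let Rect (x1 x2 y1 y2 : R) : C := (CInt (A1 x1 x2) y1 y2 - CInt (A2 y1 y2) x1 x2)%C.

Let int_A1 (x1 x2 y1 y2 : R) : x1 <= 0 -> x2 <= 0 -> is_CInt (A1 x1 x2) y1 y2 (CInt (A1 x1 x2) y1 y2).
Proof.
  intros. apply CInt_correct. intros t _. unfold A1.
  apply rcont_mult; [apply rc_k|]. apply rcont_minus; now apply rc_F2.
Qed.

Let int_A2 (x1 x2 y1 y2 : R) : x1 <= 0 -> x2 <= 0 -> is_CInt (A2 y1 y2) x1 x2 (CInt (A2 y1 y2) x1 x2).
Proof.
  intros. apply CInt_correct. intros t Ht. assert (t <= 0).
  { eapply Rle_trans; [apply Ht|]. now apply Rmax_lub. }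
  unfold A2. apply rcont_minus; now apply rc_F1.
Qed.

Let Rect_split_x (x1 x2 x3 y1 y2 : R) : x1 <= 0 -> x2 <= 0 -> x3 <= 0 ->
  Rect x1 x3 y1 y2 = (Rect x1 x2 y1 y2 + Rect x2 x3 y1 y2)%C.
Proof.
  intros H1 H2 H3. unfold Rect.
  assert (E1 : CInt (A1 x1 x3) y1 y2 = (CInt (A1 x1 x2) y1 y2 + CInt (A1 x2 x3) y1 y2)%C).
  { apply CInt_unique. eapply is_CInt_ext; [|apply is_CInt_plus; apply int_A1; auto].
    intros t _. unfold A1. ring. }
  assert (E2 : CInt (A2 y1 y2) x1 x3 = (CInt (A2 y1 y2) x1 x2 + CInt (A2 y1 y2) x2 x3)%C).
  { apply CInt_unique. eapply is_CInt_Chasles; apply int_A2; auto. }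
  rewrite E1, E2. ring.
Qed.

Let Rect_split_y (x1 x2 y1 y2 y3 : R) : x1 <= 0 -> x2 <= 0 ->
  Rect x1 x2 y1 y3 = (Rect x1 x2 y1 y2 + Rect x1 x2 y2 y3)%C.
Proof.
  intros H1 H2. unfold Rect.
  assert (E1 : CInt (A2 y1 y3) x1 x2 = (CInt (A2 y1 y2) x1 x2 + CInt (A2 y2 y3) x1 x2)%C).
  { apply CInt_unique. eapply is_CInt_ext; [|apply is_CInt_plus; apply int_A2; auto].
    intros t _. unfold A2. ring. }
  assert (E2 : CInt (A1 x1 x2) y1 y3 = (CInt (A1 x1 x2) y1 y2 + CInt (A1 x1 x2) y2 y3)%C).
  { apply CInt_unique. eapply is_CInt_Chasles; apply int_A1; auto. }
  rewrite E1, E2. ring.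
Qed.

Let H_lip (x y x0 y0 : R) : x <= 0 -> x0 <= 0 ->
  Cmod (H x y - H x0 y0) <= 2 * R0 * (Rabs (x - x0) + Rabs (y - y0)).
Proof.
  intros Hx Hx0.
  replace (H x y - H x0 y0)%C with (RtoC (exp x - exp x0) * dl y + RtoC (exp x0) * (RtoC R0 * (cis y - cis y0)))%C.
  2:{ unfold H, dl. rewrite RtoC_minus. ring. }
  eapply Rle_trans; [apply Cmod_triangle|].
  rewrite !Cmod_mult, !Cmod_R.
  generalize (exp_lipschitz x x0 Hx Hx0) (cis_lipschitz y y0) (dl_le y) (exp_le1 x0 Hx0)
    (Rabs_pos (exp x - exp x0)) (Cmod_ge_0 (dl y)) (Cmod_ge_0 (cis y - cis y0)). intros.
  rewrite (Rabs_right (exp x0)) by lra. rewrite (Rabs_right R0) by lra.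
  assert (Rabs (exp x - exp x0) * Cmod (dl y) <= Rabs (x - x0) * (2 * R0)).
  { apply Rmult_le_compat; lra. }
  assert (R0 * Cmod (cis y - cis y0) <= R0 * Rabs (y - y0)) by (apply Rmult_le_compat_l; lra).
  assert (0 <= R0 * Cmod (cis y - cis y0)) by (apply Rmult_le_pos; lra).
  assert (0 <= R0 * Rabs (y - y0)) by lra.
  nra.
Qed.

(* An affine function of [H] has an exact primitive, so only the remainder of the
   first-order expansion of [f] contributes. *)
Let Rect_small (x0 y0 e : R) : x0 <= 0 -> 0 < e -> exists d, 0 < d /\
  forall x1 x2 y1 y2, x1 <= x0 <= x2 -> y1 <= y0 <= y2 -> x2 <= 0 -> x2 - x1 < d -> y2 - y1 < d ->
   Cmod (Rect x1 x2 y1 y2) <= e * ((x2 - x1) + (y2 - y1)) ^ 2.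
Proof.
  intros Hx0 He.
  destruct (Hf (H x0 y0) (H_in x0 y0 Hx0)) as [l Hl].
  set (e' := e / (4 * R0 * (K + 1))).
  assert (He' : 0 < e'). { apply Rdiv_lt_0_compat; nra. }
  destruct (Hl e' He') as [d [Hd Hw]].
  exists (d / (4 * R0)). split; [apply Rdiv_lt_0_compat; lra|].
  intros x1 x2 y1 y2 Hx Hy Hx2 Dx Dy.
  set (D := (x2 - x1) + (y2 - y1)). assert (HD : 0 <= D) by (unfold D; lra).
  set (E := fun x y => (F x y - f (H x0 y0) - l * (H x y - H x0 y0))%C).
  assert (HE : forall x y, x1 <= x <= x2 -> y1 <= y <= y2 -> Cmod (E x y) <= e' * (2 * R0 * D)).
  { intros x y Hxx Hyy. assert (L := H_lip x y x0 y0 ltac:(lra) Hx0).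
    assert (Rabs (x - x0) <= x2 - x1) by (apply Rabs_le; lra).
    assert (Rabs (y - y0) <= y2 - y1) by (apply Rabs_le; lra).
    assert (L2 : Cmod (H x y - H x0 y0) <= 2 * R0 * D).
    { eapply Rle_trans; [exact L|]. apply Rmult_le_compat_l; unfold D; lra. }
    eapply Rle_trans; [apply Hw|].
    - eapply Rle_lt_trans; [exact L2|].
      replace d with (4 * R0 * (d / (4 * R0))) by (field; lra). unfold D. nra.
    - apply Rmult_le_compat_l; lra. }
  assert (I1 : is_CInt (fun t => l * RtoC (exp x2 - exp x1) * RtoC R0 * (Ci * cis t))%C y1 y2
      (l * RtoC (exp x2 - exp x1) * RtoC R0 * (cis y2 - cis y1))%C).
  { apply is_CInt_scal, is_CInt_cis. }
  assert (I2 : is_CInt (fun x => l * RtoC R0 * (cis y2 - cis y1) * RtoC (exp x))%C x1 x2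
      (l * RtoC R0 * (cis y2 - cis y1) * RtoC (exp x2 - exp x1))%C).
  { apply is_CInt_scal, is_CInt_exp. }
  assert (J1 : is_CInt (fun t => k t * (E x2 t - E x1 t))%C y1 y2
      (CInt (A1 x1 x2) y1 y2 - l * RtoC (exp x2 - exp x1) * RtoC R0 * (cis y2 - cis y1))%C).
  { eapply is_CInt_ext; [|apply is_CInt_minus; [apply int_A1|exact I1]]; try lra.
    intros t _. unfold A1, E, k, H. rewrite RtoC_minus. field. apply dl_neq. }
  assert (J2 : is_CInt (fun x => E x y2 - E x y1)%C x1 x2
      (CInt (A2 y1 y2) x1 x2 - l * RtoC R0 * (cis y2 - cis y1) * RtoC (exp x2 - exp x1))%C).
  { eapply is_CInt_ext; [|apply is_CInt_minus; [apply int_A2|exact I2]]; try lra.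
    intros t _. unfold A2, E, H, dl. ring. }
  set (m := e' * (2 * R0 * D)) in *.
  assert (B1 := is_CInt_bound _ y1 y2 (K * (2 * m)) _ ltac:(lra) (fun t Ht =>
     Rle_trans _ _ _ (Req_le _ _ (Cmod_mult _ _)) (Rmult_le_compat _ _ _ _ (Cmod_ge_0 _) (Cmod_ge_0 _) (k_le t)
       (Rle_trans _ _ _ (Cmod_minus_le _ _) (Rle_trans _ _ _ (Rplus_le_compat _ _ _ _ (HE x2 t ltac:(lra) Ht) (HE x1 t ltac:(lra) Ht)) (Req_le (m + m) (2 * m) ltac:(ring)))))) J1).
  assert (B2 := is_CInt_bound _ x1 x2 (2 * m) _ ltac:(lra) (fun t Ht =>
       (Rle_trans _ _ _ (Cmod_minus_le _ _) (Rle_trans _ _ _ (Rplus_le_compat _ _ _ _ (HE t y2 Ht ltac:(lra)) (HE t y1 Ht ltac:(lra))) (Req_le (m + m) (2 * m) ltac:(ring))))) J2).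
  match type of B1 with Cmod ?u <= _ => set (u1 := u) in * end.
  match type of B2 with Cmod ?u <= _ => set (u2 := u) in * end.
  replace (Rect x1 x2 y1 y2) with (u1 - u2)%C by (unfold u1, u2, Rect; ring).
  eapply Rle_trans; [apply Cmod_minus_le|].
  assert (0 <= m) by (unfold m; apply Rmult_le_pos; nra).
  apply Rle_trans with (D * ((K + 1) * (2 * m))).
  { assert (y2 - y1 <= D) by (unfold D; lra). assert (x2 - x1 <= D) by (unfold D; lra).
    assert ((y2 - y1) * (K * (2 * m)) <= D * (K * (2 * m))) by (apply Rmult_le_compat_r; auto; apply Rmult_le_pos; lra).
    assert ((x2 - x1) * (2 * m) <= D * (2 * m)) by (apply Rmult_le_compat_r; lra). lra. }
  apply Req_le. unfold m, e'. field. split; lra.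
Qed.

Let Rect_zero (X : R) : 0 < X -> Rect (- X) 0 0 (2 * PI) = 0.
Proof.
  intros HX. assert (HPI := PI_RGT_0).
  assert (Z := bisection (fun x y s => Rect x (x + s * X) y (y + s * (2 * PI))) (- X) 0 X (2 * PI) HX ltac:(lra)).
  cbv beta in Z. replace (- X + 1 * X) with 0 in Z by ring. replace (0 + 1 * (2 * PI)) with (2 * PI) in Z by ring.
  apply Z; clear Z.
  - intros x y s Hs Ha Hb Hc Hd.
    assert (0 < s * X) by nra.
    rewrite (Rect_split_x x (x + s / 2 * X) (x + s * X)) by lra.
    rewrite (Rect_split_y x (x + s / 2 * X) y (y + s / 2 * (2 * PI)) (y + s * (2 * PI))) by lra.
    rewrite (Rect_split_y (x + s / 2 * X) (x + s * X) y (y + s / 2 * (2 * PI)) (y + s * (2 * PI))) by lra.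
    replace (x + s / 2 * X + s / 2 * X) with (x + s * X) by field.
    replace (y + s / 2 * (2 * PI) + s / 2 * (2 * PI)) with (y + s * (2 * PI)) by field.
    ring.
  - intros x0 y0 e Hx0 Hy0 He.
    set (q := X + 2 * PI).
    destruct (Rect_small x0 y0 (e / q^2)) as [d [Hd Hr]]; [lra| |].
    { apply Rdiv_lt_0_compat; auto. apply pow_lt. unfold q; lra. }
    exists (d / q). split; [apply Rdiv_lt_0_compat; unfold q; lra|].
    intros x y s Hs Ha Hb Hc Hd' Hx Hy.
    assert (Sq : s * q < d).
    { replace d with (d / q * q) by (field; unfold q; lra). apply Rmult_lt_compat_r; [unfold q|]; lra. }
    assert (0 < s * X) by nra. assert (0 < s * PI) by nra.
    eapply Rle_trans; [apply Hr; try lra; unfold q in Sq; lra|].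
    apply Req_le. unfold q. field. lra.
Qed.

(** On the rectangle [-X, 0] x [0, 2 PI] the horizontal sides cancel by periodicity, and on the side
    x = -X the values of [F] tend to [f z] uniformly as X grows. The integral of the kernel [k]
    itself stays unevaluated here. *)
Lemma cauchy_aux : is_CInt (fun t => k t * f (a + RtoC R0 * cis t))%C 0 (2 * PI)
   (f z * CInt k 0 (2 * PI))%C.
Proof.
  assert (HPI := PI_RGT_0).
  assert (IK : is_CInt k 0 (2 * PI) (CInt k 0 (2 * PI))) by (apply CInt_correct; auto).
  assert (IF : is_CInt (fun t => k t * F 0 t)%C 0 (2 * PI) (CInt (fun t => k t * F 0 t)%C 0 (2 * PI))).
  { apply CInt_correct. intros t _. apply rcont_mult; [apply rc_k|apply rc_F2; lra]. }
  eapply is_CInt_ext with (f := fun t => (k t * F 0 t)%C).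
  { intros t _. unfold F, H, dl. rewrite exp_0. do 2 f_equal. ring. }
  eapply is_CInt_eq; [exact IF|]. apply Cminus_eq0, Cmod_eps0. intros e He.
  destruct (Hf z) as [l Hl]; [lra|].
  set (e' := e / (2 * PI * K)).
  assert (He' : 0 < e') by (apply Rdiv_lt_0_compat; nra).
  destruct (is_cderiv_cont _ _ _ Hl e' He') as [d [Hd Hc]].
  assert (Xe : exists X, 0 < X /\ exp (- X) < d / (2 * R0)).
  { assert (Hq : 0 < d / (2 * R0)) by (apply Rdiv_lt_0_compat; lra).
    exists (Rmax 1 (1 - ln (d / (2 * R0)))). split; [generalize (Rmax_l 1 (1 - ln (d / (2 * R0)))); lra|].
    rewrite <- (exp_ln (d / (2 * R0))) by auto. apply exp_increasing.
    rewrite exp_ln by auto. generalize (Rmax_r 1 (1 - ln (d / (2 * R0)))). lra. }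
  destruct Xe as [X [HX HXd]].
  assert (Z := Rect_zero X HX). unfold Rect in Z.
  assert (Z2 : CInt (A2 0 (2 * PI)) (- X) 0 = 0).
  { apply CInt_unique. eapply is_CInt_ext with (f := fun _ => RtoC 0).
    - intros x _. unfold A2, F, H, dl, cis. rewrite cos_2PI, sin_2PI, cos_0, sin_0. ring.
    - eapply is_CInt_eq; [apply is_CInt_const|ring]. }
  rewrite Z2 in Z.
  assert (IX : is_CInt (fun t => k t * (F (- X) t - f z))%C 0 (2 * PI)
    (CInt (fun t => k t * F 0 t)%C 0 (2 * PI) - CInt (A1 (- X) 0) 0 (2 * PI) - f z * CInt k 0 (2 * PI))%C).
  { eapply is_CInt_ext; [|apply is_CInt_minus; [apply is_CInt_minus; [exact IF|apply int_A1; lra]|apply is_CInt_scal; exact IK]].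
    intros t _. unfold A1. ring. }
  replace (CInt (A1 (- X) 0) 0 (2 * PI)) with (RtoC 0) in IX.
  2:{ symmetry. replace (CInt (A1 (- X) 0) 0 (2 * PI)) with (CInt (A1 (- X) 0) 0 (2 * PI) - 0)%C by ring. exact Z. }
  replace (CInt (fun t => k t * F 0 t) 0 (2 * PI) - f z * CInt k 0 (2 * PI))%C
    with (CInt (fun t => k t * F 0 t) 0 (2 * PI) - 0 - f z * CInt k 0 (2 * PI))%C by ring.
  replace e with ((2 * PI - 0) * (K * e')) by (unfold e'; field; lra).
  eapply is_CInt_bound; [lra| |exact IX].
  intros t _. cbv beta. rewrite Cmod_mult. apply Rmult_le_compat; try apply Cmod_ge_0; [apply k_le|].
  left. apply Hc. unfold H. replace (z + RtoC (exp (- X)) * dl t - z)%C with (RtoC (exp (- X)) * dl t)%C by ring.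
  rewrite Cmod_mult, Cmod_R, Rabs_right by (left; apply exp_pos).
  generalize (dl_le t) (exp_pos (- X)) (Cmod_ge_0 (dl t)). intros.
  replace d with (d / (2 * R0) * (2 * R0)) by (field; lra). nra.
Qed.

End Cauchy.

Lemma is_CInt_conj (f : R -> C) (u v : R) (l : C) :
  is_CInt f u v l -> is_CInt (fun t => Cconj (f t)) u v (Cconj l).
Proof.
  intros H. apply is_CInt_pair; simpl.
  - apply (is_CInt_fst _ _ _ _ H).
  - apply (is_RInt_opp (V := R_NormedModule)). apply (is_CInt_snd _ _ _ _ H).
Qed.

Lemma cis_conj (t : R) : (Cconj (cis t) * cis t = 1)%C.
Proof.
  rewrite Cmult_comm, <- Cmod2_conj, Cmod_cis. f_equal. ring.
Qed.

Lemma mean_value (f : C -> C) (a : C) (R1 r : R) : holo_on a R1 f -> 0 < r < R1 ->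
  is_CInt (fun t => f (a + RtoC r * cis t)%C) 0 (2 * PI) (RtoC (2 * PI) * f a)%C.
Proof.
  intros Hf Hr. assert (H0 : Cmod (a - a) < r).
  { replace (a - a)%C with (RtoC 0) by ring. rewrite Cmod_0. lra. }
  assert (Z := cauchy_aux f a a R1 r Hf ltac:(lra) ltac:(lra) H0).
  assert (RtoC r <> 0) by (intros E; apply RtoC_inj in E; lra).
  assert (EK : forall t, (Ci * RtoC r * cis t / (a - a + RtoC r * cis t))%C = Ci).
  { intros t. replace (a - a + RtoC r * cis t)%C with (RtoC r * cis t)%C by ring.
    field; repeat split; auto using cis_neq_0. }
  assert (IK : CInt (fun t : R => (Ci * RtoC r * cis t / (a - a + RtoC r * cis t))%C) 0 (2 * PI) = (RtoC (2 * PI) * Ci)%C).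
  { apply CInt_unique. eapply is_CInt_ext with (f := fun _ => Ci).
    - intros t _. now rewrite EK.
    - eapply is_CInt_eq; [apply is_CInt_const|]. now rewrite Rminus_0_r. }
  cbv beta zeta in Z. rewrite IK in Z. apply (is_CInt_scal (/ Ci)) in Z.
  eapply is_CInt_eq; [eapply is_CInt_ext; [|exact Z]|].
  - intros t _. cbv beta. rewrite EK. field. apply Ci_nz.
  - field. apply Ci_nz.
Qed.

(** What [cauchy_aux] leaves open is the winding integral of its kernel. It follows from the mean
    value property of the conjugated kernel [g], whose value at the centre is 1. *)
Theorem cauchy_formula (f : C -> C) (a z : C) (R1 r : R) :
  holo_on a R1 f -> 0 < r < R1 -> Cmod (z - a) < r ->
  is_CInt (fun t => RtoC r * cis t / (a + RtoC r * cis t - z) * f (a + RtoC r * cis t))%C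
    0 (2 * PI) (RtoC (2 * PI) * f z)%C.
Proof.
  intros Hf Hr Hz. assert (Z := cauchy_aux f a z R1 r Hf ltac:(lra) ltac:(lra) Hz).
  assert (Hr0 : RtoC r <> 0) by (intros E; apply RtoC_inj in E; lra).
  assert (Hden : forall t, (RtoC r * cis t - (z - a))%C <> 0).
  { intros t E. apply Cminus_eq0 in E. rewrite <- E, Cmod_mult, Cmod_cis, Cmod_R, Rabs_right in Hz; lra. }
  assert (IK : CInt (fun t : R => (Ci * RtoC r * cis t / (a - z + RtoC r * cis t))%C) 0 (2 * PI) = (RtoC (2 * PI) * Ci)%C).
  { apply CInt_unique.
    (* The conjugate of the Cauchy kernel is again holomorphic in the circle variable. *)
    set (g := fun w : C => (/ (1 - Cconj (z - a) * (w - a) / RtoC (r * r)))%C).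
    assert (Hlt : exists r2, r < r2 /\ forall w, Cmod (w - a) < r2 -> (1 - Cconj (z - a) * (w - a) / RtoC (r * r))%C <> 0).
    (* The pole of [g] is the reflection of [z] in the circle, at distance r^2/|z - a| from the
       centre; this radius lies strictly between [r] and that distance. *)
    { exists (2 * r * r / (r + Cmod (z - a))). assert (P := Cmod_ge_0 (z - a)). split.
      - apply Rmult_lt_reg_r with (r + Cmod (z - a)); [lra|].
        unfold Rdiv. rewrite Rmult_assoc, Rinv_l by lra. nra.
      - intros w Hw E. apply Cminus_eq0 in E.
        assert (E2 : Cmod (Cconj (z - a) * (w - a) / RtoC (r * r)) = 1) by (rewrite <- E; apply Cmod_1).
        assert (Hrr : RtoC (r * r) <> 0) by (intros E'; apply RtoC_inj in E'; nra).
        rewrite Cmod_div, Cmod_mult, Cmod_conj, Cmod_R, Rabs_right in E2 by (auto; nra).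
        assert (E3 : Cmod (z - a) * Cmod (w - a) = r * r).
        { replace (r * r) with (1 * (r * r)) by ring. rewrite <- E2. field. lra. }
        assert (E4 : Cmod (w - a) * (r + Cmod (z - a)) < 2 * r * r).
        { replace (2 * r * r) with (2 * r * r / (r + Cmod (z - a)) * (r + Cmod (z - a))) by (field; lra).
          apply Rmult_lt_compat_r; lra. }
        generalize (Cmod_ge_0 (w - a)). intros. nra. }
    destruct Hlt as [r2 [Hr2 Hne]].
    assert (Hg : holo_on a r2 g).
    { intros w Hw. eexists. unfold g. apply is_cderiv_inv; [|now apply Hne].
      unfold Cdiv. apply is_cderiv_minus; [apply is_cderiv_const|].
      apply is_cderiv_mult; [|apply is_cderiv_const].
      apply is_cderiv_mult; [apply is_cderiv_const|].
      apply is_cderiv_minus; [apply is_cderiv_id|apply is_cderiv_const]. }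
    assert (M := mean_value g a r2 r Hg ltac:(lra)).
    apply is_CInt_conj, (is_CInt_scal Ci) in M.
    eapply is_CInt_eq; [eapply is_CInt_ext; [|exact M]|].
    - intros t _. unfold g.
      assert (Hn : (1 - Cconj (z - a) * (a + RtoC r * cis t - a) / RtoC (r * r))%C <> 0).
      { apply Hne. replace (a + RtoC r * cis t - a)%C with (RtoC r * cis t)%C by ring.
        rewrite Cmod_mult, Cmod_cis, Cmod_R, Rabs_right; lra. }
      rewrite Cinv_conj by auto. rewrite Cminus_conj, Cdiv_conj, Cmult_conj, Cconj_conj
        by (intros E'; apply RtoC_inj in E'; nra).
      replace (a + RtoC r * cis t - a)%C with (RtoC r * cis t)%C by ring.
      rewrite Cmult_conj.
      assert (ER : forall x : R, Cconj (RtoC x) = RtoC x) by (intros x; unfold Cconj, RtoC; simpl; now rewrite Ropp_0).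
      rewrite !ER, RtoC_mult.
      assert (EC : Cconj (cis t) = (/ cis t)%C).
      { assert (Q := cis_conj t). assert (Q2 := cis_neq_0 t).
        transitivity (Cconj (cis t) * cis t * / cis t)%C; [field; auto|rewrite Q; ring]. }
      rewrite EC. specialize (Hden t).
      assert (Hd2 : (a - z + RtoC r * cis t)%C <> 0).
      { replace (a - z + RtoC r * cis t)%C with (RtoC r * cis t - (z - a))%C by ring. auto. }
      field; repeat split; auto using cis_neq_0, Ci_nz.
    - assert (ER : forall x : R, Cconj (RtoC x) = RtoC x) by (intros x; unfold Cconj, RtoC; simpl; now rewrite Ropp_0).
      unfold g. rewrite Cmult_conj, ER.
      replace (Cconj (/ (1 - Cconj (z - a) * (a - a) / (r * r)%R)))%C with (RtoC 1).
      ring. replace (1 - Cconj (z - a) * (a - a) / (r * r)%R)%C with (RtoC 1).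
      rewrite <- RtoC_inv by lra. rewrite ER. f_equal. field.
      field. intros E'; apply RtoC_inj in E'; nra. }
  cbv beta zeta in Z. rewrite IK in Z. apply (is_CInt_scal (/ Ci)) in Z.
  eapply is_CInt_eq; [eapply is_CInt_ext; [|exact Z]|].
  - intros t _. cbv beta.
    assert (Hd2 := Hden t).
    replace (a - z + RtoC r * cis t)%C with (RtoC r * cis t - (z - a))%C by ring.
    replace (a + RtoC r * cis t - z)%C with (RtoC r * cis t - (z - a))%C by ring.
    field; repeat split; auto using cis_neq_0, Ci_nz.
  - field. apply Ci_nz.
Qed.

Lemma holo_cont (a : C) (R1 : R) (f : C -> C) (z : C) :
  holo_on a R1 f -> Cmod (z - a) < R1 -> ccont f z.
Proof. intros H Hz. destruct (H z Hz) as [l Hl]. eapply is_cderiv_cont, Hl. Qed.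

Lemma holo_C_derive (a : C) (R1 : R) (f : C -> C) (z : C) :
  holo_on a R1 f -> Cmod (z - a) < R1 -> is_cderiv f z (C_derive f z).
Proof.
  intros H Hz. destruct (H z Hz) as [l Hl]. now rewrite (is_cderiv_C_derive _ _ _ Hl).
Qed.

Lemma closed_disk_max (u : C -> R) (a : C) (r : R) : 0 <= r ->
  (forall z, Cmod (z - a) <= r -> ccont (fun w => RtoC (u w)) z) ->
  exists z0, Cmod (z0 - a) <= r /\ forall w, Cmod (w - a) <= r -> u w <= u z0.
Proof.
  intros Hr Hu.
  apply (max_on_compact (fun z => Cmod (z - a) <= r) u (r + Cmod a)); auto.
  - intros z Hz. generalize (Cmod_rtriangle z a). lra.
  - intros l Hl. apply Rnot_lt_le. intros H.
    destruct (Hl (Cmod (l - a) - r)) as [z [Hz Hzl]]; [lra|].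
    generalize (Cmod_dist_tri l z a). rewrite (Cmod_sym l z). lra.
  - exists a. replace (a - a)%C with (RtoC 0) by ring. rewrite Cmod_0. lra.
Qed.

Lemma holo_bounded (f : C -> C) (a : C) (R1 r : R) : holo_on a R1 f -> r < R1 ->
  exists M, 0 < M /\ forall z, Cmod (z - a) <= r -> Cmod (f z) <= M.
Proof.
  intros Hf Hr. destruct (Rle_lt_dec 0 r) as [Hr0|Hr0].
  - destruct (closed_disk_max (fun w => Cmod (f w)) a r Hr0) as [z0 [_ H]].
    { intros z Hz. apply ccont_Cmod. eapply holo_cont; eauto. lra. }
    exists (Cmod (f z0) + 1). split; [generalize (Cmod_ge_0 (f z0)); lra|].
    intros z Hz. specialize (H z Hz). lra.
  - exists 1. split; [lra|]. intros z Hz. generalize (Cmod_ge_0 (z - a)). lra.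
Qed.

(** * Cauchy integrals, derivatives and the maximum principle *)

Section Kernel.
Variables (a : C) (r : R) (phi : R -> C).
Hypothesis Hr : 0 < r.
Hypothesis Hphi : forall t, rcont phi t.
Let w (t : R) : C := (a + RtoC r * cis t)%C.

Lemma circle_dist (z : C) (t : R) : r - Cmod (z - a) <= Cmod (w t - z).
Proof.
  unfold w. replace (a + RtoC r * cis t - z)%C with (RtoC r * cis t - (z - a))%C by ring.
  eapply Rle_trans; [|apply Cmod_rtriangle]. rewrite Cmod_mult, Cmod_cis, Cmod_R, Rabs_right; lra.
Qed.

Lemma circle_neq (z : C) (t : R) : Cmod (z - a) < r -> (w t - z)%C <> 0.
Proof. intros H. apply Cmod_gt_0. generalize (circle_dist z t). lra. Qed.

Lemma rcont_kernel (z : C) (n : nat) (t : R) : Cmod (z - a) < r ->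
  rcont (fun t => phi t / (w t - z) ^ n)%C t.
Proof.
  intros Hz. unfold Cdiv. apply rcont_mult; auto.
  assert (Hw : rcont (fun t => (w t - z) ^ n)%C t).
  { assert (W : rcont (fun t => w t - z)%C t).
    { apply rcont_minus; [|apply rcont_const]. unfold w. apply rcont_plus; [apply rcont_const|].
      apply rcont_mult; [apply rcont_const|apply rcont_cis]. }
    induction n; simpl; [apply rcont_const|now apply rcont_mult]. }
  apply (rcont_comp Cinv (fun t => (w t - z) ^ n)%C); auto.
  apply ccont_inv_id. apply Cpow_nz. now apply circle_neq.
Qed.

Definition cauchy_int (n : nat) (z : C) : C := CInt (fun t => phi t / (w t - z) ^ n)%C 0 (2 * PI).

Lemma cauchy_int_correct (n : nat) (z : C) : Cmod (z - a) < r ->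
  is_CInt (fun t => phi t / (w t - z) ^ n)%C 0 (2 * PI) (cauchy_int n z).
Proof. intros Hz. apply CInt_correct. intros t _. now apply rcont_kernel. Qed.

Lemma phi_bounded : exists B, 0 < B /\ forall t, 0 <= t <= 2 * PI -> Cmod (phi t) <= B.
Proof.
  assert (HPI := PI_RGT_0).
  destruct (continuity_ab_maj (fun t => Cmod (phi t)) 0 (2 * PI)) as [t0 [Ht0 _]]; [lra| |].
  - intros c _ e He. destruct (rcont_elim _ _ (Hphi c) e He) as [d [Hd H]].
    exists d. split; auto. intros x [_ Hx]. simpl in *. unfold R_dist in *.
    eapply Rle_lt_trans; [apply Cmod_rtriangle_abs|]. apply H. exact Hx.
  - exists (Cmod (phi t0) + 1). split; [generalize (Cmod_ge_0 (phi t0)); lra|].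
    intros t Ht. specialize (Ht0 t Ht). lra.
Qed.

(** Differentiation under the integral sign with a quadratic remainder. The exponent 1 gives the
    derivative of a holomorphic function as an integral, the exponent 2 shows that this derivative
    is again differentiable; higher orders come by iteration. *)
Lemma cauchy_int_deriv (n : nat) (z : C) : (n = 1 \/ n = 2)%nat -> Cmod (z - a) < r ->
  is_cderiv (cauchy_int n) z (RtoC (INR n) * cauchy_int (S n) z)%C.
Proof.
  intros Hn Hz. assert (HPI := PI_RGT_0).
  destruct phi_bounded as [B [HB HBt]].
  set (e0 := (r - Cmod (z - a)) / 2). assert (He0 : 0 < e0) by (unfold e0; lra).
  (* With p = w - z and q = w - v the remainders of the kernels are (v - z)^2/(p^2 q) for exponent 1
     and (v - z)^2 (p + 2q)/(p^3 q^2) for exponent 2, where |p| and |q| are at least [e0]. The sum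
     of the two bounds serves both cases. *)
  set (A := 2 * PI * (B * ((2 * (2 * r + r) + 2 * r) / (e0 ^ 5) + 1 / e0 ^ 3))).
  assert (HA : 0 < A).
  { unfold A. apply Rmult_lt_0_compat; [lra|]. apply Rmult_lt_0_compat; auto.
    apply Rplus_lt_0_compat; apply Rdiv_lt_0_compat; try lra; apply pow_lt; auto. }
  assert (Key : forall v, Cmod (v - z) < e0 ->
     Cmod (cauchy_int n v - cauchy_int n z - RtoC (INR n) * cauchy_int (S n) z * (v - z)) <= A * Cmod (v - z) ^ 2).
  { intros v Hv.
    assert (Hva : Cmod (v - a) < r) by (generalize (Cmod_dist_tri v z a); unfold e0 in *; lra).
    assert (I := is_CInt_minus _ _ _ _ _ _ (is_CInt_minus _ _ _ _ _ _ (cauchy_int_correct n v Hva)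
       (cauchy_int_correct n z Hz)) (is_CInt_scal (RtoC (INR n) * (v - z))%C _ _ _ _ (cauchy_int_correct (S n) z Hz))).
    replace (RtoC (INR n) * cauchy_int (S n) z * (v - z))%C with (RtoC (INR n) * (v - z) * cauchy_int (S n) z)%C by ring.
    eapply Rle_trans; [eapply (is_CInt_bound _ 0 (2 * PI) (B * ((2 * (2 * r + r) + 2 * r) / (e0 ^ 5) + 1 / e0 ^ 3) * Cmod (v - z) ^ 2)); [lra| |exact I]|].
    2:{ unfold A. apply Req_le. ring. }
    intros t Ht. cbv beta.
    assert (D1 := circle_dist z t). assert (D2 := circle_dist v t).
    assert (N1 := circle_neq z t Hz). assert (N2 := circle_neq v t Hva).
    assert (D3 : e0 <= Cmod (w t - v)).
    { generalize (Cmod_dist_tri v z a); unfold e0 in *; lra. }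
    assert (D4 : e0 <= Cmod (w t - z)) by (unfold e0 in *; lra).
    assert (U : Cmod (w t - z) <= 2 * r).
    { generalize (Cmod_dist_tri (w t) a z). unfold w. replace (a + r * cis t - a)%C with (r * cis t)%C by ring.
      rewrite Cmod_mult, Cmod_cis, Cmod_R, Rabs_right by lra. rewrite (Cmod_sym a z). lra. }
    set (p := (w t - z)%C) in *. set (q := (w t - v)%C) in *.
    assert (Ev : (v - z)%C = (p - q)%C) by (unfold p, q; ring).
    assert (P0 := HBt t Ht). assert (Pge := Cmod_ge_0 (phi t)).
    assert (Ip : / Cmod p <= / e0) by (apply Rinv_le_contravar; auto).
    assert (Iq : / Cmod q <= / e0) by (apply Rinv_le_contravar; auto).
    assert (Ipp : 0 < / Cmod p) by (apply Rinv_0_lt_compat; lra).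
    assert (Iqp : 0 < / Cmod q) by (apply Rinv_0_lt_compat; lra).
    assert (Ie : 0 < / e0) by (apply Rinv_0_lt_compat; lra).
    set (h := Cmod (v - z)) in *. assert (Hh : 0 <= h) by (apply Cmod_ge_0).
    assert (S1 : 0 <= (2 * (2 * r + r) + 2 * r) * (/ e0) ^ 5).
    { apply Rmult_le_pos; [lra|]. apply pow_le; lra. }
    assert (S2 : 0 <= (/ e0) ^ 3) by (apply pow_le; lra).
    replace ((2 * (2 * r + r) + 2 * r) / e0 ^ 5 + 1 / e0 ^ 3) with ((2 * (2 * r + r) + 2 * r) * (/ e0) ^ 5 + (/ e0) ^ 3) by (field; lra).
    destruct Hn as [-> | ->].
    - replace (phi t / q ^ 1 - phi t / p ^ 1 - RtoC (INR 1) * (v - z) * (phi t / p ^ 2))%C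
        with (phi t * ((v - z) * (v - z) * (/ p * / p * / q)))%C.
      2:{ rewrite Ev. simpl. field. auto. }
      rewrite !Cmod_mult, !Cmod_inv by auto. fold h.
      apply Rle_trans with (B * (h * h * (/ e0 * / e0 * / e0))).
      { apply Rmult_le_compat; auto.
        - repeat apply Rmult_le_pos; lra.
        - apply Rmult_le_compat_l; [nra|]. repeat apply Rmult_le_compat; try lra; apply Rmult_le_pos; lra. }
      replace (B * (h * h * (/ e0 * / e0 * / e0))) with (B * ((/ e0) ^ 3) * h ^ 2) by ring.
      apply Rmult_le_compat_r; [nra|]. apply Rmult_le_compat_l; lra.
    - replace (phi t / q ^ 2 - phi t / p ^ 2 - RtoC (INR 2) * (v - z) * (phi t / p ^ 3))%C
        with (phi t * ((v - z) * (v - z) * ((p + 2 * q) * (/ p * / p * / p * / q * / q))))%C.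
      2:{ rewrite Ev. simpl INR. rewrite RtoC_plus. simpl. field. auto. }
      rewrite !Cmod_mult, !Cmod_inv by auto. fold h.
      assert (PQ : Cmod (p + 2 * q) <= 2 * (2 * r + r) + 2 * r).
      { replace (p + 2 * q)%C with (3 * p - 2 * (v - z))%C by (rewrite Ev; ring).
        eapply Rle_trans; [apply Cmod_minus_le|]. rewrite !Cmod_mult, !Cmod_R, !Rabs_right by lra.
        fold h. unfold e0 in Hv. generalize (Cmod_ge_0 (z - a)). lra. }
      apply Rle_trans with (B * (h * h * ((2 * (2 * r + r) + 2 * r) * (/ e0 * / e0 * / e0 * / e0 * / e0)))).
      { apply Rmult_le_compat; auto.
        - repeat apply Rmult_le_pos; try lra. apply Cmod_ge_0.
        - apply Rmult_le_compat_l; [nra|]. apply Rmult_le_compat; auto.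
          + apply Cmod_ge_0.
          + repeat apply Rmult_le_pos; lra.
          + repeat apply Rmult_le_compat; try lra; repeat apply Rmult_le_pos; lra. }
      replace (B * (h * h * ((2 * (2 * r + r) + 2 * r) * (/ e0 * / e0 * / e0 * / e0 * / e0))))
        with (B * ((2 * (2 * r + r) + 2 * r) * (/ e0) ^ 5) * h ^ 2) by ring.
      apply Rmult_le_compat_r; [nra|]. apply Rmult_le_compat_l; lra. }
  intros e He. exists (Rmin e0 (e / A)). split.
  { apply Rmin_pos; auto. apply Rdiv_lt_0_compat; auto. }
  intros v Hv. generalize (Rmin_l e0 (e / A)) (Rmin_r e0 (e / A)). intros.
  eapply Rle_trans; [apply Key; lra|].
  assert (A * Cmod (v - z) <= e).
  { replace e with (A * (e / A)) by (field; lra). apply Rmult_le_compat_l; lra. }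
  generalize (Cmod_ge_0 (v - z)). intros. simpl. nra.
Qed.

End Kernel.

Lemma RtoC_2PI_neq : RtoC (2 * PI) <> 0.
Proof. assert (HPI := PI_RGT_0). intros E; apply RtoC_inj in E; lra. Qed.

Section CauchyConsequences.
Variables (f : C -> C) (a : C) (R1 : R).
Hypothesis Hf : holo_on a R1 f.

Definition cauchy_density (r : R) (t : R) : C := (RtoC r * cis t * f (a + RtoC r * cis t) / RtoC (2 * PI))%C.

Lemma circle_in (r : R) (t : R) : 0 < r -> Cmod (a + RtoC r * cis t - a) = r.
Proof.
  intros Hr. replace (a + RtoC r * cis t - a)%C with (RtoC r * cis t)%C by ring.
  rewrite Cmod_mult, Cmod_cis, Cmod_R, Rabs_right; lra.
Qed.

Lemma rcont_circle (r : R) (t : R) : rcont (fun t => a + RtoC r * cis t)%C t.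
Proof. apply rcont_plus; [apply rcont_const|]. apply rcont_mult; [apply rcont_const|apply rcont_cis]. Qed.

Lemma rcont_density (r : R) (t : R) : 0 < r < R1 -> rcont (cauchy_density r) t.
Proof.
  intros Hr. unfold cauchy_density, Cdiv. apply rcont_mult; [|apply rcont_const]. apply rcont_mult.
  - apply rcont_mult; [apply rcont_const|apply rcont_cis].
  - apply (rcont_comp f (fun t => a + RtoC r * cis t)%C); [apply rcont_circle|].
    eapply holo_cont; eauto. rewrite circle_in; lra.
Qed.

Lemma cauchy_repr (r : R) (z : C) : 0 < r < R1 -> Cmod (z - a) < r ->
  f z = cauchy_int a r (cauchy_density r) 1 z.
Proof.
  intros Hr Hz. symmetry. apply CInt_unique.
  assert (Z := cauchy_formula f a z R1 r Hf Hr Hz). apply (is_CInt_scal (/ RtoC (2 * PI))) in Z.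
  eapply is_CInt_eq; [eapply is_CInt_ext; [|exact Z]|].
  - intros t _. unfold cauchy_density. simpl.
    assert (N := circle_neq a r ltac:(lra) z t Hz). field. split; auto using RtoC_2PI_neq.
  - field. apply RtoC_2PI_neq.
Qed.

Lemma cauchy_repr_derive (r : R) (z : C) : 0 < r < R1 -> Cmod (z - a) < r ->
  is_cderiv f z (cauchy_int a r (cauchy_density r) 2 z).
Proof.
  intros Hr Hz.
  apply is_cderiv_ext_loc with (f := cauchy_int a r (cauchy_density r) 1) (r := r - Cmod (z - a)); [lra| |].
  - intros w Hw. symmetry. apply cauchy_repr; auto. generalize (Cmod_dist_tri w z a). lra.
  - eapply is_cderiv_eq. apply cauchy_int_deriv; auto; try lra. intros; now apply rcont_density.
    simpl INR. ring.
Qed.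

Lemma holo_derive : holo_on a R1 (C_derive f).
Proof.
  intros z Hz. set (r := (Cmod (z - a) + R1) / 2).
  assert (P := Cmod_ge_0 (z - a)).
  assert (Hr : 0 < r < R1) by (unfold r; lra). assert (Hzr : Cmod (z - a) < r) by (unfold r; lra).
  eexists. apply is_cderiv_ext_loc with (f := cauchy_int a r (cauchy_density r) 2) (r := r - Cmod (z - a)); [lra| |].
  - intros w Hw. symmetry. apply is_cderiv_C_derive, cauchy_repr_derive; auto.
    generalize (Cmod_dist_tri w z a). lra.
  - apply cauchy_int_deriv; auto; try lra. intros; now apply rcont_density.
Qed.

Lemma cauchy_estimate (r M : R) : 0 < r < R1 -> (forall z, Cmod (z - a) = r -> Cmod (f z) <= M) ->
  Cmod (C_derive f a) <= M / r.
Proof.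
  intros Hr HM. assert (HPI := PI_RGT_0).
  assert (H0 : Cmod (a - a) < r) by (replace (a - a)%C with (RtoC 0) by ring; rewrite Cmod_0; lra).
  rewrite (is_cderiv_C_derive _ _ _ (cauchy_repr_derive r a Hr H0)).
  assert (I := cauchy_int_correct a r (cauchy_density r) ltac:(lra) (fun t => rcont_density r t Hr) 2 a H0).
  eapply Rle_trans; [eapply (is_CInt_bound _ 0 (2 * PI) (M / r / (2 * PI))); [lra| |exact I]|apply Req_le; field; lra].
  intros t _. unfold cauchy_density.
  assert (N := circle_neq a r ltac:(lra) a t H0).
  rewrite Cmod_div by now apply Cpow_nz.
  rewrite Cmod_pow, circle_in, Cmod_div, !Cmod_mult, Cmod_cis, !Cmod_R, !Rabs_right by (auto using RtoC_2PI_neq; lra).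
  replace (r * 1 * Cmod (f (a + RtoC r * cis t)%C) / (2 * PI) / r ^ 2) with (Cmod (f (a + RtoC r * cis t)%C) * (/ r / (2 * PI))) by (field; lra).
  replace (M / r / (2 * PI)) with (M * (/ r / (2 * PI))) by (field; lra).
  apply Rmult_le_compat_r.
  - apply Rlt_le, Rdiv_lt_0_compat; [now apply Rinv_0_lt_compat|lra].
  - apply HM, circle_in; lra.
Qed.

Lemma taylor2 (r : R) : 0 < r < R1 -> exists A, 0 < A /\ forall z v, Cmod (z - a) <= r -> Cmod (v - a) <= r ->
  Cmod (f v - f z - C_derive f z * (v - z)) <= A * Cmod (v - z) ^ 2.
Proof.
  intros Hr. assert (HPI := PI_RGT_0). set (q := (r + R1) / 2). assert (Hq : r < q < R1) by (unfold q; lra).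
  destruct (phi_bounded (cauchy_density q)) as [B [HB HBt]].
  { intros t. apply rcont_density. lra. }
  set (e0 := q - r). assert (He0 : 0 < e0) by (unfold e0; lra).
  exists (2 * PI * (B * (/ e0 * / e0 * / e0))). assert (Ie : 0 < / e0) by now apply Rinv_0_lt_compat.
  split. { apply Rmult_lt_0_compat; [lra|]. apply Rmult_lt_0_compat; auto. apply Rmult_lt_0_compat; auto. now apply Rmult_lt_0_compat. }
  intros z v Hz Hv. assert (Hq0 : 0 < q < R1) by lra.
  assert (Hz' : Cmod (z - a) < q) by lra. assert (Hv' : Cmod (v - a) < q) by lra.
  rewrite (is_cderiv_C_derive _ _ _ (cauchy_repr_derive q z Hq0 Hz')).
  rewrite (cauchy_repr q z Hq0 Hz'), (cauchy_repr q v Hq0 Hv').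
  assert (cc := fun t => rcont_density q t Hq0).
  assert (I := is_CInt_minus _ _ _ _ _ _ (is_CInt_minus _ _ _ _ _ _
       (cauchy_int_correct a q (cauchy_density q) (proj1 Hq0) cc 1 v Hv')
       (cauchy_int_correct a q (cauchy_density q) (proj1 Hq0) cc 1 z Hz'))
       (is_CInt_scal (v - z)%C _ _ _ _ (cauchy_int_correct a q (cauchy_density q) (proj1 Hq0) cc 2 z Hz'))).
  replace (cauchy_int a q (cauchy_density q) 2 z * (v - z))%C with ((v - z) * cauchy_int a q (cauchy_density q) 2 z)%C by ring.
  eapply Rle_trans; [eapply (is_CInt_bound _ 0 (2 * PI) (B * (/ e0 * / e0 * / e0) * Cmod (v - z) ^ 2)); [lra| |exact I]|apply Req_le; ring].
  intros t Ht. cbv beta.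
  assert (D1 := circle_dist a q (proj1 Hq0) z t). assert (D2 := circle_dist a q (proj1 Hq0) v t).
  assert (N1 := circle_neq a q (proj1 Hq0) z t Hz'). assert (N2 := circle_neq a q (proj1 Hq0) v t Hv').
  set (w := (a + RtoC q * cis t)%C) in *.
  replace (cauchy_density q t / (w - v) ^ 1 - cauchy_density q t / (w - z) ^ 1 - (v - z) * (cauchy_density q t / (w - z) ^ 2))%C
    with (cauchy_density q t * (/ (w - z) * / (w - z) * / (w - v)) * (v - z) ^ 2)%C by (simpl; field; auto).
  rewrite !Cmod_mult, Cmod_pow, !Cmod_inv by auto.
  assert (D3 : e0 <= Cmod (w - v)) by (unfold e0; lra).
  assert (D4 : e0 <= Cmod (w - z)) by (unfold e0; lra).
  assert (Ip : / Cmod (w - z) <= / e0) by (apply Rinv_le_contravar; auto).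
  assert (Iq : / Cmod (w - v) <= / e0) by (apply Rinv_le_contravar; auto).
  assert (Ipp : 0 < / Cmod (w - z)) by (apply Rinv_0_lt_compat; lra).
  assert (Iqp : 0 < / Cmod (w - v)) by (apply Rinv_0_lt_compat; lra).
  apply Rmult_le_compat_r; [apply pow_le, Cmod_ge_0|].
  apply Rmult_le_compat; auto; [apply Cmod_ge_0|repeat apply Rmult_le_pos; lra|].
  repeat apply Rmult_le_compat; try lra. apply Rmult_le_pos; lra.
Qed.

(** The removable singularity of the difference quotient: by partial fractions it equals, near [z0],
    the Cauchy integral of the density divided by w - z0, and is therefore holomorphic there too. *)
Lemma divide_root (z0 : C) : Cmod (z0 - a) < R1 ->
  exists g, holo_on a R1 g /\ g z0 = C_derive f z0 /\ forall z, f z = (f z0 + (z - z0) * g z)%C.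
Proof.
  intros Hz0.
  set (g := fun z => if Ceq_dec z z0 then C_derive f z0 else ((f z - f z0) / (z - z0))%C).
  assert (gE : forall z, z <> z0 -> g z = ((f z - f z0) / (z - z0))%C).
  { intros z Hz. unfold g. destruct (Ceq_dec z z0); congruence. }
  assert (g0 : g z0 = C_derive f z0) by (unfold g; destruct (Ceq_dec z0 z0); congruence).
  exists g. split; [|split; auto].
  - intros z Hz. destruct (Ceq_dec z z0) as [->|Hne].
    + assert (P := Cmod_ge_0 (z0 - a)). set (r := (Cmod (z0 - a) + R1) / 2).
      assert (Hr : 0 < r < R1) by (unfold r; lra). assert (Hzr : Cmod (z0 - a) < r) by (unfold r; lra).
      set (psi := fun t => (cauchy_density r t / (a + RtoC r * cis t - z0) ^ 1)%C).
      assert (cc := fun t => rcont_density r t Hr).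
      assert (cp : forall t, rcont psi t). { intros t. apply (rcont_kernel a r (cauchy_density r)); auto; lra. }
      eexists. apply is_cderiv_ext_loc with (f := cauchy_int a r psi 1) (r := r - Cmod (z0 - a)); [lra| |].
      2:{ apply cauchy_int_deriv; auto; lra. }
      intros w Hw. assert (Hw' : Cmod (w - a) < r) by (generalize (Cmod_dist_tri w z0 a); lra).
      apply CInt_unique. destruct (Ceq_dec w z0) as [->|Hne].
      * rewrite g0, (is_cderiv_C_derive _ _ _ (cauchy_repr_derive r z0 Hr Hzr)).
        eapply is_CInt_ext; [|apply (cauchy_int_correct a r _ (proj1 Hr) cc 2 z0 Hzr)].
        intros t _. unfold psi. simpl. field. apply (circle_neq a r (proj1 Hr)); auto.
      * rewrite gE by auto. rewrite (cauchy_repr r w Hr Hw'), (cauchy_repr r z0 Hr Hzr).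
        assert (Hd : (w - z0)%C <> 0) by (intros E; apply Hne; now apply Cminus_eq0).
        eapply is_CInt_eq; [eapply is_CInt_ext; [|apply (is_CInt_scal (/ (w - z0)));
          apply (is_CInt_minus _ _ _ _ _ _ (cauchy_int_correct a r _ (proj1 Hr) cc 1 w Hw') (cauchy_int_correct a r _ (proj1 Hr) cc 1 z0 Hzr))]|field; auto].
        intros t _. unfold psi. simpl.
        assert (N1 := circle_neq a r (proj1 Hr) w t Hw'). assert (N2 := circle_neq a r (proj1 Hr) z0 t Hzr).
        field. auto.
    + destruct (Hf z Hz) as [l Hl]. assert (Hp := Cmod_minus_pos _ _ Hne).
      eexists. apply is_cderiv_ext_loc with (f := fun z => ((f z - f z0) / (z - z0))%C) (r := Cmod (z - z0)); auto.
      * intros w Hw. rewrite gE; auto. intros ->. rewrite Cmod_sym in Hw. lra.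
      * apply is_cderiv_div.
        -- apply is_cderiv_minus; [exact Hl|apply is_cderiv_const].
        -- apply is_cderiv_minus; [apply is_cderiv_id|apply is_cderiv_const].
        -- now apply Cmod_gt_0.
  - intros z. destruct (Ceq_dec z z0) as [->|Hne]; [ring|].
    rewrite gE by auto. field. intros E; apply Hne; now apply Cminus_eq0.
Qed.

End CauchyConsequences.

Lemma pow_bounded_le (q M c : R) : 0 <= M -> (forall n, q ^ n <= c * M ^ n) -> q <= M.
Proof.
  intros HM H. apply Rnot_lt_le. intros Hlt.
  set (M' := (q + M) / 2). assert (M < M' < q) by (unfold M'; lra).
  assert (H1 : forall n, (q / M') ^ n <= Rabs c).
  { intros n. unfold Rdiv. rewrite Rpow_mult_distr, pow_inv.
    apply Rmult_le_reg_r with (M' ^ n); [apply pow_lt; lra|].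
    rewrite Rmult_assoc, Rinv_l by (apply pow_nonzero; lra). rewrite Rmult_1_r.
    eapply Rle_trans; [apply H|]. apply Rle_trans with (Rabs c * M ^ n).
    - apply Rmult_le_compat_r; [now apply pow_le|apply Rle_abs].
    - apply Rmult_le_compat_l; [apply Rabs_pos|]. apply pow_incr. lra. }
  assert (Hx : 1 < Rabs (q / M')).
  { assert (1 < q / M'). { apply Rmult_lt_reg_r with M'; [lra|]. unfold Rdiv. rewrite Rmult_assoc, Rinv_l; lra. }
    rewrite Rabs_right; lra. }
  destruct (Pow_x_infinity _ Hx (Rabs c + 1)) as [N HN]. specialize (HN N (le_n N)). specialize (H1 N).
  rewrite <- RPow_abs in HN.
  assert (0 < q / M') by (apply Rdiv_lt_0_compat; lra).
  rewrite (Rabs_right (q / M')) in HN by lra. lra.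
Qed.

Lemma holo_pow (a : C) (R1 : R) (f : C -> C) (n : nat) : holo_on a R1 f -> holo_on a R1 (fun z => f z ^ n)%C.
Proof.
  intros Hf z Hz. induction n as [|n [l Hl]]; simpl.
  - exists 0. apply is_cderiv_const.
  - destruct (Hf z Hz) as [m Hm]. eexists. apply is_cderiv_mult; eauto.
Qed.

(** Landau's trick: Cauchy's formula for f^n gives |f z|^n <= c M^n with c = r/(r - |z - a|)
    independent of n, and such bounds for all n force |f z| <= M. *)
Lemma max_modulus (f : C -> C) (a : C) (R1 r M : R) (z : C) : holo_on a R1 f -> 0 < r < R1 ->
  (forall w, Cmod (w - a) = r -> Cmod (f w) <= M) -> Cmod (z - a) <= r -> Cmod (f z) <= M.
Proof.
  intros Hf Hr HM Hz. assert (HPI := PI_RGT_0).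
  destruct Hz as [Hz|Hz]; [|auto].
  assert (M0 : 0 <= M).
  { eapply Rle_trans; [apply (Cmod_ge_0 (f (a + RtoC r * cis 0)%C))|]. apply HM. apply circle_in; lra. }
  apply pow_bounded_le with (c := r / (r - Cmod (z - a))); auto. intros n.
  assert (I := cauchy_formula _ a z R1 r (holo_pow a R1 f n Hf) Hr Hz).
  apply (is_CInt_bound _ _ _ (r / (r - Cmod (z - a)) * M ^ n)) in I; [|lra|].
  - rewrite Cmod_mult, Cmod_pow, Cmod_R, Rabs_right in I by lra.
    apply Rmult_le_reg_l with (2 * PI); [lra|]. lra.
  - intros t _. cbv beta. rewrite Cmod_mult. apply Rmult_le_compat; try apply Cmod_ge_0.
    + assert (N := circle_neq a r (proj1 Hr) z t Hz). assert (D := circle_dist a r (proj1 Hr) z t).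
      rewrite Cmod_div, Cmod_mult, Cmod_cis, Cmod_R, Rabs_right by (auto; lra). rewrite Rmult_1_r.
      apply Rmult_le_compat_l; [lra|]. apply Rinv_le_contravar; lra.
    + rewrite Cmod_pow. apply pow_incr. split; [apply Cmod_ge_0|]. apply HM, circle_in; lra.
Qed.

(** * Holomorphic functions on the unit disk *)

Definition holoD (f : C -> C) : Prop := forall z, Cmod z < 1 -> exists l, is_cderiv f z l.

Lemma holoD_holomorphic (f : C -> C) : holoD f <-> holomorphic f.
Proof.
  split; intros H z Hz.
  - destruct (H z Hz) as [l Hl]. exists l. now apply is_cderiv_is_derive.
  - destruct (H z Hz) as [l Hl]. exists l. now apply is_cderiv_is_derive.
Qed.

Lemma holoD_on (f : C -> C) : holoD f <-> holo_on 0 1 f.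
Proof.
  split; intros H z Hz; apply H.
  - now replace (z - 0)%C with z in Hz by ring.
  - now replace (z - 0)%C with z by ring.
Qed.

Lemma holoD_local (f : C -> C) (a : C) (r : R) : holoD f -> r <= 1 - Cmod a -> holo_on a r f.
Proof.
  intros H Hr z Hz. apply H. generalize (Cmod_triangle (z - a) a).
  replace (z - a + a)%C with z by ring. lra.
Qed.

Lemma holoD_deriv (f : C -> C) (z : C) : holoD f -> Cmod z < 1 -> is_cderiv f z (C_derive f z).
Proof. intros H Hz. destruct (H z Hz) as [l Hl]. now rewrite (is_cderiv_C_derive _ _ _ Hl). Qed.

Lemma holoD_cont (f : C -> C) (z : C) : holoD f -> Cmod z < 1 -> ccont f z.
Proof. intros H Hz. eapply is_cderiv_cont, holoD_deriv; auto. Qed.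

Lemma holoD_C_derive (f : C -> C) : holoD f -> holoD (C_derive f).
Proof. intros H. apply holoD_on, holo_derive, holoD_on, H. Qed.

Lemma holoD_const (k : C) : holoD (fun _ => k).
Proof. intros z _. eexists. apply is_cderiv_const. Qed.

Lemma holoD_id : holoD (fun z => z).
Proof. intros z _. eexists. apply is_cderiv_id. Qed.

Lemma holoD_plus (f g : C -> C) : holoD f -> holoD g -> holoD (fun z => f z + g z)%C.
Proof. intros Hf Hg z Hz. eexists. apply is_cderiv_plus; apply holoD_deriv; auto. Qed.

Lemma holoD_minus (f g : C -> C) : holoD f -> holoD g -> holoD (fun z => f z - g z)%C.
Proof. intros Hf Hg z Hz. eexists. apply is_cderiv_minus; apply holoD_deriv; auto. Qed.

Lemma holoD_mult (f g : C -> C) : holoD f -> holoD g -> holoD (fun z => f z * g z)%C.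
Proof. intros Hf Hg z Hz. eexists. apply is_cderiv_mult; apply holoD_deriv; auto. Qed.

Lemma holoD_div (f g : C -> C) : holoD f -> holoD g -> (forall z, Cmod z < 1 -> g z <> 0) ->
  holoD (fun z => f z / g z)%C.
Proof. intros Hf Hg Hn z Hz. eexists. apply is_cderiv_div; auto; apply holoD_deriv; auto. Qed.

Lemma holoD_pow (f : C -> C) (n : nat) : holoD f -> holoD (fun z => f z ^ n)%C.
Proof. intros H. apply holoD_on, holo_pow, holoD_on, H. Qed.

Lemma disk_nbhd (z w : C) : Cmod (w - z) < 1 - Cmod z -> Cmod w < 1.
Proof.
  intros H. generalize (Cmod_triangle (w - z) z). replace (w - z + z)%C with w by ring. lra.
Qed.

Lemma holoD_comp (f g : C -> C) : holoD f -> holoD g -> (forall z, Cmod z < 1 -> Cmod (f z) < 1) ->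
  holoD (fun z => g (f z)).
Proof. intros Hf Hg H z Hz. eexists. apply is_cderiv_comp; apply holoD_deriv; auto. Qed.

Lemma C_derive_ext (f g : C -> C) (z : C) : (forall z, Cmod z < 1 -> f z = g z) -> holoD f -> Cmod z < 1 ->
  C_derive g z = C_derive f z.
Proof.
  intros E Hf Hz. apply is_cderiv_C_derive.
  apply is_cderiv_ext_loc with (f := f) (r := 1 - Cmod z); [lra| |now apply holoD_deriv].
  intros w Hw. apply E. now apply (disk_nbhd z).
Qed.

Lemma C_derive_n_succ (n : nat) (f : C -> C) : C_derive_n (S n) f = C_derive_n n (C_derive f).
Proof. unfold C_derive_n. apply Nat.iter_succ_r. Qed.

Lemma C_derive_n_ext (n : nat) : forall f g : C -> C, (forall z, Cmod z < 1 -> f z = g z) -> holoD f ->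
  forall z, Cmod z < 1 -> C_derive_n n g z = C_derive_n n f z.
Proof.
  induction n as [|n IH]; intros f g E Hf z Hz.
  - symmetry. now apply E.
  - rewrite !C_derive_n_succ. apply IH; auto.
    + intros w Hw. symmetry. now apply C_derive_ext.
    + now apply holoD_C_derive.
Qed.

Lemma max_modulus_disk (f : C -> C) (r M : R) (z : C) : holoD f -> 0 < r < 1 ->
  (forall w, Cmod w = r -> Cmod (f w) <= M) -> Cmod z <= r -> Cmod (f z) <= M.
Proof.
  intros Hf Hr HM Hz. apply (max_modulus f 0 1 r); auto.
  - now apply holoD_on.
  - intros w Hw. apply HM. now replace (w - 0)%C with w in Hw by ring.
  - now replace (z - 0)%C with z by ring.
Qed.

Lemma max_modulus_limsup (f : C -> C) (M : R) : holoD f ->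
  (forall e, 0 < e -> exists r, r < 1 /\ forall w, r < Cmod w < 1 -> Cmod (f w) <= M + e) ->
  forall z, Cmod z < 1 -> Cmod (f z) <= M.
Proof.
  intros Hf HM z Hz. apply Rnot_lt_le. intros Hlt.
  destruct (HM ((Cmod (f z) - M) / 2)) as [r [Hr H]]; [lra|].
  set (q := Rmax (Rmax r (Cmod z)) 0).
  assert (Q1 : r <= q) by (unfold q; eapply Rle_trans; [apply Rmax_l|apply Rmax_l]).
  assert (Q2 : Cmod z <= q) by (unfold q; eapply Rle_trans; [apply Rmax_r|apply Rmax_l]).
  assert (Q3 : 0 <= q) by (unfold q; apply Rmax_r).
  assert (Q4 : q < 1). { unfold q. repeat apply Rmax_lub_lt; lra. }
  assert (Cmod (f z) <= M + (Cmod (f z) - M) / 2); [|lra].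
  apply (max_modulus_disk f ((q + 1) / 2)); auto; try lra.
  intros w Hw. apply H. lra.
Qed.

Lemma divide_rootD (f : C -> C) (z0 : C) : holoD f -> Cmod z0 < 1 ->
  exists g, holoD g /\ g z0 = C_derive f z0 /\ forall z, f z = (f z0 + (z - z0) * g z)%C.
Proof.
  intros Hf Hz. destruct (divide_root f 0 1 (proj1 (holoD_on f) Hf) z0) as [g [Hg H]].
  { now replace (z0 - 0)%C with z0 by ring. }
  exists g. split; auto. now apply holoD_on.
Qed.

(** * Möbius transformations of the disk and orders of zeros *)

Definition mob (a z : C) : C := ((z - a) / (1 - Cconj a * z))%C.

Lemma mob_den_pos (a z : C) : Cmod a < 1 -> Cmod z < 1 -> 0 < Cmod (1 - Cconj a * z).
Proof.
  intros Ha Hz. generalize (Cmod_rtriangle 1 (Cconj a * z)).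
  rewrite Cmod_1, Cmod_mult, Cmod_conj. generalize (Cmod_ge_0 a) (Cmod_ge_0 z). nra.
Qed.

Lemma mob_den (a z : C) : Cmod a < 1 -> Cmod z < 1 -> (1 - Cconj a * z)%C <> 0.
Proof. intros. apply Cmod_gt_0. now apply mob_den_pos. Qed.

Lemma Cmod2_expand (z : C) : Cmod z ^ 2 = fst z ^ 2 + snd z ^ 2.
Proof. unfold Cmod. rewrite pow2_sqrt; [ring|]. nra. Qed.

Lemma mob_identity (a z : C) : Cmod (1 - Cconj a * z) ^ 2 - Cmod (z - a) ^ 2 = (1 - Cmod a ^ 2) * (1 - Cmod z ^ 2).
Proof. rewrite !Cmod2_expand. destruct a as [a1 a2], z as [x y]. simpl. ring. Qed.

Lemma mob_mod (a z : C) : Cmod a < 1 -> Cmod z < 1 ->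
  1 - Cmod (mob a z) ^ 2 = (1 - Cmod a ^ 2) * (1 - Cmod z ^ 2) / Cmod (1 - Cconj a * z) ^ 2.
Proof.
  intros Ha Hz. assert (P := mob_den_pos a z Ha Hz). unfold mob.
  rewrite Cmod_div by now apply mob_den. rewrite <- mob_identity. field. lra.
Qed.

Lemma sq_lt_1 (x : R) : 0 <= x -> x < 1 -> x ^ 2 < 1.
Proof. intros. nra. Qed.

Lemma lt_1_sq (x : R) : x ^ 2 < 1 -> x < 1.
Proof. intros. nra. Qed.

Lemma mob_in (a z : C) : Cmod a < 1 -> Cmod z < 1 -> Cmod (mob a z) < 1.
Proof.
  intros Ha Hz. apply lt_1_sq. assert (P := mob_den_pos a z Ha Hz).
  assert (E := mob_mod a z Ha Hz).
  assert (0 < (1 - Cmod a ^ 2) * (1 - Cmod z ^ 2) / Cmod (1 - Cconj a * z) ^ 2); [|lra].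
  apply Rdiv_lt_0_compat; [|apply pow_lt; auto].
  generalize (sq_lt_1 _ (Cmod_ge_0 a) Ha) (sq_lt_1 _ (Cmod_ge_0 z) Hz). intros.
  apply Rmult_lt_0_compat; lra.
Qed.

Lemma is_cderiv_mob (a z : C) : Cmod a < 1 -> Cmod z < 1 ->
  is_cderiv (mob a) z (RtoC (1 - Cmod a ^ 2) / (1 - Cconj a * z) ^ 2)%C.
Proof.
  intros Ha Hz. assert (N := mob_den a z Ha Hz). unfold mob. eapply is_cderiv_eq.
  - apply is_cderiv_div; auto.
    + apply is_cderiv_minus; [apply is_cderiv_id|apply is_cderiv_const].
    + apply is_cderiv_minus; [apply is_cderiv_const|].
      apply is_cderiv_mult; [apply is_cderiv_const|apply is_cderiv_id].
  - cbv beta. rewrite RtoC_minus, Cmod2_conj. simpl. field. auto.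
Qed.

Lemma holoD_mob (a : C) : Cmod a < 1 -> holoD (mob a).
Proof. intros Ha z Hz. eexists. now apply is_cderiv_mob. Qed.

Lemma mob_near_boundary (a : C) (e : R) : Cmod a < 1 -> 0 < e ->
  exists r, 0 < r < 1 /\ forall w, r < Cmod w < 1 -> 1 - e < Cmod (mob a w).
Proof.
  intros Ha He. assert (A := Cmod_ge_0 a).
  set (d := Rmin (1/2) (e * (1 - Cmod a) ^ 2 / 4)).
  assert (Q : 0 < (1 - Cmod a) ^ 2) by (apply pow_lt; lra).
  assert (Hd : 0 < d <= 1/2). { split; [apply Rmin_pos; nra|apply Rmin_l]. }
  exists (1 - d). split; [lra|]. intros w Hw.
  assert (Hw1 : Cmod w < 1) by lra.
  assert (E := mob_mod a w Ha Hw1). assert (P := mob_den_pos a w Ha Hw1).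
  assert (Dn : 1 - Cmod a <= Cmod (1 - Cconj a * w)).
  { generalize (Cmod_rtriangle 1 (Cconj a * w)). rewrite Cmod_1, Cmod_mult, Cmod_conj. nra. }
  assert (B : (1 - Cmod a ^ 2) * (1 - Cmod w ^ 2) / Cmod (1 - Cconj a * w) ^ 2 <= e / 2).
  { apply Rmult_le_reg_r with (Cmod (1 - Cconj a * w) ^ 2); [apply pow_lt; auto|].
    unfold Rdiv at 1. rewrite Rmult_assoc, Rinv_l by (apply pow_nonzero; lra). rewrite Rmult_1_r.
    assert (d <= e * (1 - Cmod a) ^ 2 / 4) by apply Rmin_r.
    assert ((1 - Cmod a) ^ 2 <= Cmod (1 - Cconj a * w) ^ 2) by (apply pow_incr; lra).
    assert (1 - Cmod w ^ 2 <= 2 * d) by nra. assert (0 <= 1 - Cmod w ^ 2) by nra.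
    assert ((1 - Cmod a ^ 2) * (1 - Cmod w ^ 2) <= 1 * (2 * d)) by (apply Rmult_le_compat; nra).
    nra. }
  assert (M := mob_in a w Ha Hw1). assert (M0 := Cmod_ge_0 (mob a w)). nra.
Qed.

(** A Schwarz lemma of every order replaces power series. Write f = [mob z0]^m G. On a circle near
    the boundary |[mob z0]| is at least rho, which exceeds x = |[mob z0 z]|, so the maximum
    principle for G gives |f z| <= M (x/rho)^m for all m. *)
Lemma flat_zero (f : C -> C) (z0 : C) : holoD f -> Cmod z0 < 1 ->
  (forall m, exists g, holoD g /\ forall z, f z = ((z - z0) ^ m * g z)%C) ->
  forall z, Cmod z < 1 -> f z = 0.
Proof.
  intros Hf Hz0 H z Hz. apply Cmod_eps0. intros e He.
  assert (M1 := mob_in z0 z Hz0 Hz).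
  set (x := Cmod (mob z0 z)) in *. assert (Hx0 : 0 <= x) by apply Cmod_ge_0.
  destruct (mob_near_boundary z0 ((1 - x) / 2) Hz0) as [r [Hr Hb]]; [lra|].
  set (q := (Rmax r (Cmod z) + 1) / 2).
  assert (Q : Rmax r (Cmod z) < 1) by (apply Rmax_lub_lt; lra).
  assert (Q1 := Rmax_l r (Cmod z)). assert (Q2 := Rmax_r r (Cmod z)).
  destruct (holo_bounded f 0 1 q) as [M [HM HMb]]; [now apply holoD_on|unfold q; lra|].
  set (rho := (1 + x) / 2). assert (Hrho : x < rho < 1) by (unfold rho; lra).
  assert (Key : forall m, Cmod (f z) <= M * (x / rho) ^ m).
  { intros m. destruct (H m) as [g [Hg Hfg]].
    set (G := fun w => (g w * (1 - Cconj z0 * w) ^ m)%C).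
    assert (HG : holoD G).
    { apply holoD_mult; auto. apply holoD_pow. apply holoD_minus; [apply holoD_const|].
      apply holoD_mult; [apply holoD_const|apply holoD_id]. }
    assert (fG : forall w, Cmod w < 1 -> f w = (mob z0 w ^ m * G w)%C).
    { intros w Hw. rewrite Hfg. unfold G, mob, Cdiv. rewrite Cpow_mult_l, Cpow_inv by now apply mob_den.
      field. apply Cpow_nz. now apply mob_den. }
    assert (BG : Cmod (G z) <= M / rho ^ m).
    { apply (max_modulus_disk G q); auto; [unfold q; lra| |unfold q; lra].
      intros w Hw. assert (Hw1 : Cmod w < 1) by (unfold q in Hw; lra).
      assert (B := HMb w). replace (w - 0)%C with w in B by ring. specialize (B (Req_le _ _ Hw)).
      rewrite fG, Cmod_mult, Cmod_pow in B by auto.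
      assert (rho <= Cmod (mob z0 w)).
      { left. replace rho with (1 - (1 - x) / 2) by (unfold rho; field). apply Hb. unfold q in Hw. lra. }
      assert (rho ^ m <= Cmod (mob z0 w) ^ m) by (apply pow_incr; lra).
      assert (0 < rho ^ m) by (apply pow_lt; lra).
      apply Rmult_le_reg_r with (rho ^ m); auto. unfold Rdiv. rewrite Rmult_assoc, Rinv_l by lra.
      generalize (Cmod_ge_0 (G w)). nra. }
    rewrite fG, Cmod_mult, Cmod_pow by auto. fold x.
    replace (M * (x / rho) ^ m) with (x ^ m * (M / rho ^ m)).
    - apply Rmult_le_compat_l; auto. now apply pow_le.
    - unfold Rdiv. rewrite Rpow_mult_distr, pow_inv. ring. }
  assert (Hq : Rabs (x / rho) < 1).
  { rewrite Rabs_right. apply Rmult_lt_reg_r with rho; [lra|]. unfold Rdiv. rewrite Rmult_assoc, Rinv_l; lra.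
    apply Rle_ge. apply Rmult_le_pos; auto. left. apply Rinv_0_lt_compat; lra. }
  destruct (pow_lt_1_zero _ Hq (e / M)) as [N HN]; [apply Rdiv_lt_0_compat; lra|].
  specialize (HN N (le_n N)). specialize (Key N).
  apply Rle_trans with (M * Rabs ((x / rho) ^ N)).
  - eapply Rle_trans; [exact Key|]. apply Rmult_le_compat_l; [lra|apply Rle_abs].
  - replace e with (M * (e / M)) by (field; lra). apply Rmult_le_compat_l; lra.
Qed.

(** If dividing by z - z0 never stopped, every power of z - z0 would divide f, which [flat_zero]
    excludes. *)
Lemma order_factor (f : C -> C) (z0 : C) : holoD f -> Cmod z0 < 1 -> (exists z, Cmod z < 1 /\ f z <> 0) ->
  exists m g, holoD g /\ g z0 <> 0 /\ forall z, f z = ((z - z0) ^ m * g z)%C.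
Proof.
  intros Hf Hz0 [z [Hz Hne]]. apply NNPP. intros HN. apply Hne.
  apply (flat_zero f z0); auto. intros m. induction m as [|m [g [Hg Hfg]]].
  - exists f. split; auto. intros; simpl; ring.
  - assert (g0 : g z0 = 0).
    { apply NNPP. intros G. apply HN. exists m, g. auto. }
    destruct (divide_rootD g z0 Hg Hz0) as [h [Hh [_ Hgh]]]. exists h. split; auto.
    intros w. rewrite Hfg, Hgh, g0. simpl. ring.
Qed.

Lemma ccont_neq (f : C -> C) (z : C) : ccont f z -> f z <> 0 ->
  exists d, 0 < d /\ forall w, Cmod (w - z) < d -> f w <> 0.
Proof.
  intros Hc Hz. assert (P := proj1 (Cmod_gt_0 _) Hz).
  destruct (Hc _ P) as [d [Hd H]]. exists d. split; auto. intros w Hw E.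
  specialize (H w Hw). rewrite E in H. replace (0 - f z)%C with (- f z)%C in H by ring.
  rewrite Cmod_opp in H. lra.
Qed.

Lemma isolated_zeros (f : C -> C) (z0 : C) : holoD f -> Cmod z0 < 1 -> (exists z, Cmod z < 1 /\ f z <> 0) ->
  exists d, 0 < d /\ forall w, w <> z0 -> Cmod (w - z0) < d -> f w <> 0.
Proof.
  intros Hf Hz0 Hne. destruct (order_factor f z0 Hf Hz0 Hne) as [m [g [Hg [g0 Hfg]]]].
  destruct (ccont_neq g z0 (holoD_cont g z0 Hg Hz0) g0) as [d [Hd H]].
  exists d. split; auto. intros w Hw Hwd. rewrite Hfg. apply Cmult_neq_0; auto.
  apply Cpow_nz. intros E. apply Hw. now apply Cminus_eq0.
Qed.

Lemma identity_theorem (f : C -> C) (z0 : C) (d : R) : holoD f -> Cmod z0 < 1 -> 0 < d ->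
  (forall w, Cmod (w - z0) < d -> f w = 0) -> forall z, Cmod z < 1 -> f z = 0.
Proof.
  intros Hf Hz0 Hd H z Hz. apply NNPP. intros Hne.
  destruct (isolated_zeros f z0 Hf Hz0) as [d' [Hd' H']]; [now exists z|].
  set (h := Rmin d d' / 2). assert (P : 0 < Rmin d d') by now apply Rmin_pos.
  assert (E : (z0 + RtoC h - z0)%C = RtoC h) by ring.
  assert (Eh : Cmod (RtoC h) = h) by (rewrite Cmod_R, Rabs_right; unfold h; lra).
  generalize (Rmin_l d d') (Rmin_r d d'). intros.
  apply (H' (z0 + RtoC h)%C).
  - intros E'. rewrite E' in E. replace (z0 - z0)%C with (RtoC 0) in E by ring. apply RtoC_inj in E. unfold h in E; lra.
  - rewrite E, Eh. unfold h; lra.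
  - apply H. rewrite E, Eh. unfold h; lra.
Qed.

Lemma identity_mult (f g : C -> C) : holoD f -> holoD g -> (forall z, Cmod z < 1 -> (f z * g z)%C = 0) ->
  (exists z, Cmod z < 1 /\ f z <> 0) -> forall z, Cmod z < 1 -> g z = 0.
Proof.
  intros Hf Hg H [z0 [Hz0 Hne]].
  destruct (ccont_neq f z0 (holoD_cont f z0 Hf Hz0) Hne) as [d [Hd H']].
  apply (identity_theorem g z0 (Rmin d (1 - Cmod z0))); auto.
  - apply Rmin_pos; lra.
  - intros w Hw. generalize (Rmin_l d (1 - Cmod z0)) (Rmin_r d (1 - Cmod z0)). intros.
    apply NNPP. intros G. apply (Cmult_neq_0 (f w) (g w)); auto.
    + apply H'. lra.
    + apply H. apply (disk_nbhd z0). lra.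
Qed.

Lemma is_cderiv_pow_mult (g : C -> C) (z0 z l : C) (m : nat) : is_cderiv g z l ->
  is_cderiv (fun w => (w - z0) ^ S m * g w)%C z
    ((z - z0) ^ m * (RtoC (INR (S m)) * g z + (z - z0) * l))%C.
Proof.
  intros Hg.
  assert (P : forall n, is_cderiv (fun w => (w - z0) ^ S n)%C z (RtoC (INR (S n)) * (z - z0) ^ n)%C).
  { induction n as [|n IH].
    - apply is_cderiv_ext_loc with (f := fun w => (w - z0)%C) (r := 1); [lra| |].
      + intros; simpl; ring.
      + eapply is_cderiv_eq; [apply is_cderiv_minus; [apply is_cderiv_id|apply is_cderiv_const]|]. simpl. ring.
    - apply is_cderiv_ext_loc with (f := fun w => ((w - z0) * (w - z0) ^ S n)%C) (r := 1); [lra| |].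
      + intros; simpl; ring.
      + eapply is_cderiv_eq; [apply is_cderiv_mult; [apply is_cderiv_minus; [apply is_cderiv_id|apply is_cderiv_const]|exact IH]|].
        cbv beta. rewrite (S_INR (S n)), RtoC_plus. simpl Cpow. ring. }
  eapply is_cderiv_eq; [apply is_cderiv_mult; [apply P|exact Hg]|]. cbv beta. simpl Cpow. ring.
Qed.

Lemma derive_n_order (m : nat) : forall (f g : C -> C) (z0 : C), holoD g -> Cmod z0 < 1 ->
  (forall z, Cmod z < 1 -> f z = ((z - z0) ^ m * g z)%C) ->
  vanishes_to_order f z0 m /\ C_derive_n m f z0 = (RtoC (INR (fact m)) * g z0)%C.
Proof.
  induction m as [|m IH]; intros f g z0 Hg Hz0 Hf.
  - split; [intros k Hk; lia|]. simpl. rewrite Hf by auto. simpl. ring.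
  - set (g1 := fun z => (RtoC (INR (S m)) * g z + (z - z0) * C_derive g z)%C).
    assert (Hg1 : holoD g1).
    { apply holoD_plus; apply holoD_mult; auto using holoD_const, holoD_C_derive.
      apply holoD_minus; [apply holoD_id|apply holoD_const]. }
    set (f0 := fun z => ((z - z0) ^ S m * g z)%C).
    assert (Hf0 : holoD f0).
    { apply holoD_mult; auto. apply holoD_pow. apply holoD_minus; [apply holoD_id|apply holoD_const]. }
    assert (Hd : forall z, Cmod z < 1 -> C_derive f z = ((z - z0) ^ m * g1 z)%C).
    { intros z Hz. rewrite (C_derive_ext f0 f z); auto.
      - apply is_cderiv_C_derive. apply is_cderiv_pow_mult. now apply holoD_deriv.
      - intros w Hw. symmetry. now apply Hf. }
    destruct (IH (C_derive f) g1 z0 Hg1 Hz0 Hd) as [V D]. split.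
    + intros [|k] Hk.
      * simpl. rewrite Hf by auto. simpl. ring.
      * rewrite C_derive_n_succ. apply V. lia.
    + rewrite C_derive_n_succ, D. unfold g1. rewrite fact_simpl, mult_INR, RtoC_mult. ring.
Qed.

Lemma RtoC_fact_neq (m : nat) : RtoC (INR (fact m)) <> 0.
Proof. intros E. apply RtoC_inj in E. now apply (INR_fact_neq_0 m). Qed.

Lemma vanishes_factor (f : C -> C) (z0 : C) (m : nat) : holoD f -> Cmod z0 < 1 -> vanishes_to_order f z0 m ->
  exists g, holoD g /\ forall z, Cmod z < 1 -> f z = ((z - z0) ^ m * g z)%C.
Proof.
  intros Hf Hz0 HV.
  destruct (classic (exists z, Cmod z < 1 /\ f z <> 0)) as [Hne|Hz].
  - destruct (order_factor f z0 Hf Hz0 Hne) as [k [g [Hg [g0 Hfg]]]].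
    assert (m <= k)%nat.
    { apply Nat.nlt_ge. intros Hlt.
      destruct (derive_n_order k f g z0 Hg Hz0 (fun z _ => Hfg z)) as [_ D].
      rewrite (HV k Hlt) in D. symmetry in D.
      apply (Cmult_neq_0 _ _ (RtoC_fact_neq k) g0 D). }
    exists (fun z => ((z - z0) ^ (k - m) * g z)%C). split.
    + apply holoD_mult; auto. apply holoD_pow. apply holoD_minus; [apply holoD_id|apply holoD_const].
    + intros z _. rewrite Hfg. replace k with (m + (k - m))%nat at 1 by lia. rewrite Cpow_add_r. ring.
  - exists (fun _ => 0). split; [apply holoD_const|]. intros z Hz'.
    replace (f z) with (RtoC 0); [ring|]. symmetry. apply NNPP. intros N. apply Hz. eauto.
Qed.

(** The relation between the leading coefficients of f and of its derivative is recorded because it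
    turns a comparison of derivatives at [z0] into a comparison of the functions near [z0]. *)
Lemma integrate_factor (f g : C -> C) (z0 : C) (m : nat) : holoD f -> holoD g -> Cmod z0 < 1 -> f z0 = 0 ->
  (forall z, Cmod z < 1 -> C_derive f z = ((z - z0) ^ m * g z)%C) ->
  exists h, holoD h /\ (RtoC (INR (S m)) * h z0)%C = g z0 /\ forall z, Cmod z < 1 -> f z = ((z - z0) ^ S m * h z)%C.
Proof.
  intros Hf Hg Hz0 f0 Hd.
  destruct (derive_n_order m (C_derive f) g z0 Hg Hz0 Hd) as [V D].
  destruct (vanishes_factor f z0 (S m) Hf Hz0) as [h [Hh Hfh]].
  { intros [|k] Hk; [exact f0|]. rewrite C_derive_n_succ. apply V. lia. }
  exists h. split; [auto|split; auto].
  destruct (derive_n_order (S m) f h z0 Hh Hz0 Hfh) as [_ D'].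
  rewrite C_derive_n_succ, D in D'. rewrite fact_simpl, mult_INR, RtoC_mult in D'.
  assert (N := RtoC_fact_neq m).
  transitivity (/ RtoC (INR (fact m)) * (RtoC (INR (S m)) * RtoC (INR (fact m)) * h z0))%C; [field; auto|].
  rewrite <- D'. field; auto.
Qed.

(** * The Schwarz-Pick lemma and comparison of conformal densities *)

Definition self_map (f : C -> C) : Prop := forall z, Cmod z < 1 -> Cmod (f z) < 1.

Lemma circle_max_lt (u : C -> R) (a : C) (r M : R) : 0 < r ->
  (forall z, Cmod (z - a) = r -> ccont (fun w => RtoC (u w)) z) ->
  (forall z, Cmod (z - a) = r -> u z < M) ->
  exists M', M' < M /\ forall z, Cmod (z - a) = r -> u z <= M'.
Proof.
  intros Hr Hu HM.
  destruct (max_on_compact (fun z => Cmod (z - a) = r) u (r + Cmod a)) as [z0 [Hz0 H]]; auto.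
  - intros z Hz. generalize (Cmod_rtriangle z a). lra.
  - intros l Hl. apply NNPP. intros Hne.
    destruct (Hl (Rabs (Cmod (l - a) - r))) as [z [Hz Hzl]].
    { apply Rabs_pos_lt. lra. }
    apply (Rlt_irrefl (Rabs (Cmod (l - a) - r))). eapply Rle_lt_trans; [|exact Hzl].
    rewrite <- Hz. eapply Rle_trans; [apply Cmod_rtriangle_abs|].
    rewrite (Cmod_sym z l). apply Req_le. f_equal. ring.
  - exists (a + RtoC r * cis 0)%C. apply circle_in; lra.
  - exists (u z0). split; auto.
Qed.

Lemma strict_max_modulus (f : C -> C) (a : C) (R1 r M : R) : holo_on a R1 f -> 0 < r < R1 ->
  (forall w, Cmod (w - a) = r -> Cmod (f w) < M) -> Cmod (f a) < M.
Proof.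
  intros Hf Hr HM.
  destruct (circle_max_lt (fun w => Cmod (f w)) a r M) as [M' [HM' H]]; auto; try lra.
  - intros z Hz. apply ccont_Cmod. eapply holo_cont; eauto. lra.
  - eapply Rle_lt_trans; [|exact HM']. apply (max_modulus f a R1 r); auto.
    replace (a - a)%C with (RtoC 0) by ring. rewrite Cmod_0. lra.
Qed.

Lemma ccont_gt (u : C -> R) (z : C) (m : R) : ccont (fun w => RtoC (u w)) z -> m < u z ->
  exists d, 0 < d /\ forall w, Cmod (w - z) < d -> m < u w.
Proof.
  intros Hc Hm. destruct (Hc (u z - m)) as [d [Hd H]]; [lra|]. exists d. split; auto.
  intros w Hw. specialize (H w Hw). rewrite Cmod_RtoC_minus in H. apply Rabs_def2 in H. lra.
Qed.

Lemma self_map_sq (f : C -> C) (z : C) : self_map f -> Cmod z < 1 -> 0 < 1 - Cmod (f z) ^ 2.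
Proof. intros H Hz. generalize (sq_lt_1 _ (Cmod_ge_0 (f z)) (H z Hz)). lra. Qed.

Lemma mob_comp_deriv (f : C -> C) (al : C) (z : C) : holoD f -> self_map f -> Cmod al < 1 -> Cmod z < 1 ->
  C_derive (fun w => mob al (f w)) z = (RtoC (1 - Cmod al ^ 2) / (1 - Cconj al * f z) ^ 2 * C_derive f z)%C.
Proof.
  intros Hf Sf Ha Hz. apply is_cderiv_C_derive. apply is_cderiv_comp; [now apply holoD_deriv|].
  apply is_cderiv_mob; auto.
Qed.

Lemma holoD_mobder (f : C -> C) (al : C) : holoD f -> self_map f -> Cmod al < 1 ->
  holoD (fun z => RtoC (1 - Cmod al ^ 2) / (1 - Cconj al * f z) ^ 2)%C.
Proof.
  intros Hf Sf Ha. apply holoD_div.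
  - apply holoD_const.
  - apply holoD_pow. apply holoD_minus; [apply holoD_const|]. apply holoD_mult; auto using holoD_const.
  - intros z Hz. apply Cpow_nz. apply mob_den; auto.
Qed.

Lemma Cmod_neq0_pos (z : C) : z <> 0 -> 0 < Cmod z.
Proof. apply Cmod_gt_0. Qed.

(** With q = chi F/G this is |chi| times the quotient of the densities of f and b, continued across
    the zeros of the common factor P of their derivatives. *)
Definition pick_ratio (q f b : C -> C) (z : C) : R :=
  Cmod (q z) * (1 - Cmod (b z) ^ 2) / (1 - Cmod (f z) ^ 2).

Lemma ccont_pow2 (u : C -> R) (z : C) : ccont (fun w => RtoC (u w)) z -> ccont (fun w => RtoC (u w ^ 2)) z.
Proof.
  intros H. apply ccont_ext_loc with (f := fun w => (RtoC (u w) * RtoC (u w))%C) (r := 1); [lra| |].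
  - intros w _. rewrite <- RtoC_mult. f_equal. ring.
  - now apply ccont_mult.
Qed.

Lemma pick_ratio_cont (q f b : C -> C) (z : C) : ccont q z -> ccont f z -> ccont b z -> 1 - Cmod (f z) ^ 2 <> 0 ->
  ccont (fun w => RtoC (pick_ratio q f b w)) z.
Proof.
  intros Hq Hf Hb Hn.
  assert (Hd : ccont (fun w => RtoC (1 - Cmod (f w) ^ 2)) z).
  { apply ccont_ext_loc with (f := fun w => (RtoC 1 - RtoC (Cmod (f w) ^ 2))%C) (r := 1); [lra| |].
    - intros; now rewrite RtoC_minus.
    - apply ccont_minus; [apply ccont_const|]. now apply ccont_pow2, ccont_Cmod. }
  assert (Hb' : ccont (fun w => RtoC (1 - Cmod (b w) ^ 2)) z).
  { apply ccont_ext_loc with (f := fun w => (RtoC 1 - RtoC (Cmod (b w) ^ 2))%C) (r := 1); [lra| |].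
    - intros; now rewrite RtoC_minus.
    - apply ccont_minus; [apply ccont_const|]. now apply ccont_pow2, ccont_Cmod. }
  assert (Hne : RtoC (1 - Cmod (f z) ^ 2) <> 0) by (intros E; apply RtoC_inj in E; auto).
  destruct (ccont_neq _ z Hd Hne) as [d [Hdp Hdn]].
  apply ccont_ext_loc with (f := fun w => (RtoC (Cmod (q w)) * RtoC (1 - Cmod (b w) ^ 2) / RtoC (1 - Cmod (f w) ^ 2))%C) (r := d); auto.
  - intros w Hw. unfold pick_ratio. rewrite RtoC_div, RtoC_mult; auto.
    intros E. apply (Hdn w Hw). now rewrite E.
  - apply ccont_div; auto. apply ccont_mult; auto. now apply ccont_Cmod.
Qed.

(* After moving f(z0) and b(z0) to 0 by Möbius maps, the strict inequality between the
   densities gives |f| > |b| near z0, so the ratio strictly exceeds the modulus of a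
   holomorphic function with which it agrees at z0. *)
Lemma pick_ratio_no_max (f b P F G chi : C -> C) (z0 : C) (r0 d : R) :
  holoD f -> holoD b -> self_map f -> self_map b -> holoD P -> holoD F -> holoD G ->
  (exists z, Cmod z < 1 /\ P z <> 0) ->
  (forall z, Cmod z < 1 -> C_derive f z = (P z * F z)%C) ->
  (forall z, Cmod z < 1 -> C_derive b z = (P z * G z)%C) ->
  Cmod z0 < 1 -> 0 < r0 -> holo_on z0 r0 chi -> Cmod (chi z0) <= 1 -> G z0 <> 0 -> 0 < d ->
  (forall z, Cmod (z - z0) < d -> pick_ratio (fun z => chi z * F z / G z)%C f b z
      <= pick_ratio (fun z => chi z * F z / G z)%C f b z0) ->
  1 < pick_ratio (fun z => chi z * F z / G z)%C f b z0 -> False.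
Proof.
  intros Hf Hb Sf Sb HP HF HG HPn Df Db Hz0 Hr0 Hchi Hchi1 HGz Hd Hmax Hgt.
  set (al := f z0) in *. set (be := b z0) in *.
  assert (Ha : Cmod al < 1) by now apply Sf. assert (Hbe : Cmod be < 1) by now apply Sb.
  set (kf := fun z => (RtoC (1 - Cmod al ^ 2) / (1 - Cconj al * f z) ^ 2)%C).
  set (kb := fun z => (RtoC (1 - Cmod be ^ 2) / (1 - Cconj be * b z) ^ 2)%C).
  assert (Hkf : holoD kf) by now apply holoD_mobder. assert (Hkb : holoD kb) by now apply holoD_mobder.
  set (f1 := fun z => mob al (f z)). set (b1 := fun z => mob be (b z)).
  assert (Hf1 : holoD f1) by (apply (holoD_comp f (mob al)); auto using holoD_mob).
  assert (Hb1 : holoD b1) by (apply (holoD_comp b (mob be)); auto using holoD_mob).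
  destruct (order_factor P z0 HP Hz0 HPn) as [m [P1 [HP1 [P1n HPf]]]].
  destruct (integrate_factor f1 (fun z => P1 z * (kf z * F z))%C z0 m) as [fh [Hfh [fh0 Efh]]]; auto.
  { apply holoD_mult; auto. now apply holoD_mult. }
  { unfold f1, mob, al. unfold Cdiv. ring. }
  { intros z Hz. unfold f1. rewrite mob_comp_deriv, Df, HPf by auto. unfold kf. ring. }
  destruct (integrate_factor b1 (fun z => P1 z * (kb z * G z))%C z0 m) as [bh [Hbh [bh0 Ebh]]]; auto.
  { apply holoD_mult; auto. now apply holoD_mult. }
  { unfold b1, mob, be. unfold Cdiv. ring. }
  { intros z Hz. unfold b1. rewrite mob_comp_deriv, Db, HPf by auto. unfold kb. ring. }
  assert (A1 := self_map_sq f z0 Sf Hz0). assert (B1 := self_map_sq b z0 Sb Hz0). fold al in A1. fold be in B1.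
  assert (ER : forall x y : C, (y - x = 0)%C -> x = y) by (intros x y E; symmetry; now apply Cminus_eq0).
  assert (kf0 : kf z0 = (/ RtoC (1 - Cmod al ^ 2))%C).
  { unfold kf. fold al. replace (1 - Cconj al * al)%C with (RtoC (1 - Cmod al ^ 2)).
    - field. intros E; apply RtoC_inj in E; lra.
    - rewrite RtoC_minus, Cmod2_conj. ring. }
  assert (kb0 : kb z0 = (/ RtoC (1 - Cmod be ^ 2))%C).
  { unfold kb. fold be. replace (1 - Cconj be * be)%C with (RtoC (1 - Cmod be ^ 2)).
    - field. intros E; apply RtoC_inj in E; lra.
    - rewrite RtoC_minus, Cmod2_conj. ring. }
  assert (HGp := Cmod_neq0_pos _ HGz).
  assert (Hcmp : Cmod (G z0) / (1 - Cmod be ^ 2) < Cmod (F z0) / (1 - Cmod al ^ 2)).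
  { unfold pick_ratio in Hgt. fold al be in Hgt. rewrite Cmod_div, Cmod_mult in Hgt by auto.
    assert (E : 1 * (1 - Cmod al ^ 2) * Cmod (G z0) < Cmod (chi z0) * Cmod (F z0) * (1 - Cmod be ^ 2)).
    { apply Rmult_lt_reg_r with (/ ((1 - Cmod al ^ 2) * Cmod (G z0))).
      - apply Rinv_0_lt_compat. now apply Rmult_lt_0_compat.
      - replace (1 * (1 - Cmod al ^ 2) * Cmod (G z0) * / ((1 - Cmod al ^ 2) * Cmod (G z0))) with 1 by (field; lra).
        eapply Rlt_le_trans; [exact Hgt|]. apply Req_le. field. lra. }
    assert (E2 : Cmod (chi z0) * Cmod (F z0) * (1 - Cmod be ^ 2) <= Cmod (F z0) * (1 - Cmod be ^ 2)).
    { apply Rmult_le_compat_r; [lra|]. generalize (Cmod_ge_0 (F z0)). nra. }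
    apply Rmult_lt_reg_r with ((1 - Cmod al ^ 2) * (1 - Cmod be ^ 2)); [now apply Rmult_lt_0_compat|].
    replace (Cmod (G z0) / (1 - Cmod be ^ 2) * ((1 - Cmod al ^ 2) * (1 - Cmod be ^ 2))) with (1 * (1 - Cmod al ^ 2) * Cmod (G z0)) by (field; lra).
    replace (Cmod (F z0) / (1 - Cmod al ^ 2) * ((1 - Cmod al ^ 2) * (1 - Cmod be ^ 2))) with (Cmod (F z0) * (1 - Cmod be ^ 2)) by (field; lra).
    lra. }
  assert (Hh : Cmod (bh z0) < Cmod (fh z0)).
  { assert (Sm : 0 < INR (S m)) by (apply lt_0_INR; lia).
    apply (f_equal Cmod) in fh0, bh0. rewrite kf0, !Cmod_mult, Cmod_R, Rabs_right in fh0 by lra.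
    rewrite kb0, !Cmod_mult, Cmod_R, Rabs_right in bh0 by lra.
    rewrite Cmod_inv, Cmod_R, Rabs_right in fh0, bh0 by (try lra; intros E; apply RtoC_inj in E; lra).
    assert (P1p := Cmod_neq0_pos _ P1n).
    apply Rmult_lt_reg_l with (INR (S m)); auto. rewrite fh0, bh0. apply Rmult_lt_compat_l; auto.
    unfold Rdiv in Hcmp. lra. }
  destruct (ccont_gt (fun w => Cmod (fh w) - Cmod (bh w)) z0 0) as [d1 [Hd1 Hgt1]]; [|lra|].
  { apply ccont_ext_loc with (f := fun w => (RtoC (Cmod (fh w)) - RtoC (Cmod (bh w)))%C) (r := 1); [lra| |].
    - intros; now rewrite RtoC_minus.
    - apply ccont_minus; apply ccont_Cmod, holoD_cont; auto. }
  destruct (ccont_neq G z0 (holoD_cont G z0 HG Hz0) HGz) as [d2 [Hd2 HGn]].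
  set (R1 := Rmin (Rmin r0 d) (Rmin d1 (Rmin d2 (1 - Cmod z0)))).
  assert (HR1 : 0 < R1) by (unfold R1; repeat apply Rmin_pos; lra).
  assert (R1a : R1 <= r0) by (unfold R1; eapply Rle_trans; [apply Rmin_l|apply Rmin_l]).
  assert (R1b : R1 <= d) by (unfold R1; eapply Rle_trans; [apply Rmin_l|apply Rmin_r]).
  assert (R1c : R1 <= d1) by (unfold R1; eapply Rle_trans; [apply Rmin_r|apply Rmin_l]).
  assert (R1d : R1 <= d2) by (unfold R1; eapply Rle_trans; [apply Rmin_r|]; eapply Rle_trans; [apply Rmin_r|apply Rmin_l]).
  assert (R1e : R1 <= 1 - Cmod z0) by (unfold R1; eapply Rle_trans; [apply Rmin_r|]; eapply Rle_trans; [apply Rmin_r|apply Rmin_r]).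
  (* Densities are invariant under Möbius maps applied to the values, so the ratio is |rho| (1 -
     |b1|^2)/(1 - |f1|^2) with [f1] and [b1] vanishing at [z0]. The derivative factors [kf] and [kb]
     of the Möbius maps are absorbed in [rho]. *)
  set (rho := fun z => (chi z * (kf z * F z) / (kb z * G z))%C).
  assert (kbn : forall z, Cmod z < 1 -> kb z <> 0).
  { intros z Hz E. unfold kb, Cdiv in E. revert E. apply Cmult_neq_0.
    - intros E; apply RtoC_inj in E; lra.
    - intros E.
      assert (Q : ((1 - Cconj be * b z) ^ 2)%C <> 0) by (apply Cpow_nz, mob_den; auto).
      apply (f_equal (fun x => (x * (1 - Cconj be * b z) ^ 2)%C)) in E.
      rewrite Cinv_l, Cmult_0_l in E by auto. apply RtoC_inj in E. lra. }
  assert (Hrho : holo_on z0 R1 rho).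
  { intros z Hz. assert (Hz1 : Cmod z < 1) by (apply (disk_nbhd z0); lra).
    destruct (Hchi z) as [l Hl]; [lra|]. eexists. unfold rho. apply is_cderiv_div.
    - apply is_cderiv_mult; [exact Hl|]. apply is_cderiv_mult; apply holoD_deriv; auto.
    - apply is_cderiv_mult; apply holoD_deriv; auto.
    - apply Cmult_neq_0; [now apply kbn|]. apply HGn. lra. }
  assert (Erho : forall z, Cmod (z - z0) < R1 ->
     pick_ratio (fun z => chi z * F z / G z)%C f b z = Cmod (rho z) * (1 - Cmod (b1 z) ^ 2) / (1 - Cmod (f1 z) ^ 2)).
  { intros z Hz. assert (Hz1 : Cmod z < 1) by (apply (disk_nbhd z0); lra).
    assert (Gn : G z <> 0) by (apply HGn; lra).
    unfold pick_ratio, f1, b1. rewrite !mob_mod by auto.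
    unfold rho, kf, kb.
    assert (Q1 : (1 - Cconj al * f z)%C <> 0) by (apply mob_den; auto).
    assert (Q2 : (1 - Cconj be * b z)%C <> 0) by (apply mob_den; auto).
    assert (Q3 := Cmod_neq0_pos _ Q1). assert (Q4 := Cmod_neq0_pos _ Q2).
    assert (NA : RtoC (1 - Cmod al ^ 2) <> 0) by (intros E; apply RtoC_inj in E; lra).
    assert (NB : RtoC (1 - Cmod be ^ 2) <> 0) by (intros E; apply RtoC_inj in E; lra).
    rewrite !Cmod_div, !Cmod_mult, !Cmod_div, !Cmod_pow, !Cmod_R, !Rabs_right by
      (try (apply Cmult_neq_0; auto; unfold Cdiv; apply (kbn z); auto); try apply Cpow_nz; auto; lra).
    assert (C1 := self_map_sq f z Sf Hz1). assert (C2 := Cmod_neq0_pos _ Gn).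
    field. repeat split; try lra. }
  assert (Hf1b1 : forall z, Cmod (z - z0) < R1 -> z <> z0 -> Cmod (b1 z) < Cmod (f1 z)).
  { intros z Hz Hne. assert (Hz1 : Cmod z < 1) by (apply (disk_nbhd z0); lra).
    rewrite Efh, Ebh, !Cmod_mult by auto. apply Rmult_lt_compat_l.
    - apply Cmod_neq0_pos, Cpow_nz. intros E; apply Hne. now apply Cminus_eq0.
    - specialize (Hgt1 z ltac:(lra)). lra. }
  assert (f1z : f1 z0 = 0) by (unfold f1, mob, al, Cdiv; ring).
  assert (b1z : b1 z0 = 0) by (unfold b1, mob, be, Cdiv; ring).
  assert (Hz00 : Cmod (z0 - z0) < R1) by (replace (z0 - z0)%C with (RtoC 0) by ring; rewrite Cmod_0; lra).
  assert (Erho0 := Erho z0 Hz00). rewrite f1z, b1z, Cmod_0 in Erho0.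
  replace (Cmod (rho z0) * (1 - 0 ^ 2) / (1 - 0 ^ 2)) with (Cmod (rho z0)) in Erho0 by field.
  (* On a small circle |b1| < |f1| puts |rho| strictly below the ratio wherever [rho] does not
     vanish. The ratio is at most its value |rho z0| at the centre, and the strict maximum principle
     yields the absurd inequality. *)
  assert (Hstrict : Cmod (rho z0) < Cmod (rho z0)); [|lra].
  apply (strict_max_modulus rho z0 R1 (R1 / 2)); auto; [lra|].
  intros w Hw. assert (Hw1 : Cmod (w - z0) < R1) by lra.
  assert (Hwn : w <> z0).
  { intros ->. replace (z0 - z0)%C with (RtoC 0) in Hw by ring. rewrite Cmod_0 in Hw. lra. }
  assert (Hwd : Cmod w < 1) by (apply (disk_nbhd z0); lra).
  rewrite <- Erho0. destruct (Req_dec (Cmod (rho w)) 0) as [E0|E0]; [lra|].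
  assert (rp : 0 < Cmod (rho w)) by (generalize (Cmod_ge_0 (rho w)); lra).
  eapply Rlt_le_trans; [|apply (Hmax w); lra]. rewrite Erho by auto.
  assert (L := Hf1b1 w Hw1 Hwn). assert (Lb := Cmod_ge_0 (b1 w)).
  assert (Lf : Cmod (f1 w) < 1) by (apply mob_in; auto).
  assert (Lq : 0 < 1 - Cmod (f1 w) ^ 2) by nra.
  apply Rmult_lt_reg_r with (1 - Cmod (f1 w) ^ 2); auto.
  unfold Rdiv. rewrite Rmult_assoc, Rinv_l by lra. rewrite Rmult_1_r.
  apply Rmult_lt_compat_l; auto. nra.
Qed.

(* The boundary behaviour of finite Blaschke products: the Schwarz-Pick inequality is
   asymptotically an equality at the circle. *)
Definition boundary_sharp (b : C -> C) : Prop :=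
  forall e, 0 < e -> exists r, r < 1 /\ forall z, r < Cmod z < 1 ->
    (1 - e) * (1 - Cmod (b z) ^ 2) <= (1 - Cmod z ^ 2) * Cmod (C_derive b z).

Lemma schwarz_pick (f : C -> C) (z0 : C) : holoD f -> self_map f -> Cmod z0 < 1 ->
  Cmod (C_derive f z0) * (1 - Cmod z0 ^ 2) <= 1 - Cmod (f z0) ^ 2.
Proof.
  intros Hf Sf Hz0. set (al := f z0). assert (Ha : Cmod al < 1) by now apply Sf.
  set (g := fun z => mob al (f z)).
  assert (Hg : holoD g) by (apply (holoD_comp f (mob al)); auto using holoD_mob).
  assert (g0 : g z0 = 0) by (unfold g, mob, al, Cdiv; ring).
  destruct (divide_rootD g z0 Hg Hz0) as [h [Hh [h0 Egh]]].
  set (k := fun z => (h z * (1 - Cconj z0 * z))%C).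
  assert (Hk : holoD k).
  { apply holoD_mult; auto. apply holoD_minus; [apply holoD_const|]. apply holoD_mult; auto using holoD_const, holoD_id. }
  assert (Ek : forall z, Cmod z < 1 -> (g z = mob z0 z * k z)%C).
  { intros z Hz. rewrite Egh, g0. unfold k, mob. field. now apply mob_den. }
  assert (Bk : Cmod (k z0) <= 1).
  { apply (max_modulus_limsup k 1); auto. intros e He.
    destruct (mob_near_boundary z0 (e / (1 + e)) Hz0) as [r [Hr Hb]]; [apply Rdiv_lt_0_compat; lra|].
    exists r. split; [lra|]. intros w Hw. specialize (Hb w Hw).
    assert (B := Ek w ltac:(lra)). apply (f_equal Cmod) in B. rewrite Cmod_mult in B.
    assert (Cmod (g w) < 1) by (apply mob_in; auto; apply Sf; lra).
    replace (1 - e / (1 + e)) with (/ (1 + e)) in Hb by (field; lra).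
    assert (0 < / (1 + e)) by (apply Rinv_0_lt_compat; lra).
    apply Rmult_le_reg_l with (/ (1 + e)); auto. rewrite Rinv_l by lra.
    generalize (Cmod_ge_0 (k w)). nra. }
  assert (D : C_derive g z0 = (RtoC (1 - Cmod al ^ 2) / (1 - Cconj al * al) ^ 2 * C_derive f z0)%C)
    by exact (mob_comp_deriv f al z0 Hf Sf Ha Hz0).
  assert (A1 := self_map_sq f z0 Sf Hz0). fold al in A1.
  assert (Z1 : 0 < 1 - Cmod z0 ^ 2) by (generalize (Cmod_ge_0 z0); nra).
  assert (Ek0 : k z0 = (C_derive f z0 * (RtoC (1 - Cmod z0 ^ 2) / RtoC (1 - Cmod al ^ 2)))%C).
  { unfold k. rewrite h0, D.
    replace (1 - Cconj al * al)%C with (RtoC (1 - Cmod al ^ 2)) by (rewrite RtoC_minus, Cmod2_conj; ring).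
    replace (1 - Cconj z0 * z0)%C with (RtoC (1 - Cmod z0 ^ 2)) by (rewrite RtoC_minus, Cmod2_conj; ring).
    field. intros E; apply RtoC_inj in E; lra. }
  rewrite Ek0, Cmod_mult, Cmod_div, !Cmod_R, !Rabs_right in Bk by (try lra; intros E; apply RtoC_inj in E; lra).
  apply Rmult_le_reg_r with (/ (1 - Cmod al ^ 2)); [now apply Rinv_0_lt_compat|].
  rewrite Rinv_r by lra. unfold Rdiv in Bk. lra.
Qed.

(** If |c| = 1 for c = f z0, the parallelogram law |f + c|^2 + |f - c|^2 = 2|f|^2 + 2|c|^2 <= 4
    gives |f + c| < 2 wherever f differs from c, hence on small circles about [z0]. At the centre f
    + c = 2c has modulus 2, against the strict maximum principle. *)
Lemma strict_self_map (f : C -> C) : holoD f -> (forall z, Cmod z < 1 -> Cmod (f z) <= 1) ->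
  (exists z w, Cmod z < 1 /\ Cmod w < 1 /\ f z <> f w) -> self_map f.
Proof.
  intros Hf Hle [u [v [Hu [Hv Huv]]]] z0 Hz0. apply Rnot_le_lt. intros Hge.
  assert (H1 : Cmod (f z0) = 1) by (generalize (Hle z0 Hz0); lra).
  set (c := f z0) in *.
  assert (Hfc : holoD (fun z => f z - c)%C) by (apply holoD_minus; auto using holoD_const).
  destruct (isolated_zeros _ z0 Hfc Hz0) as [d [Hd Hiso]].
  { destruct (Ceq_dec (f u) c) as [E|E].
    - exists v. split; auto. intros E2. apply Huv. rewrite E. symmetry. now apply Cminus_eq0.
    - exists u. split; auto. intros E2. apply E. now apply Cminus_eq0. }
  set (g := fun z => (f z + c)%C).
  assert (Hg : holoD g) by (apply holoD_plus; auto using holoD_const).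
  set (r := Rmin d (1 - Cmod z0) / 2). assert (0 < Rmin d (1 - Cmod z0)) by (apply Rmin_pos; lra).
  generalize (Rmin_l d (1 - Cmod z0)) (Rmin_r d (1 - Cmod z0)); intros.
  assert (Hlt : Cmod (g z0) < 2).
  { apply (strict_max_modulus g z0 (1 - Cmod z0) r); [apply holoD_local; auto; lra|unfold r; lra|].
    intros w Hw. assert (Hw1 : Cmod w < 1) by (apply (disk_nbhd z0); unfold r in Hw; lra).
    assert (Hwz : w <> z0).
    { intros ->. replace (z0 - z0)%C with (RtoC 0) in Hw by ring. rewrite Cmod_0 in Hw. unfold r in Hw; lra. }
    assert (N := Hiso w Hwz ltac:(unfold r in Hw; lra)). apply Cmod_gt_0 in N. cbv beta in N.
    assert (Par : Cmod (f w + c) ^ 2 + Cmod (f w - c) ^ 2 = 2 * Cmod (f w) ^ 2 + 2 * Cmod c ^ 2).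
    { rewrite !Cmod2_expand. destruct (f w), c. simpl. ring. }
    specialize (Hle w Hw1). unfold g. rewrite H1 in Par.
    assert (Cmod (f w) ^ 2 <= 1) by (generalize (Cmod_ge_0 (f w)); nra).
    assert (0 < Cmod (f w - c) ^ 2) by (apply pow_lt; auto).
    generalize (Cmod_ge_0 (f w + c)). nra. }
  unfold g in Hlt. fold c in Hlt. replace (c + c)%C with (2 * c)%C in Hlt by ring.
  rewrite Cmod_mult, H1, Cmod_R, Rabs_right in Hlt; lra.
Qed.

(** If the ratio exceeded 1 somewhere in the region h >= 0, it would have a maximum there. That
    maximum is not near the circle, where [boundary_sharp] for b and the Schwarz-Pick lemma for f
    keep the ratio almost below 1; nor on h = 0, by hypothesis; nor at an interior point, by
    [pick_ratio_no_max]. With chi = 1 and h = 1 this is the comparison on the whole disk, with no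
    inner boundary to check. *)
Lemma ahlfors_comparison (f b P F G chi : C -> C) (h : C -> R) :
  holoD f -> holoD b -> self_map f -> self_map b -> holoD P -> holoD F -> holoD G -> holoD chi ->
  (exists z, Cmod z < 1 /\ P z <> 0) ->
  (forall z, Cmod z < 1 -> C_derive f z = (P z * F z)%C) ->
  (forall z, Cmod z < 1 -> C_derive b z = (P z * G z)%C) ->
  boundary_sharp b ->
  (forall z, ccont (fun w => RtoC (h w)) z) ->
  (forall z, Cmod z < 1 -> 0 <= h z -> G z <> 0) ->
  (forall z, Cmod z < 1 -> Cmod (chi z) <= 1) ->
  (forall z, Cmod z < 1 -> h z = 0 -> Cmod (chi z * F z) * (1 - Cmod (b z) ^ 2) <= Cmod (G z) * (1 - Cmod (f z) ^ 2)) ->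
  forall z, Cmod z < 1 -> 0 <= h z ->
    Cmod (chi z * F z) * (1 - Cmod (b z) ^ 2) <= Cmod (G z) * (1 - Cmod (f z) ^ 2).
Proof.
  intros Hf Hb Sf Sb HP HF HG Hchi HPn Df Db Hbs Hh HGn Hchi1 Hbd z1 Hz1 Hhz1.
  set (u := pick_ratio (fun z => chi z * F z / G z)%C f b).
  assert (Eu : forall z m, Cmod z < 1 -> 0 <= h z ->
     (u z <= m <-> Cmod (chi z * F z) * (1 - Cmod (b z) ^ 2) <= m * (Cmod (G z) * (1 - Cmod (f z) ^ 2)))).
  { intros z m Hz Hhz. assert (Gn := HGn z Hz Hhz). assert (Gp := Cmod_neq0_pos _ Gn).
    assert (Fp := self_map_sq f z Sf Hz).
    assert (E : u z * (Cmod (G z) * (1 - Cmod (f z) ^ 2)) = Cmod (chi z * F z) * (1 - Cmod (b z) ^ 2)).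
    { unfold u, pick_ratio. rewrite Cmod_div by auto. field. lra. }
    rewrite <- E. assert (Q : 0 < Cmod (G z) * (1 - Cmod (f z) ^ 2)) by now apply Rmult_lt_0_compat.
    split; intros; [apply Rmult_le_compat_r; lra|]. apply Rmult_le_reg_r with (2 := H); auto. }
  rewrite <- (Rmult_1_l (Cmod (G z1) * _)). apply Eu; auto.
  apply Rnot_lt_le. intros Hlt.
  (* This makes 1/(1 - e) = 2u/(u + 1) for u = [u z1] > 1, a number strictly below u. *)
  set (e := (u z1 - 1) / (2 * u z1)).
  assert (He : 0 < e < 1 /\ 1 / (1 - e) < u z1).
  { assert (E1 : 1 - e = (u z1 + 1) / (2 * u z1)) by (unfold e; field; lra).
    assert (E2 : 0 < e) by (apply Rdiv_lt_0_compat; lra).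
    assert (E3 : 0 < 1 - e) by (rewrite E1; apply Rdiv_lt_0_compat; lra).
    split; [lra|]. rewrite E1. replace (1 / ((u z1 + 1) / (2 * u z1))) with (2 * u z1 / (u z1 + 1)) by (field; lra).
    apply Rmult_lt_reg_r with (u z1 + 1); [lra|]. unfold Rdiv. rewrite Rmult_assoc, Rinv_l by lra. nra. }
  destruct He as [[He0 He1] He2].
  destruct (Hbs e He0) as [r [Hr Hrb]].
  assert (Hout : forall z, r < Cmod z < 1 -> 0 <= h z -> u z <= 1 / (1 - e)).
  { intros z Hz Hhz. apply Eu; [lra|auto|].
    assert (Gn := HGn z ltac:(lra) Hhz). assert (Gp := Cmod_neq0_pos _ Gn).
    specialize (Hrb z Hz). assert (SPz := schwarz_pick f z Hf Sf ltac:(lra)). rewrite Db, Cmod_mult in Hrb by lra.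
    rewrite Df, Cmod_mult in SPz by lra.
    assert (Bp := self_map_sq b z Sb ltac:(lra)). assert (Fp := self_map_sq f z Sf ltac:(lra)).
    assert (Zp : 0 < 1 - Cmod z ^ 2) by (generalize (Cmod_ge_0 z); nra).
    assert (Pp : 0 < Cmod (P z)).
    { destruct (Req_dec (Cmod (P z)) 0) as [E|E]; [|generalize (Cmod_ge_0 (P z)); lra].
      rewrite E in Hrb. assert (0 < (1 - e) * (1 - Cmod (b z) ^ 2)) by (apply Rmult_lt_0_compat; lra). lra. }
    rewrite Cmod_mult. assert (X := Hchi1 z ltac:(lra)).
    apply Rle_trans with (Cmod (F z) * (1 - Cmod (b z) ^ 2)).
    { apply Rmult_le_compat_r; [lra|]. generalize (Cmod_ge_0 (F z)). nra. }
    apply Rmult_le_reg_l with (Cmod (P z) * (1 - Cmod z ^ 2) * (1 - e)); [repeat apply Rmult_lt_0_compat; lra|].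
    replace (Cmod (P z) * (1 - Cmod z ^ 2) * (1 - e) * (1 / (1 - e) * (Cmod (G z) * (1 - Cmod (f z) ^ 2))))
      with ((1 - Cmod z ^ 2) * (Cmod (P z) * Cmod (G z)) * (1 - Cmod (f z) ^ 2)) by (field; lra).
    replace (Cmod (P z) * (1 - Cmod z ^ 2) * (1 - e) * (Cmod (F z) * (1 - Cmod (b z) ^ 2)))
      with (Cmod (P z) * Cmod (F z) * (1 - Cmod z ^ 2) * ((1 - e) * (1 - Cmod (b z) ^ 2))) by ring.
    apply Rle_trans with ((1 - Cmod (f z) ^ 2) * ((1 - e) * (1 - Cmod (b z) ^ 2))).
    - apply Rmult_le_compat_r; [apply Rmult_le_pos; lra|lra].
    - rewrite (Rmult_comm _ (1 - Cmod (f z) ^ 2)). apply Rmult_le_compat_l; lra. }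
  assert (Hz1r : Cmod z1 <= r).
  { apply Rnot_lt_le. intros L. specialize (Hout z1 ltac:(lra) Hhz1). lra. }
  assert (P0 := Cmod_ge_0 z1).
  (* The maximum is taken over |z| <= q with q > r. Beyond r the ratio is less than [u z1], so the
     maximum lies in |z| <= r, at distance at least q - r from the outer edge. *)
  set (q := (r + 1) / 2).
  assert (HK : forall z, Cmod z <= q -> Cmod z < 1) by (intros; unfold q in *; lra).
  destruct (max_on_compact (fun z => Cmod z <= q /\ 0 <= h z) u q) as [z0 [[Hz0 Hh0] Hm]].
  - intros z Hz. apply Hz.
  - intros l Hl. split.
    + apply Rnot_lt_le. intros L. destruct (Hl (Cmod l - q)) as [z [[Hz _] Hzl]]; [lra|].
      generalize (Cmod_rtriangle l z). rewrite (Cmod_sym l z). lra.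
    + apply Rnot_lt_le. intros L.
      destruct (ccont_gt (fun w => - h w) l 0) as [d [Hd H]]; [|lra|].
      * apply ccont_ext_loc with (f := fun w => (- RtoC (h w))%C) (r := 1); [lra| |apply ccont_opp, Hh].
        intros; now rewrite RtoC_opp.
      * destruct (Hl d Hd) as [z [[_ Hz] Hzl]]. specialize (H z Hzl). lra.
  - exists z1. split; auto. unfold q. lra.
  - intros z [Hz Hhz]. assert (Hz' := HK z Hz). apply pick_ratio_cont.
    + apply ccont_div; [|apply holoD_cont; auto|now apply HGn].
      apply ccont_mult; apply holoD_cont; auto.
    + now apply holoD_cont.
    + now apply holoD_cont.
    + generalize (self_map_sq f z Sf Hz'). lra.
  - assert (Hz0' := HK z0 Hz0).
    assert (H01 : u z1 <= u z0) by (apply Hm; split; auto; unfold q; lra).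
    assert (H0r : Cmod z0 <= r).
    { apply Rnot_lt_le. intros L. specialize (Hout z0 ltac:(lra) Hh0). lra. }
    assert (Hhp : 0 < h z0).
    { destruct Hh0 as [L|E]; auto. exfalso. symmetry in E.
      assert (u z0 <= 1); [|lra]. apply Eu; [auto|lra|]. rewrite Rmult_1_l. now apply Hbd. }
    destruct (ccont_gt h z0 0 (Hh z0) Hhp) as [d [Hd Hhd]].
    apply (pick_ratio_no_max f b P F G chi z0 (1 - Cmod z0) (Rmin d (q - r))); auto; try lra.
    + apply holoD_local; auto; lra.
    + apply Rmin_pos; unfold q; lra.
    + intros z Hz. generalize (Rmin_l d (q - r)) (Rmin_r d (q - r)). intros.
      apply Hm. split.
      * generalize (Cmod_triangle (z - z0) z0). replace (z - z0 + z0)%C with z by ring. lra.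
      * left. apply Hhd. lra.
    + unfold u in *. lra.
Qed.

Lemma polar_form (z : C) : exists t, z = (RtoC (Cmod z) * cis t)%C.
Proof.
  destruct (Ceq_dec z 0) as [->|Hz].
  - exists 0. rewrite Cmod_0. ring.
  - assert (P := Cmod_neq0_pos _ Hz).
    assert (E2 := Cmod2_expand z).
    set (x := fst z / Cmod z). set (y := snd z / Cmod z).
    assert (XY : x ^ 2 + y ^ 2 = 1).
    { unfold x, y. replace ((fst z / Cmod z) ^ 2 + (snd z / Cmod z) ^ 2) with ((fst z ^ 2 + snd z ^ 2) / Cmod z ^ 2) by (field; lra).
      rewrite <- E2. field. lra. }
    assert (Hx : -1 <= x <= 1) by nra.
    assert (Hs : sin (acos x) = sqrt (y ^ 2)).
    { rewrite sin_acos by auto. f_equal. unfold Rsqr. lra. }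
    assert (Ez : z = (RtoC (Cmod z) * (x, y))%C).
    { destruct z as [z1 z2]. unfold x, y, Cmult, RtoC; simpl fst; simpl snd. f_equal; field; lra. }
    destruct (Rle_lt_dec 0 y) as [Hy|Hy].
    + exists (acos x). rewrite Ez at 1. f_equal. unfold cis. rewrite cos_acos, Hs, sqrt_pow2; auto.
    + exists (- acos x). rewrite Ez at 1. f_equal. unfold cis. rewrite cos_neg, sin_neg, cos_acos, Hs by auto.
      replace (y ^ 2) with ((- y) ^ 2) by ring. rewrite sqrt_pow2 by lra. f_equal. ring.
Qed.

Lemma cis_plus (s t : R) : cis (s + t) = (cis s * cis t)%C.
Proof. unfold cis, Cmult; simpl. rewrite cos_plus, sin_plus. f_equal. ring. Qed.

Lemma cis_pow (t : R) (n : nat) : (cis t ^ n)%C = cis (INR n * t).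
Proof.
  induction n as [|n IH].
  - simpl. unfold cis. rewrite Rmult_0_l, cos_0, sin_0. reflexivity.
  - rewrite S_INR. simpl Cpow. rewrite IH, <- cis_plus. f_equal. ring.
Qed.

Lemma unit_root (z : C) (n : nat) : (1 <= n)%nat ->
  exists eta, Cmod eta = 1 /\ (eta ^ n * z)%C = RtoC (Cmod z).
Proof.
  intros Hn. destruct (polar_form z) as [t Ht]. exists (cis (- t / INR n)). split; [apply Cmod_cis|].
  assert (INR n <> 0) by (apply not_0_INR; lia).
  rewrite cis_pow. rewrite Ht at 1. replace (INR n * (- t / INR n)) with (- t) by (field; auto).
  transitivity (RtoC (Cmod z) * (cis (- t) * cis t))%C; [ring|].
  rewrite <- cis_plus, Rplus_opp_l. unfold cis. rewrite cos_0, sin_0.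
  change ((1, 0) : C) with (RtoC 1). ring.
Qed.

Lemma Cmod_sq_diff (x y : C) : Cmod x ^ 2 - Cmod y ^ 2 <= Cmod (x - y) * (Cmod x + Cmod y).
Proof.
  replace (Cmod x ^ 2 - Cmod y ^ 2) with ((Cmod x - Cmod y) * (Cmod x + Cmod y)) by ring.
  apply Rmult_le_compat_r; [generalize (Cmod_ge_0 x) (Cmod_ge_0 y); lra|apply Cmod_rtriangle].
Qed.

(* Equality at 0 in the comparison of densities. If f - mu b vanished to finite order k at 0,
   F / (mu G) - 1 would vanish to order l = k - N - 1, while its real part is O(r^(l+1)). *)
Lemma density_rigidity (f b P F G : C -> C) :
  holoD f -> holoD b -> self_map f -> self_map b -> holoD P -> holoD F -> holoD G ->
  (exists z, Cmod z < 1 /\ P z <> 0) ->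
  (forall z, Cmod z < 1 -> C_derive f z = (P z * F z)%C) ->
  (forall z, Cmod z < 1 -> C_derive b z = (P z * G z)%C) ->
  (forall z, Cmod z < 1 -> Cmod (F z) * (1 - Cmod (b z) ^ 2) <= Cmod (G z) * (1 - Cmod (f z) ^ 2)) ->
  f 0 = 0 -> b 0 = 0 -> Cmod (F 0) = Cmod (G 0) -> F 0 <> 0 ->
  exists mu, Cmod mu = 1 /\ forall z, Cmod z < 1 -> f z = (mu * b z)%C.
Proof.
  intros Hf Hb Sf Sb HP HF HG HPn Df Db Hle f0 b0 E0 Fn.
  assert (Gn : G 0 <> 0). { apply Cmod_gt_0. rewrite <- E0. now apply Cmod_gt_0. }
  assert (D0 : Cmod 0 < 1) by (rewrite Cmod_0; lra).
  set (mu := (F 0 / G 0)%C). exists mu.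
  assert (Gp := Cmod_neq0_pos _ Gn).
  assert (Hmu : Cmod mu = 1).
  { unfold mu. rewrite Cmod_div, E0 by auto. field. lra. }
  assert (mun : mu <> 0) by (apply Cmod_gt_0; lra).
  split; auto. apply NNPP. intros HN.
  set (d := fun z => (f z - mu * b z)%C).
  assert (Hd : holoD d) by (apply holoD_minus; auto; apply holoD_mult; auto using holoD_const).
  assert (Hdn : exists z, Cmod z < 1 /\ d z <> 0).
  { apply NNPP. intros Hn. apply HN. intros z Hz. apply NNPP. intros E. apply Hn. exists z. split; auto.
    intros E2. apply E. now apply Cminus_eq0. }
  destruct (order_factor P 0 HP D0 HPn) as [m [P1 [HP1 [P1n HPf]]]].
  set (e := fun z => (F z - mu * G z)%C).
  assert (He : holoD e) by (apply holoD_minus; auto; apply holoD_mult; auto using holoD_const).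
  assert (Dd : forall z, Cmod z < 1 -> C_derive d z = (P z * e z)%C).
  { intros z Hz. apply is_cderiv_C_derive. eapply is_cderiv_eq.
    - apply is_cderiv_minus; [now apply holoD_deriv|].
      apply is_cderiv_mult; [apply is_cderiv_const|now apply holoD_deriv].
    - cbv beta. rewrite Df, Db by auto. unfold e. ring. }
  assert (d0 : d 0 = 0) by (unfold d; rewrite f0, b0; ring).
  assert (e0 : e 0 = 0) by (unfold e, mu; field; auto).
  assert (Hen : exists z, Cmod z < 1 /\ e z <> 0).
  { apply NNPP. intros Hn. destruct Hdn as [z [Hz Hdz]]. apply Hdz.
    destruct (order_factor d 0 Hd D0 (ex_intro _ z (conj Hz Hdz))) as [k [g [Hg [gn Edg]]]].
    destruct (derive_n_order k d g 0 Hg D0 (fun z _ => Edg z)) as [_ Dk].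
    exfalso. assert (Z : C_derive_n k d 0 = 0).
    { destruct k as [|k]; [exact d0|]. rewrite C_derive_n_succ.
      rewrite (C_derive_n_ext k (fun _ => RtoC 0)); auto using holoD_const.
      - clear. induction k; [reflexivity|]. rewrite C_derive_n_succ.
        rewrite (C_derive_n_ext k (fun _ => RtoC 0)); auto using holoD_const; [|rewrite Cmod_0; lra].
        intros z _. symmetry. apply is_cderiv_C_derive, is_cderiv_const.
      - intros w Hw. rewrite Dd by auto. replace (e w) with (RtoC 0); [ring|].
        symmetry. apply NNPP. intros E. apply Hn. eauto. }
    rewrite Z in Dk. symmetry in Dk. revert Dk. apply Cmult_neq_0; auto using RtoC_fact_neq. }
  destruct (order_factor e 0 He D0 Hen) as [l [e1 [He1 [e1n Eel]]]].
  assert (l0 : (1 <= l)%nat).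
  { destruct l; [|lia]. exfalso. apply e1n. rewrite Eel in e0. simpl in e0. now rewrite Cmult_1_l in e0. }
  destruct (integrate_factor d (fun z => P1 z * e1 z)%C 0 (m + l)) as [dh [Hdh [_ Edh]]]; auto.
  { now apply holoD_mult. }
  { intros z Hz. rewrite Dd, HPf, Eel, Cpow_add_r by auto. ring. }
  destruct (holo_bounded dh 0 1 (1/2)) as [M [HM HMb]]; [now apply holoD_on|lra|].
  destruct (divide_rootD f 0 Hf D0) as [f1 [Hf1 [_ Ef1]]].
  destruct (divide_rootD b 0 Hb D0) as [b1 [Hb1 [_ Eb1]]].
  destruct (holo_bounded f1 0 1 (1/2)) as [M1 [HM1 HMb1]]; [now apply holoD_on|lra|].
  destruct (holo_bounded b1 0 1 (1/2)) as [M2 [HM2 HMb2]]; [now apply holoD_on|lra|].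
  destruct (ccont_neq G 0 (holoD_cont G 0 HG D0) Gn) as [r0 [Hr0 HGn]].
  destruct (ccont_gt (fun z => 1 - Cmod (b z)) 0 (1/2)) as [r1 [Hr1 Hb12]].
  { apply ccont_ext_loc with (f := fun z => (RtoC 1 - RtoC (Cmod (b z)))%C) (r := 1); [lra| |].
    - intros; now rewrite RtoC_minus.
    - apply ccont_minus; [apply ccont_const|]. now apply ccont_Cmod, holoD_cont. }
  { rewrite b0, Cmod_0. lra. }
  (* On |z| = r the difference |b|^2 - |f|^2 is at most M r^(l+1) (M1 + M2). The factor 2
     compensates division by 1 - |b|^2, which is at least 1/2, so that |F/(mu G)| <= 1 + K
     r^(l+1). *)
  set (K := 2 * M * (M1 + M2)). assert (HK : 0 < K) by (unfold K; repeat apply Rmult_lt_0_compat; lra).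
  set (q := Cmod (e1 0 / (mu * G 0))).
  assert (Hq : 0 < q). { apply Cmod_gt_0. intros E. apply e1n.
    replace (e1 0) with (e1 0 / (mu * G 0) * (mu * G 0))%C by (field; auto). rewrite E. ring. }
  set (E := fun z => (e1 z / (mu * G z))%C).
  assert (Ec : ccont E 0).
  { apply ccont_div; [now apply holoD_cont| |now apply Cmult_neq_0].
    apply ccont_mult; [apply ccont_const|now apply holoD_cont]. }
  destruct (Ec (q / 4)) as [r2 [Hr2 Hr2c]]; [lra|].
  set (Rr := Rmin (Rmin (Rmin (1/2) r2) r0) (Rmin r1 (q / (4 * K)))).
  assert (Rp : 0 < Rr).
  { unfold Rr. repeat apply Rmin_pos; try lra. apply Rdiv_lt_0_compat; lra. }
  assert (Ra : Rr <= 1/2) by (unfold Rr; eapply Rle_trans; [apply Rmin_l|]; eapply Rle_trans; [apply Rmin_l|apply Rmin_l]).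
  assert (Re2 : Rr <= r2) by (unfold Rr; eapply Rle_trans; [apply Rmin_l|]; eapply Rle_trans; [apply Rmin_l|apply Rmin_r]).
  assert (Rb : Rr <= r0) by (unfold Rr; eapply Rle_trans; [apply Rmin_l|apply Rmin_r]).
  assert (Rc : Rr <= r1) by (unfold Rr; eapply Rle_trans; [apply Rmin_r|apply Rmin_l]).
  assert (Rd : Rr <= q / (4 * K)) by (unfold Rr; eapply Rle_trans; [apply Rmin_r|apply Rmin_r]).
  set (r := Rr / 2).
  assert (Hr : 0 < r < Rr) by (unfold r; lra).
  set (A := K * r ^ (l + 1)).
  assert (Ap : 0 < A) by (apply Rmult_lt_0_compat; auto; apply pow_lt; lra).
  assert (EE : forall z, Cmod z < Rr -> (F z / (mu * G z) = 1 + z ^ l * E z)%C).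
  { intros z Hz. assert (G z <> 0).
    { apply HGn. replace (z - 0)%C with z by ring. lra. }
    assert (EF : F z = (mu * G z + (z - 0) ^ l * e1 z)%C) by (rewrite <- Eel; unfold e; ring).
    rewrite EF. replace (z - 0)%C with z by ring. unfold E. field. auto. }
  assert (Hcirc : forall z, Cmod z = r -> Re (z ^ l * E z) <= A).
  { intros z Hz. assert (Hz1 : Cmod z < 1) by lra. assert (Hzr : Cmod z < Rr) by lra.
    assert (z0 : (z - 0)%C = z) by ring.
    assert (Gz : G z <> 0) by (apply HGn; rewrite z0; lra). assert (Gzp := Cmod_neq0_pos _ Gz).
    assert (L := Hle z Hz1). assert (Bb := Hb12 z ltac:(rewrite z0; lra)).
    assert (Bp := Cmod_ge_0 (b z)). assert (Fp := Cmod_ge_0 (f z)).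
    assert (S1 : 1 / 2 <= 1 - Cmod (b z) ^ 2) by nra.
    assert (S2 : Cmod (mu * b z) = Cmod (b z)) by (rewrite Cmod_mult, Hmu; ring).
    assert (S3 := Cmod_sq_diff (mu * b z) (f z)). rewrite S2 in S3.
    assert (S4 : Cmod (mu * b z - f z) <= M * r ^ (l + 1)).
    { rewrite Cmod_sym. change (f z - mu * b z)%C with (d z). rewrite Edh, z0, Cmod_mult, Cmod_pow, Hz by auto.
      rewrite Rmult_comm. apply Rmult_le_compat; try apply Cmod_ge_0; try (apply pow_le; lra).
      - apply HMb. rewrite z0. lra.
      - replace (S (m + l)) with (m + (l + 1))%nat by lia. rewrite (pow_add r m (l + 1)).
        rewrite <- (Rmult_1_l (r ^ (l + 1))) at 2. apply Rmult_le_compat_r; [apply pow_le; lra|].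
        rewrite <- (pow1 m). apply pow_incr. lra. }
    assert (S5 : Cmod (b z) + Cmod (f z) <= M1 + M2).
    { rewrite Ef1, Eb1, f0, b0, z0, !Cplus_0_l, !Cmod_mult, Hz.
      assert (X1 := HMb1 z ltac:(rewrite z0; lra)). assert (X2 := HMb2 z ltac:(rewrite z0; lra)).
      generalize (Cmod_ge_0 (f1 z)) (Cmod_ge_0 (b1 z)). nra. }
    assert (S6 : Cmod (b z) ^ 2 - Cmod (f z) ^ 2 <= M * r ^ (l + 1) * (M1 + M2)).
    { eapply Rle_trans; [exact S3|]. apply Rmult_le_compat; auto; [apply Cmod_ge_0|lra]. }
    assert (S7 : Cmod (F z / (mu * G z)) <= 1 + A).
    { rewrite Cmod_div, Cmod_mult, Hmu, Rmult_1_l by (apply Cmult_neq_0; auto).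
      apply Rmult_le_reg_r with (Cmod (G z) * (1 - Cmod (b z) ^ 2)); [apply Rmult_lt_0_compat; lra|].
      replace (Cmod (F z) / Cmod (G z) * (Cmod (G z) * (1 - Cmod (b z) ^ 2))) with (Cmod (F z) * (1 - Cmod (b z) ^ 2)) by (field; lra).
      eapply Rle_trans; [exact L|].
      replace ((1 + A) * (Cmod (G z) * (1 - Cmod (b z) ^ 2))) with (Cmod (G z) * ((1 + A) * (1 - Cmod (b z) ^ 2))) by ring.
      apply Rmult_le_compat_l; [lra|]. unfold A, K in *. nra. }
    rewrite EE in S7 by auto.
    assert (S8 := re_le_Cmod (1 + z ^ l * E z)). apply Rabs_le_between in S8.
    rewrite re_plus, re_RtoC in S8. lra. }
  (* In the direction [eta] the leading term z^l [E 0] is the positive number r^l q. The error of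
     [E] and the bound [A] each use at most a quarter of it, so the real part is too large there. *)
  destruct (unit_root (E 0) l l0) as [eta [Heta Eeta]].
  set (z := (RtoC r * eta)%C).
  assert (Hz : Cmod z = r) by (unfold z; rewrite Cmod_mult, Heta, Cmod_R, Rabs_right; lra).
  specialize (Hcirc z Hz).
  assert (Hc := Hr2c z). replace (z - 0)%C with z in Hc by ring. specialize (Hc ltac:(lra)).
  assert (Ez : (z ^ l * E z)%C = (RtoC (r ^ l * q) + z ^ l * (E z - E 0))%C).
  { transitivity (RtoC r ^ l * (eta ^ l * E 0) + z ^ l * (E z - E 0))%C.
    - unfold z at 1 3. rewrite !Cpow_mult_l. ring.
    - rewrite Eeta, <- RtoC_pow, <- RtoC_mult. reflexivity. }
  rewrite Ez, re_plus, re_RtoC in Hcirc.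
  assert (B := re_le_Cmod (z ^ l * (E z - E 0))). apply Rabs_le_between in B.
  rewrite Cmod_mult, Cmod_pow, Hz in B.
  assert (Rl : 0 < r ^ l) by (apply pow_lt; lra).
  assert (r ^ l * Cmod (E z - E 0) <= r ^ l * (q / 4)) by (apply Rmult_le_compat_l; lra).
  assert (EA : A = r ^ l * (K * r)) by (unfold A; rewrite pow_add; ring).
  assert (K * r <= q / 4).
  { apply Rle_trans with (K * (q / (4 * K))); [apply Rmult_le_compat_l; lra|]. apply Req_le. field. lra. }
  assert (r ^ l * (K * r) <= r ^ l * (q / 4)) by (apply Rmult_le_compat_l; lra).
  assert (0 < r ^ l * q) by now apply Rmult_lt_0_compat.
  lra.
Qed.

(** * Normal families *)

(** The constants depend on f only through its bound [M], which gives equicontinuity of a bounded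
    family and control of its derivatives by difference quotients. Both estimates are maximum
    principles for divided differences. *)
Lemma uniform_taylor (f : C -> C) (M r : R) (z v : C) : holoD f -> (forall z, Cmod z < 1 -> Cmod (f z) <= M) ->
  0 < r < 1 - Cmod z -> Cmod (v - z) <= r ->
  Cmod (f v - f z) <= 2 * M / r * Cmod (v - z) /\
  Cmod (f v - f z - C_derive f z * (v - z)) <= 3 * M / r ^ 2 * Cmod (v - z) ^ 2.
Proof.
  intros Hf HM Hr Hv. assert (Zp := Cmod_ge_0 z).
  assert (Hz : Cmod z < 1) by lra.
  assert (Hl : forall g, holoD g -> holo_on z (1 - Cmod z) g) by (intros; apply holoD_local; auto; lra).
  assert (Hin : forall w, Cmod (w - z) = r -> Cmod w < 1) by (intros; apply (disk_nbhd z); lra).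
  destruct (divide_rootD f z Hf Hz) as [g [Hg [g0 Eg]]].
  destruct (divide_rootD g z Hg Hz) as [k [Hk [k0 Ek]]].
  assert (Dz : Cmod (C_derive f z) <= M / r).
  { apply (cauchy_estimate f z (1 - Cmod z)); auto. }
  split.
  - replace (f v - f z)%C with ((v - z) * g v)%C by (rewrite (Eg v); ring).
    rewrite Cmod_mult, Rmult_comm. apply Rmult_le_compat_r; [apply Cmod_ge_0|].
    apply (max_modulus g z (1 - Cmod z) r); auto. intros w Hw.
    assert (A1 := HM w (Hin w Hw)). assert (A2 := HM z Hz).
    assert (A3 := Cmod_minus_le (f w) (f z)).
    replace (f w - f z)%C with ((w - z) * g w)%C in A3 by (rewrite (Eg w); ring).
    rewrite Cmod_mult, Hw in A3. apply Rmult_le_reg_l with r; [lra|].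
    replace (r * (2 * M / r)) with (2 * M) by (field; lra). lra.
  - replace (f v - f z - C_derive f z * (v - z))%C with ((v - z) ^ 2 * k v)%C.
    2:{ rewrite (Eg v), (Ek v), g0. simpl. ring. }
    rewrite Cmod_mult, Cmod_pow, Rmult_comm. apply Rmult_le_compat_r; [apply pow_le, Cmod_ge_0|].
    apply (max_modulus k z (1 - Cmod z) r); auto. intros w Hw.
    assert (A1 := HM w (Hin w Hw)). assert (A2 := HM z Hz).
    assert (A3 : Cmod ((w - z) ^ 2 * k w) <= 3 * M).
    { replace ((w - z) ^ 2 * k w)%C with (f w - f z - C_derive f z * (w - z))%C.
      2:{ rewrite (Eg w), (Ek w), g0. simpl. ring. }
      eapply Rle_trans; [apply Cmod_minus_le|]. generalize (Cmod_minus_le (f w) (f z)).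
      rewrite Cmod_mult, Hw. intros.
      assert (Cmod (C_derive f z) * r <= M / r * r) by (apply Rmult_le_compat_r; lra).
      replace (M / r * r) with M in H0 by (field; lra). lra. }
    rewrite Cmod_mult, Cmod_pow, Hw in A3. apply Rmult_le_reg_l with (r ^ 2); [apply pow_lt; lra|].
    replace (r ^ 2 * (3 * M / r ^ 2)) with (3 * M) by (field; lra). lra.
Qed.

Lemma cvg_seq_Cmod_le (u : nat -> C) (l : C) (M : R) (n0 : nat) : cvg_seq u l ->
  (forall n, (n0 <= n)%nat -> Cmod (u n) <= M) -> Cmod l <= M.
Proof.
  intros Hu HM. apply Rnot_lt_le. intros L. destruct (Hu (Cmod l - M)) as [N HN]; [lra|].
  specialize (HN (max N n0) ltac:(lia)). specialize (HM (max N n0) ltac:(lia)).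
  generalize (Cmod_rtriangle l (u (max N n0))). rewrite (Cmod_sym l). lra.
Qed.

Lemma cvg_seq_plus (u v : nat -> C) (l m : C) : cvg_seq u l -> cvg_seq v m -> cvg_seq (fun n => u n + v n)%C (l + m).
Proof.
  intros Hu Hv e He. destruct (Hu (e/2)) as [N1 H1]; [lra|]. destruct (Hv (e/2)) as [N2 H2]; [lra|].
  exists (max N1 N2). intros n Hn. specialize (H1 n ltac:(lia)). specialize (H2 n ltac:(lia)).
  replace (u n + v n - (l + m))%C with ((u n - l) + (v n - m))%C by ring.
  generalize (Cmod_triangle (u n - l) (v n - m)). lra.
Qed.

Lemma cvg_seq_scal (k : C) (u : nat -> C) (l : C) : cvg_seq u l -> cvg_seq (fun n => k * u n)%C (k * l).
Proof.
  intros Hu e He. assert (P := Cmod_ge_0 k).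
  destruct (Hu (e / (Cmod k + 1))) as [N H]; [apply Rdiv_lt_0_compat; lra|].
  exists N. intros n Hn. specialize (H n Hn).
  replace (k * u n - k * l)%C with (k * (u n - l))%C by ring. rewrite Cmod_mult.
  assert (Q := Cmod_ge_0 (u n - l)).
  assert (Cmod (u n - l) * (Cmod k + 1) < e).
  { replace e with (e / (Cmod k + 1) * (Cmod k + 1)) by (field; lra). apply Rmult_lt_compat_r; lra. }
  lra.
Qed.

Lemma cvg_seq_const (k : C) : cvg_seq (fun _ => k) k.
Proof.
  intros e He. exists O. intros n _. replace (k - k)%C with (RtoC 0) by ring. now rewrite Cmod_0.
Qed.

Lemma cvg_seq_ext (u v : nat -> C) (l : C) : (forall n, u n = v n) -> cvg_seq u l -> cvg_seq v l.
Proof. intros E H e He. destruct (H e He) as [N HN]. exists N. intros n Hn. rewrite <- E. auto. Qed.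

Lemma cvg_seq_minus (u v : nat -> C) (l m : C) : cvg_seq u l -> cvg_seq v m -> cvg_seq (fun n => u n - v n)%C (l - m).
Proof.
  intros Hu Hv. apply (cvg_seq_scal (-1)) in Hv.
  replace (l - m)%C with (l + -1 * m)%C by ring.
  apply cvg_seq_ext with (u := fun n => (u n + -1 * v n)%C); [intros; ring|now apply cvg_seq_plus].
Qed.

Lemma cvg_seq_bounded (u : nat -> C) (l : C) : cvg_seq u l -> exists M, forall n, Cmod (u n) <= M.
Proof.
  intros Hu. destruct (Hu 1) as [N HN]; [lra|].
  assert (HB : exists B, forall n, (n < N)%nat -> Cmod (u n) <= B).
  { clear HN. induction N as [|N [B HB]]; [exists 0; intros; lia|].
    exists (Rmax B (Cmod (u N))). intros n Hn. destruct (Nat.eq_dec n N) as [->|E]; [apply Rmax_r|].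
    eapply Rle_trans; [apply HB; lia|apply Rmax_l]. }
  destruct HB as [B HB]. exists (Rmax B (Cmod l + 1)). intros n. destruct (le_lt_dec N n) as [L|L].
  - specialize (HN n L). eapply Rle_trans; [|apply Rmax_r]. generalize (Cmod_rtriangle (u n) l). lra.
  - eapply Rle_trans; [apply HB; auto|apply Rmax_l].
Qed.

Lemma cvg_seq_mult (u v : nat -> C) (l m : C) : cvg_seq u l -> cvg_seq v m -> cvg_seq (fun n => u n * v n)%C (l * m).
Proof.
  intros Hu Hv. destruct (cvg_seq_bounded v m Hv) as [M HM].
  assert (M0 : 0 <= M) by (eapply Rle_trans; [apply Cmod_ge_0|apply (HM O)]).
  assert (H1 : cvg_seq (fun n => (u n - l) * v n)%C 0).
  { intros e He. destruct (Hu (e / (M + 1))) as [N HN]; [apply Rdiv_lt_0_compat; lra|].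
    exists N. intros n Hn. specialize (HN n Hn). replace ((u n - l) * v n - 0)%C with ((u n - l) * v n)%C by ring.
    rewrite Cmod_mult. specialize (HM n). assert (P := Cmod_ge_0 (u n - l)). assert (Q := Cmod_ge_0 (v n)).
    assert (Cmod (u n - l) * (M + 1) < e).
    { replace e with (e / (M + 1) * (M + 1)) by (field; lra). apply Rmult_lt_compat_r; lra. }
    nra. }
  replace (l * m)%C with (0 + l * m)%C by ring.
  apply cvg_seq_ext with (u := fun n => ((u n - l) * v n + l * v n)%C); [intros; ring|].
  apply cvg_seq_plus; auto. now apply cvg_seq_scal.
Qed.

Lemma cvg_seq_unique (u : nat -> C) (l m : C) : cvg_seq u l -> cvg_seq u m -> l = m.
Proof.
  intros H1 H2. apply Cminus_eq0, Cmod_eps0. intros e He.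
  destruct (H1 (e/2)) as [N1 A]; [lra|]. destruct (H2 (e/2)) as [N2 B]; [lra|].
  specialize (A (max N1 N2) ltac:(lia)). specialize (B (max N1 N2) ltac:(lia)).
  generalize (Cmod_dist_tri l (u (max N1 N2)) m). rewrite (Cmod_sym l (u (max N1 N2))). lra.
Qed.

Lemma cvg_seq_RtoC_Cmod (u : nat -> C) (l : C) : cvg_seq u l -> cvg_seq (fun n => RtoC (Cmod (u n))) (RtoC (Cmod l)).
Proof.
  intros H e He. destruct (H e He) as [N HN]. exists N. intros n Hn.
  rewrite Cmod_RtoC_minus. eapply Rle_lt_trans; [apply Cmod_rtriangle_abs|auto].
Qed.

Lemma cvg_real_le (u v : nat -> R) (l m : R) (n0 : nat) : cvg_seq (fun n => RtoC (u n)) (RtoC l) -> cvg_seq (fun n => RtoC (v n)) (RtoC m) ->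
  (forall n, (n0 <= n)%nat -> u n <= v n) -> l <= m.
Proof.
  intros Hu Hv H. apply Rnot_lt_le. intros L.
  destruct (Hu ((l - m) / 2)) as [N1 A]; [lra|]. destruct (Hv ((l - m) / 2)) as [N2 B]; [lra|].
  set (N := max n0 (max N1 N2)). specialize (A N ltac:(unfold N; lia)). specialize (B N ltac:(unfold N; lia)).
  rewrite Cmod_RtoC_minus in A, B. apply Rabs_def2 in A. apply Rabs_def2 in B.
  specialize (H N ltac:(unfold N; lia)). lra.
Qed.

Lemma cauchy_cvg (u : nat -> C) : (forall e, 0 < e -> exists N, forall n m, (N <= n)%nat -> (N <= m)%nat -> Cmod (u n - u m) < e) ->
  exists l, cvg_seq u l.
Proof.
  intros H. destruct (H 1) as [N HN]; [lra|].
  destruct (complex_bw (fun n => u (n + N)%nat) (Cmod (u N) + 1)) as [phi [l [Hphi Hl]]].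
  { intros n. specialize (HN (n + N)%nat N ltac:(lia) ltac:(lia)).
    generalize (Cmod_rtriangle (u (n + N)%nat) (u N)). lra. }
  exists l. intros e He. destruct (H (e/2)) as [N1 HN1]; [lra|]. destruct (Hl (e/2)) as [N2 HN2]; [lra|].
  exists N1. intros n Hn. set (k := max N1 N2).
  specialize (HN2 k ltac:(unfold k; lia)).
  specialize (HN1 n (phi k + N)%nat Hn). generalize (extraction_ge phi Hphi k). intros.
  specialize (HN1 ltac:(unfold k in *; lia)).
  generalize (Cmod_dist_tri (u n) (u (phi k + N)%nat) l). lra.
Qed.

(** Two applications of the Cantor pairing enumerate the triples (i, j, n). Numerators are natural
    numbers, and the shift by -1 reaches the negative coordinates; some of the points lie outside
    the disk. *)
Definition grid (k : nat) : C :=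
  let (i, b) := of_nat k in let (j, n) := of_nat b in (INR i / (INR n + 1) - 1, INR j / (INR n + 1) - 1).

Lemma grid_dense (z : C) (e : R) : Cmod z < 1 -> 0 < e -> exists k, Cmod (grid k - z) < e.
Proof.
  intros Hz He. destruct z as [x y].
  assert (B := Rmax_Cmod (x, y)). simpl fst in B; simpl snd in B.
  assert (Bx := Rmax_l (Rabs x) (Rabs y)). assert (By := Rmax_r (Rabs x) (Rabs y)).
  assert (Hx : Rabs x < 1) by lra. assert (Hy : Rabs y < 1) by lra.
  apply Rabs_def2 in Hx. apply Rabs_def2 in Hy.
  destruct (archimed_cor1 (e / 2)) as [n [Hn Hn0]]; [lra|].
  assert (Pn : 0 < INR n) by now apply lt_0_INR.
  assert (Q : 0 < INR n + 1) by lra.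
  destruct (nfloor_ex ((x + 1) * (INR n + 1))) as [i Hi]; [apply Rmult_le_pos; lra|].
  destruct (nfloor_ex ((y + 1) * (INR n + 1))) as [j Hj]; [apply Rmult_le_pos; lra|].
  exists (to_nat (i, to_nat (j, n))). unfold grid. rewrite !cancel_of_to.
  assert (F : forall (t : R) (k : nat), INR k <= (t + 1) * (INR n + 1) < INR k + 1 -> Rabs (INR k / (INR n + 1) - 1 - t) < e / 2).
  { intros t k Hk. assert (E : / (INR n + 1) < e / 2).
    { eapply Rlt_trans; [|exact Hn]. apply Rinv_lt_contravar; nra. }
    assert (Ip : 0 < / (INR n + 1)) by now apply Rinv_0_lt_compat.
    apply Rabs_lt_between.
    replace (INR k / (INR n + 1) - 1 - t) with ((INR k - (t + 1) * (INR n + 1)) * / (INR n + 1)) by (field; lra).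
    split; nra. }
  eapply Rle_lt_trans; [apply Cmod_2Rmax|]. simpl.
  assert (G : Rmax (Rabs (INR i / (INR n + 1) - 1 + - x)) (Rabs (INR j / (INR n + 1) - 1 + - y)) < e / 2).
  { apply Rmax_lub_lt; apply F; auto. }
  assert (0 <= Rmax (Rabs (INR i / (INR n + 1) - 1 + - x)) (Rabs (INR j / (INR n + 1) - 1 + - y))).
  { eapply Rle_trans; [apply Rabs_pos|apply Rmax_l]. }
  assert (sqrt 2 < 2). { rewrite <- (sqrt_square 2) at 2 by lra. apply sqrt_lt_1; lra. }
  assert (0 <= sqrt 2) by apply sqrt_pos. nra.
Qed.

(** A diagonal subsequence converges on the grid, and the uniform Lipschitz bound extends
    convergence to the disk. The uniform quadratic Taylor bound makes the derivatives converge and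
    passes to the limit, where it identifies the derivative of [g]. *)
Theorem montel (f : nat -> C -> C) (M : R) : (forall n, holoD (f n)) -> (forall n z, Cmod z < 1 -> Cmod (f n z) <= M) ->
  exists phi g, extraction phi /\ holoD g /\ forall z, Cmod z < 1 ->
    cvg_seq (fun n => f (phi n) z) (g z) /\ cvg_seq (fun n => C_derive (f (phi n)) z) (C_derive g z).
Proof.
  intros Hf HM.
  assert (M0 : 0 <= M). { eapply Rle_trans; [apply Cmod_ge_0|apply (HM O 0)]. rewrite Cmod_0; lra. }
  destruct (diagonal_extraction (fun n k => if Rlt_dec (Cmod (grid k)) 1 then f n (grid k) else 0) (fun _ => M)) as [phi [Hphi Hcv]].
  { intros n k. destruct (Rlt_dec (Cmod (grid k)) 1); [now apply HM|now rewrite Cmod_0]. }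
  assert (C1 : forall z, Cmod z < 1 -> exists l, cvg_seq (fun n => f (phi n) z) l).
  { intros z Hz. apply cauchy_cvg. intros e He. set (r := (1 - Cmod z) / 2). assert (Hr : 0 < r < 1 - Cmod z) by (unfold r; lra).
    set (L := 2 * M / r). assert (L0 : 0 <= L) by (unfold L, Rdiv; apply Rmult_le_pos; [lra|left; apply Rinv_0_lt_compat; lra]).
    destruct (grid_dense z (Rmin r (e / (3 * (L + 1)))) Hz) as [k Hk].
    { apply Rmin_pos; [lra|]. apply Rdiv_lt_0_compat; lra. }
    assert (K1 : Cmod (grid k - z) < r) by (eapply Rlt_le_trans; [exact Hk|apply Rmin_l]).
    assert (K2 : Cmod (grid k - z) < e / (3 * (L + 1))) by (eapply Rlt_le_trans; [exact Hk|apply Rmin_r]).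
    assert (Kd : Cmod (grid k) < 1) by (apply (disk_nbhd z); lra).
    destruct (Hcv k) as [l Hl]. destruct (Rlt_dec (Cmod (grid k)) 1) as [_|]; [|contradiction].
    destruct (Hl (e/6)) as [N HN]; [lra|]. exists N. intros n m Hn Hm.
    assert (Lip : forall p, Cmod (f p (grid k) - f p z) <= e / 3).
    { intros p. destruct (uniform_taylor (f p) M r z (grid k)) as [T _]; auto; [lra|]. fold L in T.
      assert (Q := Cmod_ge_0 (grid k - z)).
      assert (Cmod (grid k - z) * (3 * (L + 1)) < e).
      { replace e with (e / (3 * (L + 1)) * (3 * (L + 1))) by (field; lra). apply Rmult_lt_compat_r; lra. }
      nra. }
    assert (A1 := HN n Hn). assert (A2 := HN m Hm). assert (A3 := Lip (phi n)). assert (A4 := Lip (phi m)).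
    generalize (Cmod_dist_tri (f (phi n) z) (f (phi n) (grid k)) (f (phi m) z))
      (Cmod_dist_tri (f (phi n) (grid k)) l (f (phi m) z)) (Cmod_dist_tri l (f (phi m) (grid k)) (f (phi m) z)).
    rewrite (Cmod_sym (f (phi n) z) (f (phi n) (grid k))), (Cmod_sym l (f (phi m) (grid k))). lra. }
  assert (C2 : forall z, exists l, Cmod z < 1 -> cvg_seq (fun n => f (phi n) z) l).
  { intros z. destruct (Rlt_dec (Cmod z) 1) as [H|H]; [destruct (C1 z H) as [l Hl]; now exists l|exists 0; contradiction]. }
  set (g := fun z => proj1_sig (constructive_indefinite_description _ (C2 z))).
  assert (Hg : forall z, Cmod z < 1 -> cvg_seq (fun n => f (phi n) z) (g z)).
  { intros z. exact (proj2_sig (constructive_indefinite_description _ (C2 z))). }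
  assert (Key : forall z, Cmod z < 1 -> exists l, cvg_seq (fun n => C_derive (f (phi n)) z) l /\ is_cderiv g z l).
  { intros z Hz. set (r := (1 - Cmod z) / 2). assert (Hr : 0 < r < 1 - Cmod z) by (unfold r; lra).
    set (A := 3 * M / r ^ 2). assert (A0 : 0 <= A) by (unfold A, Rdiv; apply Rmult_le_pos; [lra|left; apply Rinv_0_lt_compat, pow_lt; lra]).
    assert (T : forall p v, Cmod (v - z) <= r -> Cmod (f p v - f p z - C_derive (f p) z * (v - z)) <= A * Cmod (v - z) ^ 2).
    { intros p v Hv. apply uniform_taylor; auto. }
    assert (Hl : exists l, cvg_seq (fun n => C_derive (f (phi n)) z) l).
    { apply cauchy_cvg. intros e He.
      (* After multiplication by h, two Taylor remainders cost 2 A h^2 < e h/2, and the four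
         differences of values at v and z cost e h/8 each. *)
      set (h := Rmin r (e / (4 * (A + 1)))). assert (Hh : 0 < h) by (apply Rmin_pos; [lra|apply Rdiv_lt_0_compat; lra]).
      assert (Hh1 : h <= r) by apply Rmin_l.
      assert (Hh2 : h * (4 * (A + 1)) <= e).
      { replace e with (e / (4 * (A + 1)) * (4 * (A + 1))) by (field; lra). apply Rmult_le_compat_r; [lra|apply Rmin_r]. }
      set (v := (z + RtoC h)%C). assert (Ev : (v - z)%C = RtoC h) by (unfold v; ring).
      assert (Mv : Cmod (v - z) = h) by (rewrite Ev, Cmod_R, Rabs_right; lra).
      assert (Dv : Cmod v < 1) by (apply (disk_nbhd z); lra).
      assert (Ehp : 0 < e * h / 8) by (apply Rdiv_lt_0_compat; [now apply Rmult_lt_0_compat|lra]).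
      destruct (Hg v Dv _ Ehp) as [N1 HN1]. destruct (Hg z Hz _ Ehp) as [N2 HN2].
      exists (max N1 N2). intros n m Hn Hm.
      assert (B1 := HN1 n ltac:(lia)). assert (B2 := HN1 m ltac:(lia)).
      assert (B3 := HN2 n ltac:(lia)). assert (B4 := HN2 m ltac:(lia)).
      assert (T1 := T (phi n) v ltac:(lra)). assert (T2 := T (phi m) v ltac:(lra)). rewrite Mv in T1, T2.
      apply Rmult_lt_reg_r with h; auto. rewrite <- Mv at 1. rewrite <- Cmod_mult.
      replace ((C_derive (f (phi n)) z - C_derive (f (phi m)) z) * (v - z))%C
        with (((f (phi n) v - g v) - (f (phi m) v - g v)) - ((f (phi n) z - g z) - (f (phi m) z - g z))
          - ((f (phi n) v - f (phi n) z - C_derive (f (phi n)) z * (v - z)) - (f (phi m) v - f (phi m) z - C_derive (f (phi m)) z * (v - z))))%C by ring.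
      eapply Rle_lt_trans; [apply Cmod_minus_le|].
      eapply Rle_lt_trans; [apply Rplus_le_compat; [eapply Rle_trans; [apply Cmod_minus_le|apply Rplus_le_compat; apply Cmod_minus_le]|apply Cmod_minus_le]|].
      nra. }
    destruct Hl as [l Hl]. exists l. split; auto.
    assert (G : forall v, Cmod (v - z) <= r -> Cmod (g v - g z - l * (v - z)) <= A * Cmod (v - z) ^ 2).
    { intros v Hv. assert (Dv : Cmod v < 1) by (apply (disk_nbhd z); lra).
      apply (cvg_seq_Cmod_le (fun n => (f (phi n) v - f (phi n) z - (v - z) * C_derive (f (phi n)) z)%C) _ _ O).
      - rewrite (Cmult_comm l). apply cvg_seq_minus; [apply cvg_seq_minus; auto|]. now apply cvg_seq_scal.
      - intros n _. rewrite (Cmult_comm (v - z)). now apply T. }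
    intros e He. exists (Rmin r (e / (A + 1))). split; [apply Rmin_pos; [lra|apply Rdiv_lt_0_compat; lra]|].
    intros v Hv. generalize (Rmin_l r (e / (A + 1))) (Rmin_r r (e / (A + 1))). intros.
    eapply Rle_trans; [apply G; lra|]. assert (P := Cmod_ge_0 (v - z)).
    assert (Cmod (v - z) * (A + 1) <= e).
    { replace e with (e / (A + 1) * (A + 1)) by (field; lra). apply Rmult_le_compat_r; lra. }
    nra. }
  exists phi, g. split; [auto|split].
  - intros z Hz. destruct (Key z Hz) as [l [_ Hl]]. eauto.
  - intros z Hz. split; auto. destruct (Key z Hz) as [l [Hl Hd]]. now rewrite (is_cderiv_C_derive _ _ _ Hd).
Qed.

(** Vanishing to order m, stated as an inequality, passes to pointwise limits when the constant is
    uniform; this recovers the factorization from the inequality. *)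
Lemma order_from_bound (g : C -> C) (z0 : C) (m : nat) (A r : R) : holoD g -> Cmod z0 < 1 -> 0 < r ->
  (forall w, Cmod (w - z0) < r -> Cmod (g w) <= A * Cmod (w - z0) ^ m) ->
  exists h, holoD h /\ forall z, Cmod z < 1 -> g z = ((z - z0) ^ m * h z)%C.
Proof.
  intros Hg Hz0 Hr HA.
  destruct (classic (exists z, Cmod z < 1 /\ g z <> 0)) as [Hne|Hz].
  2:{ exists (fun _ => 0). split; [apply holoD_const|]. intros z Hz'.
    replace (g z) with (RtoC 0); [ring|]. symmetry. apply NNPP. intros N. apply Hz. eauto. }
  destruct (order_factor g z0 Hg Hz0 Hne) as [k [e [He [en Ee]]]].
  destruct (le_lt_dec m k) as [L|L].
  - exists (fun z => ((z - z0) ^ (k - m) * e z)%C). split.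
    + apply holoD_mult; auto. apply holoD_pow. apply holoD_minus; [apply holoD_id|apply holoD_const].
    + intros z _. rewrite Ee. replace k with (m + (k - m))%nat at 1 by lia. rewrite Cpow_add_r. ring.
  - exfalso. assert (Ep := Cmod_neq0_pos _ en).
    assert (A0 : 0 <= Rabs A) by apply Rabs_pos.
    destruct (ccont_gt (fun w => Cmod (e w)) z0 (Cmod (e z0) / 2)) as [d [Hd Hed]]; [now apply ccont_Cmod, holoD_cont|lra|].
    set (h := Rmin (Rmin d r) (Rmin 1 (Cmod (e z0) / (2 * (Rabs A + 1)))) / 2).
    assert (P : 0 < Rmin (Rmin d r) (Rmin 1 (Cmod (e z0) / (2 * (Rabs A + 1))))).
    { repeat apply Rmin_pos; try lra. apply Rdiv_lt_0_compat; lra. }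
    assert (h1 : h < d) by (generalize (Rle_trans _ _ _ (Rmin_l (Rmin d r) (Rmin 1 (Cmod (e z0) / (2 * (Rabs A + 1))))) (Rmin_l _ _)); unfold h; lra).
    assert (h2 : h < r) by (generalize (Rle_trans _ _ _ (Rmin_l (Rmin d r) (Rmin 1 (Cmod (e z0) / (2 * (Rabs A + 1))))) (Rmin_r _ _)); unfold h; lra).
    assert (h3 : h < 1) by (generalize (Rle_trans _ _ _ (Rmin_r (Rmin d r) (Rmin 1 (Cmod (e z0) / (2 * (Rabs A + 1))))) (Rmin_l _ _)); unfold h; lra).
    assert (h4 : h < Cmod (e z0) / (2 * (Rabs A + 1))) by (generalize (Rle_trans _ _ _ (Rmin_r (Rmin d r) (Rmin 1 (Cmod (e z0) / (2 * (Rabs A + 1))))) (Rmin_r _ _)); unfold h; lra).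
    assert (h0 : 0 < h) by (unfold h; lra). clearbody h.
    set (w := (z0 + RtoC h)%C). assert (Ew : (w - z0)%C = RtoC h) by (unfold w; ring).
    assert (Mw : Cmod (w - z0) = h) by (rewrite Ew, Cmod_R, Rabs_right; lra).
    specialize (HA w ltac:(lra)). specialize (Hed w ltac:(lra)).
    rewrite Ee, Cmod_mult, Cmod_pow, Mw in HA.
    replace m with (k + (m - k))%nat in HA by lia. rewrite pow_add in HA.
    assert (hk : 0 < h ^ k) by now apply pow_lt.
    assert (h5 : h ^ (m - k) <= h).
    { replace (m - k)%nat with (S (m - k - 1)) by lia. simpl. apply Rle_trans with (h * 1); [|lra].
      apply Rmult_le_compat_l; [lra|]. rewrite <- (pow1 (m - k - 1)). apply pow_incr. lra. }
    assert (h6 : 0 < h ^ (m - k)) by now apply pow_lt.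
    assert (X : Cmod (e w) <= Rabs A * h).
    { apply Rmult_le_reg_l with (h ^ k); auto. eapply Rle_trans; [exact HA|].
      assert (A * h ^ (m - k) <= Rabs A * h).
      { apply Rle_trans with (Rabs A * h ^ (m - k)); [apply Rmult_le_compat_r; [lra|apply Rle_abs]|apply Rmult_le_compat_l; auto]. }
      nra. }
    assert (h * (2 * (Rabs A + 1)) < Cmod (e z0)).
    { replace (Cmod (e z0)) with (Cmod (e z0) / (2 * (Rabs A + 1)) * (2 * (Rabs A + 1))) by (field; lra).
      apply Rmult_lt_compat_r; lra. }
    nra.
Qed.

(** * Logarithms and a Harnack inequality *)

Definition Cexp (z : C) : C := (RtoC (exp (fst z)) * cis (snd z))%C.

Lemma Cmod_Cexp (z : C) : Cmod (Cexp z) = exp (Re z).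
Proof.
  unfold Cexp. rewrite Cmod_mult, Cmod_cis, Cmod_R, Rabs_right by (left; apply exp_pos). apply Rmult_1_r.
Qed.

Lemma Cexp_plus (z w : C) : Cexp (z + w) = (Cexp z * Cexp w)%C.
Proof. unfold Cexp. simpl. rewrite exp_plus, cis_plus, RtoC_mult. ring. Qed.

Lemma Cexp_0 : Cexp 0 = 1.
Proof. unfold Cexp; simpl. rewrite exp_0. unfold cis. rewrite cos_0, sin_0. change ((1, 0) : C) with (RtoC 1). ring. Qed.

Lemma cis_expansion (y : R) : Cmod (cis y - 1 - Ci * RtoC y) <= y ^ 2.
Proof.
  assert (H : forall a b, a <= b -> (forall t, a <= t <= b -> Rabs t <= b - a) ->
     Cmod (cis b - cis a - RtoC (b - a) * Ci) <= (b - a) ^ 2).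
  { intros a b Hab Ht.
    assert (I := is_CInt_minus _ _ _ _ _ _ (is_CInt_cis a b) (is_CInt_const Ci a b)).
    apply (is_CInt_bound _ a b (b - a)) in I; auto; [lra|].
    intros t Htt. replace (Ci * cis t - Ci)%C with (Ci * (cis t - cis 0))%C.
    - rewrite Cmod_mult, Cmod_Ci, Rmult_1_l. eapply Rle_trans; [apply cis_lipschitz|].
      rewrite Rminus_0_r. auto.
    - unfold cis at 2. rewrite cos_0, sin_0. change ((1, 0) : C) with (RtoC 1). ring. }
  assert (c0 : cis 0 = 1) by (unfold cis; rewrite cos_0, sin_0; reflexivity).
  destruct (Rle_lt_dec 0 y) as [L|L].
  - specialize (H 0 y L). rewrite c0, Rminus_0_r in H. rewrite (Cmult_comm Ci). apply H.
    intros t Ht. rewrite Rabs_right; lra.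
  - specialize (H y 0 (Rlt_le _ _ L)). rewrite c0 in H.
    replace ((0 - y) ^ 2) with (y ^ 2) in H by ring.
    rewrite <- Cmod_opp. replace (- (cis y - 1 - Ci * y))%C with (1 - cis y - RtoC (0 - y) * Ci)%C.
    + apply H. intros t Ht. rewrite Rabs_left1; lra.
    + rewrite RtoC_minus. ring.
Qed.

Lemma exp_expansion (x : R) : Rabs x <= 1 / 2 -> 0 <= exp x - 1 - x <= 2 * x ^ 2.
Proof.
  intros Hx. apply Rabs_le_between in Hx. split; [generalize (exp_ineq1_le x); lra|].
  assert (H := exp_ineq1_le (- x)). rewrite exp_Ropp in H. assert (P := exp_pos x).
  assert (exp x * (1 - x) <= 1).
  { replace 1 with (exp x * / exp x) at 2 by (field; lra). apply Rmult_le_compat_l; lra. }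
  nra.
Qed.

Lemma is_cderiv_Cexp (z : C) : is_cderiv Cexp z (Cexp z).
Proof.
  assert (K : forall h : C, Cmod h <= 1 / 2 -> Cmod (Cexp h - 1 - h) <= 10 * Cmod h ^ 2).
  { intros [x y] Hh. assert (B := Rmax_Cmod (x, y)). simpl fst in B; simpl snd in B.
    assert (Bx := Rmax_l (Rabs x) (Rabs y)). assert (By := Rmax_r (Rabs x) (Rabs y)).
    set (m := Cmod (x, y)) in *.
    assert (Hx : Rabs x <= m) by lra. assert (Hy : Rabs y <= m) by lra.
    assert (E := exp_expansion x ltac:(lra)). assert (S := cis_expansion y).
    assert (x2 : x ^ 2 <= m ^ 2). { rewrite <- (pow2_abs x). apply pow_incr. split; [apply Rabs_pos|auto]. }
    assert (y2 : y ^ 2 <= m ^ 2). { rewrite <- (pow2_abs y). apply pow_incr. split; [apply Rabs_pos|auto]. }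
    assert (Ehh : (Cexp (x, y) - 1 - (x, y))%C =
      (RtoC (exp x) * (cis y - 1 - Ci * RtoC y) + RtoC (exp x - 1) * (Ci * RtoC y) + RtoC (exp x - 1 - x))%C).
    { unfold Cexp. simpl fst; simpl snd. replace ((x, y) : C) with (RtoC x + Ci * RtoC y)%C.
      - rewrite !RtoC_minus. ring.
      - unfold Ci, RtoC, Cmult, Cplus; simpl. f_equal; ring. }
    rewrite Ehh. eapply Rle_trans; [apply Cmod_triangle|].
    eapply Rle_trans; [apply Rplus_le_compat_r, Cmod_triangle|].
    rewrite !Cmod_mult, Cmod_Ci, !Cmod_R.
    assert (ex : 0 < exp x <= 2).
    { split; [apply exp_pos|]. apply Rabs_le_between in Hx. nra. }
    assert (em : Rabs (exp x - 1) <= 2 * m).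
    { apply Rabs_le. apply Rabs_le_between in Hx. nra. }
    rewrite (Rabs_right (exp x)) by lra. rewrite (Rabs_right (exp x - 1 - x)) by lra.
    assert (exp x * Cmod (cis y - 1 - Ci * y) <= 2 * m ^ 2).
    { apply Rmult_le_compat; try lra. apply Cmod_ge_0. }
    assert (Rabs (exp x - 1) * (1 * Rabs y) <= 2 * m * (1 * m)).
    { apply Rmult_le_compat; try apply Rabs_pos; try lra. generalize (Rabs_pos y); lra. }
    assert (0 <= m ^ 2) by (apply pow2_ge_0). lra. }
  assert (P : 0 < Cmod (Cexp z)) by (rewrite Cmod_Cexp; apply exp_pos).
  intros e He. exists (Rmin (1/2) (e / (10 * Cmod (Cexp z)))). split.
  { apply Rmin_pos; [lra|]. apply Rdiv_lt_0_compat; lra. }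
  intros w Hw. generalize (Rmin_l (1/2) (e / (10 * Cmod (Cexp z)))) (Rmin_r (1/2) (e / (10 * Cmod (Cexp z)))). intros.
  replace w with (z + (w - z))%C at 1 by ring. rewrite Cexp_plus.
  replace (Cexp z * Cexp (w - z) - Cexp z - Cexp z * (w - z))%C with (Cexp z * (Cexp (w - z) - 1 - (w - z)))%C by ring.
  rewrite Cmod_mult. specialize (K (w - z)%C ltac:(lra)). assert (Q := Cmod_ge_0 (w - z)).
  assert (Cmod (w - z) * (10 * Cmod (Cexp z)) <= e).
  { replace e with (e / (10 * Cmod (Cexp z)) * (10 * Cmod (Cexp z))) by (field; lra).
    apply Rmult_le_compat_r; lra. }
  apply Rle_trans with (Cmod (Cexp z) * (10 * Cmod (w - z) ^ 2)); [apply Rmult_le_compat_l; lra|]. nra.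
Qed.

Lemma is_CInt_curve (f : C -> C) (df : C -> C) (a u : C) :
  (forall t, 0 <= t <= 1 -> is_cderiv f (a + RtoC t * u)%C (df (a + RtoC t * u)%C)) ->
  (forall t, 0 <= t <= 1 -> ccont df (a + RtoC t * u)%C) ->
  is_CInt (fun t => u * df (a + RtoC t * u))%C 0 1 (f (a + u)%C - f a)%C.
Proof.
  intros Hd Hc.
  assert (L : forall t, rcont (fun s => a + RtoC s * u)%C t).
  { intros t. apply rcont_plus; [apply rcont_const|]. apply rcont_mult; [|apply rcont_const].
    apply rcont_pair; [apply derivable_continuous_pt, derivable_pt_id|apply continuity_const; now intros ? ?]. }
  replace (f (a + u)%C - f a)%C with (f (a + RtoC 1 * u)%C - f (a + RtoC 0 * u)%C)%C.
  2:{ f_equal; [f_equal; ring|]. do 2 f_equal; ring. }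
  apply (is_RInt_derive (V := C_R_CompleteNormedModule) (fun t => f (a + RtoC t * u)%C)).
  - rewrite Rmin_left, Rmax_right by lra. intros t Ht.
    split; [apply is_linear_scal_l|].
    intros x Hx. apply (is_filter_lim_locally_unique (V := R_NormedModule)) in Hx. simpl in Hx. subst x.
    intros e. destruct (Hd t Ht (e / (Cmod u + 1))) as [d [Hdp H]].
    { apply Rdiv_lt_0_compat; [apply cond_pos|]. generalize (Cmod_ge_0 u); lra. }
    assert (U := Cmod_ge_0 u).
    assert (Hd' : 0 < d / (Cmod u + 1)) by (apply Rdiv_lt_0_compat; lra).
    exists (mkposreal _ Hd'). intros s Hs. change (Rabs (s - t) < d / (Cmod u + 1)) in Hs.
    rewrite C_R_norm.
    assert (E : (a + RtoC s * u - (a + RtoC t * u))%C = (RtoC (s - t) * u)%C) by (rewrite RtoC_minus; ring).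
    specialize (H (a + RtoC s * u)%C). rewrite E, Cmod_mult, Cmod_R in H.
    assert (Hs2 : Rabs (s - t) * (Cmod u + 1) < d).
    { replace d with (d / (Cmod u + 1) * (Cmod u + 1)) by (field; lra). apply Rmult_lt_compat_r; lra. }
    assert (Q := Rabs_pos (s - t)). specialize (H ltac:(nra)).
    match goal with |- Cmod ?X <= _ => replace X with (f (a + RtoC s * u)%C - f (a + RtoC t * u)%C - df (a + RtoC t * u)%C * (RtoC (s - t) * u))%C end.
    + eapply Rle_trans; [exact H|].
      set (k := e / (Cmod u + 1)) in *.
      assert (k0 : 0 < k) by (apply Rdiv_lt_0_compat; [apply cond_pos|lra]).
      assert (Ek : k * (Cmod u + 1) = pos e) by (unfold k; field; lra).
      rewrite <- Ek. change (k * (Rabs (s - t) * Cmod u) <= k * (Cmod u + 1) * Rabs (s - t)). nra.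
    + change (f (a + s * u) - f (a + t * u) - df (a + t * u) * (RtoC (s - t) * u) =
        (f (a + s * u) - f (a + t * u)) - @scal R_AbsRing C_R_NormedModule (s - t)%R (u * df (a + t * u)))%C.
      rewrite scal_R_Cmult. ring.
  - rewrite Rmin_left, Rmax_right by lra. intros t Ht.
    apply (rcont_mult (fun _ => u)); [apply rcont_const|].
    apply (rcont_comp df (fun s => a + RtoC s * u)%C); auto.
Qed.

Lemma segment_in (a z : C) (t : R) : 0 <= t <= 1 -> Cmod (a + RtoC t * (z - a) - a) <= Cmod (z - a).
Proof.
  intros Ht. replace (a + RtoC t * (z - a) - a)%C with (RtoC t * (z - a))%C by ring.
  rewrite Cmod_mult, Cmod_R, Rabs_right by lra. generalize (Cmod_ge_0 (z - a)). nra.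
Qed.

Lemma deriv_zero_const (f : C -> C) (a : C) (R1 : R) : (forall z, Cmod (z - a) < R1 -> is_cderiv f z 0) ->
  forall z, Cmod (z - a) < R1 -> f z = f a.
Proof.
  intros H z Hz.
  assert (I : is_CInt (fun t => (z - a) * (fun _ => RtoC 0) (a + RtoC t * (z - a)))%C 0 1 (f (a + (z - a))%C - f a)%C).
  { apply (is_CInt_curve f (fun _ => RtoC 0) a (z - a)).
    - intros t Ht. apply H. eapply Rle_lt_trans; [now apply segment_in|auto].
    - intros t _. apply ccont_const. }
  assert (I2 : is_CInt (fun t => (z - a) * (fun _ => RtoC 0) (a + RtoC t * (z - a)))%C 0 1 0).
  { eapply is_CInt_eq; [apply is_CInt_const|ring]. }
  assert (E := eq_trans (eq_sym (CInt_unique _ _ _ _ I)) (CInt_unique _ _ _ _ I2)).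
  replace (a + (z - a))%C with z in E by ring. now apply Cminus_eq0.
Qed.

(** [F] integrates f along the ray from the centre. Differentiating the integrand in the end point
    gives f(p) + (p - a) f'(p) at p = a + t(z - a), and its integral over t is f(z); [taylor2]
    controls the error uniformly in t. *)
Lemma primitive (f : C -> C) (a : C) (R1 : R) : holo_on a R1 f ->
  exists F : C -> C, F a = 0 /\ forall z, Cmod (z - a) < R1 -> is_cderiv F z (f z).
Proof.
  intros Hf.
  set (F := fun z => CInt (fun t => (z - a) * f (a + RtoC t * (z - a)))%C 0 1).
  assert (L : forall u t, rcont (fun s => a + RtoC s * u)%C t).
  { intros u t. apply rcont_plus; [apply rcont_const|]. apply rcont_mult; [|apply rcont_const].
    apply rcont_pair; [apply derivable_continuous_pt, derivable_pt_id|apply continuity_const; now intros ? ?]. }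
  assert (FI : forall z, Cmod (z - a) < R1 -> is_CInt (fun t => (z - a) * f (a + RtoC t * (z - a)))%C 0 1 (F z)).
  { intros z Hz. apply CInt_correct. rewrite Rmin_left, Rmax_right by lra. intros t Ht.
    apply (rcont_mult (fun _ => (z - a)%C)); [apply rcont_const|].
    apply (rcont_comp f (fun s => a + RtoC s * (z - a))%C); auto.
    eapply holo_cont; eauto. eapply Rle_lt_trans; [now apply segment_in|auto]. }
  exists F. split.
  { apply CInt_unique. eapply is_CInt_ext with (f := fun _ => RtoC 0).
    - intros t _. ring.
    - eapply is_CInt_eq; [apply is_CInt_const|ring]. }
  intros z Hz. assert (Zp := Cmod_ge_0 (z - a)).
  set (r := (Cmod (z - a) + R1) / 2). assert (Hr : Cmod (z - a) < r < R1) by (unfold r; lra).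
  destruct (taylor2 f a R1 Hf r) as [A [HA T]]; [lra|].
  destruct (holo_bounded (C_derive f) a R1 r) as [B [HB HBb]]; [now apply holo_derive|lra|].
  set (g := fun w => ((w - a) * f w)%C).
  assert (Hg : forall w, Cmod (w - a) < R1 -> is_cderiv g w (f w + (w - a) * C_derive f w)%C).
  { intros w Hw. eapply is_cderiv_eq; [apply is_cderiv_mult; [apply is_cderiv_minus; [apply is_cderiv_id|apply is_cderiv_const]|eapply holo_C_derive; eauto]|].
    cbv beta. ring. }
  assert (Hgd : holo_on a R1 (fun w => f w + (w - a) * C_derive f w)%C).
  { intros w Hw. destruct (holo_derive f a R1 Hf w Hw) as [l Hl]. eexists.
    apply is_cderiv_plus; [eapply holo_C_derive; eauto|].
    apply is_cderiv_mult; [apply is_cderiv_minus; [apply is_cderiv_id|apply is_cderiv_const]|exact Hl]. }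
  (* t f(a+tu) is a primitive of f(a+tu) + t u f'(a+tu). *)
  assert (I0 : is_CInt (fun t => (z - a) * (f (a + RtoC t * (z - a)) + (a + RtoC t * (z - a) - a) * C_derive f (a + RtoC t * (z - a))))%C 0 1 (g (a + (z - a))%C - g a)%C).
  { apply (is_CInt_curve g (fun w => f w + (w - a) * C_derive f w)%C).
    - intros t Ht. apply Hg. eapply Rle_lt_trans; [now apply segment_in|auto].
    - intros t Ht. eapply holo_cont; [exact Hgd|]. eapply Rle_lt_trans; [now apply segment_in|auto]. }
  replace (g (a + (z - a))%C - g a)%C with ((z - a) * f z)%C in I0.
  2:{ unfold g. replace (a + (z - a))%C with z by ring. ring. }
  assert (If : is_CInt (fun t => f (a + RtoC t * (z - a)) + (a + RtoC t * (z - a) - a) * C_derive f (a + RtoC t * (z - a)))%C 0 1 (f z)).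
  { destruct (Ceq_dec z a) as [->|Hne].
    - eapply is_CInt_ext with (f := fun _ => f a).
      + intros t _. replace (a + RtoC t * (a - a))%C with a by ring. ring.
      + eapply is_CInt_eq; [apply is_CInt_const|]. rewrite Rminus_0_r. ring.
    - assert (N : (z - a)%C <> 0) by (intros E; apply Hne; now apply Cminus_eq0).
      eapply is_CInt_eq; [eapply is_CInt_ext; [|exact (is_CInt_scal (/ (z - a)) _ _ _ _ I0)]|field; auto].
      intros t _. cbv beta. field. auto. }
  assert (Key : forall v, Cmod (v - z) < r - Cmod (z - a) -> Cmod (F v - F z - f z * (v - z)) <= (r * A + B) * Cmod (v - z) ^ 2).
  { intros v Hv. assert (Hva : Cmod (v - a) < r) by (generalize (Cmod_dist_tri v z a); lra).
    assert (I := is_CInt_minus _ _ _ _ _ _ (is_CInt_minus _ _ _ _ _ _ (FI v ltac:(lra)) (FI z Hz)) (is_CInt_scal (v - z)%C _ _ _ _ If)).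
    rewrite (Cmult_comm (f z)).
    replace ((r * A + B) * Cmod (v - z) ^ 2) with ((1 - 0) * ((r * A + B) * Cmod (v - z) ^ 2)) by ring.
    eapply (is_CInt_bound _ 0 1); [lra| |exact I]. intros t Ht. cbv beta.
    set (p := (a + RtoC t * (z - a))%C). set (q := (a + RtoC t * (v - a))%C).
    assert (Hp : Cmod (p - a) <= r) by (eapply Rle_trans; [now apply segment_in|lra]).
    assert (Hq : Cmod (q - a) <= r) by (eapply Rle_trans; [now apply segment_in|lra]).
    assert (Eqp : (q - p)%C = (RtoC t * (v - z))%C) by (unfold p, q; ring).
    assert (X : ((v - a) * f q - (z - a) * f p - (v - z) * (f p + (p - a) * C_derive f p))%C =
      ((v - a) * (f q - f p - C_derive f p * (q - p)) + RtoC t * (v - z) * (v - z) * C_derive f p)%C).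
    { rewrite Eqp. unfold p. ring. }
    rewrite X. eapply Rle_trans; [apply Cmod_triangle|]. rewrite !Cmod_mult, Cmod_R, Rabs_right by lra.
    assert (TT := T p q Hp Hq). rewrite Eqp, Cmod_mult, Cmod_R, Rabs_right in TT by lra. rewrite <- Eqp in TT.
    set (h := Cmod (v - z)) in *. assert (h0 : 0 <= h) by apply Cmod_ge_0.
    assert (t * h <= h) by nra. assert ((t * h) ^ 2 <= h ^ 2) by (apply pow_incr; split; [apply Rmult_le_pos; lra|auto]).
    assert (Cmod (f q - f p - C_derive f p * (q - p)) <= A * h ^ 2) by nra.
    assert (Cmod (v - a) * Cmod (f q - f p - C_derive f p * (q - p)) <= r * (A * h ^ 2)).
    { apply Rmult_le_compat; try apply Cmod_ge_0; lra. }
    assert (t * h * h * Cmod (C_derive f p) <= h * h * B).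
    { apply Rmult_le_compat; [nra|apply Cmod_ge_0|nra|now apply HBb]. }
    nra. }
  set (K := r * A + B). assert (HK : 0 < K) by (unfold K; nra).
  intros e He. exists (Rmin (r - Cmod (z - a)) (e / K)). split; [apply Rmin_pos; [lra|apply Rdiv_lt_0_compat; lra]|].
  intros v Hv. generalize (Rmin_l (r - Cmod (z - a)) (e / K)) (Rmin_r (r - Cmod (z - a)) (e / K)). intros.
  eapply Rle_trans; [apply Key; lra|]. fold K. assert (Q := Cmod_ge_0 (v - z)).
  assert (Cmod (v - z) * K <= e).
  { replace e with (e / K * K) by (field; lra). apply Rmult_le_compat_r; lra. }
  simpl. nra.
Qed.

Lemma holomorphic_log (G : C -> C) (a : C) (R1 : R) : holo_on a R1 G ->
  (forall z, Cmod (z - a) < R1 -> G z <> 0) ->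
  exists F : C -> C, F a = 0 /\ holo_on a R1 F /\ forall z, Cmod (z - a) < R1 -> G z = (G a * Cexp (F z))%C.
Proof.
  intros HG Hn.
  destruct (primitive (fun z => C_derive G z / G z)%C a R1) as [F [F0 HF]].
  { intros z Hz. destruct (holo_derive G a R1 HG z Hz) as [l Hl]. eexists. apply is_cderiv_div; [exact Hl| |auto].
    eapply holo_C_derive; eauto. }
  exists F. split; auto. split. { intros z Hz. eexists. now apply HF. }
  intros z Hz.
  assert (E := deriv_zero_const (fun w => G w * Cexp (- F w))%C a R1).
  assert (H1 : forall w, Cmod (w - a) < R1 -> is_cderiv (fun w => G w * Cexp (- F w))%C w 0).
  { intros w Hw. eapply is_cderiv_eq.
    - apply is_cderiv_mult; [eapply holo_C_derive; eauto|].
      apply (is_cderiv_comp (fun w => - F w)%C Cexp); [apply is_cderiv_opp, HF; auto|apply is_cderiv_Cexp].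
    - cbv beta. field. now apply Hn. }
  specialize (E H1 z Hz). cbv beta in E. rewrite F0 in E.
  replace (- 0)%C with (RtoC 0) in E by ring. rewrite Cexp_0 in E.
  assert (X : (Cexp (- F z) * Cexp (F z))%C = 1) by (rewrite <- Cexp_plus, <- Cexp_0; f_equal; ring).
  transitivity (G z * (Cexp (- F z) * Cexp (F z)))%C; [rewrite X; ring|].
  rewrite Cmult_assoc, E. ring.
Qed.

(* Harnack's inequality for the negative harmonic function log |G|: the logarithm maps the
   disc to a half-plane, to which the Schwarz lemma is applied. *)
Lemma zero_free_lower_bound (G : C -> C) (a : C) (R1 : R) : 0 < R1 -> holo_on a R1 G ->
  (forall z, Cmod (z - a) < R1 -> G z <> 0) -> (forall z, Cmod (z - a) < R1 -> Cmod (G z) <= 1) ->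
  exists K, 0 < K /\ forall z, Cmod (z - a) < R1 -> exp (- (K / (R1 - Cmod (z - a)))) <= Cmod (G z).
Proof.
  intros HR HG Hn H1.
  destruct (holomorphic_log G a R1 HG Hn) as [F [F0 [HF EF]]].
  assert (Ha : Cmod (a - a) < R1) by (replace (a - a)%C with (RtoC 0) by ring; now rewrite Cmod_0).
  assert (Gp := Cmod_neq0_pos _ (Hn a Ha)).
  (* The bound |G| <= 1 reads Re F <= s - 1. The extra 1 keeps s positive even if |G a| = 1, so that
     F/(F - 2s) sends the half-plane Re F < s into the disk and 0 to 0. *)
  set (s := - ln (Cmod (G a)) + 1).
  assert (Ga : Cmod (G a) = exp (1 - s)).
  { unfold s. replace (1 - (- ln (Cmod (G a)) + 1)) with (ln (Cmod (G a))) by ring. now rewrite exp_ln. }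
  assert (Hs : 1 <= s).
  { unfold s. assert (ln (Cmod (G a)) <= 0); [|lra]. rewrite <- ln_1. apply ln_le; auto. }
  assert (ReF : forall z, Cmod (z - a) < R1 -> Re (F z) <= s - 1).
  { intros z Hz. assert (B := H1 z Hz). rewrite EF, Cmod_mult, Cmod_Cexp, Ga, <- exp_plus in B by auto.
    apply Rnot_lt_le. intros L. assert (exp 0 < exp (1 - s + Re (F z))) by (apply exp_increasing; lra).
    rewrite exp_0 in H. lra. }
  assert (Hden : forall z, Cmod (z - a) < R1 -> (F z - 2 * RtoC s)%C <> 0).
  { intros z Hz E. assert (B := ReF z Hz). apply Cminus_eq0 in E. rewrite E in B.
    rewrite <- RtoC_mult, re_RtoC in B. lra. }
  set (k := fun z => (F z / (F z - 2 * RtoC s))%C).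
  assert (Hk : holo_on a R1 k).
  { intros z Hz. destruct (HF z Hz) as [l Hl]. eexists. apply is_cderiv_div; [exact Hl| |auto].
    apply is_cderiv_minus; [exact Hl|apply is_cderiv_const]. }
  assert (Bk : forall z, Cmod (z - a) < R1 -> Cmod (k z) <= 1).
  { intros z Hz. assert (N := Cmod_neq0_pos _ (Hden z Hz)). unfold k. rewrite Cmod_div by auto.
    apply Rmult_le_reg_r with (Cmod (F z - 2 * RtoC s)); auto. unfold Rdiv. rewrite Rmult_assoc, Rinv_l, Rmult_1_r, Rmult_1_l by lra.
    apply Rsqr_incr_0_var; [|lra]. rewrite !Rsqr_pow2, !Cmod2_expand.
    assert (B := ReF z Hz). unfold Re in B. destruct (F z) as [x y]. simpl in *. nra. }
  destruct (divide_root k a R1 Hk a Ha) as [h [Hh [_ Ekh]]].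
  assert (k0 : k a = 0) by (unfold k; rewrite F0; unfold Cdiv; ring).
  assert (Bh : forall z, Cmod (z - a) < R1 -> Cmod (h z) <= / R1).
  { intros z Hz. apply Rnot_lt_le. intros L.
    assert (P : 0 < / R1) by now apply Rinv_0_lt_compat.
    set (r1 := / ((Cmod (h z) + / R1) / 2)).
    assert (Hr1 : 0 < r1) by (apply Rinv_0_lt_compat; lra).
    assert (Hr2 : r1 < R1).
    { unfold r1. assert (X : / ((Cmod (h z) + / R1) / 2) < / / R1); [|now rewrite Rinv_inv in X].
      apply Rinv_lt_contravar; [apply Rmult_lt_0_compat; lra|lra]. }
    set (r := Rmax r1 (Cmod (z - a))).
    assert (Hr : r < R1) by (apply Rmax_lub_lt; auto).
    assert (r1r : r1 <= r) by apply Rmax_l. assert (zr : Cmod (z - a) <= r) by apply Rmax_r.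
    assert (Cmod (h z) <= / r1).
    { apply (max_modulus h a R1 r); auto; [lra|]. intros w Hw.
      assert (B := Bk w ltac:(lra)). rewrite Ekh, k0, Cplus_0_l, Cmod_mult, Hw in B.
      apply Rmult_le_reg_l with r1; auto. rewrite Rinv_r by lra.
      generalize (Cmod_ge_0 (h w)). nra. }
    unfold r1 in H. rewrite Rinv_inv in H. lra. }
  (* Solving for F costs 2 s R1/(R1 - |z - a|); one further s R1/(R1 - |z - a|), which is at least
     s, covers the constant 1 - s. *)
  exists (3 * s * R1). split; [apply Rmult_lt_0_compat; lra|]. intros z Hz.
  assert (P := Cmod_ge_0 (z - a)).
  assert (Bkz : Cmod (k z) <= Cmod (z - a) / R1).
  { rewrite Ekh, k0, Cplus_0_l, Cmod_mult. apply Rmult_le_compat_l; auto. }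
  assert (N := Hden z Hz).
  assert (X1 : Cmod (z - a) / R1 < 1).
  { apply Rmult_lt_reg_r with R1; auto. unfold Rdiv. rewrite Rmult_assoc, Rinv_l; lra. }
  assert (k1 : (1 - k z)%C <> 0).
  { intros E. apply Cminus_eq0 in E. rewrite <- E, Cmod_1 in Bkz. lra. }
  assert (EFz : F z = (- (2 * RtoC s * k z / (1 - k z)))%C).
  { assert (E1 : (1 - k z)%C = (- 2 * RtoC s / (F z - 2 * RtoC s))%C) by (unfold k; field; auto).
    assert (s0 : RtoC s <> 0) by (intros E; apply RtoC_inj in E; lra).
    rewrite E1. unfold k. field. split; auto. }
  assert (Mk : 1 - Cmod (z - a) / R1 <= Cmod (1 - k z)).
  { generalize (Cmod_rtriangle 1 (k z)). rewrite Cmod_1. lra. }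
  assert (BF : Cmod (F z) <= 2 * s * R1 / (R1 - Cmod (z - a))).
  { rewrite EFz, Cmod_opp, Cmod_div, !Cmod_mult, !Cmod_R, !Rabs_right by (auto; lra).
    apply Rle_trans with (2 * s * 1 / (1 - Cmod (z - a) / R1)).
    - unfold Rdiv at 1 2. apply Rmult_le_compat.
      + apply Rmult_le_pos; [lra|apply Cmod_ge_0].
      + left. apply Rinv_0_lt_compat. lra.
      + apply Rmult_le_compat_l; lra.
      + apply Rinv_le_contravar; lra.
    - apply Req_le. field. lra. }
  assert (BR := re_le_Cmod (F z)). apply Rabs_le_between in BR.
  rewrite EF, Cmod_mult, Cmod_Cexp, Ga, <- exp_plus by auto.
  assert (S2 : s <= s * R1 / (R1 - Cmod (z - a))).
  { apply Rmult_le_reg_r with (R1 - Cmod (z - a)); [lra|]. unfold Rdiv. rewrite (Rmult_assoc (s * R1)), Rinv_l by lra. nra. }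
  assert (E3 : 3 * s * R1 / (R1 - Cmod (z - a)) = 2 * s * R1 / (R1 - Cmod (z - a)) + s * R1 / (R1 - Cmod (z - a))) by (field; lra).
  assert (L : - (3 * s * R1 / (R1 - Cmod (z - a))) <= 1 - s + Re (F z)) by lra.
  destruct L as [L| ->]; [left; now apply exp_increasing|lra].
Qed.

(** * Finite Blaschke products with prescribed critical points *)

(** Polynomial functions of degree at most n in Horner form. They are kept as functions, because
    values at points of the circle are all that the Wronskian argument uses. *)
Fixpoint is_poly (n : nat) (f : C -> C) : Prop :=
  match n with
  | O => exists c, forall z, f z = c
  | S m => exists c g, is_poly m g /\ forall z, f z = (c + z * g z)%C
  end.

Lemma is_poly_ext (n : nat) : forall f g, (forall z, f z = g z) -> is_poly n f -> is_poly n g.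
Proof.
  destruct n as [|n]; simpl; intros f g E H.
  - destruct H as [c H]. exists c. intros z. now rewrite <- E.
  - destruct H as [c [h [Hh H]]]. exists c, h. split; auto. intros z. now rewrite <- E.
Qed.

Lemma is_poly_const (n : nat) (c : C) : is_poly n (fun _ => c).
Proof.
  revert c. induction n as [|n IH]; intros c; simpl; [now exists c|].
  exists c, (fun _ => RtoC 0). split; auto. intros; ring.
Qed.

Lemma is_poly_plus (n : nat) : forall f g, is_poly n f -> is_poly n g -> is_poly n (fun z => f z + g z)%C.
Proof.
  induction n as [|n IH]; simpl; intros f g.
  - intros [c Hc] [d Hd]. exists (c + d)%C. intros; now rewrite Hc, Hd.
  - intros [c [f1 [Hf1 Hc]]] [d [g1 [Hg1 Hd]]]. exists (c + d)%C, (fun z => f1 z + g1 z)%C.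
    split; auto. intros; rewrite Hc, Hd; ring.
Qed.

Lemma is_poly_scal (n : nat) (k : C) : forall f, is_poly n f -> is_poly n (fun z => k * f z)%C.
Proof.
  induction n as [|n IH]; simpl; intros f.
  - intros [c Hc]. exists (k * c)%C. intros; now rewrite Hc.
  - intros [c [f1 [Hf1 Hc]]]. exists (k * c)%C, (fun z => k * f1 z)%C.
    split; auto. intros; rewrite Hc; ring.
Qed.

Lemma is_poly_minus (n : nat) (f g : C -> C) : is_poly n f -> is_poly n g -> is_poly n (fun z => f z - g z)%C.
Proof.
  intros Hf Hg. apply is_poly_ext with (f := fun z => (f z + -1 * g z)%C); [intros; ring|].
  apply is_poly_plus; auto. now apply is_poly_scal.
Qed.

Lemma is_poly_le (n m : nat) (f : C -> C) : (n <= m)%nat -> is_poly n f -> is_poly m f.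
Proof.
  intros H. revert m H f. induction n as [|n IH]; intros m H f Hf.
  - destruct Hf as [c Hc]. apply is_poly_ext with (f := fun _ => c); [intros; now rewrite Hc|]. apply is_poly_const.
  - destruct m as [|m]; [lia|]. destruct Hf as [c [g [Hg Hc]]]. exists c, g. split; auto. apply IH; auto. lia.
Qed.

Lemma is_poly_mult (n m : nat) : forall f g, is_poly n f -> is_poly m g -> is_poly (n + m) (fun z => f z * g z)%C.
Proof.
  induction n as [|n IH]; intros f g Hf Hg.
  - destruct Hf as [c Hc]. apply is_poly_ext with (f := fun z => (c * g z)%C); [intros; now rewrite Hc|].
    now apply is_poly_scal.
  - destruct Hf as [c [f1 [Hf1 Hc]]].
    apply is_poly_ext with (f := fun z => (c * g z + z * (f1 z * g z))%C); [intros; rewrite Hc; ring|].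
    apply is_poly_plus.
    + apply is_poly_scal. apply is_poly_le with (n := m); auto. lia.
    + simpl. exists (RtoC 0), (fun z => f1 z * g z)%C. split; auto. intros; ring.
Qed.

Lemma is_poly_id : is_poly 1 (fun z => z).
Proof. simpl. exists (RtoC 0), (fun _ => RtoC 1). split; [now exists 1|]. intros; ring. Qed.

Lemma is_poly_pow (n : nat) : is_poly n (fun z => z ^ n)%C.
Proof.
  induction n as [|n IH]; simpl; [now exists 1|].
  exists (RtoC 0), (fun z => z ^ n)%C. split; auto. intros; ring.
Qed.

Lemma is_poly_divide (n : nat) (a : C) : forall f, is_poly (S n) f ->
  exists g, is_poly n g /\ forall z, f z = (f a + (z - a) * g z)%C.
Proof.
  induction n as [|n IH]; intros f [c [g [Hg Hc]]].
  - destruct Hg as [d Hd]. exists (fun _ => d). split; [now exists d|]. intros z. rewrite !Hc, !Hd. ring.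
  - destruct (IH g Hg) as [h [Hh Eh]]. exists (fun z => g z + a * h z)%C. split.
    + apply is_poly_plus; auto. apply is_poly_le with (n := n); auto. now apply is_poly_scal.
    + intros z. rewrite !Hc. transitivity (c + a * (g a + (z - a) * h z) + (z - a) * g z)%C; [rewrite <- Eh|]; ring.
Qed.

Lemma poly_zero (n : nat) : forall (f : C -> C) (xi : nat -> C), is_poly n f ->
  (forall i j, (i <= n)%nat -> (j <= n)%nat -> xi i = xi j -> i = j) ->
  (forall i, (i <= n)%nat -> f (xi i) = 0) -> forall z, f z = 0.
Proof.
  induction n as [|n IH]; intros f xi Hf Hinj H0 z.
  - destruct Hf as [c Hc]. rewrite Hc. rewrite <- (Hc (xi O)). auto.
  - destruct (is_poly_divide n (xi (S n)) f Hf) as [g [Hg Eg]].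
    rewrite H0 in Eg by lia.
    assert (G : forall z, g z = 0).
    { apply (IH g xi Hg).
      - intros i j Hi Hj. apply Hinj; lia.
      - intros i Hi. assert (E := Eg (xi i)). rewrite H0 in E by lia.
        apply NNPP. intros N. assert (X : (xi i - xi (S n))%C <> 0).
        { intros E'. apply Cminus_eq0, Hinj in E'; lia. }
        apply (Cmult_neq_0 _ _ X N). rewrite E. ring. }
    rewrite Eg, G. ring.
Qed.

(** Stability of interpolation, by Newton's scheme: split off the last node and divide. At the other
    nodes the quotient is bounded by 2e/d, with d the least distance to the removed node. *)
Lemma poly_node_bound (n : nat) (xi : nat -> C) :
  (forall i, Cmod (xi i) <= 1) ->
  (forall i j, (i <= n)%nat -> (j <= n)%nat -> xi i = xi j -> i = j) ->
  exists L, 0 < L /\ forall f e, is_poly n f -> 0 <= e -> (forall i, (i <= n)%nat -> Cmod (f (xi i)) <= e) ->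
    forall z, Cmod z <= 1 -> Cmod (f z) <= L * e.
Proof.
  intros Hxi. induction n as [|n IH]; intros Hinj.
  - exists 1. split; [lra|]. intros f e [c Hc] He H z _. rewrite Hc, <- (Hc (xi O)), Rmult_1_l. auto.
  - destruct IH as [L [HL IH]]; [intros; apply Hinj; auto|].
    assert (Hd : exists d, 0 < d /\ forall i, (i <= n)%nat -> d <= Cmod (xi i - xi (S n))).
    { assert (G : forall m, (m <= S n)%nat -> exists d, 0 < d /\ forall i, (i < m)%nat -> d <= Cmod (xi i - xi (S n))).
      { induction m as [|m IHm]; intros Hm; [exists 1; split; [lra|intros; lia]|].
        destruct IHm as [d [Hd H]]; [lia|].
        assert (P : 0 < Cmod (xi m - xi (S n))).
        { apply Cmod_minus_pos. intros E. apply Hinj in E; lia. }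
        exists (Rmin d (Cmod (xi m - xi (S n)))). split; [now apply Rmin_pos|].
        intros i Hi. destruct (Nat.eq_dec i m) as [->|N]; [apply Rmin_r|].
        eapply Rle_trans; [apply Rmin_l|]. apply H. lia. }
      destruct (G (S n) (le_n _)) as [d [Hd H]]. exists d. split; auto. intros i Hi. apply H. lia. }
    destruct Hd as [d [Hd Hdi]].
    exists (1 + 2 * (L * (2 / d))). split.
    { assert (0 < 2 / d) by (apply Rdiv_lt_0_compat; lra). nra. }
    intros f e Hf He H z Hz.
    destruct (is_poly_divide n (xi (S n)) f Hf) as [g [Hg Eg]].
    assert (G : Cmod (g z) <= L * (2 * e / d)).
    { apply IH; auto.
      - apply Rmult_le_pos; [lra|left; now apply Rinv_0_lt_compat].
      - intros i Hi. assert (A := H i ltac:(lia)). assert (B := H (S n) (le_n _)). assert (D := Hdi i Hi).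
        assert (X := Cmod_minus_le (f (xi i)) (f (xi (S n)))).
        rewrite (Eg (xi i)) in X at 1. replace (f (xi (S n)) + (xi i - xi (S n)) * g (xi i) - f (xi (S n)))%C
          with ((xi i - xi (S n)) * g (xi i))%C in X by ring.
        rewrite Cmod_mult in X. apply Rmult_le_reg_l with d; auto.
        replace (d * (2 * e / d)) with (2 * e) by (field; lra).
        generalize (Cmod_ge_0 (g (xi i))). nra. }
    rewrite Eg. eapply Rle_trans; [apply Cmod_triangle|]. rewrite Cmod_mult.
    assert (A := H (S n) (le_n _)). assert (B := Cmod_minus_le z (xi (S n))). assert (D := Hxi (S n)).
    assert (Cmod (z - xi (S n)) * Cmod (g z) <= 2 * (L * (2 * e / d))).
    { apply Rmult_le_compat; try apply Cmod_ge_0; lra. }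
    replace ((1 + 2 * (L * (2 / d))) * e) with (e + 2 * (L * (2 * e / d))) by (field; lra). lra.
Qed.

Lemma poly_cderiv (n : nat) : forall f, is_poly n f -> exists g, forall z, is_cderiv f z (g z).
Proof.
  induction n as [|n IH]; intros f Hf.
  - destruct Hf as [c Hc]. exists (fun _ => RtoC 0). intros z.
    apply is_cderiv_ext_loc with (f := fun _ => c) (r := 1); [lra|auto|apply is_cderiv_const].
  - destruct Hf as [c [g [Hg Hc]]]. destruct (IH g Hg) as [h Hh].
    exists (fun z => g z + z * h z)%C. intros z.
    apply is_cderiv_ext_loc with (f := fun z => (c + z * g z)%C) (r := 1); [lra|auto|].
    eapply is_cderiv_eq; [apply is_cderiv_plus; [apply is_cderiv_const|apply is_cderiv_mult; [apply is_cderiv_id|apply Hh]]|].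
    cbv beta; ring.
Qed.

(* pe n x is the polynomial with coefficients x 0, ..., x n and pd n x its derivative;
   ps n x is the reciprocal polynomial z^n conj(p(1/conj z)) and psd n x its derivative. *)
Fixpoint pe (n : nat) (x : nat -> C) (z : C) : C :=
  match n with O => x O | S m => (x O + z * pe m (fun k => x (S k)) z)%C end.

Fixpoint pd (n : nat) (x : nat -> C) (z : C) : C :=
  match n with O => RtoC 0 | S m => (pe m (fun k => x (S k)) z + z * pd m (fun k => x (S k)) z)%C end.

Fixpoint ps (n : nat) (x : nat -> C) (z : C) : C :=
  match n with O => Cconj (x O) | S m => (Cconj (x O) * z ^ S m + ps m (fun k => x (S k)) z)%C end.

Fixpoint psd (n : nat) (x : nat -> C) (z : C) : C :=
  match n with O => RtoC 0 | S m => (Cconj (x O) * (RtoC (INR (S m)) * z ^ m) + psd m (fun k => x (S k)) z)%C end.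

Lemma pe_poly (n : nat) : forall x, is_poly n (pe n x).
Proof. induction n as [|n IH]; intros x; simpl; [now exists (x O)|]. exists (x O), (pe n (fun k => x (S k))). auto. Qed.

Lemma zpd_poly (n : nat) : forall x, is_poly n (fun z => z * pd n x z)%C.
Proof.
  induction n as [|n IH]; intros x.
  - exists (RtoC 0). intros z. simpl. ring.
  - simpl. exists (RtoC 0), (fun z => pe n (fun k => x (S k)) z + z * pd n (fun k => x (S k)) z)%C. split.
    + apply is_poly_plus; [apply pe_poly|apply IH].
    + intros; ring.
Qed.

Lemma ps_poly (n : nat) : forall x, is_poly n (ps n x).
Proof.
  induction n as [|n IH]; intros x; [now exists (Cconj (x O))|].
  apply is_poly_plus.
  - apply is_poly_scal. apply is_poly_pow.
  - apply is_poly_le with (n := n); auto.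
Qed.

Lemma zpsd_poly (n : nat) : forall x, is_poly n (fun z => z * psd n x z)%C.
Proof.
  induction n as [|n IH]; intros x; [exists (RtoC 0); intros; simpl; ring|].
  apply is_poly_ext with (f := fun z => (Cconj (x O) * RtoC (INR (S n)) * z ^ S n + z * psd n (fun k => x (S k)) z)%C).
  - intros z. cbn [psd]. rewrite Cpow_S. ring.
  - apply is_poly_plus.
    + apply is_poly_scal. apply is_poly_pow.
    + apply is_poly_le with (n := n); auto.
Qed.

Lemma is_cderiv_pow (n : nat) (z : C) : is_cderiv (fun w => w ^ S n)%C z (RtoC (INR (S n)) * z ^ n)%C.
Proof.
  apply is_cderiv_ext_loc with (f := fun w => ((w - 0) ^ S n * (fun _ => 1) w)%C) (r := 1); [lra| |].
  - intros w _. replace (w - 0)%C with w by ring. ring.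
  - eapply is_cderiv_eq; [apply is_cderiv_pow_mult, is_cderiv_const|].
    replace (z - 0)%C with z by ring. ring.
Qed.

Lemma pe_deriv (n : nat) : forall x z, is_cderiv (pe n x) z (pd n x z).
Proof.
  induction n as [|n IH]; intros x z; simpl; [apply is_cderiv_const|].
  eapply is_cderiv_eq; [apply is_cderiv_plus; [apply is_cderiv_const|apply is_cderiv_mult; [apply is_cderiv_id|apply IH]]|].
  cbv beta. ring.
Qed.

Lemma ps_deriv (n : nat) : forall x z, is_cderiv (ps n x) z (psd n x z).
Proof.
  induction n as [|n IH]; intros x z; [apply is_cderiv_const|].
  cbn [ps psd]. apply is_cderiv_plus; [|apply IH].
  eapply is_cderiv_eq; [apply is_cderiv_mult; [apply is_cderiv_const|apply is_cderiv_pow]|]. cbv beta. ring.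
Qed.

Lemma pe_lin (n : nat) : forall x y (s : R) z,
  pe n (fun k => x k + RtoC s * y k)%C z = (pe n x z + RtoC s * pe n y z)%C.
Proof. induction n as [|n IH]; intros x y s z; simpl; [auto|]. rewrite IH. ring. Qed.

Lemma pd_lin (n : nat) : forall x y (s : R) z,
  pd n (fun k => x k + RtoC s * y k)%C z = (pd n x z + RtoC s * pd n y z)%C.
Proof. induction n as [|n IH]; intros x y s z; simpl; [ring|]. rewrite IH, pe_lin. ring. Qed.

Lemma Cconj_RtoC (s : R) : Cconj (RtoC s) = RtoC s.
Proof. unfold Cconj, RtoC; simpl. now rewrite Ropp_0. Qed.

Lemma ps_lin (n : nat) : forall x y (s : R) z,
  ps n (fun k => x k + RtoC s * y k)%C z = (ps n x z + RtoC s * ps n y z)%C.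
Proof.
  induction n as [|n IH]; intros x y s z; cbn [ps]; [|rewrite IH]; rewrite Cplus_conj, Cmult_conj, Cconj_RtoC; ring.
Qed.

Lemma psd_lin (n : nat) : forall x y (s : R) z,
  psd n (fun k => x k + RtoC s * y k)%C z = (psd n x z + RtoC s * psd n y z)%C.
Proof.
  induction n as [|n IH]; intros x y s z; cbn [psd]; [ring|]. rewrite IH, Cplus_conj, Cmult_conj, Cconj_RtoC. ring.
Qed.

(* The derivative of z ps / pe is wron / pe^2. *)
Definition wron (n : nat) (x : nat -> C) (z : C) : C :=
  ((ps n x z + z * psd n x z) * pe n x z - z * ps n x z * pd n x z)%C.

(* wron2 and omega2 are the polarizations of wron and omega. *)
Definition wron2 (n : nat) (x y : nat -> C) (z : C) : C :=
  ((ps n x z + z * psd n x z) * pe n y z - z * ps n x z * pd n y z +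
   ((ps n y z + z * psd n y z) * pe n x z - z * ps n y z * pd n x z))%C.

(** The parameter is real since [ps] conjugates the coefficients: [wron] is a quadratic map over the
    reals only. *)
Lemma wron_quad (n : nat) (x y : nat -> C) (s : R) (z : C) :
  wron n (fun k => x k + RtoC s * y k)%C z = (wron n x z + RtoC s * wron2 n x y z + RtoC (s * s) * wron n y z)%C.
Proof. unfold wron, wron2. rewrite pe_lin, pd_lin, ps_lin, psd_lin, RtoC_mult. ring. Qed.

Lemma wron_poly (n : nat) (x : nat -> C) : is_poly (n + n) (wron n x).
Proof.
  unfold wron. apply is_poly_minus.
  - apply is_poly_mult; [|apply pe_poly]. apply is_poly_plus; [apply ps_poly|apply zpsd_poly].
  - apply is_poly_ext with (f := fun z => (ps n x z * (z * pd n x z))%C); [intros; ring|].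
    apply is_poly_mult; [apply ps_poly|apply zpd_poly].
Qed.

Lemma wron2_poly (n : nat) (x y : nat -> C) : is_poly (n + n) (wron2 n x y).
Proof.
  apply is_poly_ext with (f := fun z => (wron n (fun k => x k + RtoC 1 * y k)%C z - wron n x z - wron n y z)%C).
  - intros z. rewrite wron_quad, Rmult_1_r. ring.
  - apply is_poly_minus; [apply is_poly_minus|]; apply wron_poly.
Qed.

(* On the circle, wron is xi^n omega. *)
Definition omega (n : nat) (x : nat -> C) (xi : C) : R :=
  (INR n + 1) * Cmod (pe n x xi) ^ 2 - 2 * Re (Cconj (pe n x xi) * (xi * pd n x xi)).

Lemma circle_conj (xi : C) : Cmod xi = 1 -> (Cconj xi * xi)%C = 1.
Proof. intros H. rewrite Cmult_comm, <- Cmod2_conj, H. f_equal. ring. Qed.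

Lemma ps_circle (n : nat) : forall x xi, Cmod xi = 1 -> ps n x xi = (xi ^ n * Cconj (pe n x xi))%C.
Proof.
  induction n as [|n IH]; intros x xi Hxi; cbn [ps pe]; [simpl; ring|].
  rewrite IH by auto. rewrite Cplus_conj, Cmult_conj. simpl Cpow.
  transitivity (xi * xi ^ n * Cconj (x O) + (Cconj xi * xi) * (xi ^ n * Cconj (pe n (fun k => x (S k)) xi)))%C; [rewrite circle_conj by auto|]; ring.
Qed.

Lemma psd_circle (n : nat) : forall x xi, Cmod xi = 1 ->
  (xi * psd n x xi)%C = (xi ^ n * (RtoC (INR n) * Cconj (pe n x xi) - Cconj (xi * pd n x xi)))%C.
Proof.
  induction n as [|n IH]; intros x xi Hxi; [simpl; rewrite Cmult_conj, Cconj_RtoC; ring|].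
  cbn [psd pe pd]. rewrite Cmult_plus_distr_l, IH by auto.
  rewrite !Cmult_conj, !Cplus_conj, !Cmult_conj. rewrite S_INR, RtoC_plus. simpl Cpow.
  set (g := Cconj (pe n (fun k => x (S k)) xi)). set (h := Cconj (pd n (fun k => x (S k)) xi)).
  set (c := Cconj (x O)). set (e := Cconj xi). assert (E : (e * xi)%C = 1) by now apply circle_conj.
  transitivity (xi * (c * ((RtoC (INR n) + 1) * xi ^ n)) + xi ^ n * ((e * xi) * (RtoC (INR n) * g) - (e * xi) * (e * h)))%C.
  - rewrite E. ring.
  - ring.
Qed.

Lemma re_conj_sum (u : C) : RtoC (2 * Re u) = (u + Cconj u)%C.
Proof. destruct u as [a b]. unfold RtoC, Cconj, Cplus; simpl. f_equal; ring. Qed.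

Lemma wron_circle (n : nat) (x : nat -> C) (xi : C) : Cmod xi = 1 ->
  wron n x xi = (xi ^ n * RtoC (omega n x xi))%C.
Proof.
  intros H. unfold wron, omega.
  rewrite psd_circle, ps_circle by auto.
  rewrite RtoC_minus, RtoC_mult, re_conj_sum, RtoC_plus, Cmod2_conj, !Cmult_conj, Cconj_conj. ring.
Qed.

Lemma omega_unique (n : nat) (xi : C) (u v : R) : Cmod xi = 1 -> (xi ^ n * RtoC u)%C = (xi ^ n * RtoC v)%C -> u = v.
Proof.
  intros H E. apply RtoC_inj.
  assert (N : (xi ^ n)%C <> 0) by (apply Cpow_nz, Cmod_gt_0; lra).
  transitivity (/ (xi ^ n) * (xi ^ n * RtoC u))%C; [field; auto|]. rewrite E. field; auto.
Qed.

Definition omega2 (n : nat) (x y : nat -> C) (xi : C) : R :=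
  2 * ((INR n + 1) * Re (Cconj (pe n x xi) * pe n y xi)
    - Re (Cconj (pe n x xi) * (xi * pd n y xi)) - Re (Cconj (pe n y xi) * (xi * pd n x xi))).

Lemma omega_quad (n : nat) (x y : nat -> C) (s : R) (xi : C) :
  omega n (fun k => x k + RtoC s * y k)%C xi = omega n x xi + s * omega2 n x y xi + s * s * omega n y xi.
Proof.
  unfold omega, omega2. rewrite pe_lin, pd_lin, !Cmod2_expand.
  destruct (pe n x xi) as [a1 a2], (pe n y xi) as [b1 b2], (pd n x xi) as [c1 c2], (pd n y xi) as [d1 d2], xi as [e1 e2].
  simpl. ring.
Qed.

Lemma wron2_circle (n : nat) (x y : nat -> C) (xi : C) : Cmod xi = 1 ->
  wron2 n x y xi = (xi ^ n * RtoC (omega2 n x y xi))%C.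
Proof.
  intros H. assert (E := wron_quad n x y 1 xi).
  rewrite !wron_circle, omega_quad in E by auto.
  rewrite !Rmult_1_l, !RtoC_plus in E.
  transitivity (xi ^ n * omega n x xi + 1 * wron2 n x y xi + 1 * (xi ^ n * omega n y xi) - xi ^ n * omega n x xi - xi ^ n * omega n y xi)%C; [ring|].
  rewrite <- E. ring.
Qed.

(** The constant term is the value at 0, bounded by the maximum principle. Subtracting it and
    dividing by z, of modulus 1 on the circle, at most doubles the bound. *)
Lemma coef_bound (n : nat) : forall (x : nat -> C) (A : R),
  (forall xi, Cmod xi = 1 -> Cmod (pe n x xi) <= A) -> forall k, (k <= n)%nat -> Cmod (x k) <= 2 ^ k * A.
Proof.
  induction n as [|n IH]; intros x A HA k Hk.
  - replace k with O by lia. simpl. rewrite Rmult_1_l. apply (HA 1). apply Cmod_1.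
  - assert (H0 : Cmod (x O) <= A).
    { assert (M : Cmod (pe (S n) x 0) <= A).
      { apply (max_modulus (pe (S n) x) 0 2 1).
        - intros w _. eexists. apply pe_deriv.
        - lra.
        - intros w Hw. apply HA. now replace (w - 0)%C with w in Hw by ring.
        - replace (0 - 0)%C with (RtoC 0) by ring. rewrite Cmod_0. lra. }
      simpl in M. now replace (x O + 0 * pe n (fun k => x (S k)) 0)%C with (x O) in M by ring. }
    destruct k as [|k]; [simpl; lra|].
    replace (2 ^ S k * A) with (2 ^ k * (2 * A)) by (simpl; ring).
    apply (IH (fun k => x (S k)) (2 * A)); [|lia].
    intros xi Hxi. assert (B := HA xi Hxi). simpl in B.
    replace (Cmod (pe n (fun k => x (S k)) xi)) with (Cmod (xi * pe n (fun k => x (S k)) xi)) by (rewrite Cmod_mult, Hxi; ring).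
    replace (xi * pe n (fun k => x (S k)) xi)%C with ((x O + xi * pe n (fun k => x (S k)) xi) - x O)%C by ring.
    eapply Rle_trans; [apply Cmod_minus_le|]. lra.
Qed.

Lemma pe_bound (n : nat) : forall (x : nat -> C) (A : R) (z : C), Cmod z <= 1 -> (forall k, (k <= n)%nat -> Cmod (x k) <= A) ->
  Cmod (pe n x z) <= (INR n + 1) * A.
Proof.
  induction n as [|n IH]; intros x A z Hz HA.
  - simpl. rewrite Rplus_0_l, Rmult_1_l. auto.
  - rewrite S_INR. cbn [pe]. eapply Rle_trans; [apply Cmod_triangle|]. rewrite Cmod_mult.
    assert (B := IH (fun k => x (S k)) A z Hz (fun k Hk => HA (S k) (le_n_S _ _ Hk))).
    assert (D := HA O (Nat.le_0_l _)). assert (Cmod z * Cmod (pe n (fun k => x (S k)) z) <= 1 * ((INR n + 1) * A)).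
    { apply Rmult_le_compat; auto; apply Cmod_ge_0. }
    lra.
Qed.

Lemma pd_bound (n : nat) : forall (x : nat -> C) (A : R) (z : C), Cmod z <= 1 -> (forall k, (k <= n)%nat -> Cmod (x k) <= A) ->
  Cmod (pd n x z) <= (INR n + 1) ^ 2 * A.
Proof.
  induction n as [|n IH]; intros x A z Hz HA.
  - simpl. rewrite Cmod_0. assert (D := HA O (le_n _)). generalize (Cmod_ge_0 (x O)). lra.
  - rewrite S_INR. cbn [pd]. eapply Rle_trans; [apply Cmod_triangle|]. rewrite Cmod_mult.
    assert (B := IH (fun k => x (S k)) A z Hz (fun k Hk => HA (S k) (le_n_S _ _ Hk))).
    assert (B' := pe_bound n (fun k => x (S k)) A z Hz (fun k Hk => HA (S k) (le_n_S _ _ Hk))).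
    assert (D := HA O (Nat.le_0_l _)). assert (D0 := Cmod_ge_0 (x O)).
    assert (Cmod z * Cmod (pd n (fun k => x (S k)) z) <= 1 * ((INR n + 1) ^ 2 * A)).
    { apply Rmult_le_compat; auto; apply Cmod_ge_0. }
    assert (N := pos_INR n). nra.
Qed.

Lemma pe_cvg (n : nat) : forall (x : nat -> nat -> C) (y : nat -> C) (z : C),
  (forall k, (k <= n)%nat -> cvg_seq (fun m => x m k) (y k)) -> cvg_seq (fun m => pe n (x m) z) (pe n y z).
Proof.
  induction n as [|n IH]; intros x y z H; simpl; [apply H; lia|].
  apply cvg_seq_plus; [apply H; lia|]. apply cvg_seq_scal.
  apply (IH (fun m k => x m (S k)) (fun k => y (S k))). intros k Hk. apply H. lia.
Qed.

Lemma pd_cvg (n : nat) : forall (x : nat -> nat -> C) (y : nat -> C) (z : C),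
  (forall k, (k <= n)%nat -> cvg_seq (fun m => x m k) (y k)) -> cvg_seq (fun m => pd n (x m) z) (pd n y z).
Proof.
  induction n as [|n IH]; intros x y z H; simpl; [apply cvg_seq_const|].
  assert (H' : forall k, (k <= n)%nat -> cvg_seq (fun m => x m (S k)) (y (S k))) by (intros k Hk; apply H; lia).
  apply cvg_seq_plus.
  - apply (pe_cvg n (fun m k => x m (S k)) (fun k => y (S k))); auto.
  - apply cvg_seq_scal. apply (IH (fun m k => x m (S k)) (fun k => y (S k))); auto.
Qed.

Lemma cvg_seq_conj (u : nat -> C) (l : C) : cvg_seq u l -> cvg_seq (fun n => Cconj (u n)) (Cconj l).
Proof.
  intros H e He. destruct (H e He) as [N HN]. exists N. intros n Hn.
  rewrite <- Cminus_conj, Cmod_conj. auto.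
Qed.

Lemma omega_complex (n : nat) (x : nat -> C) (xi : C) :
  RtoC (omega n x xi) = ((RtoC (INR n) + 1) * (pe n x xi * Cconj (pe n x xi))
     - (Cconj (pe n x xi) * (xi * pd n x xi) + Cconj (Cconj (pe n x xi) * (xi * pd n x xi))))%C.
Proof.
  unfold omega. rewrite RtoC_minus, RtoC_mult, re_conj_sum, RtoC_plus, Cmod2_conj. reflexivity.
Qed.

Lemma omega_cvg (n : nat) (x : nat -> nat -> C) (y : nat -> C) (xi : C) :
  (forall k, (k <= n)%nat -> cvg_seq (fun m => x m k) (y k)) ->
  cvg_seq (fun m => RtoC (omega n (x m) xi)) (RtoC (omega n y xi)).
Proof.
  intros H. rewrite omega_complex.
  apply cvg_seq_ext with (u := fun m => ((RtoC (INR n) + 1) * (pe n (x m) xi * Cconj (pe n (x m) xi))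
     - (Cconj (pe n (x m) xi) * (xi * pd n (x m) xi) + Cconj (Cconj (pe n (x m) xi) * (xi * pd n (x m) xi))))%C).
  { intros m. symmetry. apply omega_complex. }
  assert (A := pe_cvg n x y xi H). assert (B := pd_cvg n x y xi H).
  assert (E : cvg_seq (fun m => Cconj (pe n (x m) xi) * (xi * pd n (x m) xi))%C (Cconj (pe n y xi) * (xi * pd n y xi))%C).
  { apply cvg_seq_mult; [now apply cvg_seq_conj|now apply cvg_seq_scal]. }
  apply cvg_seq_minus.
  - apply cvg_seq_scal. apply cvg_seq_mult; auto. now apply cvg_seq_conj.
  - apply cvg_seq_plus; auto. now apply cvg_seq_conj.
Qed.

(** * Blaschke products in terms of the coefficients of their denominator *)

Definition zero_free (n : nat) (x : nat -> C) : Prop :=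
  exists m, 0 < m /\ forall z, Cmod z <= 1 -> m <= Cmod (pe n x z).

Definition blaschke (n : nat) (x : nat -> C) (z : C) : C := (z * ps n x z / pe n x z)%C.

Lemma is_cderiv_zps (n : nat) (x : nat -> C) (z : C) :
  is_cderiv (fun z => z * ps n x z)%C z (ps n x z + z * psd n x z)%C.
Proof.
  eapply is_cderiv_eq; [apply is_cderiv_mult; [apply is_cderiv_id|apply ps_deriv]|]. cbv beta. ring.
Qed.

Lemma zps_circle (n : nat) (x : nat -> C) (xi : C) : Cmod xi = 1 -> Cmod (xi * ps n x xi) = Cmod (pe n x xi).
Proof.
  intros H. rewrite ps_circle, !Cmod_mult, Cmod_pow, Cmod_conj, H, pow1 by auto. ring.
Qed.

Lemma quad_expansion (u v e : C) (A B h : R) : 0 <= h <= 1 -> 0 <= A -> Cmod u <= B -> Cmod v <= B -> Cmod e <= A * h ^ 2 ->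
  Rabs (Cmod (u - RtoC h * v + e) ^ 2 - (Cmod u ^ 2 - 2 * h * Re (Cconj u * v))) <= (B ^ 2 + A ^ 2 + 4 * A * B) * h ^ 2.
Proof.
  intros Hh HA Hu Hv He.
  assert (E : Cmod (u - RtoC h * v + e) ^ 2 - (Cmod u ^ 2 - 2 * h * Re (Cconj u * v)) =
    h ^ 2 * Cmod v ^ 2 + Cmod e ^ 2 + 2 * Re (Cconj (u - RtoC h * v) * e)).
  { rewrite !Cmod2_expand. destruct u as [a b], v as [c d], e as [p q]. simpl. ring. }
  rewrite E. clear E.
  assert (P1 := Cmod_ge_0 u). assert (P2 := Cmod_ge_0 v). assert (P3 := Cmod_ge_0 e).
  assert (R1 : Rabs (Re (Cconj (u - RtoC h * v) * e)) <= 2 * B * (A * h ^ 2)).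
  { eapply Rle_trans; [apply re_le_Cmod|]. rewrite Cmod_mult, Cmod_conj.
    apply Rmult_le_compat; try apply Cmod_ge_0; auto.
    eapply Rle_trans; [apply Cmod_minus_le|]. rewrite Cmod_mult, Cmod_R, Rabs_right by lra. nra. }
  apply Rabs_le_between in R1.
  assert (h2 : 0 <= h ^ 2 <= 1) by nra.
  assert (V2 : Cmod v ^ 2 <= B ^ 2) by (apply pow_incr; auto).
  assert (E2 : Cmod e ^ 2 <= A ^ 2 * h ^ 2).
  { apply Rle_trans with ((A * h ^ 2) ^ 2); [apply pow_incr; auto|].
    replace ((A * h ^ 2) ^ 2) with (A ^ 2 * h ^ 2 * h ^ 2) by ring.
    rewrite <- (Rmult_1_r (A ^ 2 * h ^ 2)) at 2. apply Rmult_le_compat_l; [|lra].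
    apply Rmult_le_pos; [apply pow2_ge_0|lra]. }
  assert (0 <= Cmod e ^ 2) by apply pow2_ge_0.
  assert (0 <= h ^ 2 * Cmod v ^ 2) by (apply Rmult_le_pos; [lra|apply pow2_ge_0]).
  assert (h ^ 2 * Cmod v ^ 2 <= h ^ 2 * B ^ 2) by (apply Rmult_le_compat_l; lra).
  assert (0 <= A * B * h ^ 2) by (apply Rmult_le_pos; [apply Rmult_le_pos; lra|lra]).
  assert (0 <= A ^ 2 * h ^ 2) by (apply Rmult_le_pos; [apply pow2_ge_0|lra]).
  assert (0 <= B ^ 2 * h ^ 2) by (apply Rmult_le_pos; [apply pow2_ge_0|lra]).
  apply Rabs_le. split; lra.
Qed.

(* Second-order radial expansion of |q|^2 - |z q^*|^2 at the circle, where it vanishes. *)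
Lemma radial_expansion (n : nat) (x : nat -> C) : exists K, 0 < K /\ forall xi h, Cmod xi = 1 -> 0 <= h <= 1 ->
  Rabs (Cmod (pe n x (RtoC (1 - h) * xi)) ^ 2 - Cmod (RtoC (1 - h) * xi * ps n x (RtoC (1 - h) * xi)) ^ 2
     - 2 * h * omega n x xi) <= K * h ^ 2 /\
  Rabs (Cmod (pe n x (RtoC (1 - h) * xi)) - Cmod (pe n x xi)) <= K * h /\
  Rabs (Cmod (wron n x (RtoC (1 - h) * xi)) - Cmod (wron n x xi)) <= K * h.
Proof.
  assert (H1 : holo_on 0 2 (pe n x)) by (intros z _; eexists; apply pe_deriv).
  assert (H2 : holo_on 0 2 (fun z => z * ps n x z)%C) by (intros z _; eexists; apply is_cderiv_zps).
  assert (H3 : holo_on 0 2 (wron n x)).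
  { destruct (poly_cderiv _ _ (wron_poly n x)) as [g Hg]. intros z _. eexists. apply Hg. }
  destruct (taylor2 _ 0 2 H1 1) as [A1 [PA1 T1]]; [lra|].
  destruct (taylor2 _ 0 2 H2 1) as [A2 [PA2 T2]]; [lra|].
  destruct (taylor2 _ 0 2 H3 1) as [A3 [PA3 T3]]; [lra|].
  destruct (holo_bounded _ 0 2 1 H1) as [B1 [PB1 BB1]]; [lra|].
  destruct (holo_bounded _ 0 2 1 H2) as [B2 [PB2 BB2]]; [lra|].
  destruct (holo_bounded _ 0 2 1 (holo_derive _ _ _ H1)) as [B3 [PB3 BB3]]; [lra|].
  destruct (holo_bounded _ 0 2 1 (holo_derive _ _ _ H2)) as [B4 [PB4 BB4]]; [lra|].
  destruct (holo_bounded _ 0 2 1 (holo_derive _ _ _ H3)) as [B5 [PB5 BB5]]; [lra|].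
  set (A := A1 + A2 + A3). set (B := B1 + B2 + B3 + B4 + B5).
  set (K0 := B ^ 2 + A ^ 2 + 4 * A * B).
  assert (PA : 0 < A) by (unfold A; lra). assert (PB : 0 < B) by (unfold B; lra).
  assert (PK0 : 0 < K0) by (unfold K0; nra).
  exists (2 * K0 + A + B). split; [lra|]. intros xi h Hxi Hh.
  set (z := (RtoC (1 - h) * xi)%C).
  assert (Z0 : forall w : C, (w - 0)%C = w) by (intros; ring).
  assert (Mz : Cmod z <= 1) by (unfold z; rewrite Cmod_mult, Cmod_R, Hxi, Rabs_right; lra).
  assert (Ez : (z - xi)%C = (- (RtoC h * xi))%C) by (unfold z; rewrite RtoC_minus; ring).
  assert (Mzx : Cmod (z - xi) = h) by (rewrite Ez, Cmod_opp, Cmod_mult, Cmod_R, Hxi, Rabs_right; lra).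
  assert (h2 : 0 <= h ^ 2 <= h) by nra.
  assert (S1 := T1 xi z ltac:(rewrite Z0; lra) ltac:(rewrite Z0; lra)).
  assert (S2 := T2 xi z ltac:(rewrite Z0; lra) ltac:(rewrite Z0; lra)).
  assert (S3 := T3 xi z ltac:(rewrite Z0; lra) ltac:(rewrite Z0; lra)).
  rewrite Mzx in S1, S2, S3.
  assert (U1 := BB1 xi ltac:(rewrite Z0; lra)). assert (U2 := BB2 xi ltac:(rewrite Z0; lra)).
  assert (U3 := BB3 xi ltac:(rewrite Z0; lra)). assert (U4 := BB4 xi ltac:(rewrite Z0; lra)).
  assert (U5 := BB5 xi ltac:(rewrite Z0; lra)).
  rewrite (is_cderiv_C_derive _ _ _ (pe_deriv n x xi)) in S1, U3.
  rewrite (is_cderiv_C_derive _ _ _ (is_cderiv_zps n x xi)) in S2, U4.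
  cbv beta in S2, U2.
  set (q := pe n x xi) in *. set (q' := pd n x xi) in *. set (p := (xi * ps n x xi)%C) in *.
  set (p' := (ps n x xi + xi * psd n x xi)%C) in *.
  assert (V1 : Cmod (xi * q') <= B) by (rewrite Cmod_mult, Hxi; unfold B; lra).
  assert (V2 : Cmod (xi * p') <= B) by (rewrite Cmod_mult, Hxi; unfold B; lra).
  split; [|split].
  - set (e1 := (pe n x z - q - q' * (z - xi))%C) in *. set (e2 := (z * ps n x z - p - p' * (z - xi))%C) in *.
    assert (Q1 := quad_expansion q (xi * q') e1 A B h Hh ltac:(lra) ltac:(unfold B; lra) V1 ltac:(unfold A; nra)).
    assert (Q2 := quad_expansion p (xi * p') e2 A B h Hh ltac:(lra) ltac:(unfold B; lra) V2 ltac:(unfold A; nra)).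
    replace (q - RtoC h * (xi * q') + e1)%C with (pe n x z) in Q1 by (unfold e1; rewrite Ez; ring).
    replace (p - RtoC h * (xi * p') + e2)%C with (z * ps n x z)%C in Q2 by (unfold e2; rewrite Ez; ring).
    assert (Epq : Cmod p = Cmod q) by (now apply zps_circle).
    assert (Eom : omega n x xi = Re (Cconj p * (xi * p')) - Re (Cconj q * (xi * q'))).
    { apply RtoC_inj. rewrite omega_complex. fold q q'.
      assert (Ep : p = (xi * (xi ^ n * Cconj q))%C) by (unfold p; rewrite ps_circle by auto; reflexivity).
      assert (Ep' : p' = (xi ^ n * Cconj q + xi ^ n * (RtoC (INR n) * Cconj q - Cconj (xi * q')))%C).
      { unfold p'. rewrite ps_circle, psd_circle by auto. reflexivity. }
      assert (X : (Cconj p * (xi * p'))%C = (q * ((RtoC (INR n) + 1) * Cconj q - Cconj (xi * q')))%C).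
      { rewrite Ep, Ep', !Cmult_conj, Cconj_conj, Cpow_conj.
        assert (Y : (Cconj xi * xi)%C = 1) by now apply circle_conj.
        assert (Y' : (Cconj xi ^ n * xi ^ n)%C = 1).
        { rewrite <- Cpow_mult_l, Y. apply Cpow_1_l. }
        transitivity ((Cconj xi * xi) * (Cconj xi ^ n * xi ^ n) * q * ((RtoC (INR n) + 1) * Cconj q - (Cconj xi * Cconj q')))%C; [ring|].
        rewrite Y, Y'. ring. }
      rewrite X.
      assert (RE : forall u : C, RtoC (Re u) = ((u + Cconj u) / 2)%C) by apply re_alt.
      rewrite RtoC_minus, !RE. rewrite !Cmult_conj, !Cminus_conj, !Cmult_conj, Cplus_conj, !Cconj_RtoC, !Cconj_conj. field. }
    apply Rabs_le_between in Q1. apply Rabs_le_between in Q2. fold K0 in Q1, Q2. rewrite Epq in Q2.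
    apply Rabs_le. rewrite Eom. assert (0 <= (A + B) * h ^ 2) by (apply Rmult_le_pos; lra). lra.
  - eapply Rle_trans; [apply Cmod_rtriangle_abs|].
    replace (pe n x z - q)%C with ((pe n x z - q - q' * (z - xi)) + q' * (z - xi))%C by ring.
    eapply Rle_trans; [apply Cmod_triangle|]. rewrite Cmod_mult, Mzx.
    assert (Cmod q' * h <= B * h) by (apply Rmult_le_compat_r; unfold B; lra).
    assert (A1 * h ^ 2 <= A * h) by (apply Rmult_le_compat; unfold A; lra).
    assert (0 <= K0 * h) by (apply Rmult_le_pos; lra). lra.
  - eapply Rle_trans; [apply Cmod_rtriangle_abs|].
    replace (wron n x z - wron n x xi)%C with ((wron n x z - wron n x xi - C_derive (wron n x) xi * (z - xi)) + C_derive (wron n x) xi * (z - xi))%C by ring.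
    eapply Rle_trans; [apply Cmod_triangle|]. rewrite Cmod_mult, Mzx.
    assert (Cmod (C_derive (wron n x) xi) * h <= B * h) by (apply Rmult_le_compat_r; unfold B; lra).
    assert (A3 * h ^ 2 <= A * h) by (apply Rmult_le_compat; unfold A; lra).
    assert (0 <= K0 * h) by (apply Rmult_le_pos; lra). lra.
Qed.

Lemma disk_polar (z : C) : exists xi, Cmod xi = 1 /\ z = (RtoC (Cmod z) * xi)%C.
Proof. destruct (polar_form z) as [t Ht]. exists (cis t). split; [apply Cmod_cis|auto]. Qed.

Section Blaschke.
Variables (n : nat) (x : nat -> C) (dl : R).
Hypothesis Hzf : zero_free n x.
Hypothesis Hdl : 0 < dl.
Hypothesis Hom : forall xi, Cmod xi = 1 -> dl <= omega n x xi.

Lemma zero_free_neq (z : C) : Cmod z <= 1 -> pe n x z <> 0.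
Proof. destruct Hzf as [m [Hm H]]. intros Hz. apply Cmod_gt_0. specialize (H z Hz). lra. Qed.

Lemma holoD_pe : holoD (pe n x).
Proof. intros z _. eexists. apply pe_deriv. Qed.

Lemma holoD_ps : holoD (ps n x).
Proof. intros z _. eexists. apply ps_deriv. Qed.

Lemma holoD_wron : holoD (wron n x).
Proof. destruct (poly_cderiv _ _ (wron_poly n x)) as [g Hg]. intros z _. eexists. apply Hg. Qed.

Lemma blaschke_deriv (z : C) : Cmod z < 1 -> is_cderiv (blaschke n x) z (wron n x z * / (pe n x z * pe n x z))%C.
Proof.
  intros Hz. unfold blaschke. eapply is_cderiv_eq.
  - apply is_cderiv_div; [apply is_cderiv_zps|apply pe_deriv|apply zero_free_neq; lra].
  - reflexivity.
Qed.

Lemma holoD_blaschke : holoD (blaschke n x).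
Proof. intros z Hz. eexists. now apply blaschke_deriv. Qed.

Lemma near_circle_radius (K : R) : exists h0, 0 < h0 <= 1 /\ K * h0 <= dl.
Proof.
  exists (Rmin 1 (dl / (Rabs K + 1))). assert (P := Rabs_pos K).
  assert (0 < dl / (Rabs K + 1)) by (apply Rdiv_lt_0_compat; lra).
  split; [split; [apply Rmin_pos; lra|apply Rmin_l]|].
  assert (M := Rmin_r 1 (dl / (Rabs K + 1))). assert (Q : 0 < Rmin 1 (dl / (Rabs K + 1))) by (apply Rmin_pos; lra).
  assert (Rmin 1 (dl / (Rabs K + 1)) * (Rabs K + 1) <= dl).
  { replace dl with (dl / (Rabs K + 1) * (Rabs K + 1)) at 2 by (field; lra). apply Rmult_le_compat_r; lra. }
  assert (K <= Rabs K) by apply Rle_abs. nra.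
Qed.

(** The quotient [ps]/[pe] is the Blaschke product divided by z. Since [omega] is bounded below by
    [dl], the radial expansion gives |z ps| <= |pe| close to the circle, and the maximum principle
    carries |ps/pe| <= 1 inside. *)
Lemma ps_le_pe (z : C) : Cmod z < 1 -> Cmod (ps n x z) <= Cmod (pe n x z).
Proof.
  intros Hz. assert (Q : Cmod (ps n x z / pe n x z) <= 1).
  { revert z Hz. apply (max_modulus_limsup (fun z => ps n x z / pe n x z)%C).
    - apply holoD_div; [apply holoD_ps|apply holoD_pe|]. intros z Hz. apply zero_free_neq. lra.
    - intros e He. destruct (radial_expansion n x) as [K [HK H]].
      destruct (near_circle_radius K) as [h0 [Hh0 Kh0]].
      exists (Rmax (1 - h0) (/ (1 + e))). split.
      { apply Rmax_lub_lt; [lra|]. rewrite <- Rinv_1. apply Rinv_lt_contravar; lra. }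
      intros w Hw. destruct (disk_polar w) as [xi [Hxi Ew]].
      assert (W1 := Rmax_l (1 - h0) (/ (1 + e))). assert (W2 := Rmax_r (1 - h0) (/ (1 + e))).
      assert (Ip : 0 < / (1 + e)) by (apply Rinv_0_lt_compat; lra).
      set (h := 1 - Cmod w). assert (Hh : 0 < h <= h0) by (unfold h; lra).
      destruct (H xi h Hxi ltac:(lra)) as [H1 _].
      replace (RtoC (1 - h) * xi)%C with w in H1.
      2:{ rewrite Ew at 1. do 2 f_equal. unfold h. ring. }
      assert (O := Hom xi Hxi). apply Rabs_le_between in H1.
      assert (K * h <= dl) by nra. assert (K * h ^ 2 <= dl * h) by nra.
      assert (X : Cmod (w * ps n x w) ^ 2 <= Cmod (pe n x w) ^ 2).
      { assert (dl * h <= h * omega n x xi) by nra. assert (0 <= h * omega n x xi) by nra. lra. }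
      assert (Y : Cmod (w * ps n x w) <= Cmod (pe n x w)).
      { apply Rsqr_incr_0_var; [|apply Cmod_ge_0]. rewrite !Rsqr_pow2. exact X. }
      assert (N : pe n x w <> 0) by (apply zero_free_neq; lra). assert (Np := Cmod_neq0_pos _ N).
      rewrite Cmod_div by auto. rewrite Cmod_mult in Y.
      apply Rmult_le_reg_r with (Cmod (pe n x w)); auto. unfold Rdiv. rewrite Rmult_assoc, Rinv_l, Rmult_1_r by lra.
      assert (Iw : / Cmod w <= 1 + e).
      { rewrite <- (Rinv_inv (1 + e)). apply Rinv_le_contravar; lra. }
      apply Rle_trans with (/ Cmod w * (Cmod w * Cmod (ps n x w))).
      + apply Req_le. field. lra.
      + apply Rmult_le_compat; auto; try lra.
        * left. apply Rinv_0_lt_compat. lra.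
        * apply Rmult_le_pos; [lra|apply Cmod_ge_0]. }
  assert (N : pe n x z <> 0) by (apply zero_free_neq; lra). assert (Np := Cmod_neq0_pos _ N).
  rewrite Cmod_div in Q by auto. apply Rmult_le_reg_r with (/ Cmod (pe n x z)); [now apply Rinv_0_lt_compat|].
  rewrite Rinv_r by lra. exact Q.
Qed.

Lemma blaschke_le (z : C) : Cmod z < 1 -> Cmod (blaschke n x z) <= Cmod z.
Proof.
  intros Hz. unfold blaschke. assert (N : pe n x z <> 0) by (apply zero_free_neq; lra). assert (Np := Cmod_neq0_pos _ N).
  rewrite Cmod_div, Cmod_mult by auto. assert (L := ps_le_pe z Hz). assert (P := Cmod_ge_0 z).
  apply Rmult_le_reg_r with (Cmod (pe n x z)); auto. unfold Rdiv. rewrite Rmult_assoc, Rinv_l, Rmult_1_r by lra.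
  now apply Rmult_le_compat_l.
Qed.

Lemma self_map_blaschke : self_map (blaschke n x).
Proof. intros z Hz. eapply Rle_lt_trans; [now apply blaschke_le|auto]. Qed.

Lemma blaschke_0 : blaschke n x 0 = 0.
Proof. unfold blaschke, Cdiv. ring. Qed.

(** On the circle omega/|pe|^2 equals xi b'(xi)/b(xi), the angular derivative of the Blaschke
    product, and |b(z)| <= |z| makes it at least 1. The lemma bounds [pe], hence the coefficients,
    when only [omega] is controlled. *)
Lemma pe_sq_le_omega (xi : C) : Cmod xi = 1 -> Cmod (pe n x xi) ^ 2 <= omega n x xi.
Proof.
  intros Hxi. destruct (radial_expansion n x) as [K [HK H]].
  apply Rnot_lt_le. intros L. set (q := Cmod (pe n x xi)) in *. set (o := omega n x xi) in *.
  assert (q0 : 0 <= q) by apply Cmod_ge_0. assert (O := Hom xi Hxi). fold o in O.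
  set (K2 := 2 * K + 4 * K * q + q ^ 2 + 1). assert (PK2 : 0 < K2) by (unfold K2; nra).
  set (h := Rmin (1/2) ((q ^ 2 - o) / K2)).
  assert (Hh : 0 < h <= 1/2).
  { split; [apply Rmin_pos; [lra|]|apply Rmin_l]. apply Rdiv_lt_0_compat; lra. }
  assert (HhK : h * K2 <= q ^ 2 - o).
  { replace (q ^ 2 - o) with ((q ^ 2 - o) / K2 * K2) by (field; lra). apply Rmult_le_compat_r; [lra|apply Rmin_r]. }
  destruct (H xi h Hxi ltac:(lra)) as [H1 [H2 _]]. fold q in H2. fold o in H1.
  set (w := (RtoC (1 - h) * xi)%C) in *.
  assert (Mw : Cmod w = 1 - h) by (unfold w; rewrite Cmod_mult, Cmod_R, Hxi, Rabs_right; lra).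
  assert (Lw := ps_le_pe w ltac:(lra)). rewrite Cmod_mult, Mw in H1.
  set (Q := Cmod (pe n x w)) in *. set (P := Cmod (ps n x w)) in *.
  assert (P0 : 0 <= P) by apply Cmod_ge_0. assert (Q0 : 0 <= Q) by apply Cmod_ge_0.
  apply Rabs_le_between in H1. apply Rabs_le_between in H2.
  assert (P2 : ((1 - h) * P) ^ 2 <= (1 - h) ^ 2 * Q ^ 2).
  { rewrite Rpow_mult_distr. apply Rmult_le_compat_l; [apply pow2_ge_0|]. apply pow_incr; lra. }
  assert (E1 : (2 * h - h ^ 2) * Q ^ 2 <= 2 * h * o + K * h ^ 2) by nra.
  assert (E2 : (2 - h) * Q ^ 2 <= 2 * o + K * h).
  { apply Rmult_le_reg_l with h; [lra|]. lra. }
  assert (E3 : q ^ 2 - 2 * K * q * h <= Q ^ 2).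
  { destruct (Rle_lt_dec (q - K * h) 0) as [C1|C1].
    - assert (0 <= Q ^ 2) by apply pow2_ge_0. nra.
    - assert ((q - K * h) ^ 2 <= Q ^ 2) by (apply pow_incr; lra). nra. }
  assert ((2 - h) * (q ^ 2 - 2 * K * q * h) <= (2 - h) * Q ^ 2) by (apply Rmult_le_compat_l; lra).
  unfold K2 in HhK. assert (0 <= K * q * h) by (apply Rmult_le_pos; [apply Rmult_le_pos|]; lra).
  nra.
Qed.

(** At distance h from the circle both |pe|^2 - |z ps|^2 and (1 - |z|^2)|wron| are 2 h omega +
    O(h^2); as [omega] is at least [dl], their quotient tends to 1 uniformly. *)
Lemma blaschke_boundary_sharp : boundary_sharp (blaschke n x).
Proof.
  intros e He. destruct (radial_expansion n x) as [K [HK H]].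
  destruct (Rle_lt_dec 1 e) as [E1|E1].
  { exists 0. split; [lra|]. intros z Hz.
    assert (0 <= (1 - Cmod z ^ 2) * Cmod (C_derive (blaschke n x) z)).
    { apply Rmult_le_pos; [nra|apply Cmod_ge_0]. }
    assert (B := self_map_sq _ z self_map_blaschke ltac:(lra)). nra. }
  assert (Hob : exists Om, 0 < Om /\ forall xi, Cmod xi = 1 -> Cmod (wron n x xi) <= Om).
  { destruct (poly_cderiv _ _ (wron_poly n x)) as [g Hg].
    destruct (holo_bounded (wron n x) 0 2 1) as [Om [HO HOb]]; [intros z _; eexists; apply Hg|lra|].
    exists Om. split; auto. intros xi Hxi. apply HOb. replace (xi - 0)%C with xi by ring. lra. }
  destruct Hob as [Om [POm HOm]].
  (* The errors to absorb are K h^2 from the first expansion, 2 K h^2 from that of |wron|, and h^2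
     omega <= Om h^2 from 1 - |z|^2 = 2h - h^2, against the gain 2 e h omega. *)
  set (K2 := (3 * K + Om) / (2 * e)).
  destruct (near_circle_radius K2) as [h0 [Hh0 Kh0]].
  exists (1 - h0). split; [lra|]. intros z Hz.
  destruct (disk_polar z) as [xi [Hxi Ez]].
  set (h := 1 - Cmod z). assert (Hh : 0 < h <= h0) by (unfold h; lra).
  destruct (H xi h Hxi ltac:(lra)) as [H1 [_ H3]].
  replace (RtoC (1 - h) * xi)%C with z in H1, H3 by (rewrite Ez at 1; do 2 f_equal; unfold h; ring).
  assert (Mz : Cmod z = 1 - h) by (unfold h; ring).
  rewrite (is_cderiv_C_derive _ _ _ (blaschke_deriv z ltac:(lra))).
  assert (N : pe n x z <> 0) by (apply zero_free_neq; lra). assert (Np := Cmod_neq0_pos _ N).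
  unfold blaschke. rewrite (Cmod_mult (wron n x z)), Cmod_inv, (Cmod_mult (pe n x z)), Cmod_div by (auto using Cmult_neq_0).
  rewrite (wron_circle n x xi), (Cmod_mult (xi ^ n)), Cmod_pow, Hxi, pow1, Rmult_1_l, Cmod_R in H3 by auto.
  assert (O := Hom xi Hxi). rewrite (Rabs_right (omega n x xi)) in H3 by lra.
  assert (OO := HOm xi Hxi). rewrite (wron_circle n x xi), (Cmod_mult (xi ^ n)), Cmod_pow, Hxi, pow1, Rmult_1_l, Cmod_R, Rabs_right in OO by (auto; lra).
  set (o := omega n x xi) in *. set (q := Cmod (pe n x z)) in *.
  set (p := Cmod (z * ps n x z)) in *. set (W := Cmod (wron n x z)) in *.
  apply Rabs_le_between in H1. apply Rabs_le_between in H3.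
  apply Rmult_le_reg_r with (q ^ 2); [apply pow_lt; auto|].
  replace ((1 - e) * (1 - (p / q) ^ 2) * q ^ 2) with ((1 - e) * (q ^ 2 - p ^ 2)) by (field; lra).
  replace ((1 - Cmod z ^ 2) * (W * / (q * q)) * q ^ 2) with ((2 * h - h ^ 2) * W) by (rewrite Mz; field; lra).
  assert (KK : (3 * K + Om) * h <= 2 * e * o).
  { assert (K2 * h <= K2 * h0).
    { apply Rmult_le_compat_l; [|lra]. unfold K2. apply Rmult_le_pos; [lra|]. left. apply Rinv_0_lt_compat. lra. }
    assert ((3 * K + Om) * h = K2 * h * (2 * e)) by (unfold K2; field; lra). nra. }
  apply Rle_trans with ((1 - e) * (2 * h * o + K * h ^ 2)).
  { apply Rmult_le_compat_l; lra. }
  apply Rle_trans with ((2 * h - h ^ 2) * (o - K * h)).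
  2:{ apply Rmult_le_compat_l; [nra|lra]. }
  assert (h2 : 0 <= h ^ 2) by apply pow2_ge_0.
  assert (X1 : (1 - e) * (K * h ^ 2) <= K * h ^ 2) by nra.
  assert (X2 : h ^ 2 * o <= h ^ 2 * Om) by (apply Rmult_le_compat_l; lra).
  assert (X3 : (3 * K + Om) * h * h <= 2 * e * o * h) by (apply Rmult_le_compat_r; lra).
  assert (X4 : 0 <= K * h ^ 3) by (apply Rmult_le_pos; [lra|apply pow_le; lra]).
  nra.
Qed.

Lemma wron_nonzero : exists z, Cmod z < 1 /\ wron n x z <> 0.
Proof.
  destruct (radial_expansion n x) as [K [HK H]].
  destruct (near_circle_radius (2 * K)) as [h0 [Hh0 Kh0]].
  assert (H1 : Cmod (RtoC 1) = 1) by apply Cmod_1.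
  destruct (H (RtoC 1) h0 H1 ltac:(lra)) as [_ [_ H3]].
  rewrite (wron_circle n x (RtoC 1)), (Cmod_mult (RtoC 1 ^ n)), Cmod_pow, H1, pow1, Rmult_1_l, Cmod_R in H3 by auto.
  assert (O := Hom (RtoC 1) H1). rewrite (Rabs_right (omega n x (RtoC 1))) in H3 by lra. apply Rabs_le_between in H3.
  exists (RtoC (1 - h0) * RtoC 1)%C. split.
  - rewrite Cmod_mult, Cmod_R, H1, Rabs_right; lra.
  - apply Cmod_gt_0. lra.
Qed.

End Blaschke.

Lemma pe_eq_coef (n : nat) (x y : nat -> C) (nu : C) : (forall z, Cmod z < 1 -> pe n x z = (nu * pe n y z)%C) ->
  forall z, pe n x z = (nu * pe n y z)%C.
Proof.
  intros H. assert (P : is_poly n (fun z => pe n x z - nu * pe n y z)%C).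
  { apply is_poly_minus; [apply pe_poly|]. apply is_poly_scal, pe_poly. }
  assert (Z := poly_zero n _ (fun i => RtoC (/ (INR i + 2))) P).
  intros z. apply Cminus_eq0. apply Z.
  - intros i j _ _ E. apply RtoC_inj in E. apply Rinv_eq_reg in E. apply INR_eq. lra.
  - intros i _. cbv beta. rewrite H; [ring|]. rewrite Cmod_R, Rabs_right.
    + rewrite <- Rinv_1. apply Rinv_lt_contravar; generalize (pos_INR i); lra.
    + apply Rle_ge. left. apply Rinv_0_lt_compat. generalize (pos_INR i); lra.
Qed.

(* Finite Blaschke products vanishing at 0 are determined by their critical points. *)
Lemma wron_injective (n : nat) (x y : nat -> C) (d1 d2 : R) : zero_free n x -> zero_free n y -> 0 < d1 -> 0 < d2 ->
  (forall xi, Cmod xi = 1 -> d1 <= omega n x xi) -> (forall xi, Cmod xi = 1 -> d2 <= omega n y xi) ->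
  (forall z, wron n x z = wron n y z) ->
  exists nu, Cmod nu = 1 /\ forall z, pe n x z = (nu * pe n y z)%C.
Proof.
  intros Zx Zy Hd1 Hd2 Ox Oy HW.
  assert (Hx := holoD_blaschke n x Zx). assert (Hy := holoD_blaschke n y Zy).
  assert (Sx := self_map_blaschke n x d1 Zx Hd1 Ox). assert (Sy := self_map_blaschke n y d2 Zy Hd2 Oy).
  assert (Bx := blaschke_boundary_sharp n x d1 Zx Hd1 Ox). assert (By := blaschke_boundary_sharp n y d2 Zy Hd2 Oy).
  set (F := fun w => (/ (pe n x w * pe n x w))%C). set (G := fun w => (/ (pe n y w * pe n y w))%C).
  assert (NX : forall z, Cmod z < 1 -> pe n x z <> 0) by (intros; apply zero_free_neq; auto; lra).
  assert (NY : forall z, Cmod z < 1 -> pe n y z <> 0) by (intros; apply zero_free_neq; auto; lra).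
  assert (HF : holoD F).
  { intros z Hz. eexists. apply is_cderiv_inv; [|now apply Cmult_neq_0; apply NX].
    apply is_cderiv_mult; apply pe_deriv. }
  assert (HG : holoD G).
  { intros z Hz. eexists. apply is_cderiv_inv; [|now apply Cmult_neq_0; apply NY].
    apply is_cderiv_mult; apply pe_deriv. }
  assert (Fn : forall z, Cmod z < 1 -> F z <> 0).
  { intros z Hz E. apply (Cmult_neq_0 _ _ (NX z Hz) (NX z Hz)).
    transitivity (pe n x z * pe n x z * (pe n x z * pe n x z) * F z)%C; [unfold F; field; auto|rewrite E; ring]. }
  assert (Gn : forall z, Cmod z < 1 -> G z <> 0).
  { intros z Hz E. apply (Cmult_neq_0 _ _ (NY z Hz) (NY z Hz)).
    transitivity (pe n y z * pe n y z * (pe n y z * pe n y z) * G z)%C; [unfold G; field; auto|rewrite E; ring]. }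
  assert (Wn := wron_nonzero n x d1 Hd1 Ox).
  assert (Dx : forall z, Cmod z < 1 -> C_derive (blaschke n x) z = (wron n x z * F z)%C).
  { intros z Hz. apply is_cderiv_C_derive. now apply blaschke_deriv. }
  assert (Dy : forall z, Cmod z < 1 -> C_derive (blaschke n y) z = (wron n x z * G z)%C).
  { intros z Hz. rewrite HW. apply is_cderiv_C_derive. now apply blaschke_deriv. }
  assert (C1 : forall z, Cmod z < 1 -> Cmod (F z) * (1 - Cmod (blaschke n y z) ^ 2) <= Cmod (G z) * (1 - Cmod (blaschke n x z) ^ 2)).
  { intros z Hz. rewrite <- (Cmult_1_l (F z)).
    apply (ahlfors_comparison (blaschke n x) (blaschke n y) (wron n x) F G (fun _ => RtoC 1) (fun _ => 1)); auto using holoD_wron, holoD_const; try lra.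
    - intros; apply ccont_const.
    - intros; rewrite Cmod_1; lra.
    - intros; lra. }
  assert (C2 : forall z, Cmod z < 1 -> Cmod (G z) * (1 - Cmod (blaschke n x z) ^ 2) <= Cmod (F z) * (1 - Cmod (blaschke n y z) ^ 2)).
  { intros z Hz. rewrite <- (Cmult_1_l (G z)).
    apply (ahlfors_comparison (blaschke n y) (blaschke n x) (wron n x) G F (fun _ => RtoC 1) (fun _ => 1)); auto using holoD_wron, holoD_const; try lra.
    - intros; apply ccont_const.
    - intros; rewrite Cmod_1; lra.
    - intros; lra. }
  assert (D0 : Cmod 0 < 1) by (rewrite Cmod_0; lra).
  destruct (density_rigidity (blaschke n x) (blaschke n y) (wron n x) F G) as [mu [Hmu Emu]]; auto using holoD_wron, blaschke_0.
  { assert (A := C1 0 D0). assert (B := C2 0 D0). rewrite !blaschke_0, Cmod_0 in A, B. lra. }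
  assert (mun : mu <> 0) by (apply Cmod_gt_0; lra).
  (* b_x = mu b_y gives q_y^2 = mu q_x^2, so q_y / q_x is locally constant. *)
  assert (EFG : forall z, Cmod z < 1 -> (F z - mu * G z)%C = 0).
  { apply (identity_mult (wron n x) (fun z => F z - mu * G z)%C); auto using holoD_wron.
    - apply holoD_minus; auto. apply holoD_mult; auto using holoD_const.
    - intros z Hz. transitivity (C_derive (blaschke n x) z - mu * C_derive (blaschke n y) z)%C.
      + rewrite Dx, Dy by auto. ring.
      + rewrite (C_derive_ext (fun z => mu * blaschke n y z)%C (blaschke n x) z); auto.
        * rewrite (is_cderiv_C_derive (fun z => mu * blaschke n y z)%C z (mu * C_derive (blaschke n y) z)%C); [ring|].
          eapply is_cderiv_eq; [apply is_cderiv_mult; [apply is_cderiv_const|apply holoD_deriv; auto]|]. cbv beta; ring.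
        * intros w Hw. symmetry. now apply Emu.
        * apply holoD_mult; auto using holoD_const. }
  set (s := fun z => (pe n x z / pe n y z)%C).
  assert (Hs : holoD s) by (apply holoD_div; auto using holoD_pe).
  assert (Ess : forall z, Cmod z < 1 -> (s z * s z)%C = (/ mu)%C).
  { intros z Hz. assert (E := EFG z Hz). apply Cminus_eq0 in E. unfold F, G in E. unfold s.
    assert (X := NX z Hz). assert (Y := NY z Hz).
    transitivity ((/ mu) * ((mu * / (pe n y z * pe n y z)) * (pe n x z * pe n x z)))%C; [field; auto|].
    rewrite <- E. field. auto. }
  assert (Sc : forall z, Cmod z < 1 -> s z = s 0).
  { intros z Hz. apply (deriv_zero_const s 0 1).
    - intros w Hw. replace (w - 0)%C with w in Hw by ring.
      assert (D1 := holoD_deriv s w Hs Hw).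
      assert (D2 := is_cderiv_mult _ _ _ _ _ D1 D1).
      assert (D3 : is_cderiv (fun w => s w * s w)%C w 0).
      { apply is_cderiv_ext_loc with (f := fun _ => (/ mu)%C) (r := 1 - Cmod w); [lra| |apply is_cderiv_const].
        intros v Hv. symmetry. apply Ess. now apply (disk_nbhd w). }
      assert (E := is_cderiv_unique _ _ _ _ D2 D3).
      assert (sn : s w <> 0).
      { intros E'. specialize (Ess w Hw). rewrite E' in Ess. rewrite Cmult_0_l in Ess.
        apply (f_equal (fun t => (t * mu)%C)) in Ess. rewrite Cinv_l in Ess by auto.
        apply C1_nz. rewrite <- Ess. ring. }
      eapply is_cderiv_eq; [exact D1|].
      transitivity ((C_derive s w * s w + s w * C_derive s w) / (2 * s w))%C; [field; auto|rewrite E; unfold Cdiv; ring].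
    - now replace (z - 0)%C with z by ring. }
  exists (s 0). split.
  - assert (E := f_equal Cmod (Ess 0 D0)). rewrite Cmod_mult, Cmod_inv, Hmu, Rinv_1 in E by auto.
    assert (P := Cmod_ge_0 (s 0)). nra.
  - apply pe_eq_coef. intros z Hz. rewrite <- (Sc z Hz). unfold s. field. now apply NY.
Qed.

(** * Linear algebra over the reals *)

Fixpoint rsum (f : nat -> R) (n : nat) : R :=
  match n with O => 0 | S m => rsum f m + f m end.

Lemma rsum_ext (f g : nat -> R) (n : nat) : (forall k, (k < n)%nat -> f k = g k) -> rsum f n = rsum g n.
Proof.
  induction n as [|n IH]; intros H; simpl; auto. rewrite IH, H; auto.
Qed.

Lemma rsum_lin (f g : nat -> R) (a : R) (n : nat) : rsum (fun k => f k + a * g k) n = rsum f n + a * rsum g n.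
Proof. induction n as [|n IH]; simpl; [ring|]. rewrite IH. ring. Qed.

Lemma rsum_zero (f : nat -> R) (n : nat) : (forall k, (k < n)%nat -> f k = 0) -> rsum f n = 0.
Proof. induction n as [|n IH]; intros H; simpl; auto. rewrite IH, H; auto. ring. Qed.

(** The increasing enumeration of the indices other than the pivot p. *)
Definition skip (p j : nat) : nat := if Nat.ltb j p then j else S j.

Lemma rsum_skip (f : nat -> R) (n p : nat) : (p <= n)%nat -> rsum f (S n) = f p + rsum (fun j => f (skip p j)) n.
Proof.
  induction n as [|n IH]; intros Hp.
  - replace p with O by lia. simpl. ring.
  - destruct (Nat.eq_dec p (S n)) as [->|N].
    + cbn [rsum]. rewrite (rsum_ext (fun j => f (skip (S n) j)) f n).
      * unfold skip. rewrite (proj2 (Nat.ltb_lt n (S n))) by lia. ring.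
      * intros k Hk. unfold skip. now rewrite (proj2 (Nat.ltb_lt k (S n))) by lia.
    + change (rsum f (S (S n))) with (rsum f (S n) + f (S n)). rewrite IH by lia.
      cbn [rsum]. replace (skip p n) with (S n); [ring|].
      unfold skip. now rewrite (proj2 (Nat.ltb_ge n p)) by lia.
Qed.

(** Gaussian elimination on n equations in n + 1 unknowns: a pivot in the last row removes one
    unknown and that row. If the last row vanishes, the last unknown is put to 0 instead. *)
Lemma dependent_columns (n : nat) : forall A : nat -> nat -> R,
  exists c : nat -> R, (exists j, (j <= n)%nat /\ c j <> 0) /\
    forall i, (i < n)%nat -> rsum (fun j => A i j * c j) (S n) = 0.
Proof.
  induction n as [|n IH]; intros A.
  - exists (fun _ => 1). split; [exists O; split; [lia|lra]|intros; lia].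
  - destruct (classic (exists p, (p <= S n)%nat /\ A n p <> 0)) as [[p [Hp Np]]|H].
    + destruct (IH (fun i j => A i (skip p j) - A n (skip p j) / A n p * A i p)) as [c [[j [Hj Nj]] Hc]].
      set (cp := - rsum (fun j => A n (skip p j) * c j) (S n) / A n p).
      set (d := fun m => if Nat.eq_dec m p then cp else c (if Nat.ltb m p then m else (m - 1)%nat)).
      assert (Dp : d p = cp) by (unfold d; destruct (Nat.eq_dec p p); congruence).
      assert (Ds : forall k, d (skip p k) = c k).
      { intros k. unfold d, skip. destruct (Nat.ltb_spec k p) as [L|L].
        - destruct (Nat.eq_dec k p); [lia|]. now rewrite (proj2 (Nat.ltb_lt k p)) by lia.
        - destruct (Nat.eq_dec (S k) p); [lia|]. rewrite (proj2 (Nat.ltb_ge (S k) p)) by lia. f_equal. lia. }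
      exists d. split.
      * exists (skip p j). rewrite Ds. split; auto. unfold skip. destruct (Nat.ltb_spec j p); lia.
      * intros i Hi. rewrite (rsum_skip _ (S n) p) by lia. rewrite Dp.
        rewrite (rsum_ext (fun k => A i (skip p k) * d (skip p k)) (fun k => A i (skip p k) * c k)) by (intros; now rewrite Ds).
        destruct (Nat.eq_dec i n) as [->|Ni].
        -- unfold cp. field. auto.
        -- assert (E := Hc i ltac:(lia)).
           rewrite (rsum_ext _ (fun k => A i (skip p k) * c k + (- (A i p / A n p)) * (A n (skip p k) * c k))) in E.
           2:{ intros k _. field. auto. }
           rewrite rsum_lin in E. unfold cp. rewrite <- E. field. auto.
    + destruct (IH A) as [c [[j [Hj Nj]] Hc]].
      exists (fun m => if Nat.eq_dec m (S n) then 0 else c m). split.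
      * exists j. destruct (Nat.eq_dec j (S n)); [lia|]. auto.
      * intros i Hi. destruct (Nat.eq_dec i n) as [->|Ni].
        -- apply rsum_zero. intros k Hk. replace (A n k) with 0; [ring|].
           symmetry. apply NNPP. intros N. apply H. exists k. split; [lia|auto].
        -- change (rsum (fun j0 => A i j0 * (if Nat.eq_dec j0 (S n) then 0 else c j0)) (S (S n)))
             with (rsum (fun j0 => A i j0 * (if Nat.eq_dec j0 (S n) then 0 else c j0)) (S n)
               + A i (S n) * (if Nat.eq_dec (S n) (S n) then 0 else c (S n))).
           rewrite (rsum_ext _ (fun j0 => A i j0 * c j0)).
           ++ rewrite Hc by lia. destruct (Nat.eq_dec (S n) (S n)); [ring|congruence].
           ++ intros k Hk. destruct (Nat.eq_dec k (S n)); [lia|auto].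
Qed.

(** The images of the N unit vectors together with y are N + 1 columns of height N, hence dependent.
    Injectivity makes the coefficient of y nonzero, and the relation can be solved for y. *)
Lemma injective_surjective (N : nat) (T : (nat -> R) -> nat -> R) :
  (forall u v a i, T (fun k => u k + a * v k) i = T u i + a * T v i) ->
  (forall u v i, (forall k, (k < N)%nat -> u k = v k) -> T u i = T v i) ->
  (forall u, (forall i, (i < N)%nat -> T u i = 0) -> forall k, (k < N)%nat -> u k = 0) ->
  forall y : nat -> R, exists u, forall i, (i < N)%nat -> T u i = y i.
Proof.
  intros Hlin Hext Hinj y.
  set (e := fun j k : nat => if Nat.eq_dec k j then 1 else 0).
  destruct (dependent_columns N (fun i j => if Nat.ltb j N then T (e j) i else y i)) as [c [[j [Hj Nj]] Hc]].
  assert (T0 : forall i, T (fun _ => 0) i = 0).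
  { intros i. assert (E := Hlin (fun _ => 0) (fun _ => 0) 1 i).
    rewrite (Hext (fun k => 0 + 1 * 0) (fun _ => 0)) in E by (intros; ring). lra. }
  assert (Tc : forall i, T c i = rsum (fun j => T (e j) i * c j) N).
  { intros i. assert (G : forall m, T (fun k => if Nat.ltb k m then c k else 0) i = rsum (fun j => T (e j) i * c j) m).
    { induction m as [|m IHm].
      - simpl. transitivity (T (fun _ => 0) i); [apply Hext; intros; reflexivity|apply T0].
      - simpl rsum. rewrite <- IHm, (Rmult_comm (T (e m) i)), <- Hlin. apply Hext. intros k _. unfold e.
        destruct (Nat.ltb_spec k (S m)); destruct (Nat.ltb_spec k m); destruct (Nat.eq_dec k m); try lia; subst; try ring. }
    rewrite <- G. apply Hext. intros k Hk. now rewrite (proj2 (Nat.ltb_lt k N)) by lia. }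
  assert (E : forall i, (i < N)%nat -> T c i + y i * c N = 0).
  { intros i Hi. rewrite Tc, <- (Hc i Hi). cbn [rsum]. rewrite Nat.ltb_irrefl. f_equal.
    apply rsum_ext. intros k Hk. now rewrite (proj2 (Nat.ltb_lt k N)) by lia. }
  destruct (Req_dec (c N) 0) as [Z|Z].
  - exfalso. apply Nj. destruct (Nat.eq_dec j N) as [->|N']; auto.
    apply Hinj; [|lia]. intros i Hi. specialize (E i Hi). rewrite Z in E. lra.
  - exists (fun k => 0 + (- / c N) * c k). intros i Hi. rewrite (Hlin (fun _ => 0) c), T0.
    specialize (E i Hi). replace (T c i) with (- (y i * c N)) by lra. field. auto.
Qed.

Lemma pe_ext (n : nat) : forall x y z, (forall k, (k <= n)%nat -> x k = y k) -> pe n x z = pe n y z.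
Proof.
  induction n as [|n IH]; intros x y z H; simpl; [apply H; lia|].
  rewrite H by lia. f_equal. f_equal. apply IH. intros k Hk. apply H. lia.
Qed.

Lemma pd_ext (n : nat) : forall x y z, (forall k, (k <= n)%nat -> x k = y k) -> pd n x z = pd n y z.
Proof.
  induction n as [|n IH]; intros x y z H; simpl; auto.
  rewrite (IH (fun k => x (S k)) (fun k => y (S k))) by (intros; apply H; lia).
  rewrite (pe_ext n (fun k => x (S k)) (fun k => y (S k))) by (intros; apply H; lia). reflexivity.
Qed.

Lemma omega2_ext (n : nat) (x r s : nat -> C) (xi : C) : (forall k, (k <= n)%nat -> r k = s k) ->
  omega2 n x r xi = omega2 n x s xi.
Proof. intros H. unfold omega2. now rewrite (pe_ext n r s), (pd_ext n r s). Qed.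

Lemma omega2_lin (n : nat) (x r s : nat -> C) (a : R) (xi : C) :
  omega2 n x (fun k => r k + RtoC a * s k)%C xi = omega2 n x r xi + a * omega2 n x s xi.
Proof.
  unfold omega2. rewrite pe_lin, pd_lin.
  destruct (pe n x xi), (pe n r xi), (pe n s xi), (pd n x xi), (pd n r xi), (pd n s xi), xi. simpl. ring.
Qed.

(** * The continuity method for prescribed Wronskians *)

(** The indices 0 to 2n give as many nodes as a polynomial of degree at most 2n has coefficients.
    Their angles lie in [0, 1), where the cosine is injective, so they are distinct. *)
Definition node (n i : nat) : C := cis (INR i / INR (n + n + 1)).

Lemma Cmod_node (n i : nat) : Cmod (node n i) = 1.
Proof. apply Cmod_cis. Qed.

Lemma node_inj (n i j : nat) : (i <= n + n)%nat -> (j <= n + n)%nat -> node n i = node n j -> i = j.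
Proof.
  intros Hi Hj E. unfold node, cis in E. injection E as E _.
  assert (P : 0 < INR (n + n + 1)) by (apply lt_0_INR; lia).
  assert (R : forall k, (k <= n + n)%nat -> 0 <= INR k / INR (n + n + 1) <= PI).
  { intros k Hk. assert (INR k / INR (n + n + 1) <= 1).
    { apply Rmult_le_reg_r with (INR (n + n + 1)); auto. unfold Rdiv. rewrite Rmult_assoc, Rinv_l, Rmult_1_r, Rmult_1_l by lra.
      apply le_INR. lia. }
    split; [|generalize PI2_1; lra].
    apply Rmult_le_pos; [apply pos_INR|left; now apply Rinv_0_lt_compat]. }
  assert (X : INR i / INR (n + n + 1) = INR j / INR (n + n + 1)).
  { destruct (R i Hi), (R j Hj).
    destruct (Rtotal_order (INR i / INR (n + n + 1)) (INR j / INR (n + n + 1))) as [L|[L|L]]; auto.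
    - apply cos_decreasing_1 in L; auto; lra.
    - apply cos_decreasing_1 in L; auto; lra. }
  apply INR_eq. apply Rmult_eq_reg_r with (/ INR (n + n + 1)); [exact X|].
  apply Rinv_neq_0_compat. lra.
Qed.

Definition of_coords (v : nat -> R) (k : nat) : C := (v (2 * k)%nat, v (2 * k + 1)%nat).

Lemma omega_bounded (n : nat) (x : nat -> C) : exists B, 0 < B /\
  (forall z, Cmod z <= 1 -> Cmod (pe n x z) <= B) /\ forall xi, Cmod xi = 1 -> Rabs (omega n x xi) <= B.
Proof.
  assert (H1 : holo_on 0 2 (pe n x)) by (intros z _; eexists; apply pe_deriv).
  assert (H2 : holo_on 0 2 (wron n x)).
  { destruct (poly_cderiv _ _ (wron_poly n x)) as [g Hg]. intros z _. eexists. apply Hg. }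
  destruct (holo_bounded _ 0 2 1 H1) as [B1 [PB1 BB1]]; [lra|].
  destruct (holo_bounded _ 0 2 1 H2) as [B2 [PB2 BB2]]; [lra|].
  exists (B1 + B2). split; [lra|]. split.
  - intros z Hz. specialize (BB1 z). replace (z - 0)%C with z in BB1 by ring. specialize (BB1 Hz). lra.
  - intros xi Hxi. specialize (BB2 xi). replace (xi - 0)%C with xi in BB2 by ring.
    rewrite wron_circle, Cmod_mult, Cmod_pow, Hxi, pow1, Rmult_1_l, Cmod_R in BB2 by auto.
    specialize (BB2 (Rle_refl 1)). lra.
Qed.

Lemma zero_free_perturb (n : nat) (x r : nat -> C) : zero_free n x ->
  exists t0, 0 < t0 /\ forall t, Rabs t <= t0 -> zero_free n (fun k => x k + RtoC t * r k)%C.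
Proof.
  intros [m [Hm H]]. destruct (omega_bounded n r) as [B [HB [HB1 _]]].
  exists (m / (2 * B)). split; [apply Rdiv_lt_0_compat; lra|]. intros t Ht.
  exists (m / 2). split; [lra|]. intros z Hz. rewrite pe_lin.
  assert (A := H z Hz). assert (D := HB1 z Hz).
  replace (pe n x z + RtoC t * pe n r z)%C with (pe n x z - - (RtoC t * pe n r z))%C by ring.
  eapply Rle_trans; [|apply Cmod_rtriangle]. rewrite Cmod_opp, Cmod_mult, Cmod_R.
  assert (Rabs t * Cmod (pe n r z) <= m / (2 * B) * B).
  { apply Rmult_le_compat; auto; [apply Rabs_pos|apply Cmod_ge_0]. }
  replace (m / (2 * B) * B) with (m / 2) in H0 by (field; lra). lra.
Qed.

(* omega is quadratic, so if its differential at x vanishes in the direction r, then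
   x + t r and x - t r have the same Wronskian; hence wron_injective controls the kernel
   of the differential, and a dimension count gives surjectivity. *)
Lemma omega2_surjective (n : nat) (x : nat -> C) (dl : R) : zero_free n x -> 0 < dl ->
  (forall xi, Cmod xi = 1 -> dl <= omega n x xi) ->
  forall y : nat -> R, exists r : nat -> C, forall i, (i <= n + n)%nat -> omega2 n x r (node n i) = y i.
Proof.
  intros Hzf Hdl Hom y.
  (* The 2n + 2 real coordinates of the direction face 2n + 1 node values and one gauge equation.
     Rotating the coefficients leaves the Wronskian unchanged, so the direction i x is always in the
     kernel; the condition on the constant coefficient excludes it. *)
  set (T := fun v i => if Nat.leb i (n + n) then omega2 n x (of_coords v) (node n i)
     else Im (Cconj (x O) * of_coords v O)).
  destruct (injective_surjective (2 * n + 2) T) with (y := y) as [u Hu].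
  - intros u v a i. unfold T. destruct (Nat.leb i (n + n)).
    + rewrite <- omega2_lin. apply omega2_ext. intros k _. unfold of_coords, RtoC, Cmult, Cplus; simpl. f_equal; ring.
    + unfold of_coords. simpl. ring.
  - intros u v i H. unfold T.
    assert (E : forall k, (k <= n)%nat -> of_coords u k = of_coords v k).
    { intros k Hk. unfold of_coords. rewrite !H by lia. reflexivity. }
    destruct (Nat.leb i (n + n)); [now apply omega2_ext|]. now rewrite E by lia.
  - intros u H. set (r := of_coords u).
    assert (N0 : forall i, (i <= n + n)%nat -> omega2 n x r (node n i) = 0).
    { intros i Hi. specialize (H i ltac:(lia)). unfold T in H. now rewrite (proj2 (Nat.leb_le i (n + n))) in H by lia. }
    assert (G0 : Im (Cconj (x O) * r O) = 0).
    { specialize (H (2 * n + 1)%nat ltac:(lia)). unfold T in H. now rewrite (proj2 (Nat.leb_gt (2 * n + 1) (n + n))) in H by lia. }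
    assert (W2 : forall z, wron2 n x r z = 0).
    { apply (poly_zero (n + n) (wron2 n x r) (node n)).
      - apply wron2_poly.
      - intros. now apply (node_inj n).
      - intros i Hi. rewrite wron2_circle by apply Cmod_node. rewrite N0 by auto. ring. }
    assert (O2 : forall xi, Cmod xi = 1 -> omega2 n x r xi = 0).
    { intros xi Hxi. apply (omega_unique n xi); auto. rewrite <- wron2_circle, W2 by auto. ring. }
    destruct (omega_bounded n r) as [B [HB [_ HB2]]].
    destruct (zero_free_perturb n x r Hzf) as [t0 [Ht0 Hzt]].
    (* Small enough for both x + t r and x - t r to be zero-free with [omega] at least dl/2, as
       [wron_injective] demands. *)
    set (t := Rmin (Rmin t0 1) (dl / (2 * B))).
    assert (Ht : 0 < t). { repeat apply Rmin_pos; try lra. apply Rdiv_lt_0_compat; lra. }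
    assert (t1 : t <= t0) by (eapply Rle_trans; [apply Rmin_l|apply Rmin_l]).
    assert (t2 : t <= 1) by (eapply Rle_trans; [apply Rmin_l|apply Rmin_r]).
    assert (t3 : t * B <= dl / 2).
    { replace (dl / 2) with (dl / (2 * B) * B) by (field; lra). apply Rmult_le_compat_r; [lra|apply Rmin_r]. }
    clearbody t.
    assert (Zp := Hzt t ltac:(rewrite Rabs_right; lra)).
    assert (Zm := Hzt (- t) ltac:(rewrite Rabs_left; lra)).
    assert (Op : forall s, s * s = t * t -> forall xi, Cmod xi = 1 -> dl / 2 <= omega n (fun k => x k + RtoC s * r k)%C xi).
    { intros s Es xi Hxi. rewrite omega_quad, O2, Es by auto. assert (A := Hom xi Hxi). assert (D := HB2 xi Hxi).
      apply Rabs_le_between in D. assert (t * t * B <= dl / 2) by nra. nra. }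
    destruct (wron_injective n _ _ (dl / 2) (dl / 2) Zp Zm) as [nu [Hnu Enu]]; try lra.
    { apply Op. ring. } { apply Op. ring. }
    { intros z. rewrite !wron_quad, W2. replace (- t * - t) with (t * t) by ring. ring. }
    assert (E : forall z, (RtoC t * (1 + nu) * pe n r z)%C = ((nu - 1) * pe n x z)%C).
    { intros z. specialize (Enu z). rewrite !pe_lin in Enu. rewrite RtoC_opp in Enu.
      transitivity (pe n x z + RtoC t * pe n r z - pe n x z + nu * RtoC t * pe n r z)%C; [ring|]. rewrite Enu. ring. }
    assert (tn : RtoC t <> 0) by (intros E'; apply RtoC_inj in E'; lra).
    assert (X0 : forall (a : nat -> C), pe n a 0 = a O) by (intros a; destruct n; simpl; [auto|ring]).
    assert (xn : x O <> 0). { rewrite <- X0. apply zero_free_neq; auto. rewrite Cmod_0. lra. }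
    assert (np : (1 + nu)%C <> 0).
    { intros E'. assert (E0 := E 0). rewrite E', !X0 in E0.
      assert (nu = (-1)%C) by (apply Cminus_eq0; rewrite <- E'; ring). subst nu.
      apply xn. transitivity (/ (-1 - 1) * ((-1 - 1) * x O))%C; [field|rewrite <- E0; ring].
    }
    (* (nu - 1)/(nu + 1) is purely imaginary for |nu| = 1; the gauge condition kills it. *)
    assert (n1 : nu = 1).
    { assert (E0 := E 0). rewrite !X0 in E0.
      assert (R0 : r O = ((nu - 1) * Cconj (1 + nu) * RtoC (/ (t * Cmod (1 + nu) ^ 2)) * x O)%C).
      { assert (NN : RtoC (Cmod (1 + nu) ^ 2) = ((1 + nu) * Cconj (1 + nu))%C) by apply Cmod2_conj.
        assert (Mp := Cmod_neq0_pos _ np). assert (cn : Cconj (1 + nu) <> 0) by (apply Cmod_gt_0; now rewrite Cmod_conj).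
        rewrite RtoC_inv, RtoC_mult, NN by (apply Rmult_integral_contrapositive_currified; [lra|apply pow_nonzero; lra]).
        transitivity (/ (RtoC t * (1 + nu)) * (RtoC t * (1 + nu) * r O))%C; [field; auto|]. rewrite E0. field. auto. }
      rewrite R0 in G0. assert (Mp := Cmod_neq0_pos _ np). set (q := / (t * Cmod (1 + nu) ^ 2)) in *.
      assert (qp : 0 < q). { apply Rinv_0_lt_compat. apply Rmult_lt_0_compat; [lra|]. now apply pow_lt. }
      assert (xp := Cmod_neq0_pos _ xn). assert (x2 := Cmod2_expand (x O)). assert (u2 := Cmod2_expand nu). rewrite Hnu in u2.
      assert (I : Im (Cconj (x O) * ((nu - 1) * Cconj (1 + nu) * RtoC q * x O)) = 2 * snd nu * q * Cmod (x O) ^ 2).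
      { rewrite x2. destruct nu as [a b], (x O) as [c d]. simpl. ring. }
      rewrite I in G0.
      assert (s0 : snd nu = 0).
      { assert (0 < q * Cmod (x O) ^ 2) by (apply Rmult_lt_0_compat; [lra|now apply pow_lt]).
        apply Rmult_eq_reg_r with (q * Cmod (x O) ^ 2); lra. }
      destruct nu as [a b]. simpl in s0, u2. subst b.
      assert (a = 1 \/ a = -1) as [-> | ->].
      { assert ((a - 1) * (a + 1) = 0) by lra. apply Rmult_integral in H0. lra. }
      - reflexivity.
      - exfalso. apply np. unfold Cplus; simpl. unfold RtoC. f_equal; ring. }
    assert (Pr : forall z, pe n r z = 0).
    { intros z. specialize (E z). rewrite n1 in E.
      transitivity (/ (RtoC t * (1 + 1)) * (RtoC t * (1 + 1) * pe n r z))%C.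
      - field. auto.
      - rewrite E. ring. }
    assert (Rz : forall k, (k <= n)%nat -> r k = 0).
    { intros k Hk. apply Cmod_le0.
      assert (A := coef_bound n r 0 (fun xi _ => Req_le _ _ (eq_trans (f_equal Cmod (Pr xi)) Cmod_0)) k Hk). lra. }
    intros k Hk. destruct (Nat.Even_or_Odd k) as [[j Ej]|[j Ej]].
    + assert (E2 := Rz j ltac:(lia)). unfold r, of_coords in E2. injection E2 as E2 _. now rewrite Ej.
    + assert (E2 := Rz j ltac:(lia)). unfold r, of_coords in E2. injection E2 as _ E2. now rewrite Ej.
  - exists (of_coords u). intros i Hi. rewrite <- (Hu i) by lia. unfold T. now rewrite (proj2 (Nat.leb_le i (n + n))) by lia.
Qed.

Lemma pe_lower_inside (n : nat) (x : nat -> C) (eta : R) : zero_free n x -> 0 < eta ->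
  (forall xi, Cmod xi = 1 -> eta <= Cmod (pe n x xi)) -> forall z, Cmod z <= 1 -> eta <= Cmod (pe n x z).
Proof.
  intros Hzf He Hc z [Hz|Hz]; [|auto].
  assert (N : forall z, Cmod z < 1 -> pe n x z <> 0) by (intros; apply zero_free_neq; auto; lra).
  assert (B : Cmod (/ pe n x z) <= / eta).
  { apply (max_modulus_limsup (fun z => / pe n x z)%C); auto.
    - intros w Hw. eexists. apply is_cderiv_inv; [apply pe_deriv|auto].
    - intros e Hep. destruct (radial_expansion n x) as [K [HK H]].
      assert (Ie : 0 < / eta) by now apply Rinv_0_lt_compat.
      set (m := / (/ eta + e)). assert (Hm : 0 < m < eta).
      { unfold m. split; [apply Rinv_0_lt_compat; lra|]. assert (X : / (/ eta + e) < / / eta); [|now rewrite Rinv_inv in X].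
        apply Rinv_lt_contravar; [apply Rmult_lt_0_compat; lra|lra]. }
      set (h0 := Rmin 1 ((eta - m) / K)). assert (Hh0 : 0 < h0 <= 1).
      { split; [apply Rmin_pos; [lra|apply Rdiv_lt_0_compat; lra]|apply Rmin_l]. }
      assert (Kh : K * h0 <= eta - m).
      { replace (eta - m) with (K * ((eta - m) / K)) by (field; lra). apply Rmult_le_compat_l; [lra|apply Rmin_r]. }
      exists (1 - h0). split; [lra|]. intros w Hw. destruct (disk_polar w) as [xi [Hxi Ew]].
      set (h := 1 - Cmod w). destruct (H xi h Hxi ltac:(unfold h; lra)) as [_ [H2 _]].
      replace (RtoC (1 - h) * xi)%C with w in H2 by (rewrite Ew at 1; do 2 f_equal; unfold h; ring).
      apply Rabs_le_between in H2. assert (C0 := Hc xi Hxi).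
      assert (K * h <= K * h0) by (apply Rmult_le_compat_l; unfold h; lra).
      rewrite Cmod_inv by (apply N; lra). replace (/ eta + e) with (/ m) by (unfold m; now rewrite Rinv_inv).
      apply Rinv_le_contravar; lra. }
  rewrite Cmod_inv in B by auto. assert (P := Cmod_neq0_pos _ (N z Hz)).
  apply Rnot_lt_le. intros L. apply Rinv_lt_contravar in L; [lra|]. now apply Rmult_lt_0_compat.
Qed.

(* The distance from wron n x to the target, measured at the nodes, has no positive
   minimum because omega2 is surjective. *)
Lemma wron_local (n : nat) (d : R) : 0 < d -> exists rho, 0 < rho /\
  forall (w : C -> C) (ow : C -> R), is_poly (n + n) w ->
   (forall xi, Cmod xi = 1 -> w xi = (xi ^ n * RtoC (ow xi))%C) -> (forall xi, Cmod xi = 1 -> 2 * d <= ow xi) ->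
   forall x0, zero_free n x0 -> (forall i, (i <= n + n)%nat -> Rabs (omega n x0 (node n i) - ow (node n i)) <= rho) ->
   exists x, zero_free n x /\ forall z, wron n x z = w z.
Proof.
  intros Hd.
  destruct (poly_node_bound (n + n) (node n)) as [L [HL HLb]].
  { intros i. rewrite Cmod_node. lra. } { intros. now apply (node_inj n). }
  (* An error [rho] at the nodes is an error at most [d] on the whole circle; since the target is at
     least 2d, [omega] then stays at least d. *)
  set (rho := d / L). assert (Hrho : 0 < rho) by (apply Rdiv_lt_0_compat; lra).
  exists rho. split; auto. intros w ow Hw Hwo How x0 Zx0 Hx0.
  assert (Hclose : forall x e, 0 <= e -> (forall i, (i <= n + n)%nat -> Rabs (omega n x (node n i) - ow (node n i)) <= e) ->
     forall xi, Cmod xi = 1 -> Rabs (omega n x xi - ow xi) <= L * e).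
  { intros x e He H xi Hxi.
    assert (B := HLb (fun z => wron n x z - w z)%C e).
    assert (E : forall v, Cmod v = 1 -> Cmod (wron n x v - w v) = Rabs (omega n x v - ow v)).
    { intros v Hv. rewrite wron_circle, Hwo by auto.
      replace (v ^ n * RtoC (omega n x v) - v ^ n * RtoC (ow v))%C with (v ^ n * RtoC (omega n x v - ow v))%C by (rewrite RtoC_minus; ring).
      rewrite Cmod_mult, Cmod_pow, Hv, pow1, Rmult_1_l. apply Cmod_R. }
    rewrite <- E by auto. apply B; auto; [| |lra].
    - apply is_poly_minus; auto. apply wron_poly.
    - intros i Hi. rewrite E by apply Cmod_node. auto. }
  (* The error levels that can be reached. Their infimum, obtained below as minus a supremum, is
     attained by compactness and must be 0. *)
  set (P := fun e => 0 <= e /\ exists x, zero_free n x /\ forall i, (i <= n + n)%nat -> Rabs (omega n x (node n i) - ow (node n i)) <= e).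
  assert (Pup : forall e e', P e -> e <= e' -> P e').
  { intros e e' [He [x [Zx Hx]]] L1. split; [lra|]. exists x. split; auto. intros i Hi. specialize (Hx i Hi). lra. }
  assert (Prho : P rho) by (split; [lra|]; now exists x0).
  destruct (completeness (fun y => P (- y))) as [s [Hs1 Hs2]].
  { exists 0. intros y [Hy _]. lra. } { exists (- rho). now rewrite Ropp_involutive. }
  set (e := - s).
  assert (He0 : 0 <= e). { assert (s <= 0); [|unfold e; lra]. apply Hs2. intros y [Hy _]. lra. }
  assert (Hinf : forall e', P e' -> e <= e').
  { intros e' He'. unfold e. assert (- e' <= s); [|lra]. apply Hs1. now rewrite Ropp_involutive. }
  assert (Happ : forall e', e < e' -> P e').
  { intros e' He'. apply NNPP. intros N. assert (s <= - e'); [|unfold e in He'; lra].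
    apply Hs2. intros y Hy. apply Rnot_lt_le. intros L1. apply N. apply (Pup (- y)); auto. lra. }
  assert (Erho : e <= rho) by now apply Hinf.
  assert (Hseq : forall m : nat, exists x, zero_free n x /\ forall i, (i <= n + n)%nat -> Rabs (omega n x (node n i) - ow (node n i)) <= Rmin rho (e + / (INR m + 1))).
  { intros m. assert (Q : P (Rmin rho (e + / (INR m + 1)))); [|apply Q].
    unfold Rmin. destruct (Rle_dec rho (e + / (INR m + 1))); auto. apply Happ.
    assert (0 < / (INR m + 1)) by (apply Rinv_0_lt_compat; generalize (pos_INR m); lra). lra. }
  set (xs := fun m => proj1_sig (constructive_indefinite_description _ (Hseq m))).
  assert (Hxs : forall m, zero_free n (xs m) /\ forall i, (i <= n + n)%nat -> Rabs (omega n (xs m) (node n i) - ow (node n i)) <= Rmin rho (e + / (INR m + 1))).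
  { intros m. exact (proj2_sig (constructive_indefinite_description _ (Hseq m))). }
  assert (Lrho : L * rho = d) by (unfold rho; field; lra).
  assert (Hom : forall m xi, Cmod xi = 1 -> Rabs (omega n (xs m) xi - ow xi) <= d).
  { intros m xi Hxi. rewrite <- Lrho. apply Hclose; auto; [lra|]. intros i Hi.
    eapply Rle_trans; [apply Hxs; auto|apply Rmin_l]. }
  destruct (poly_cderiv _ _ Hw) as [w' Hw'].
  destruct (holo_bounded w 0 2 1) as [Mw [HMw HMwb]]; [intros z _; eexists; apply Hw'|lra|].
  assert (Mow : forall xi, Cmod xi = 1 -> ow xi <= Mw).
  { intros xi Hxi. assert (B := HMwb xi). replace (xi - 0)%C with xi in B by ring. specialize (B (Req_le _ _ Hxi)).
    rewrite Hwo, Cmod_mult, Cmod_pow, Hxi, pow1, Rmult_1_l, Cmod_R in B by auto.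
    assert (A := Rle_abs (ow xi)). lra. }
  (* From |pe|^2 <= omega <= Mw + d; the 1 allows the passage from the square to the modulus. *)
  set (A := Mw + d + 1).
  assert (Hpe : forall m xi, Cmod xi = 1 -> Cmod (pe n (xs m) xi) <= A).
  { intros m xi Hxi. assert (B := pe_sq_le_omega n (xs m) d (proj1 (Hxs m)) Hd).
    assert (B2 : Cmod (pe n (xs m) xi) ^ 2 <= omega n (xs m) xi).
    { apply B; auto. intros v Hv. assert (X := Hom m v Hv). apply Rabs_le_between in X. assert (Y := How v Hv). lra. }
    assert (X := Hom m xi Hxi). apply Rabs_le_between in X. assert (Y := Mow xi Hxi).
    assert (Z := Cmod_ge_0 (pe n (xs m) xi)). unfold A. nra. }
  assert (Hco : forall m k, (k <= n)%nat -> Cmod (xs m k) <= 2 ^ k * A).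
  { intros m k Hk. apply (coef_bound n); auto. }
  assert (A0 : 0 < A) by (unfold A; lra).
  destruct (diagonal_extraction (fun m k => if Nat.leb k n then xs m k else 0) (fun k => 2 ^ k * A)) as [phi [Hphi Hcv]].
  { intros m k. destruct (Nat.leb_spec k n); [now apply Hco|]. rewrite Cmod_0. apply Rmult_le_pos; [apply pow_le; lra|lra]. }
  set (x := fun k => proj1_sig (constructive_indefinite_description _ (Hcv k))).
  assert (Hx : forall k, (k <= n)%nat -> cvg_seq (fun m => xs (phi m) k) (x k)).
  { intros k Hk. assert (Q := proj2_sig (constructive_indefinite_description _ (Hcv k))). fold (x k) in Q. cbv beta in Q.
    now rewrite (proj2 (Nat.leb_le k n)) in Q by lia. }
  set (A' := 2 ^ n * A).
  assert (Hco' : forall m k, (k <= n)%nat -> Cmod (xs m k) <= A').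
  { intros m k Hk. eapply Rle_trans; [now apply Hco|]. apply Rmult_le_compat_r; [lra|]. apply Rle_pow; [lra|auto]. }
  (* The formula for [omega] gives omega <= |pe| Kc, so omega >= d keeps |pe| >= d/Kc on the circle,
     uniformly along the sequence. Zeros therefore cannot reach the closed disk in the limit. *)
  set (Kc := (INR n + 1) * A + 2 * ((INR n + 1) ^ 2 * A')).
  assert (Kp : 0 < Kc).
  { unfold Kc. assert (Q := pos_INR n). assert (0 < A') by (apply Rmult_lt_0_compat; [apply pow_lt; lra|lra]).
    assert (0 <= (INR n + 1) ^ 2 * A') by (apply Rmult_le_pos; [apply pow2_ge_0|lra]).
    assert (0 < (INR n + 1) * A) by (apply Rmult_lt_0_compat; lra). lra. }
  set (eta := d / Kc). assert (Heta : 0 < eta) by (apply Rdiv_lt_0_compat; lra).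
  assert (Hlow : forall m z, Cmod z <= 1 -> eta <= Cmod (pe n (xs m) z)).
  { intros m. apply pe_lower_inside; auto; [apply Hxs|]. intros xi Hxi.
    assert (X := Hom m xi Hxi). apply Rabs_le_between in X. assert (Y := How xi Hxi).
    assert (B1 := Hpe m xi Hxi). assert (B2 := pd_bound n (xs m) A' xi ltac:(lra) (Hco' m)).
    set (q := Cmod (pe n (xs m) xi)) in *. assert (q0 : 0 <= q) by apply Cmod_ge_0.
    assert (Z : omega n (xs m) xi <= q * Kc).
    { unfold omega. fold q. assert (R1 := re_le_Cmod (Cconj (pe n (xs m) xi) * (xi * pd n (xs m) xi))).
      rewrite !Cmod_mult, Cmod_conj, Hxi, Rmult_1_l in R1. fold q in R1. apply Rabs_le_between in R1.
      assert (q * Cmod (pd n (xs m) xi) <= q * ((INR n + 1) ^ 2 * A')) by (apply Rmult_le_compat_l; auto).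
      assert ((INR n + 1) * q ^ 2 <= q * ((INR n + 1) * A)).
      { replace ((INR n + 1) * q ^ 2) with (q * ((INR n + 1) * q)) by ring. apply Rmult_le_compat_l; auto.
        apply Rmult_le_compat_l; [generalize (pos_INR n); lra|auto]. }
      unfold Kc. lra. }
    apply Rmult_le_reg_r with Kc; auto. unfold eta. replace (d / Kc * Kc) with d by (field; lra). lra. }
  assert (Zx : zero_free n x).
  { exists eta. split; auto. intros z Hz.
    apply (cvg_real_le (fun _ => eta) (fun m => Cmod (pe n (xs (phi m)) z)) _ _ O).
    - apply cvg_seq_const.
    - apply cvg_seq_RtoC_Cmod. now apply (pe_cvg n (fun m => xs (phi m))).
    - intros m _. auto. }
  assert (Ex : forall i, (i <= n + n)%nat -> Rabs (omega n x (node n i) - ow (node n i)) <= e).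
  { intros i Hi. assert (Q := omega_cvg n (fun m => xs (phi m)) x (node n i) Hx).
    apply le_epsilon. intros eps Heps.
    assert (Q2 : cvg_seq (fun m => omega n (xs (phi m)) (node n i) - ow (node n i))%C (omega n x (node n i) - ow (node n i))%C).
    { apply cvg_seq_minus; auto. apply cvg_seq_const. }
    destruct (archimed_cor1 eps Heps) as [N [HN HN0]].
    rewrite <- Cmod_RtoC_minus. apply (cvg_seq_Cmod_le _ _ _ N Q2). intros m Hm.
    rewrite Cmod_RtoC_minus. eapply Rle_trans; [apply Hxs; auto|]. eapply Rle_trans; [apply Rmin_r|].
    apply Rplus_le_compat_l. left. eapply Rle_lt_trans; [|exact HN].
    apply Rinv_le_contravar; [now apply lt_0_INR|].
    assert (N <= phi m)%nat by (generalize (extraction_ge phi Hphi m); lia). apply le_INR in H. lra. }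
  assert (Ox : forall xi, Cmod xi = 1 -> d <= omega n x xi).
  { intros xi Hxi. assert (X := Hclose x rho ltac:(lra) (fun i Hi => Rle_trans _ _ _ (Ex i Hi) Erho) xi Hxi).
    rewrite Lrho in X. apply Rabs_le_between in X. assert (Y := How xi Hxi). lra. }
  assert (E0 : e = 0).
  { apply NNPP. intros Ne. assert (Ep : 0 < e) by lra.
    (* The Newton direction: a step t along [r] multiplies each node error by 1 - t up to t^2 B <= t
       e/2, so the error level drops below the infimum e unless e = 0. *)
    destruct (omega2_surjective n x d Zx Hd Ox (fun i => - (omega n x (node n i) - ow (node n i)))) as [r Hr].
    destruct (omega_bounded n r) as [B [HB [_ HB2]]].
    destruct (zero_free_perturb n x r Zx) as [t0 [Ht0 Hzt]].
    set (t := Rmin (Rmin t0 1) (e / (2 * B))).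
    assert (Ht : 0 < t). { repeat apply Rmin_pos; try lra. apply Rdiv_lt_0_compat; lra. }
    assert (t1 : t <= t0) by (eapply Rle_trans; [apply Rmin_l|apply Rmin_l]).
    assert (t2 : t <= 1) by (eapply Rle_trans; [apply Rmin_l|apply Rmin_r]).
    assert (t3 : t * B <= e / 2).
    { replace (e / 2) with (e / (2 * B) * B) by (field; lra). apply Rmult_le_compat_r; [lra|apply Rmin_r]. }
    clearbody t.
    assert (Q : e <= (1 - t) * e + t * (e / 2)); [|nra].
    apply Hinf. split; [nra|]. exists (fun k => x k + RtoC t * r k)%C. split.
    { apply Hzt. rewrite Rabs_right; lra. }
    intros i Hi. rewrite omega_quad, Hr by auto.
    replace (omega n x (node n i) + t * - (omega n x (node n i) - ow (node n i)) + t * t * omega n r (node n i) - ow (node n i))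
      with ((1 - t) * (omega n x (node n i) - ow (node n i)) + t * t * omega n r (node n i)) by ring.
    eapply Rle_trans; [apply Rabs_triang|]. rewrite !Rabs_mult, !(Rabs_right t), (Rabs_right (1 - t)) by lra.
    assert (X := Ex i Hi). assert (Y := HB2 (node n i) (Cmod_node n i)).
    assert ((1 - t) * Rabs (omega n x (node n i) - ow (node n i)) <= (1 - t) * e) by (apply Rmult_le_compat_l; lra).
    assert (t * t * Rabs (omega n r (node n i)) <= t * t * B) by (apply Rmult_le_compat_l; nra).
    nra. }
  exists x. split; auto. intros z. apply Cminus_eq0.
  apply (poly_zero (n + n) (fun z => wron n x z - w z)%C (node n)).
  - apply is_poly_minus; auto. apply wron_poly.
  - intros. now apply (node_inj n).
  - intros i Hi. rewrite wron_circle, Hwo by apply Cmod_node.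
    replace (omega n x (node n i)) with (ow (node n i)); [ring|].
    assert (X := Ex i Hi). rewrite E0 in X. apply Rabs_le_between in X. lra.
Qed.

(** The segment from (n + 1) z^n to w is followed in N equal steps. It starts at the constant
    polynomial 1, whose Blaschke product is z^(n+1). One step changes a node value by at most (n + 1
    + Mw)/N < rho, within the reach of [wron_local], whose [rho] does not depend on the position
    along the segment. *)
Lemma wron_surjective (n : nat) (w : C -> C) (ow : C -> R) (d : R) : is_poly (n + n) w ->
  (forall xi, Cmod xi = 1 -> w xi = (xi ^ n * RtoC (ow xi))%C) -> 0 < d -> (forall xi, Cmod xi = 1 -> 2 * d <= ow xi) ->
  exists x, zero_free n x /\ forall z, wron n x z = w z.
Proof.
  intros Hw Hwo Hd0 How.
  (* The starting value n + 1 must also be at least 2 d1; the cap 1/2 ensures this for n = 0 too. *)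
  set (d1 := Rmin d (1/2)). assert (Hd1 : 0 < d1) by (apply Rmin_pos; lra).
  assert (D1 : d1 <= d) by apply Rmin_l. assert (D2 : d1 <= 1/2) by apply Rmin_r.
  destruct (wron_local n d1 Hd1) as [rho [Hrho Hloc]].
  destruct (poly_cderiv _ _ Hw) as [w' Hw'].
  destruct (holo_bounded w 0 2 1) as [Mw [HMw HMwb]]; [intros z _; eexists; apply Hw'|lra|].
  assert (Mow : forall xi, Cmod xi = 1 -> Rabs (ow xi) <= Mw).
  { intros xi Hxi. assert (B := HMwb xi). replace (xi - 0)%C with xi in B by ring. specialize (B (Req_le _ _ Hxi)).
    now rewrite Hwo, Cmod_mult, Cmod_pow, Hxi, pow1, Rmult_1_l, Cmod_R in B by auto. }
  assert (Pn := pos_INR n).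
  set (wt := fun (t : R) z => (RtoC ((1 - t) * (INR n + 1)) * z ^ n + RtoC t * w z)%C).
  set (ot := fun (t : R) xi => (1 - t) * (INR n + 1) + t * ow xi).
  destruct (archimed_cor1 (rho / (INR n + 1 + Mw))) as [N [HN HN0]]; [apply Rdiv_lt_0_compat; lra|].
  assert (PN : 0 < INR N) by now apply lt_0_INR.
  assert (Key : forall k, (k <= N)%nat -> exists x, zero_free n x /\ forall z, wron n x z = wt (INR k / INR N) z).
  { induction k as [|k IH]; intros Hk.
    - exists (fun j => if Nat.eqb j 0 then RtoC 1 else RtoC 0).
      assert (P0 : forall m z, pe m (fun _ => RtoC 0) z = 0) by (induction m; intros z; simpl; [auto|rewrite IHm; ring]).
      assert (P1 : forall z, pe n (fun j => if Nat.eqb j 0 then RtoC 1 else RtoC 0) z = 1).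
      { intros z. destruct n; simpl; auto. rewrite P0. ring. }
      assert (Pd0 : forall m z, pd m (fun _ => RtoC 0) z = 0) by (induction m; intros z; simpl; [auto|rewrite IHm, P0; ring]).
      assert (P2 : forall z, pd n (fun j => if Nat.eqb j 0 then RtoC 1 else RtoC 0) z = 0).
      { intros z. destruct n; simpl; auto. rewrite P0, Pd0. ring. }
      split.
      + exists 1. split; [lra|]. intros z _. rewrite P1, Cmod_1. lra.
      + intros z. apply Cminus_eq0.
        apply (poly_zero (n + n) (fun z => wron n (fun j => if Nat.eqb j 0 then RtoC 1 else RtoC 0) z - wt (INR 0 / INR N)%R z)%C (node n)).
        * apply is_poly_minus; [apply wron_poly|]. unfold wt. apply is_poly_plus.
          -- apply is_poly_scal. apply is_poly_le with (n := n); [lia|apply is_poly_pow].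
          -- now apply is_poly_scal.
        * intros. now apply (node_inj n).
        * intros i _. rewrite wron_circle by apply Cmod_node. unfold omega, wt. rewrite P1, P2, Cmod_1.
          replace (INR 0 / INR N) with 0 by (simpl; field; lra).
          replace ((INR n + 1) * 1 ^ 2 - 2 * Re (Cconj 1 * (node n i * 0))) with (INR n + 1).
          -- rewrite Rminus_0_r, Rmult_1_l. ring.
          -- rewrite !Cmult_0_r, re_RtoC. ring.
    - destruct IH as [x [Zx Ex]]; [lia|].
      assert (T0 : 0 <= INR (S k) / INR N <= 1).
      { split; [apply Rmult_le_pos; [apply pos_INR|left; now apply Rinv_0_lt_compat]|].
        apply Rmult_le_reg_r with (INR N); auto. unfold Rdiv. rewrite Rmult_assoc, Rinv_l, Rmult_1_r, Rmult_1_l by lra.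
        apply le_INR. lia. }
      apply (Hloc (wt (INR (S k) / INR N)) (ot (INR (S k) / INR N))) with (x0 := x); auto.
      + unfold wt. apply is_poly_plus.
        * apply is_poly_scal. apply is_poly_le with (n := n); [lia|apply is_poly_pow].
        * now apply is_poly_scal.
      + intros xi Hxi. unfold wt, ot. rewrite Hwo by auto. rewrite RtoC_plus, !RtoC_mult. ring.
      + intros xi Hxi. unfold ot. assert (Y := How xi Hxi). set (t := INR (S k) / INR N) in *. nra.
      + intros i Hi.
        assert (Eo : omega n x (node n i) = ot (INR k / INR N) (node n i)).
        { apply (omega_unique n (node n i)); [apply Cmod_node|]. rewrite <- wron_circle, Ex by apply Cmod_node.
          unfold wt, ot. rewrite Hwo by apply Cmod_node. rewrite RtoC_plus, !RtoC_mult. ring. }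
        rewrite Eo. unfold ot. rewrite S_INR.
        replace ((1 - INR k / INR N) * (INR n + 1) + INR k / INR N * ow (node n i) -
          ((1 - (INR k + 1) / INR N) * (INR n + 1) + (INR k + 1) / INR N * ow (node n i)))
          with (/ INR N * ((INR n + 1) - ow (node n i))) by (field; lra).
        rewrite Rabs_mult, (Rabs_right (/ INR N)) by (apply Rle_ge; left; now apply Rinv_0_lt_compat).
        assert (Y := Mow (node n i) (Cmod_node n i)). apply Rabs_le_between in Y.
        assert (Rabs (INR n + 1 - ow (node n i)) <= INR n + 1 + Mw) by (apply Rabs_le; lra).
        apply Rle_trans with (rho / (INR n + 1 + Mw) * (INR n + 1 + Mw)).
        * apply Rmult_le_compat; auto; [left; now apply Rinv_0_lt_compat|apply Rabs_pos|lra].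
        * apply Req_le. field. lra. }
  destruct (Key N (le_n N)) as [x [Zx Ex]]. exists x. split; auto. intros z. rewrite Ex. unfold wt.
  replace (INR N / INR N) with 1 by (field; lra). rewrite Rminus_diag, Rmult_0_l. ring.
Qed.

Definition root_poly (l : list C) (z : C) : C := fold_right (fun a p => ((z - a) * p)%C) (RtoC 1) l.

Lemma root_poly_holoD (l : list C) : holoD (root_poly l).
Proof.
  induction l as [|a l IH]; simpl; [apply holoD_const|].
  apply (holoD_mult (fun z => z - a)%C (root_poly l)); auto. apply holoD_minus; [apply holoD_id|apply holoD_const].
Qed.

(* Heins' theorem. *)
Theorem finite_blaschke_critical (l : list C) : (forall a, In a l -> Cmod a < 1) ->
  exists b U : C -> C, holoD b /\ self_map b /\ boundary_sharp b /\ b 0 = 0 /\ holoD U /\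
    (forall z, Cmod z < 1 -> U z <> 0) /\ forall z, Cmod z < 1 -> C_derive b z = (root_poly l z * U z)%C.
Proof.
  intros Hl. set (n := length l).
  (* The target numerator is the product of the (z - a)(1 - conj(a) z): these factors reflect the
     zeros in the circle, where the product equals xi^n times the product [ow] of the |xi - a|^2. In
     the disk [V] has no zeros and goes into the cofactor. *)
  set (V := fun z => fold_right (fun a p => ((1 - Cconj a * z) * p)%C) (RtoC 1) l).
  set (ow := fun xi => fold_right (fun a p => Cmod (xi - a) ^ 2 * p) 1 l).
  set (d := fold_right (fun a p => (1 - Cmod a) ^ 2 * p) 1 l).
  assert (H : is_poly (n + n) (fun z => root_poly l z * V z)%C /\
    (forall xi, Cmod xi = 1 -> (root_poly l xi * V xi)%C = (xi ^ n * RtoC (ow xi))%C) /\ 0 < d /\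
    (forall xi, Cmod xi = 1 -> d <= ow xi) /\ (forall z, Cmod z < 1 -> V z <> 0) /\ holoD V).
  { unfold n, V, ow, d. clear n V ow d. induction l as [|a l IH].
    - simpl. split; [|split; [|split; [lra|split; [intros; lra|split]]]].
      + exists (RtoC 1). intros; ring.
      + intros; ring.
      + intros. apply C1_nz.
      + apply holoD_const.
    - destruct IH as [I1 [I2 [I3 [I4 [I5 I6]]]]]; [intros; apply Hl; now right|].
      assert (Ha : Cmod a < 1) by (apply Hl; now left).
      cbn [length fold_right].
      set (V := fun z => fold_right (fun a p => ((1 - Cconj a * z) * p)%C) (RtoC 1) l) in *.
      set (ow := fun xi => fold_right (fun a p => Cmod (xi - a) ^ 2 * p) 1 l) in *.
      set (d := fold_right (fun a p => (1 - Cmod a) ^ 2 * p) 1 l) in *.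
      split; [|split; [|split; [|split; [|split]]]].
      + apply is_poly_ext with (f := fun z => (((z - a) * (1 - Cconj a * z)) * (root_poly l z * V z))%C).
        * intros z. unfold V, root_poly. cbn [fold_right]. ring.
        * replace (S (length l) + S (length l))%nat with (2 + (length l + length l))%nat by lia.
          apply is_poly_mult; auto. apply (is_poly_mult 1 1).
          -- apply is_poly_minus; [apply is_poly_id|apply is_poly_const].
          -- apply is_poly_minus; [apply is_poly_const|]. apply is_poly_scal, is_poly_id.
      + intros xi Hxi. fold (V xi). change (fold_right (fun (a0 : C) (p : R) => Cmod (xi - a0) ^ 2 * p) 1 l) with (ow xi).
        transitivity ((xi - a) * (1 - Cconj a * xi) * (root_poly l xi * V xi))%C; [unfold V, root_poly; cbn [fold_right]; ring|].
        rewrite I2, RtoC_mult, Cmod2_conj, Cminus_conj by auto. simpl Cpow.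
        transitivity ((xi - a) * (Cconj xi * xi - Cconj a * xi) * (xi ^ length l * ow xi))%C; [rewrite circle_conj by auto; reflexivity|]. ring.
      + apply Rmult_lt_0_compat; auto. apply pow_lt. lra.
      + intros xi Hxi. specialize (I4 xi Hxi). unfold ow, d in I4. apply Rmult_le_compat; auto.
        * apply pow2_ge_0.
        * left. exact I3.
        * apply pow_incr. split; [lra|]. generalize (Cmod_rtriangle xi a). lra.
      + intros z Hz. apply Cmult_neq_0; [now apply mob_den|now apply I5].
      + apply (holoD_mult (fun z => 1 - Cconj a * z)%C V); auto. apply holoD_minus; [apply holoD_const|].
        apply holoD_mult; [apply holoD_const|apply holoD_id]. }
  destruct H as [I1 [I2 [I3 [I4 [I5 I6]]]]].
  destruct (wron_surjective n (fun z => root_poly l z * V z)%C ow (d / 2) I1 I2) as [x [Zx Ex]]; [lra| |].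
  { intros xi Hxi. specialize (I4 xi Hxi). lra. }
  assert (Ox : forall xi, Cmod xi = 1 -> d <= omega n x xi).
  { intros xi Hxi. replace (omega n x xi) with (ow xi); auto.
    apply (omega_unique n xi); auto. now rewrite <- wron_circle, Ex, I2 by auto. }
  exists (blaschke n x), (fun z => V z / (pe n x z * pe n x z))%C.
  assert (NX : forall z, Cmod z < 1 -> pe n x z <> 0) by (intros; apply zero_free_neq; auto; lra).
  split; [|split; [|split; [|split; [|split; [|split]]]]].
  - now apply holoD_blaschke.
  - now apply (self_map_blaschke n x d).
  - now apply (blaschke_boundary_sharp n x d).
  - apply blaschke_0.
  - apply holoD_div; auto.
    + apply holoD_mult; apply holoD_pe.
    + intros z Hz. apply Cmult_neq_0; auto.
  - intros z Hz E. apply (I5 z Hz).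
    transitivity ((V z / (pe n x z * pe n x z)) * (pe n x z * pe n x z))%C; [field; auto|rewrite E; ring].
  - intros z Hz. rewrite (is_cderiv_C_derive _ _ _ (blaschke_deriv n x Zx z Hz)), Ex. unfold Cdiv. ring.
Qed.

(** * The extremal function as a limit of finite Blaschke products *)

(** If every list missed a zero, picking a zero outside the list of earlier ones would give
    infinitely many distinct zeros in |z| <= r; they would accumulate at a point of the disk, where
    zeros are isolated. *)
Lemma finite_zeros (g : C -> C) (r : R) : holoD g -> (exists z, Cmod z < 1 /\ g z <> 0) -> r < 1 ->
  exists L : list C, forall z, Cmod z <= r -> g z = 0 -> In z L.
Proof.
  intros Hg Hne Hr. apply NNPP. intros N.
  assert (Hn : forall L : list C, exists z, Cmod z <= r /\ g z = 0 /\ ~ In z L).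
  { intros L. apply NNPP. intros N'. apply N. exists L. intros z H1 H2. apply NNPP. intros H3. apply N'. now exists z. }
  set (nx := fun L => proj1_sig (constructive_indefinite_description _ (Hn L))).
  assert (Hnx : forall L, Cmod (nx L) <= r /\ g (nx L) = 0 /\ ~ In (nx L) L).
  { intros L. exact (proj2_sig (constructive_indefinite_description _ (Hn L))). }
  clearbody nx.
  set (Ls := fun n => Nat.iter n (fun L => nx L :: L) nil).
  set (u := fun n => nx (Ls n)).
  assert (Hin : forall n k, (k < n)%nat -> In (u k) (Ls n)).
  { induction n as [|n IH]; intros k Hk; [lia|]. change (Ls (S n)) with (u n :: Ls n).
    destruct (Nat.eq_dec k n) as [->|]; [now left|right; apply IH; lia]. }
  destruct (complex_bw u r) as [phi [l [Hphi Hl]]]; [intros n; apply Hnx|].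
  assert (Hlr : Cmod l <= r).
  { apply (cvg_seq_Cmod_le _ _ _ O Hl). intros n _. apply Hnx. }
  destruct (isolated_zeros g l Hg ltac:(lra) Hne) as [d [Hd Hiso]].
  destruct (Hl d Hd) as [n0 Hn0].
  assert (E : forall n, (n0 <= n)%nat -> u (phi n) = l).
  { intros n Hn'. apply NNPP. intros Hne'. apply (Hiso (u (phi n)) Hne'); [now apply Hn0|apply Hnx]. }
  assert (E1 := E n0 (le_n _)). assert (E2 := E (S n0) ltac:(lia)).
  destruct (Hnx (Ls (phi (S n0)))) as [_ [_ H3]]. apply H3. change (nx (Ls (phi (S n0)))) with (u (phi (S n0))).
  rewrite E2, <- E1. apply Hin. apply Hphi.
Qed.

Lemma root_poly_app (l m : list C) (z : C) : root_poly (l ++ m) z = (root_poly l z * root_poly m z)%C.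
Proof. induction l as [|a l IH]; simpl; [ring|]. unfold root_poly in *. simpl. rewrite IH. ring. Qed.

Lemma root_poly_repeat (a : C) (m : nat) (z : C) : root_poly (repeat a m) z = ((z - a) ^ m)%C.
Proof. induction m as [|m IH]; simpl; auto. unfold root_poly in *. simpl. now rewrite IH. Qed.

Lemma root_factorization (g : C -> C) (r : R) : holoD g -> (exists z, Cmod z < 1 /\ g z <> 0) -> r < 1 ->
  exists (l : list C) (h : C -> C), (forall a, In a l -> Cmod a < 1) /\ holoD h /\
    (forall z, g z = (root_poly l z * h z)%C) /\ forall z, Cmod z <= r -> h z <> 0.
Proof.
  intros Hg Hne Hr. destruct (finite_zeros g r Hg Hne Hr) as [L HL].
  revert g Hg Hne HL. induction L as [|a L IH]; intros g Hg Hne HL.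
  - exists nil, g. split; [intros a []|]. split; auto. split; [intros; unfold root_poly; simpl; ring|].
    intros z Hz E. exact (HL z Hz E).
  - destruct (Rlt_le_dec (Cmod a) 1) as [Ha|Ha].
    + destruct (order_factor g a Hg Ha Hne) as [m [g1 [Hg1 [Na E]]]].
      destruct (IH g1 Hg1) as [l [h [Hl [Hh [Eh Nh]]]]].
      * now exists a.
      * intros z Hz Ez. destruct (HL z Hz) as [->|]; auto; [rewrite E, Ez; ring|]. congruence.
      * exists (repeat a m ++ l), h. split; [|split; [auto|split; [|auto]]].
        -- intros b Hb. apply in_app_or in Hb. destruct Hb as [Hb|Hb]; auto. apply repeat_spec in Hb. now subst.
        -- intros z. rewrite root_poly_app, root_poly_repeat, E, Eh. ring.
    + apply IH; auto. intros z Hz Ez. destruct (HL z Hz Ez) as [->|]; auto. lra.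
Qed.

Lemma divide_by_orders (g F : C -> C) (c : C -> nat) : holoD g -> holoD F ->
  (forall z, Cmod z < 1 -> has_order g z (c z)) -> (forall z, Cmod z < 1 -> vanishes_to_order F z (c z)) ->
  exists k, holoD k /\ forall z, Cmod z < 1 -> F z = (g z * k z)%C.
Proof.
  intros Hg HF Ho Hv.
  (* This is F / g off the zeros of g, and the correct value at the zeros. *)
  set (k := fun z => (C_derive_n (c z) F z / C_derive_n (c z) g z)%C).
  assert (Loc : forall z, Cmod z < 1 -> exists u v, holoD u /\ holoD v /\ u z <> 0 /\
     (forall w, Cmod w < 1 -> g w = ((w - z) ^ c z * u w)%C) /\ (forall w, Cmod w < 1 -> F w = ((w - z) ^ c z * v w)%C) /\
     k z = (v z / u z)%C).
  { intros z Hz. destruct (Ho z Hz) as [Ho1 Ho2].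
    destruct (vanishes_factor g z (c z) Hg Hz Ho1) as [u [Hu Eu]].
    destruct (vanishes_factor F z (c z) HF Hz (Hv z Hz)) as [v [Hv' Ev]].
    destruct (derive_n_order (c z) g u z Hu Hz Eu) as [_ Du].
    destruct (derive_n_order (c z) F v z Hv' Hz Ev) as [_ Dv].
    assert (Nu : u z <> 0). { intros E. apply Ho2. rewrite Du, E. ring. }
    exists u, v. do 5 (split; auto). unfold k. rewrite Du, Dv. field. split; auto. apply RtoC_fact_neq. }
  assert (Eq0 : forall z, Cmod z < 1 -> g z <> 0 -> k z = (F z / g z)%C).
  { intros z Hz N. destruct (Loc z Hz) as [u [v [_ [_ [Nu [Eu [Ev ->]]]]]]].
    rewrite Ev, Eu by auto. rewrite Eu in N by auto. field. split; auto. intros E. apply N. rewrite E. ring. }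
  exists k. split.
  - intros z Hz. destruct (Loc z Hz) as [u [v [Hu [Hv' [Nu [Eu [Ev Ek]]]]]]].
    destruct (ccont_neq u z (holoD_cont u z Hu Hz) Nu) as [d [Hd Hdn]].
    destruct (Hu z Hz) as [lu Hlu]. destruct (Hv' z Hz) as [lv Hlv].
    eexists. apply (is_cderiv_ext_loc (fun w => v w / u w)%C k z _ (Rmin d (1 - Cmod z))).
    + apply Rmin_pos; lra.
    + intros w Hw. assert (W1 : Cmod w < 1) by (apply (disk_nbhd z); eapply Rlt_le_trans; [exact Hw|apply Rmin_r]).
      assert (W2 : u w <> 0) by (apply Hdn; eapply Rlt_le_trans; [exact Hw|apply Rmin_l]).
      destruct (classic (w = z)) as [->|N]; [now rewrite Ek|].
      assert (P : ((w - z) ^ c z)%C <> 0). { apply Cpow_nz. intros E. apply N. now apply Cminus_eq0. }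
      rewrite Eq0; auto; [|rewrite Eu by auto; now apply Cmult_neq_0]. rewrite Ev, Eu by auto. field. auto.
    + apply is_cderiv_div; eauto.
  - intros z Hz. destruct (Loc z Hz) as [u [v [Hu [Hv' [Nu [Eu [Ev Ek]]]]]]].
    rewrite Ek, Ev, Eu by auto. field. auto.
Qed.

(** * The extremal problem in terms of the cofactor of the derivative *)

Lemma sup_norm_le (f : C -> C) (M : R) : Rbar_le (sup_norm f) M <-> forall z, Cmod z < 1 -> Cmod (f z) <= M.
Proof.
  unfold sup_norm. destruct (Lub_Rbar_correct (fun x => exists z, unit_disk z /\ x = Cmod (f z))) as [H1 H2]. split.
  - intros H z Hz. assert (A := H1 (Cmod (f z)) (ex_intro _ z (conj Hz eq_refl))).
    exact (Rbar_le_trans _ _ _ A H).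
  - intros H. apply H2. intros x [z [Hz ->]]. now apply H.
Qed.

Lemma Hinfty_bounded (f : C -> C) : Hinfty f <-> holoD f /\ exists M, 0 < M /\ forall z, Cmod z < 1 -> Cmod (f z) <= M.
Proof.
  split.
  - intros [Hf Hb]. split; [now apply holoD_holomorphic|].
    destruct (sup_norm f) as [s| |] eqn:E.
    + exists (Rmax s 1). split; [eapply Rlt_le_trans; [apply Rlt_0_1|apply Rmax_r]|]. apply sup_norm_le. rewrite E.
      apply Rmax_l.
    + contradiction.
    + exists 1. split; [lra|]. apply sup_norm_le. now rewrite E.
  - intros [Hf [M [_ HM]]]. split; [now apply holoD_holomorphic|].
    apply sup_norm_le in HM. eapply Rbar_le_lt_trans; [exact HM|exact I].
Qed.

Lemma holoD_scal (a : C) (f : C -> C) : holoD f -> holoD (fun z => a * f z)%C.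
Proof. intros H. apply holoD_mult; auto. apply holoD_const. Qed.

Lemma C_derive_scal (a : C) (f : C -> C) (z : C) : holoD f -> Cmod z < 1 -> C_derive (fun w => a * f w)%C z = (a * C_derive f z)%C.
Proof.
  intros Hf Hz. apply is_cderiv_C_derive. eapply is_cderiv_eq.
  - apply is_cderiv_mult; [apply is_cderiv_const|now apply holoD_deriv].
  - cbv beta. ring.
Qed.

Lemma order_nonzero (c : multiset) (g : C -> C) :
  (forall z, Cmod z < 1 -> has_order g z (c z)) -> exists z, Cmod z < 1 /\ g z <> 0.
Proof.
  intros Hord.  apply NNPP. intros N. assert (H0 : Cmod 0 < 1) by (rewrite Cmod_0; lra). apply (proj2 (Hord 0 H0)).
  destruct (derive_n_order (c 0) g (fun _ => 0) 0 (holoD_const 0) H0) as [_ ->]; [|ring].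
  intros z Hz. rewrite Cmult_0_r. apply NNPP. intros N'. apply N. now exists z.
Qed.

(** The derivative g of the given function has exactly the prescribed orders, so membership in the
    class amounts to boundedness and divisibility of f' by g. With the converse below, competitors
    are handled through their cofactor k. *)
Lemma F_class_intro (c : multiset) (g f k : C -> C) (M : R) : holoD g -> (forall z, Cmod z < 1 -> has_order g z (c z)) ->
  holoD f -> 0 < M -> (forall z, Cmod z < 1 -> Cmod (f z) <= M) -> holoD k ->
  (forall z, Cmod z < 1 -> C_derive f z = (g z * k z)%C) -> F_class c f.
Proof.
  intros Hg Hord Hf HM Hb Hk E. split; [apply Hinfty_bounded; eauto|]. intros z Hz.
  destruct (vanishes_factor g z (c z) Hg Hz (proj1 (Hord z Hz))) as [u [Hu Eu]].
  apply (derive_n_order (c z) (C_derive f) (fun w => u w * k w)%C z); auto.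
  - now apply holoD_mult.
  - intros w Hw. rewrite E, Eu by auto. ring.
Qed.

Lemma F_class_elim (c : multiset) (g f : C -> C) : holoD g -> (forall z, Cmod z < 1 -> has_order g z (c z)) ->
  F_class c f ->
  holoD f /\ exists k, holoD k /\ forall z, Cmod z < 1 -> C_derive f z = (g z * k z)%C.
Proof.
  intros Hg Hord [Hf Hv]. apply Hinfty_bounded in Hf. destruct Hf as [Hf _]. split; auto.
  apply (divide_by_orders g (C_derive f) c); auto. now apply holoD_C_derive.
Qed.

(** Since g vanishes to order N = [c 0] at 0, only the leading term of g k contributes. The extremal
    problem thus concerns the single number [k 0]. *)
Lemma extremal_functional (c : multiset) (g f k : C -> C) : holoD g -> (forall z, Cmod z < 1 -> has_order g z (c z)) ->
  holoD k ->
  (forall z, Cmod z < 1 -> C_derive f z = (g z * k z)%C) ->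
  C_derive_n (S (c 0)) f 0 = (C_derive_n (c 0) g 0 * k 0)%C.
Proof.
  intros Hg Hord Hk E. assert (H0 : Cmod 0 < 1) by (rewrite Cmod_0; lra).
  destruct (vanishes_factor g 0 (c 0) Hg H0 (proj1 (Hord 0 H0))) as [u [Hu Eu]].
  destruct (derive_n_order (c 0) g u 0 Hu H0 Eu) as [_ D1].
  destruct (derive_n_order (c 0) (C_derive f) (fun w => u w * k w)%C 0 (holoD_mult _ _ Hu Hk) H0) as [_ D2].
  { intros w Hw. rewrite E, Eu by auto. ring. }
  rewrite C_derive_n_succ, D1, D2. ring.
Qed.

(** Near [z0] the quotient V/H is bounded, which bounds |A| by a multiple of |z - z0|^m;
    [order_from_bound] then gives a cofactor on the whole disk, although H may vanish elsewhere. *)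
Lemma cancel_factor (A H V : C -> C) (z0 : C) (m : nat) : holoD A -> holoD H -> holoD V -> Cmod z0 < 1 -> H z0 <> 0 ->
  (forall z, Cmod z < 1 -> (A z * H z)%C = ((z - z0) ^ m * V z)%C) ->
  exists W, holoD W /\ forall z, Cmod z < 1 -> A z = ((z - z0) ^ m * W z)%C.
Proof.
  intros HA HH HV Hz N E.
  set (Q := fun z => (V z / H z)%C).
  destruct (ccont_neq H z0 (holoD_cont H z0 HH Hz) N) as [d1 [Hd1 Hn]].
  assert (HQ : ccont Q z0).
  { destruct (HV z0 Hz) as [lv Hlv]. destruct (HH z0 Hz) as [lh Hlh]. eapply is_cderiv_cont. apply is_cderiv_div; eauto. }
  destruct (HQ 1 ltac:(lra)) as [d2 [Hd2 Hq]].
  set (r := Rmin (1 - Cmod z0) (Rmin d1 d2)). assert (Hr : 0 < r) by (repeat apply Rmin_pos; lra).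
  assert (r1 : r <= 1 - Cmod z0) by apply Rmin_l. assert (r2 : r <= d1) by (eapply Rle_trans; [apply Rmin_r|apply Rmin_l]).
  assert (r3 : r <= d2) by (eapply Rle_trans; [apply Rmin_r|apply Rmin_r]). clearbody r.
  apply (order_from_bound A z0 m (Cmod (Q z0) + 1) r HA Hz Hr).
  intros w Hw. assert (Ww : Cmod w < 1) by (apply (disk_nbhd z0); lra). assert (Nw : H w <> 0) by (apply Hn; lra).
  replace (A w) with (Q w * (w - z0) ^ m)%C.
  - rewrite Cmod_mult, Cmod_pow. apply Rmult_le_compat_r; [apply pow_le, Cmod_ge_0|].
    assert (B := Hq w ltac:(lra)). generalize (Cmod_rtriangle (Q w) (Q z0)). lra.
  - unfold Q. transitivity ((w - z0) ^ m * V w / H w)%C; [field; auto|]. rewrite <- E by auto. field. auto.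
Qed.

Lemma self_map_fixed (f : C -> C) : holoD f -> f 0 = 0 -> (forall z, Cmod z < 1 -> Cmod (f z) <= 1) -> self_map f.
Proof.
  intros Hf H0 Hb. destruct (classic (exists z w, Cmod z < 1 /\ Cmod w < 1 /\ f z <> f w)) as [H|H].
  - now apply strict_self_map.
  - intros z Hz. replace (f z) with (RtoC 0); [rewrite Cmod_0; lra|]. rewrite <- H0.
    apply NNPP. intros N. apply H. exists 0, z. rewrite Cmod_0. split; [lra|auto].
Qed.

Definition radius (n : nat) : R := 1 - / (INR n + 2).

Lemma radius_range (n : nat) : 0 < radius n < 1.
Proof.
  unfold radius. assert (P := pos_INR n).
  assert (0 < / (INR n + 2)) by (apply Rinv_0_lt_compat; lra).
  assert (/ (INR n + 2) < 1); [|lra]. rewrite <- Rinv_1. apply Rinv_lt_contravar; lra.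
Qed.

Lemma radius_cover (r : R) : r < 1 -> exists n0, forall n, (n0 <= n)%nat -> r <= radius n.
Proof.
  intros Hr. destruct (archimed_cor1 (1 - r)) as [N [HN HN0]]; [lra|]. exists N. intros n Hn.
  unfold radius. assert (0 < INR N) by now apply lt_0_INR. apply le_INR in Hn.
  assert (/ (INR n + 2) <= / INR N) by (apply Rinv_le_contravar; lra). lra.
Qed.

(** Each b_n is the product of Heins' theorem for a list of zeros of g containing all those in |z|
    <= [radius n], and [h n] is what remains of g. A competitor with f' = g k then has cofactor h k
    relative to the root polynomial, so the comparison covers all competitors at once. The relation
    between b_n', [h n] and g is kept to recover the orders in the limit. *)
Lemma dominating_sequence (g : C -> C) : holoD g -> (exists z, Cmod z < 1 /\ g z <> 0) ->
  exists b h : nat -> C -> C, forall n, holoD (b n) /\ self_map (b n) /\ boundary_sharp (b n) /\ b n 0 = 0 /\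
    holoD (h n) /\ (forall z, Cmod z <= radius n -> h n z <> 0) /\
    (exists U, holoD U /\ forall z, Cmod z < 1 -> (C_derive (b n) z * h n z)%C = (g z * U z)%C) /\
    (forall z, Cmod z < 1 -> g z <> 0 -> C_derive (b n) z <> 0) /\
    forall f k, holoD f -> self_map f -> holoD k -> (forall z, Cmod z < 1 -> C_derive f z = (g z * k z)%C) ->
      forall z, Cmod z < 1 -> Cmod (C_derive f z) * (1 - Cmod (b n z) ^ 2) <= Cmod (C_derive (b n) z) * (1 - Cmod (f z) ^ 2).
Proof.
  intros Hg Hne.
  assert (H : forall n, exists bh : (C -> C) * (C -> C), holoD (fst bh) /\ self_map (fst bh) /\ boundary_sharp (fst bh) /\ fst bh 0 = 0 /\
    holoD (snd bh) /\ (forall z, Cmod z <= radius n -> snd bh z <> 0) /\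
    (exists U, holoD U /\ forall z, Cmod z < 1 -> (C_derive (fst bh) z * snd bh z)%C = (g z * U z)%C) /\
    (forall z, Cmod z < 1 -> g z <> 0 -> C_derive (fst bh) z <> 0) /\
    forall f k, holoD f -> self_map f -> holoD k -> (forall z, Cmod z < 1 -> C_derive f z = (g z * k z)%C) ->
      forall z, Cmod z < 1 -> Cmod (C_derive f z) * (1 - Cmod (fst bh z) ^ 2) <= Cmod (C_derive (fst bh) z) * (1 - Cmod (f z) ^ 2)).
  { intros n. destruct (root_factorization g (radius n) Hg Hne) as [l [h [Hl [Hh [Eg Nh]]]]]; [apply radius_range|].
    destruct (finite_blaschke_critical l Hl) as [b [U [Hb [Sb [Bb [b0 [HU [NU Eb]]]]]]]].
    exists (b, h). cbn [fst snd]. do 6 (split; auto). split; [|split].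
    - exists U. split; auto. intros z Hz. rewrite Eb, Eg by auto. ring.
    - intros z Hz Ng. rewrite Eb by auto. rewrite Eg in Ng. apply Cmult_neq_0; auto.
      intros E. apply Ng. rewrite E. ring.
    - intros f k Hf Sf Hk Ef z Hz.
      assert (A := ahlfors_comparison f b (root_poly l) (fun z => h z * k z)%C U (fun _ => RtoC 1) (fun _ => 1)
        Hf Hb Sf Sb (root_poly_holoD l) (holoD_mult _ _ Hh Hk) HU (holoD_const 1)).
      rewrite Ef, Eb by auto. rewrite Eg, <- Cmult_assoc, !(Cmod_mult (root_poly l z)).
      rewrite !(Rmult_assoc (Cmod (root_poly l z))). apply Rmult_le_compat_l; [apply Cmod_ge_0|].
      rewrite <- (Cmult_1_l (h z * k z)). apply A; auto.
      + destruct Hne as [w [Hw Nw]]. exists w. split; auto. intros E. apply Nw. rewrite Eg, E. ring.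
      + intros w Hw. rewrite Ef, Eg by auto. ring.
      + intros w. apply ccont_const.
      + intros w _. rewrite Cmod_1. lra.
      + intros w _ E. lra.
      + lra. }
  exists (fun n => fst (proj1_sig (constructive_indefinite_description _ (H n)))),
    (fun n => snd (proj1_sig (constructive_indefinite_description _ (H n)))).
  intros n. exact (proj2_sig (constructive_indefinite_description _ (H n))).
Qed.

(** Once [radius n] exceeds |z0|, [h n] does not vanish at [z0] and (z - z0)^m divides b_n'. The
    Schwarz-Pick lemma bounds the cofactors uniformly in n, and the resulting bound on b_n' survives
    the limit. *)
Lemma limit_vanishes (b h : nat -> C -> C) (g beta : C -> C) (phi : nat -> nat) (z0 : C) (m : nat) :
  holoD g -> holoD beta -> Cmod z0 < 1 -> extraction phi ->
  (forall n, holoD (b n) /\ self_map (b n) /\ holoD (h n) /\ (forall z, Cmod z <= radius n -> h n z <> 0) /\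
    exists U, holoD U /\ forall z, Cmod z < 1 -> (C_derive (b n) z * h n z)%C = (g z * U z)%C) ->
  (forall z, Cmod z < 1 -> cvg_seq (fun n => C_derive (b (phi n)) z) (C_derive beta z)) ->
  vanishes_to_order g z0 m -> vanishes_to_order (C_derive beta) z0 m.
Proof.
  intros Hg Hbeta Hz Hphi Hb Hcvg Hv.
  destruct (vanishes_factor g z0 m Hg Hz Hv) as [u [Hu Eu]].
  set (r := (1 + Cmod z0) / 2). assert (Hr : Cmod z0 < r < 1) by (unfold r; lra). clearbody r.
  assert (C0 := Cmod_ge_0 z0).
  (* On |v| = r the derivative is at most 1/(1 - r^2) and |v - z0| is at least r - |z0|; the maximum
     principle extends the bound on the cofactor to |w| <= r. *)
  set (A := / (1 - r ^ 2) / (r - Cmod z0) ^ m).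
  assert (r2 : 0 < 1 - r ^ 2) by nra.
  assert (pm : 0 < (r - Cmod z0) ^ m) by (apply pow_lt; lra).
  destruct (radius_cover (Cmod z0)) as [n0 Hn0]; [lra|].
  assert (Bd : forall n w, (n0 <= n)%nat -> Cmod w <= r -> Cmod (C_derive (b n) w) <= A * Cmod (w - z0) ^ m).
  { intros n w Hn Hw. destruct (Hb n) as [B1 [B2 [B3 [B4 [U [HU EU]]]]]].
    destruct (cancel_factor (C_derive (b n)) (h n) (fun z => u z * U z)%C z0 m) as [W [HW EW]]; auto.
    - now apply holoD_C_derive.
    - now apply holoD_mult.
    - intros z Hz'. rewrite EU, Eu by auto. ring.
    - rewrite EW, Cmod_mult, Cmod_pow, Rmult_comm by lra. apply Rmult_le_compat_r; [apply pow_le, Cmod_ge_0|].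
      apply (max_modulus_disk W r A w HW); [lra| |auto]. intros v Hvr.
      assert (SP := schwarz_pick (b n) v B1 B2 ltac:(lra)). rewrite Hvr, EW, Cmod_mult, Cmod_pow in SP by lra.
      assert (Q : (r - Cmod z0) ^ m <= Cmod (v - z0) ^ m).
      { apply pow_incr. split; [lra|]. rewrite <- Hvr. apply Cmod_rtriangle. }
      assert (P2 : 0 <= Cmod (b n v) ^ 2) by apply pow2_ge_0. assert (P3 := Cmod_ge_0 (W v)).
      unfold A. apply Rmult_le_reg_r with ((r - Cmod z0) ^ m); auto.
      replace (/ (1 - r ^ 2) / (r - Cmod z0) ^ m * (r - Cmod z0) ^ m) with (/ (1 - r ^ 2)) by (field; lra).
      apply Rmult_le_reg_r with (1 - r ^ 2); auto. rewrite Rinv_l by lra.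
      assert (Cmod (W v) * (r - Cmod z0) ^ m <= Cmod (v - z0) ^ m * Cmod (W v)).
      { rewrite Rmult_comm. now apply Rmult_le_compat_r. }
      assert (Cmod (W v) * (r - Cmod z0) ^ m * (1 - r ^ 2) <= Cmod (v - z0) ^ m * Cmod (W v) * (1 - r ^ 2)) by (apply Rmult_le_compat_r; lra).
      lra. }
  destruct (order_from_bound (C_derive beta) z0 m A (r - Cmod z0)) as [W [HW EW]]; auto.
  - now apply holoD_C_derive.
  - lra.
  - intros w Hw. assert (Cmod w <= r) by (generalize (Cmod_rtriangle w z0); lra).
    apply (cvg_seq_Cmod_le _ _ _ n0 (Hcvg w ltac:(lra))). intros n Hn. apply Bd; auto.
    generalize (extraction_ge phi Hphi n). lia.
  - now apply (derive_n_order m (C_derive beta) W z0).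
Qed.

Lemma density_limit (u v : nat -> C) (x y : C) (a e : R) : cvg_seq u x -> cvg_seq v y ->
  (forall n, a * (1 - Cmod (u n) ^ 2) <= Cmod (v n) * e) -> a * (1 - Cmod x ^ 2) <= Cmod y * e.
Proof.
  intros Hu Hv H.
  apply (cvg_real_le (fun n => a * (1 - Cmod (u n) ^ 2)) (fun n => Cmod (v n) * e) _ _ O); [| |intros; auto].
  - assert (E : forall w, RtoC (a * (1 - Cmod w ^ 2)) = (RtoC a * (1 - RtoC (Cmod w) * RtoC (Cmod w)))%C).
    { intros w. rewrite <- RtoC_mult, <- RtoC_minus, <- RtoC_mult. f_equal. ring. }
    rewrite E. eapply cvg_seq_ext; [intros n; symmetry; apply E|].
    apply cvg_seq_scal, cvg_seq_minus; [apply cvg_seq_const|]. apply cvg_seq_mult; now apply cvg_seq_RtoC_Cmod.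
  - rewrite RtoC_mult. eapply cvg_seq_ext; [intros n; symmetry; apply RtoC_mult|].
    apply cvg_seq_mult; [now apply cvg_seq_RtoC_Cmod|apply cvg_seq_const].
Qed.

Lemma ccont_density (k b : C -> C) (z : C) : ccont k z -> ccont b z -> ccont (fun w => RtoC (Cmod (k w) * (1 - Cmod (b w) ^ 2))) z.
Proof.
  intros Hk Hb. apply (ccont_ext_loc (fun w => RtoC (Cmod (k w)) * (1 - RtoC (Cmod (b w)) * RtoC (Cmod (b w))))%C _ z 1); [lra| |].
  - intros w _. rewrite <- RtoC_mult, <- RtoC_minus, <- RtoC_mult. f_equal. ring.
  - apply ccont_mult; [now apply ccont_Cmod|]. apply ccont_minus; [apply ccont_const|]. apply ccont_mult; now apply ccont_Cmod.
Qed.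

(** The factor |g| cancels off its isolated zeros, and continuity gives the inequality at them as
    well. This matters at 0, which may be a critical point. *)
Lemma divide_density (g k1 k2 b1 b2 : C -> C) : holoD g -> (exists z, Cmod z < 1 /\ g z <> 0) ->
  holoD k1 -> holoD k2 -> holoD b1 -> holoD b2 ->
  (forall z, Cmod z < 1 -> Cmod (g z * k1 z) * (1 - Cmod (b2 z) ^ 2) <= Cmod (g z * k2 z) * (1 - Cmod (b1 z) ^ 2)) ->
  forall z, Cmod z < 1 -> Cmod (k1 z) * (1 - Cmod (b2 z) ^ 2) <= Cmod (k2 z) * (1 - Cmod (b1 z) ^ 2).
Proof.
  intros Hg Hne H1 H2 Hb1 Hb2 H z Hz. apply Rnot_lt_le. intros L.
  destruct (ccont_gt (fun w => Cmod (k1 w) * (1 - Cmod (b2 w) ^ 2) - Cmod (k2 w) * (1 - Cmod (b1 w) ^ 2)) z 0) as [d [Hd Hgt]].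
  - apply (ccont_ext_loc (fun w => RtoC (Cmod (k1 w) * (1 - Cmod (b2 w) ^ 2)) - RtoC (Cmod (k2 w) * (1 - Cmod (b1 w) ^ 2)))%C _ z 1); [lra| |].
    + intros w _. now rewrite RtoC_minus.
    + apply ccont_minus; apply ccont_density; now apply holoD_cont.
  - lra.
  - destruct (isolated_zeros g z Hg Hz Hne) as [d' [Hd' Hiso]].
    set (t := Rmin (Rmin d d') (1 - Cmod z) / 2).
    assert (Hm : 0 < Rmin (Rmin d d') (1 - Cmod z)) by (repeat apply Rmin_pos; lra).
    assert (m1 : Rmin (Rmin d d') (1 - Cmod z) <= d) by (eapply Rle_trans; [apply Rmin_l|apply Rmin_l]).
    assert (m2 : Rmin (Rmin d d') (1 - Cmod z) <= d') by (eapply Rle_trans; [apply Rmin_l|apply Rmin_r]).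
    assert (m3 : Rmin (Rmin d d') (1 - Cmod z) <= 1 - Cmod z) by apply Rmin_r.
    assert (Ht : Cmod (z + RtoC t - z) = t).
    { replace (z + RtoC t - z)%C with (RtoC t) by ring. rewrite Cmod_R. apply Rabs_right. unfold t. lra. }
    set (w := (z + RtoC t)%C) in *.
    assert (Nw : g w <> 0).
    { apply Hiso; [|rewrite Ht; unfold t; lra]. intros E. rewrite E in Ht. replace (z - z)%C with (RtoC 0) in Ht by ring.
      rewrite Cmod_0 in Ht. unfold t in Ht. lra. }
    assert (Ww : Cmod w < 1) by (apply (disk_nbhd z); rewrite Ht; unfold t; lra).
    assert (A := Hgt w ltac:(rewrite Ht; unfold t; lra)). assert (B := H w Ww). rewrite !Cmod_mult in B.
    assert (P := Cmod_neq0_pos _ Nw). rewrite !Rmult_assoc in B. apply Rmult_le_reg_l in B; lra.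
Qed.

(* The extremal function is a rotation of a limit of finite Blaschke products whose
   critical points are those of the given set in larger and larger disks. *)
Lemma extremal_approximation (c : multiset) (b : C -> C) : Hinfty_critical_set c -> extremal c b ->
  holoD b /\ self_map b /\ exists (bn : nat -> C -> C) (g beta : C -> C) (M : R) (mu : C),
    holoD g /\ (forall z, Cmod z < 1 -> c z = O -> g z <> 0) /\ 0 < M /\
    (forall z, Cmod z < 1 -> Cmod (g z) * (1 - Cmod z ^ 2) <= M) /\ Cmod mu = 1 /\ holoD beta /\
    (forall z, Cmod z < 1 -> b z = (mu * beta z)%C) /\
    (forall z, Cmod z < 1 -> cvg_seq (fun n => bn n z) (beta z) /\ cvg_seq (fun n => C_derive (bn n) z) (C_derive beta z)) /\
    forall n, holoD (bn n) /\ self_map (bn n) /\ boundary_sharp (bn n) /\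
      (forall z, Cmod z < 1 -> g z <> 0 -> C_derive (bn n) z <> 0) /\
      forall z, Cmod z < 1 -> Cmod (g z) * (1 - Cmod (bn n z) ^ 2) <= M * Cmod (C_derive (bn n) z).
Proof.
  intros [fs [Hfs [_ [_ Hord]]]] [Hb [b1 Hmax]].
  apply Hinfty_bounded in Hfs. destruct Hfs as [Hfs [M0 [HM0 Bfs]]].
  set (g := C_derive fs). assert (Hg : holoD g) by now apply holoD_C_derive.
  assert (Hord' : forall z, Cmod z < 1 -> has_order g z (c z)) by exact Hord. clear Hord.
  assert (Hne := order_nonzero c g Hord').
  destruct (F_class_elim c g b Hg Hord' Hb) as [HbD [kb [Hkb Ekb]]].
  assert (Bb := proj1 (sup_norm_le b 1) b1).
  assert (H0 : Cmod 0 < 1) by (rewrite Cmod_0; lra).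
  set (kappa := C_derive_n (c 0) g 0). assert (Nk : kappa <> 0) by apply (Hord' 0 H0).
  (* Rotating a competitor makes the value of its functional real and nonnegative. *)
  assert (Comp : forall f k, holoD f -> holoD k -> (forall z, Cmod z < 1 -> Cmod (f z) <= 1) ->
     (forall z, Cmod z < 1 -> C_derive f z = (g z * k z)%C) -> Cmod (k 0) <= Cmod (kb 0)).
  { intros f k Hf Hk Bf Ef. destruct (unit_root (kappa * k 0) 1 (le_n 1)) as [eta [Heta Eeta]].
    assert (E2 : forall z, Cmod z < 1 -> C_derive (fun z => eta * f z)%C z = (g z * (eta * k z))%C).
    { intros z Hz. rewrite C_derive_scal, Ef by auto. ring. }
    assert (B2 : forall z, Cmod z < 1 -> Cmod (eta * f z) <= 1).
    { intros z Hz. rewrite Cmod_mult, Heta, Rmult_1_l. auto. }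
    assert (Q := Hmax (fun z => eta * f z)%C
      (F_class_intro c g _ (fun z => eta * k z)%C 1 Hg Hord' (holoD_scal eta f Hf) Rlt_0_1 B2 (holoD_scal eta k Hk) E2)
      (proj2 (sup_norm_le _ 1) B2)).
    rewrite (extremal_functional c g _ _ Hg Hord' (holoD_scal eta k Hk) E2), (extremal_functional c g b kb Hg Hord' Hkb Ekb) in Q.
    fold kappa in Q. replace (kappa * (eta * k 0))%C with (eta ^ 1 * (kappa * k 0))%C in Q by (simpl; ring).
    rewrite Eeta, re_RtoC in Q. assert (R1 := re_le_Cmod (kappa * kb 0)). apply Rabs_le_between in R1.
    rewrite !Cmod_mult in *. apply Rmult_le_reg_l with (Cmod kappa); [now apply Cmod_neq0_pos|lra]. }
  assert (Iv : Cmod (RtoC (/ M0)) = / M0) by (rewrite Cmod_R; apply Rabs_right; left; now apply Rinv_0_lt_compat).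
  assert (PI : 0 < / M0) by now apply Rinv_0_lt_compat.
  assert (fsn : holoD (fun z => RtoC (/ M0) * fs z)%C) by now apply holoD_scal.
  assert (fsd : forall z, Cmod z < 1 -> C_derive (fun z => RtoC (/ M0) * fs z)%C z = (g z * RtoC (/ M0))%C).
  { intros z Hz. rewrite C_derive_scal by auto. unfold g. ring. }
  assert (fsb : forall z, Cmod z < 1 -> Cmod (RtoC (/ M0) * fs z) <= 1).
  { intros z Hz. rewrite Cmod_mult, Iv. apply Rmult_le_reg_l with M0; auto. rewrite <- Rmult_assoc, Rinv_r, Rmult_1_l, Rmult_1_r by lra. auto. }
  (* The given function divided by its bound is a competitor with constant cofactor 1/M0, so the
     maximum is positive. *)
  assert (Nkb : kb 0 <> 0).
  { intros E. assert (Q := Comp _ _ fsn (holoD_const (RtoC (/ M0))) fsb fsd). cbv beta in Q. rewrite E, Cmod_0, Iv in Q. lra. }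
  assert (NC : forall f k, holoD f -> holoD k -> (forall z, Cmod z < 1 -> C_derive f z = (g z * k z)%C) -> k 0 <> 0 ->
     exists z w, Cmod z < 1 /\ Cmod w < 1 /\ f z <> f w).
  { intros f k Hf Hk Ef N. apply NNPP. intros NN. apply N. apply (identity_mult g k Hg Hk); auto.
    intros z Hz. rewrite <- Ef by auto. apply is_cderiv_C_derive.
    apply (is_cderiv_ext_loc (fun _ => f 0) f z 0 (1 - Cmod z)); [lra| |apply is_cderiv_const].
    intros w Hw. apply NNPP. intros N'. apply NN. exists 0, w. split; auto. split; [now apply (disk_nbhd z)|auto]. }
  assert (Sb : self_map b) by (apply strict_self_map; auto; now apply (NC b kb)).
  assert (Sfs : self_map (fun z => RtoC (/ M0) * fs z)%C).
  { apply strict_self_map; auto. apply (NC _ (fun _ => RtoC (/ M0)) fsn (holoD_const _) fsd). intros E. apply RtoC_inj in E. lra. }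
  split; auto. split; auto.
  destruct (dominating_sequence g Hg Hne) as [bs [h Hbs]].
  destruct (montel bs 1) as [phi [beta [Hphi [Hbeta Hcv]]]].
  { intros n. apply Hbs. } { intros n z Hz. left. now apply Hbs. }
  assert (Vb : forall z, Cmod z < 1 -> vanishes_to_order (C_derive beta) z (c z)).
  { intros z Hz. apply (limit_vanishes bs h g beta phi z (c z)); auto.
    - intros n. destruct (Hbs n) as [X1 [X2 [X3 [X4 [X5 [X6 [X7 _]]]]]]]. auto.
    - intros w Hw. now apply Hcv.
    - now apply Hord'. }
  destruct (divide_by_orders g (C_derive beta) c Hg (holoD_C_derive _ Hbeta) Hord' Vb) as [kbe [Hkbe Ekbe]].
  assert (Bbe : forall z, Cmod z < 1 -> Cmod (beta z) <= 1).
  { intros z Hz. apply (cvg_seq_Cmod_le _ _ _ O (proj1 (Hcv z Hz))). intros n _. left. now apply Hbs. }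
  assert (be0 : beta 0 = 0).
  { apply (cvg_seq_unique (fun n => bs (phi n) 0)); [now apply Hcv|].
    apply (cvg_seq_ext (fun _ => RtoC 0)); [|apply cvg_seq_const]. intros n. symmetry. apply Hbs. }
  assert (Sbe := self_map_fixed beta Hbeta be0 Bbe).
  assert (Ineq : forall z, Cmod z < 1 -> Cmod (kb z) * (1 - Cmod (beta z) ^ 2) <= Cmod (kbe z) * (1 - Cmod (b z) ^ 2)).
  { apply (divide_density g); auto. intros z Hz. rewrite <- Ekb, <- Ekbe by auto.
    apply (density_limit (fun n => bs (phi n) z) (fun n => C_derive (bs (phi n)) z)); try now apply Hcv.
    intros n. destruct (Hbs (phi n)) as [X1 [X2 [X3 [X4 [X5 [X6 [X7 [X8 X9]]]]]]]]. now apply (X9 b kb). }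
  (* Extremality of b gives |kbe 0| <= |kb 0|, while domination by the limit gives |kb 0| <= |kbe 0|
     (1 - |b 0|^2). As [kb 0] is nonzero, this forces b 0 = 0 and equality of the densities at 0,
     the situation of [density_rigidity]. *)
  assert (L1 := Comp beta kbe Hbeta Hkbe Bbe Ekbe). assert (L2 := Ineq 0 H0). rewrite be0, Cmod_0 in L2.
  assert (Pk := Cmod_neq0_pos _ Nkb). assert (P2 := Cmod_ge_0 (b 0)).
  assert (b0 : b 0 = 0). { apply Cmod_le0. apply Rnot_lt_le. intros L. assert (0 < Cmod (b 0) ^ 2) by (apply pow_lt; lra).
    assert (P3 := Cmod_ge_0 (kbe 0)). assert (0 < Cmod (kbe 0)) by (apply Rnot_le_lt; intros L3; replace (Cmod (kbe 0)) with 0 in L2 by lra; lra).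
    assert (0 < Cmod (kbe 0) * Cmod (b 0) ^ 2) by (now apply Rmult_lt_0_compat). lra. }
  destruct (density_rigidity b beta g kb kbe) as [mu [Hmu Emu]]; auto.
  { rewrite b0, Cmod_0 in L2. lra. }
  exists (fun n => bs (phi n)), g, beta, M0, mu. split; auto. split.
  { intros z Hz Ec. destruct (Hord' z Hz) as [_ N]. now rewrite Ec in N. }
  split; auto. split.
  { intros z Hz. assert (Q := schwarz_pick _ z fsn Sfs Hz). rewrite fsd, Cmod_mult, Iv in Q by auto.
    assert (P4 := pow2_ge_0 (Cmod (RtoC (/ M0) * fs z))).
    apply Rmult_le_reg_l with (/ M0); auto. rewrite Rinv_l by lra. lra. }
  do 4 (split; auto). intros n. destruct (Hbs (phi n)) as [X1 [X2 [X3 [X4 [X5 [X6 [X7 [X8 X9]]]]]]]].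
  do 4 (split; auto). intros z Hz.
  assert (Q := X9 _ _ fsn Sfs (holoD_const (RtoC (/ M0))) fsd z Hz). rewrite fsd, Cmod_mult, Iv in Q by auto.
  assert (P3 := Cmod_ge_0 (C_derive (bs (phi n)) z)). assert (P4 := pow2_ge_0 (Cmod (RtoC (/ M0) * fs z))).
  assert (Q2 : Cmod (g z) * / M0 * (1 - Cmod (bs (phi n) z) ^ 2) <= Cmod (C_derive (bs (phi n)) z)) by nra.
  apply Rmult_le_reg_l with (/ M0); auto. rewrite <- (Rmult_assoc (/ M0) M0), Rinv_l, Rmult_1_l by lra. lra.
Qed.

(** * A barrier near a boundary point *)

Lemma exp_mono (x y : R) : x <= y -> exp x <= exp y.
Proof. intros [H| ->]; [left; now apply exp_increasing|lra]. Qed.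

(** The right-hand side is the Poisson kernel of [xi], through which the modulus of the barrier is
    computed. *)
Lemma Re_cayley (xi z : C) : z <> xi -> Cmod xi = 1 -> Re ((xi + z) / (xi - z)) = (1 - Cmod z ^ 2) / Cmod (xi - z) ^ 2.
Proof.
  intros N Hxi. assert (N' : (xi - z)%C <> 0) by (intros E; apply N; symmetry; now apply Cminus_eq0).
  assert (P := Cmod_neq0_pos _ N'). set (q := Cmod (xi - z)) in *.
  assert (cn : Cconj (xi - z) <> 0) by (apply Cmod_gt_0; now rewrite Cmod_conj).
  assert (E : ((xi + z) / (xi - z))%C = ((xi + z) * Cconj (xi - z) * RtoC (/ q ^ 2))%C).
  { rewrite RtoC_inv by (apply pow_nonzero; lra). unfold q. rewrite Cmod2_conj. field. auto. }
  rewrite E. assert (X := Cmod2_expand xi). rewrite Hxi in X. rewrite (Cmod2_expand z). unfold Rdiv.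
  replace 1 with (fst xi ^ 2 + snd xi ^ 2) by lra. destruct xi as [a b], z as [c d]. simpl. ring.
Qed.

(** The disk of radius rho tangent at [xi] is the horodisk |z - xi|^2 < rho/(1 - rho) (1 - |z|^2),
    and rho <= 1/2 makes the factor at most 1. *)
Lemma tangent_disk (xi z : C) (rho : R) : Cmod xi = 1 -> 0 < rho <= 1 / 2 ->
  Cmod (z - RtoC (1 - rho) * xi) < rho -> Cmod z < 1 /\ Cmod (z - xi) ^ 2 <= 1 - Cmod z ^ 2.
Proof.
  intros Hxi Hr Hz.
  assert (Q : Cmod z < 1).
  { replace z with (z - RtoC (1 - rho) * xi + RtoC (1 - rho) * xi)%C by ring.
    eapply Rle_lt_trans; [apply Cmod_triangle|]. rewrite (Cmod_mult (RtoC (1 - rho)) xi), Hxi, Cmod_R, Rabs_right by lra. lra. }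
  split; auto. assert (Z : Cmod (z - RtoC (1 - rho) * xi) ^ 2 < rho ^ 2) by (assert (Q0 := Cmod_ge_0 (z - RtoC (1 - rho) * xi)); nra).
  assert (X := Cmod2_expand xi). rewrite Hxi in X.
  rewrite Cmod2_expand in Z. rewrite !Cmod2_expand. destruct xi as [a b], z as [c d]. simpl in *.
  assert (E : (c - a) ^ 2 + (d - b) ^ 2 + 2 * rho * (a * (c - a) + b * (d - b)) < 0).
  { assert ((c + - ((1 - rho) * a - 0 * b)) ^ 2 + (d + - ((1 - rho) * b + 0 * a)) ^ 2 =
      (c - a) ^ 2 + (d - b) ^ 2 + 2 * rho * (a * (c - a) + b * (d - b)) + rho ^ 2 * (a ^ 2 + b ^ 2)) by ring.
    assert (rho ^ 2 * (a ^ 2 + b ^ 2) = rho ^ 2) by (rewrite <- (Rmult_1_r (rho ^ 2)) at 2; f_equal; lra). simpl in *. lra. }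
  set (s := a * (c - a) + b * (d - b)) in *. set (q := (c - a) ^ 2 + (d - b) ^ 2) in *.
  assert (E2 : c ^ 2 + d ^ 2 = 1 + 2 * s + q) by (unfold s, q; lra).
  assert (q0 : 0 <= q) by (unfold q; apply Rplus_le_le_0_compat; apply pow2_ge_0).
  assert (s0 : q + s <= 0). { assert (s <= 0) by (apply Rnot_lt_le; intros L; nra). nra. }
  replace ((c + - a) * ((c + - a) * 1) + (d + - b) * ((d + - b) * 1)) with q by (unfold q; ring).
  replace (c * (c * 1) + d * (d * 1)) with (c ^ 2 + d ^ 2) by ring. lra.
Qed.

(** Harnack's inequality needs a bounded zero-free function, but g may grow like M/(1 - |z|^2). In
    the tangent disk |z - xi|^2 <= 1 - |z|^2, so (z - xi)^2 g/M is bounded by 1 there. *)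
Lemma tangent_disk_bound (g : C -> C) (xi : C) (rho M : R) : Cmod xi = 1 -> 0 < rho <= 1 / 2 -> 0 < M -> holoD g ->
  (forall z, Cmod z < 1 -> Cmod (g z) * (1 - Cmod z ^ 2) <= M) ->
  (forall z, Cmod (z - RtoC (1 - rho) * xi) < rho -> g z <> 0) ->
  exists K, 0 < K /\ forall z, Cmod (z - RtoC (1 - rho) * xi) < rho ->
    M * exp (- (K / (rho - Cmod (z - RtoC (1 - rho) * xi)))) <= Cmod (z - xi) ^ 2 * Cmod (g z).
Proof.
  intros Hxi Hr HM Hg Hb Hn. set (c1 := (RtoC (1 - rho) * xi)%C) in *.
  assert (In : forall z, Cmod (z - c1) < rho -> Cmod z < 1 /\ Cmod (z - xi) ^ 2 <= 1 - Cmod z ^ 2) by (intros; now apply (tangent_disk xi z rho)).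
  assert (PM : 0 < / M) by now apply Rinv_0_lt_compat.
  destruct (zero_free_lower_bound (fun z => RtoC (/ M) * ((z - xi) * (z - xi) * g z))%C c1 rho) as [K [HK HKb]].
  - lra.
  - intros z Hz. apply (holoD_scal (RtoC (/ M)) (fun z => (z - xi) * (z - xi) * g z)%C); [|now apply In].
    apply holoD_mult; auto. apply holoD_mult; apply holoD_minus; auto using holoD_id, holoD_const.
  - intros z Hz. assert (z - xi <> 0)%C.
    { intros E. apply Cminus_eq0 in E. destruct (In z Hz) as [X _]. rewrite E in X. lra. }
    apply Cmult_neq_0; [intros E; apply RtoC_inj in E; lra|]. apply Cmult_neq_0; auto. now apply Cmult_neq_0.
  - intros z Hz. destruct (In z Hz) as [X1 X2]. rewrite !Cmod_mult, Cmod_R, Rabs_right by lra.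
    apply Rmult_le_reg_l with M; auto. rewrite <- Rmult_assoc, Rinv_r, Rmult_1_l, Rmult_1_r by lra.
    eapply Rle_trans; [|apply (Hb z X1)]. rewrite Rmult_comm. apply Rmult_le_compat_l; [apply Cmod_ge_0|]. simpl in X2. lra.
  - exists K. split; auto. intros z Hz. specialize (HKb z Hz). rewrite !Cmod_mult, Cmod_R, Rabs_right in HKb by lra.
    apply Rmult_le_reg_l with (/ M); auto. rewrite <- Rmult_assoc, Rinv_l, Rmult_1_l by lra. simpl. lra.
Qed.

(** Here sigma is the cosine of the angle between the chord and the inner normal at [xi]. For tau <=
    rho sigma the chord point at distance tau from [xi] lies at depth at least sigma tau/2 in the
    tangent disk, which turns the Harnack exponent into a multiple of 1/tau. *)
Lemma chord_end_bound (g : C -> C) (xi : C) (rho M sigma : R) : Cmod xi = 1 -> 0 < rho <= 1 / 2 -> 0 < M -> 0 < sigma -> holoD g ->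
  (forall z, Cmod z < 1 -> Cmod (g z) * (1 - Cmod z ^ 2) <= M) ->
  (forall z, Cmod (z - RtoC (1 - rho) * xi) < rho -> g z <> 0) ->
  exists K, 0 < K /\ forall z tau, 0 < tau <= rho * sigma -> Cmod (z - xi) = tau ->
    Re (Cconj xi * (z - xi)) = - (sigma * tau) -> M * exp (- (K / tau)) <= tau ^ 2 * Cmod (g z).
Proof.
  intros Hxi Hr HM Hs Hg Hb Hn. destruct (tangent_disk_bound g xi rho M Hxi Hr HM Hg Hb Hn) as [K [HK HKb]].
  exists (2 * K / sigma). split; [apply Rdiv_lt_0_compat; lra|]. intros z tau Ht Em Er.
  set (q := Cmod (z - RtoC (1 - rho) * xi)) in *.
  assert (q0 : 0 <= q) by apply Cmod_ge_0.
  assert (Eq : q ^ 2 = rho ^ 2 - tau * (2 * rho * sigma - tau)).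
  { assert (X := Cmod2_expand xi). rewrite Hxi in X. assert (Y := Cmod2_expand (z - xi)). rewrite Em in Y.
    unfold q. rewrite Cmod2_expand.
    destruct xi as [a b], z as [c d]. simpl in *.
    assert ((c + - ((1 - rho) * a - 0 * b)) * ((c + - ((1 - rho) * a - 0 * b)) * 1) + (d + - ((1 - rho) * b + 0 * a)) * ((d + - ((1 - rho) * b + 0 * a)) * 1) =
      ((c + - a) * ((c + - a) * 1) + (d + - b) * ((d + - b) * 1)) + 2 * rho * (a * (c + - a) - - b * (d + - b)) + rho ^ 2 * (a * (a * 1) + b * (b * 1))) by ring.
    rewrite H, Er, <- Y. replace (a * (a * 1) + b * (b * 1)) with 1 by lra. ring. }
  assert (ts : tau * sigma > 0) by nra.
  assert (Eq2 : q ^ 2 <= rho ^ 2 - tau * (rho * sigma)) by nra.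
  assert (qr : q < rho) by nra.
  assert (qd : tau * sigma / 2 <= rho - q) by nra.
  specialize (HKb z). fold q in HKb. specialize (HKb qr). rewrite Em in HKb.
  eapply Rle_trans; [|exact HKb]. apply Rmult_le_compat_l; [lra|].
  assert (K / (rho - q) <= 2 * K / sigma / tau).
  { replace (2 * K / sigma / tau) with (K / (tau * sigma / 2)) by (field; lra).
    apply Rmult_le_compat_l; [lra|]. apply Rinv_le_contravar; lra. }
  apply exp_mono. lra.
Qed.

Lemma chord_coordinates (zeta z : C) (kappa sigma : R) : Cmod zeta = 1 -> Cmod z < 1 -> 0 < sigma -> sigma ^ 2 = 1 - kappa ^ 2 ->
  Re (z * Cconj zeta) = kappa ->
  exists y, - sigma < y < sigma /\ z = (zeta * (kappa, y))%C /\ 1 - Cmod z ^ 2 = sigma ^ 2 - y ^ 2.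
Proof.
  intros Hz0 Hz Hs Es Hk. exists (Im (z * Cconj zeta)).
  assert (E : z = (zeta * (kappa, Im (z * Cconj zeta)))%C).
  { rewrite <- Hk. replace (Re (z * Cconj zeta), Im (z * Cconj zeta)) with (z * Cconj zeta)%C by (now destruct (z * Cconj zeta)%C).
    transitivity (Cconj zeta * zeta * z)%C; [rewrite circle_conj by auto; ring|ring]. }
  set (y := Im (z * Cconj zeta)) in *. clearbody y.
  assert (N : Cmod z ^ 2 = kappa ^ 2 + y ^ 2).
  { rewrite E, Cmod_mult, Hz0, Rmult_1_l, Cmod2_expand. reflexivity. }
  assert (Cmod z ^ 2 < 1) by now apply sq_lt_1; [apply Cmod_ge_0|].
  split; [split; nra|]. split; auto. lra.
Qed.

(** At the chord point zeta (kappa, y) the two Poisson kernels are (sigma + y)/(sigma - y) and its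
    inverse. Near an end one of them is at least sigma/tau, with tau the distance to that end, and
    dominates the Harnack exponent; the middle of the chord is compact, and there |g| has a positive
    minimum. *)
Lemma chord_lower_bound (g : C -> C) (zeta : C) (kappa sigma rho M : R) : Cmod zeta = 1 -> 0 < sigma -> sigma ^ 2 = 1 - kappa ^ 2 ->
  0 < rho <= 1 / 2 -> 0 < M -> holoD g ->
  (forall z, Cmod z < 1 -> Cmod (g z) * (1 - Cmod z ^ 2) <= M) ->
  (forall z, Cmod (z - RtoC (1 - rho) * (zeta * (kappa, sigma))) < rho -> g z <> 0) ->
  (forall z, Cmod (z - RtoC (1 - rho) * (zeta * (kappa, - sigma))) < rho -> g z <> 0) ->
  (forall z, Cmod z < 1 -> Re (z * Cconj zeta) = kappa -> g z <> 0) ->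
  exists K, 0 < K /\ forall z, Cmod z < 1 -> Re (z * Cconj zeta) = kappa ->
    exp (- (K * ((1 - Cmod z ^ 2) / Cmod (zeta * (kappa, sigma) - z) ^ 2 + (1 - Cmod z ^ 2) / Cmod (zeta * (kappa, (- sigma)%R) - z) ^ 2)))
      <= Cmod (g z) * (1 - Cmod z ^ 2).
Proof.
  intros Hz0 Hs Es Hr HM Hg Hb Hn1 Hn2 Hn.
  assert (U : forall s, s = sigma \/ s = - sigma -> Cmod (zeta * (kappa, s)) = 1).
  { intros s Hs'. rewrite Cmod_mult, Hz0, Rmult_1_l. unfold Cmod. simpl fst; simpl snd.
    replace (kappa ^ 2 + s ^ 2) with 1; [apply sqrt_1|]. destruct Hs' as [->| ->]; nra. }
  destruct (chord_end_bound g (zeta * (kappa, sigma)) rho M sigma) as [K1 [HK1 B1]]; auto.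
  destruct (chord_end_bound g (zeta * (kappa, (- sigma)%R)) rho M sigma) as [K2 [HK2 B2]]; auto.
  (* The modulus of the two chord points at distance rho sigma from the ends; the chord points in
     |z| <= r form the middle part. *)
  set (r := sqrt (kappa ^ 2 + (sigma * (1 - rho)) ^ 2)).
  assert (r2 : r ^ 2 = kappa ^ 2 + (sigma * (1 - rho)) ^ 2) by (unfold r; rewrite pow2_sqrt; [ring|nra]).
  assert (r0 : 0 <= r) by apply sqrt_pos.
  assert (r1 : r < 1). { apply lt_1_sq; auto. assert (0 < sigma ^ 2) by (now apply pow_lt). assert ((1 - rho) ^ 2 < 1) by nra.
    rewrite r2, Rpow_mult_distr. nra. }
  clearbody r.
  destruct (max_on_compact (fun z => Re (z * Cconj zeta) = kappa /\ Cmod z <= r) (fun z => - Cmod (g z)) r) as [zm [[Zm1 Zm2] Zm3]].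
  - intros z [_ H]; auto.
  - intros l Hl. split.
    + apply Rminus_diag_uniq. destruct (Req_dec (Re (l * Cconj zeta) - kappa) 0) as [|N]; auto.
      exfalso. assert (P := Rabs_pos_lt _ N). destruct (Hl _ P) as [z [[E _] Hd]]. rewrite <- E in Hd at 1.
      assert (A := re_le_Cmod ((z - l) * Cconj zeta)). rewrite Cmod_mult, Cmod_conj, Hz0, Rmult_1_r in A.
      replace (Re ((z - l) * Cconj zeta)) with (- (Re (l * Cconj zeta) - Re (z * Cconj zeta))) in A
        by (destruct z, l, zeta; simpl; ring). rewrite Rabs_Ropp in A. lra.
    + apply le_epsilon. intros e He. destruct (Hl e He) as [z [[_ E] Hd]]. rewrite Cmod_sym in Hd. generalize (Cmod_rtriangle l z). lra.
  - exists (zeta * RtoC kappa)%C. split.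
    + transitivity (Re (Cconj zeta * zeta * RtoC kappa)); [f_equal; ring|]. rewrite circle_conj by auto. simpl. ring.
    + rewrite Cmod_mult, Hz0, Rmult_1_l, Cmod_R. apply Rsqr_incr_0; [|apply Rabs_pos|auto]. rewrite <- Rsqr_abs. unfold Rsqr. nra.
  - intros z [_ Hz]. apply (ccont_ext_loc (fun w => - RtoC (Cmod (g w)))%C _ z 1); [lra|intros; now rewrite RtoC_opp|].
    apply ccont_opp, ccont_Cmod, holoD_cont; auto. lra.
  - set (m := Cmod (g zm) * (1 - r ^ 2)).
    assert (Nm : 0 < Cmod (g zm)) by (apply Cmod_neq0_pos, Hn; auto; lra).
    assert (Hm : 0 < m) by (apply Rmult_lt_0_compat; nra).
    assert (Pm := Rabs_pos (ln m)). assert (PM := Rabs_pos (ln M)).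
    assert (k1 : 0 < K1 / sigma) by (apply Rdiv_lt_0_compat; lra). assert (k2 : 0 < K2 / sigma) by (apply Rdiv_lt_0_compat; lra).
    assert (Lexp : forall x, 0 < x -> exp (- Rabs (ln x)) <= x).
    { intros x Hx. rewrite <- (exp_ln x) at 2 by auto. apply exp_mono. generalize (Rle_abs (- ln x)). rewrite Rabs_Ropp. lra. }
    (* One summand for each case: the minimum [m] in the middle, the factor [M] and the exponents K1
       and K2 at the ends. Constants may be multiplied by the sum of the two kernels because that
       sum is at least 1 on the chord. *)
    exists (Rabs (ln m) + Rabs (ln M) + K1 / sigma + K2 / sigma). split; [lra|]. intros z Hz Hk.
    destruct (chord_coordinates zeta z kappa sigma Hz0 Hz Hs Es Hk) as [y [Hy [Ez En]]].
    assert (D1 : Cmod (zeta * (kappa, sigma) - z) = sigma - y).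
    { rewrite Ez. replace (zeta * (kappa, sigma) - zeta * (kappa, y))%C with (zeta * (Ci * RtoC (sigma - y)))%C
        by (unfold Cminus, Cplus, Cmult, Ci, Copp, RtoC; destruct zeta; simpl; f_equal; ring).
      rewrite !Cmod_mult, Hz0, Cmod_R, Rabs_right by lra. replace (Cmod Ci) with 1; [ring|]. unfold Cmod, Ci. simpl.
      replace (0 * (0 * 1) + 1 * (1 * 1)) with 1 by ring. now rewrite sqrt_1. }
    assert (D2 : Cmod (zeta * (kappa, (- sigma)%R) - z) = sigma + y).
    { rewrite Ez. replace (zeta * (kappa, (- sigma)%R) - zeta * (kappa, y))%C with (zeta * (Ci * RtoC (- (sigma + y))))%C
        by (unfold Cminus, Cplus, Cmult, Ci, Copp, RtoC; destruct zeta; simpl; f_equal; ring).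
      rewrite !Cmod_mult, Hz0, Cmod_R, Rabs_Ropp, Rabs_right by lra. replace (Cmod Ci) with 1; [ring|]. unfold Cmod, Ci. simpl.
      replace (0 * (0 * 1) + 1 * (1 * 1)) with 1 by ring. now rewrite sqrt_1. }
    rewrite D1, D2, En.
    replace ((sigma ^ 2 - y ^ 2) / (sigma - y) ^ 2) with ((sigma + y) / (sigma - y)) by (field; lra).
    replace ((sigma ^ 2 - y ^ 2) / (sigma + y) ^ 2) with ((sigma - y) / (sigma + y)) by (field; lra).
    assert (S1 : 0 < (sigma + y) / (sigma - y)) by (apply Rdiv_lt_0_compat; lra).
    assert (S2 : 0 < (sigma - y) / (sigma + y)) by (apply Rdiv_lt_0_compat; lra).
    assert (T1 : (sigma + y) / (sigma - y) * (sigma - y) = sigma + y) by (field; lra).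
    assert (T2 : (sigma - y) / (sigma + y) * (sigma + y) = sigma - y) by (field; lra).
    set (Q1 := (sigma + y) / (sigma - y)) in *. set (Q2 := (sigma - y) / (sigma + y)) in *. clearbody Q1 Q2.
    assert (SS : 1 <= Q1 + Q2) by (destruct (Rle_lt_dec 0 y); nra).
    assert (G0 := Cmod_ge_0 (g z)).
    assert (Mono : forall A x B, 0 < x -> 0 <= A -> 0 <= B -> Rabs (ln x) + A <= (Rabs (ln m) + Rabs (ln M) + K1 / sigma + K2 / sigma) * (Q1 + Q2) ->
      x * exp (- A) <= B -> exp (- ((Rabs (ln m) + Rabs (ln M) + K1 / sigma + K2 / sigma) * (Q1 + Q2))) <= B).
    { intros A x B Hx HA HB L1 L2. eapply Rle_trans; [|exact L2].
      eapply Rle_trans; [apply (exp_mono _ (- Rabs (ln x) + - A)); lra|]. rewrite exp_plus.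
      apply Rmult_le_compat_r; [left; apply exp_pos|auto]. }
    destruct (Rle_lt_dec (sigma - y) (rho * sigma)) as [C1|C1]; [|destruct (Rle_lt_dec (sigma + y) (rho * sigma)) as [C2|C2]].
    + assert (B := B1 z (sigma - y) ltac:(lra)). rewrite (Cmod_sym z _) in B. specialize (B D1).
      assert (X : Re (Cconj (zeta * (kappa, sigma)) * (z - zeta * (kappa, sigma))) = - (sigma * (sigma - y))).
      { rewrite Ez. transitivity (Re (Cconj zeta * zeta * (Cconj (kappa, sigma) * ((kappa, y) - (kappa, sigma)))));
          [rewrite Cmult_conj; f_equal; ring|]. rewrite circle_conj by auto. simpl. ring. }
      specialize (B X).
      assert (Y1 : sigma <= Q1 * (sigma - y)) by nra.
      apply (Mono (K1 / (sigma - y)) M); auto.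
      * left. apply Rdiv_lt_0_compat; lra.
      * apply Rmult_le_pos; nra.
      * assert (K1 / (sigma - y) <= K1 / sigma * Q1).
        { apply Rmult_le_reg_r with (sigma * (sigma - y)); [nra|]. replace (K1 / (sigma - y) * (sigma * (sigma - y))) with (K1 * sigma) by (field; lra).
          replace (K1 / sigma * Q1 * (sigma * (sigma - y))) with (K1 * (Q1 * (sigma - y))) by (field; lra). nra. }
        nra.
      * eapply Rle_trans; [exact B|]. rewrite Rmult_comm. apply Rmult_le_compat_l; nra.
    + assert (B := B2 z (sigma + y) ltac:(lra)). rewrite (Cmod_sym z _) in B. specialize (B D2).
      assert (X : Re (Cconj (zeta * (kappa, (- sigma)%R)) * (z - zeta * (kappa, (- sigma)%R))) = - (sigma * (sigma + y))).
      { rewrite Ez. transitivity (Re (Cconj zeta * zeta * (Cconj (kappa, (- sigma)%R) * ((kappa, y) - (kappa, (- sigma)%R)))));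
          [rewrite Cmult_conj; f_equal; ring|]. rewrite circle_conj by auto. simpl. ring. }
      specialize (B X).
      assert (Y1 : sigma <= Q2 * (sigma + y)) by nra.
      apply (Mono (K2 / (sigma + y)) M); auto.
      * left. apply Rdiv_lt_0_compat; lra.
      * apply Rmult_le_pos; nra.
      * assert (K2 / (sigma + y) <= K2 / sigma * Q2).
        { apply Rmult_le_reg_r with (sigma * (sigma + y)); [nra|]. replace (K2 / (sigma + y) * (sigma * (sigma + y))) with (K2 * sigma) by (field; lra).
          replace (K2 / sigma * Q2 * (sigma * (sigma + y))) with (K2 * (Q2 * (sigma + y))) by (field; lra). nra. }
        nra.
      * eapply Rle_trans; [exact B|]. rewrite Rmult_comm. apply Rmult_le_compat_l; nra.
    + assert (Y : y ^ 2 <= (sigma * (1 - rho)) ^ 2) by nra.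
      assert (Zr : Cmod z <= r). { apply Rsqr_incr_0; [unfold Rsqr; nra|apply Cmod_ge_0|auto]. }
      assert (B := Zm3 z (conj Hk Zr)).
      apply (Mono 0 m); auto; try lra.
      * apply Rmult_le_pos; nra.
      * nra.
      * rewrite Ropp_0, exp_0, Rmult_1_r. unfold m. apply Rmult_le_compat; nra.
Qed.

Lemma barrier (K : R) (xi1 xi2 : C) : 0 < K -> Cmod xi1 = 1 -> Cmod xi2 = 1 ->
  exists psi, holoD psi /\ (forall z, Cmod z < 1 -> Cmod (psi z) <= 1) /\
    forall z, Cmod z < 1 -> Cmod (psi z) = exp (- (K * ((1 - Cmod z ^ 2) / Cmod (xi1 - z) ^ 2 + (1 - Cmod z ^ 2) / Cmod (xi2 - z) ^ 2))).
Proof.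
  intros HK H1 H2.
  set (q := fun z => (RtoC (- K) * ((xi1 + z) / (xi1 - z) + (xi2 + z) / (xi2 - z)))%C).
  assert (N : forall xi z, Cmod xi = 1 -> Cmod z < 1 -> (xi - z)%C <> 0).
  { intros xi z Hx Hz E. apply Cminus_eq0 in E. rewrite E in Hx. lra. }
  assert (Hq : holoD q).
  { apply (holoD_scal (RtoC (- K)) (fun z => (xi1 + z) / (xi1 - z) + (xi2 + z) / (xi2 - z))%C).
    apply holoD_plus; apply holoD_div; auto using holoD_plus, holoD_minus, holoD_const, holoD_id. }
  assert (E : forall z, Cmod z < 1 -> Cmod (Cexp (q z)) = exp (- (K * ((1 - Cmod z ^ 2) / Cmod (xi1 - z) ^ 2 + (1 - Cmod z ^ 2) / Cmod (xi2 - z) ^ 2)))).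
  { intros z Hz. rewrite Cmod_Cexp. f_equal. rewrite <- !Re_cayley; auto; try (intros E; subst; lra). unfold q.
    destruct ((xi1 + z) / (xi1 - z))%C, ((xi2 + z) / (xi2 - z))%C. simpl. ring. }
  exists (fun z => Cexp (q z)). split; [|split; auto].
  - intros z Hz. destruct (Hq z Hz) as [l Hl]. eexists. apply (is_cderiv_comp q Cexp z); [exact Hl|apply is_cderiv_Cexp].
  - intros z Hz. rewrite E by auto. eapply Rle_trans; [apply (exp_mono _ 0)|apply Req_le, exp_0].
    assert (P : forall xi, Cmod xi = 1 -> 0 <= (1 - Cmod z ^ 2) / Cmod (xi - z) ^ 2).
    { intros xi Hx. apply Rmult_le_pos; [generalize (sq_lt_1 _ (Cmod_ge_0 z) Hz); lra|].
      left. apply Rinv_0_lt_compat, pow_lt, Cmod_neq0_pos, N; auto. }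
    assert (P1 := P xi1 H1). assert (P2 := P xi2 H2). assert (0 <= K * ((1 - Cmod z ^ 2) / Cmod (xi1 - z) ^ 2 + (1 - Cmod z ^ 2) / Cmod (xi2 - z) ^ 2)) by (apply Rmult_le_pos; lra). lra.
Qed.

Lemma poisson_near (xi zeta z : C) (e : R) : Cmod xi = 1 -> Cmod zeta = 1 -> Cmod (xi - zeta) = e -> 0 < e -> Cmod z < 1 -> Cmod (z - zeta) <= e / 2 ->
  (1 - Cmod z ^ 2) / Cmod (xi - z) ^ 2 <= 8 / e ^ 2 * Cmod (z - zeta).
Proof.
  intros Hx Hz0 He He0 Hz Hd.
  assert (A : e / 2 <= Cmod (xi - z)).
  { replace (xi - zeta)%C with ((xi - z) + (z - zeta))%C in He by ring. generalize (Cmod_triangle (xi - z) (z - zeta)). lra. }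
  assert (B : 1 - Cmod z <= Cmod (z - zeta)).
  { rewrite Cmod_sym. rewrite <- Hz0 at 1. apply Cmod_rtriangle. }
  assert (C0 := Cmod_ge_0 z). assert (D : 1 - Cmod z ^ 2 <= 2 * Cmod (z - zeta)) by nra.
  assert (P : 0 < Cmod (xi - z) ^ 2) by (apply pow_lt; lra).
  apply Rmult_le_reg_r with (Cmod (xi - z) ^ 2); auto.
  replace ((1 - Cmod z ^ 2) / Cmod (xi - z) ^ 2 * Cmod (xi - z) ^ 2) with (1 - Cmod z ^ 2) by (field; lra).
  assert (Q : (e / 2) ^ 2 <= Cmod (xi - z) ^ 2) by (apply pow_incr; lra).
  assert (0 <= Cmod (z - zeta)) by apply Cmod_ge_0.
  eapply Rle_trans; [exact D|]. replace (2 * Cmod (z - zeta)) with (8 / e ^ 2 * Cmod (z - zeta) * (e / 2) ^ 2) by (field; lra).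
  apply Rmult_le_compat_l; auto. apply Rmult_le_pos; auto. left. apply Rdiv_lt_0_compat; [lra|now apply pow_lt].
Qed.

(** The quantitative core: an explicit linear rate at [zeta]. The factor 1 - |b|^2 is kept on the
    left so that the estimate passes from the b_n to their limit without division, and from there to
    its rotation b. *)
Lemma boundary_lower (c : multiset) (b : C -> C) (zeta : C) (d : R) : Hinfty_critical_set c -> extremal c b ->
  Cmod zeta = 1 -> 0 < d -> (forall z, Cmod (z - zeta) < d -> c z = O) ->
  exists A e, 0 < A /\ 0 < e /\ forall z, Cmod z < 1 -> Cmod (z - zeta) < e ->
    (1 - A * Cmod (z - zeta)) * (1 - Cmod (b z) ^ 2) <= (1 - Cmod z ^ 2) * Cmod (C_derive b z).
Proof.
  intros HC Hex Hz0 Hd Hc.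
  destruct (extremal_approximation c b HC Hex) as [Hb [Sb [bn [g [beta [M [mu [Hg [Ng [HM [Bg [Hmu [Hbeta [Eb [Hcv Hbn]]]]]]]]]]]]]]].
  (* The chord has depth [eta] and ends at distance sqrt(2 eta) < d/2 from [zeta]. With rho <= d/8
     the tangent disks at its ends, of diameter at most d/4, stay within distance d of [zeta], and
     so does the cap; g has no zeros there. *)
  set (eta := Rmin (1 / 2) (d ^ 2 / 16)).
  assert (d2 : 0 < d ^ 2) by now apply pow_lt.
  assert (He : 0 < eta) by (apply Rmin_pos; lra). assert (He1 : eta <= 1 / 2) by apply Rmin_l. assert (He2 : eta <= d ^ 2 / 16) by apply Rmin_r.
  clearbody eta. set (kappa := 1 - eta). set (sigma := sqrt (1 - kappa ^ 2)).
  assert (s2 : sigma ^ 2 = 1 - kappa ^ 2) by (unfold sigma; rewrite pow2_sqrt; [ring|unfold kappa; nra]).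
  assert (s0 : 0 < sigma) by (apply sqrt_lt_R0; unfold kappa; nra).
  clearbody sigma.
  set (rho := Rmin (1 / 2) (d / 8)). assert (Hr : 0 < rho <= 1 / 2) by (split; [apply Rmin_pos; lra|apply Rmin_l]).
  assert (Hr2 : rho <= d / 8) by apply Rmin_r. clearbody rho.
  assert (U : forall s, s = sigma \/ s = - sigma -> Cmod (zeta * (kappa, s)) = 1).
  { intros s Hs'. rewrite Cmod_mult, Hz0, Rmult_1_l. unfold Cmod. simpl fst; simpl snd.
    replace (kappa ^ 2 + s ^ 2) with 1; [apply sqrt_1|]. destruct Hs' as [->| ->]; nra. }
  assert (V : forall s, s = sigma \/ s = - sigma -> Cmod (zeta * (kappa, s) - zeta) ^ 2 = 2 * eta).
  { intros s Hs'. replace (zeta * (kappa, s) - zeta)%C with (zeta * (kappa - 1, s)%R)%C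
      by (unfold Cminus, Cplus, Cmult, Copp; destruct zeta; simpl; f_equal; ring).
    rewrite Cmod_mult, Hz0, Rmult_1_l, Cmod2_expand. simpl fst; simpl snd.
    replace (s ^ 2) with (sigma ^ 2) by (destruct Hs' as [->| ->]; ring). rewrite s2. unfold kappa. ring. }
  set (e0 := sqrt (2 * eta)). assert (e0p : 0 < e0) by (apply sqrt_lt_R0; lra).
  assert (e02 : e0 ^ 2 = 2 * eta) by (unfold e0; rewrite pow2_sqrt; lra).
  assert (W : forall s, s = sigma \/ s = - sigma -> Cmod (zeta * (kappa, s) - zeta) = e0).
  { intros s Hs'. apply Rsqr_inj; [apply Cmod_ge_0|lra|]. unfold Rsqr. specialize (V s Hs'). simpl in V, e02. lra. }
  clearbody e0.
  assert (e0d : e0 < d / 2) by nra.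
  assert (Disk : forall s z, s = sigma \/ s = - sigma -> Cmod (z - RtoC (1 - rho) * (zeta * (kappa, s))) < rho -> g z <> 0).
  { intros s z Hs' Hz. destruct (tangent_disk (zeta * (kappa, s)) z rho (U s Hs') Hr Hz) as [Z1 _]. apply Ng; auto. apply Hc.
    set (xi := (zeta * (kappa, s))%C) in *. assert (W' := W s Hs'). fold xi in W'.
    replace (z - zeta)%C with (z - RtoC (1 - rho) * xi + (- (RtoC rho * xi) + (xi - zeta)))%C by (rewrite RtoC_minus; ring).
    eapply Rle_lt_trans; [apply Cmod_triangle|]. assert (T := Cmod_triangle (- (RtoC rho * xi)) (xi - zeta)).
    rewrite Cmod_opp, Cmod_mult, Cmod_R, (Rabs_right rho), (U s Hs' : Cmod xi = 1) in T by lra. lra. }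
  assert (Reg : forall z, Cmod z < 1 -> kappa <= Re (z * Cconj zeta) -> g z <> 0).
  { intros z Hz Hk. apply Ng; auto. apply Hc.
    assert (E : Cmod (z - zeta) ^ 2 = Cmod z ^ 2 + Cmod zeta ^ 2 - 2 * Re (z * Cconj zeta)).
    { rewrite !Cmod2_expand. destruct z, zeta; simpl. ring. }
    rewrite Hz0 in E. assert (Z := sq_lt_1 _ (Cmod_ge_0 z) Hz). assert (C0 := Cmod_ge_0 (z - zeta)). unfold kappa in Hk. nra. }
  destruct (chord_lower_bound g zeta kappa sigma rho M) as [K0 [HK0 BK]]; auto.
  { intros z. apply Disk. now left. } { intros z. apply Disk. now right. } { intros z Hz E. apply Reg; auto. lra. }
  (* The bound of b_n' from below by g costs a factor M. As the kernels sum to at least 1 on the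
     chord, the extra |ln M| in the exponent absorbs it. *)
  set (K := K0 + Rabs (ln M)). assert (HK : 0 < K) by (generalize (Rabs_pos (ln M)); unfold K; lra).
  destruct (barrier K (zeta * (kappa, sigma)) (zeta * (kappa, (- sigma)%R)) HK) as [psi [Hpsi [Bpsi Epsi]]]; auto.
  set (h := fun z => Re (z * Cconj zeta) - kappa).
  assert (Ineq : forall n z, Cmod z < 1 -> 0 <= h z -> Cmod (psi z) * (1 - Cmod (bn n z) ^ 2) <= Cmod (C_derive (bn n) z) * (1 - Cmod z ^ 2)).
  { intros n z Hz Hh. destruct (Hbn n) as [X1 [X2 [X3 [X4 X5]]]].
    rewrite <- (Cmult_1_r (psi z)).
    (* The competitor is the identity map with weight [psi], and the common factor is 1. This is
       possible since b_n' has no zeros in the cap h >= 0, and its inner boundary h = 0 is the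
       chord. *)
    apply (ahlfors_comparison (fun z => z) (bn n) (fun _ => RtoC 1) (fun _ => RtoC 1) (C_derive (bn n)) psi h); auto using holoD_id, holoD_const, holoD_C_derive.
    - intros w Hw; auto.
    - exists 0. rewrite Cmod_0. split; [lra|apply C1_nz].
    - intros w _. rewrite Cmult_1_l. apply is_cderiv_C_derive, is_cderiv_id.
    - intros w _. now rewrite Cmult_1_l.
    - intros w. unfold h. apply (ccont_ext_loc (fun w => RtoC (Re (w * Cconj zeta)) - RtoC kappa)%C _ w 1); [lra|intros; now rewrite RtoC_minus|].
      apply ccont_minus; [|apply ccont_const]. apply ccont_Re. apply ccont_mult; [apply ccont_id|apply ccont_const].
    - intros w Hw Hh'. apply X4; auto. apply Reg; auto. unfold h in Hh'. lra.
    - intros w Hw Hh'. rewrite Cmult_1_r, Epsi by auto.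
      assert (Ek : Re (w * Cconj zeta) = kappa) by (unfold h in Hh'; lra).
      assert (Q := BK w Hw Ek). assert (X := X5 w Hw).
      destruct (chord_coordinates zeta w kappa sigma Hz0 Hw s0 s2 Ek) as [y [Hy [Ew En]]].
      set (S := (1 - Cmod w ^ 2) / Cmod (zeta * (kappa, sigma) - w) ^ 2 + (1 - Cmod w ^ 2) / Cmod (zeta * (kappa, (- sigma)%R) - w) ^ 2) in *.
      assert (HS : 1 <= S).
      { assert (T : forall s, s = sigma \/ s = - sigma -> Cmod (zeta * (kappa, s) - w) ^ 2 = (s - y) ^ 2).
        { intros s _. rewrite Ew. replace (zeta * (kappa, s) - zeta * (kappa, y))%C with (zeta * (0, s - y)%R)%C
            by (unfold Cminus, Cplus, Cmult, Copp; destruct zeta; simpl; f_equal; ring).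
          rewrite Cmod_mult, Hz0, Rmult_1_l, Cmod2_expand. simpl fst; simpl snd. ring. }
        unfold S. rewrite !T, En by auto.
        replace ((sigma ^ 2 - y ^ 2) / (sigma - y) ^ 2) with ((sigma + y) / (sigma - y)) by (field; lra).
        replace ((sigma ^ 2 - y ^ 2) / (- sigma - y) ^ 2) with ((sigma - y) / (sigma + y)) by (field; lra).
        assert (S1 : 0 < (sigma + y) / (sigma - y)) by (apply Rdiv_lt_0_compat; lra).
        assert (S2 : 0 < (sigma - y) / (sigma + y)) by (apply Rdiv_lt_0_compat; lra).
        assert (T1 : (sigma + y) / (sigma - y) * (sigma - y) = sigma + y) by (field; lra).
        assert (T2 : (sigma - y) / (sigma + y) * (sigma + y) = sigma - y) by (field; lra).
        set (Q1 := (sigma + y) / (sigma - y)) in *. set (Q2 := (sigma - y) / (sigma + y)) in *. clearbody Q1 Q2.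
        destruct (Rle_lt_dec 0 y); nra. }
      clearbody S.
      assert (B0 : 0 < 1 - Cmod (bn n w) ^ 2) by (generalize (sq_lt_1 _ (Cmod_ge_0 (bn n w)) (X2 w Hw)); lra).
      assert (W0 : 0 < 1 - Cmod w ^ 2) by (generalize (sq_lt_1 _ (Cmod_ge_0 w) Hw); lra).
      assert (Y : exp (- (K * S)) * M <= exp (- (K0 * S))).
      { rewrite <- (exp_ln M) by auto. rewrite <- exp_plus. apply exp_mono. unfold K.
        assert (L := Rle_abs (ln M)). assert (L0 := Rabs_pos (ln M)). nra. }
      apply Rmult_le_reg_r with M; auto.
      replace (exp (- (K * S)) * (1 - Cmod (bn n w) ^ 2) * M) with (exp (- (K * S)) * M * (1 - Cmod (bn n w) ^ 2)) by ring.
      apply Rle_trans with (Cmod (g w) * (1 - Cmod w ^ 2) * (1 - Cmod (bn n w) ^ 2)).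
      + apply Rmult_le_compat_r; lra.
      + replace (Cmod (g w) * (1 - Cmod w ^ 2) * (1 - Cmod (bn n w) ^ 2)) with (Cmod (g w) * (1 - Cmod (bn n w) ^ 2) * (1 - Cmod w ^ 2)) by ring.
        replace (Cmod (C_derive (bn n) w) * (1 - Cmod w ^ 2) * M) with (M * Cmod (C_derive (bn n) w) * (1 - Cmod w ^ 2)) by ring.
        apply Rmult_le_compat_r; lra. }
  (* Each of the two Poisson kernels is at most 8/e0^2 |z - zeta| when |z - zeta| <= e0/2, and
     exp(-t) >= 1 - t; the bound [eta] keeps z in the cap. *)
  exists (K * (16 / e0 ^ 2)), (Rmin eta (e0 / 2)).
  assert (e0q : 0 < e0 ^ 2) by now apply pow_lt.
  split; [apply Rmult_lt_0_compat; auto; apply Rdiv_lt_0_compat; lra|]. split; [apply Rmin_pos; lra|].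
  intros z Hz Hd'.
  assert (D1 : Cmod (z - zeta) < eta) by (eapply Rlt_le_trans; [exact Hd'|apply Rmin_l]).
  assert (D2 : Cmod (z - zeta) < e0 / 2) by (eapply Rlt_le_trans; [exact Hd'|apply Rmin_r]).
  assert (Hh : 0 <= h z).
  { unfold h, kappa. assert (R1 := re_le_Cmod ((z - zeta) * Cconj zeta)). rewrite Cmod_mult, Cmod_conj, Hz0, Rmult_1_r in R1.
    apply Rabs_le_between in R1. assert (E := Cmod2_expand zeta). rewrite Hz0 in E.
    replace (Re ((z - zeta) * Cconj zeta)) with (Re (z * Cconj zeta) - 1) in R1; [lra|].
    replace 1 with (fst zeta ^ 2 + snd zeta ^ 2) by lra. destruct z, zeta. simpl. ring. }
  assert (L : Cmod (psi z) * (1 - Cmod (beta z) ^ 2) <= Cmod (C_derive beta z) * (1 - Cmod z ^ 2)).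
  { apply (density_limit (fun n => bn n z) (fun n => C_derive (bn n) z)); try now apply Hcv. intros n. now apply Ineq. }
  assert (Ed : C_derive b z = (mu * C_derive beta z)%C).
  { rewrite <- C_derive_scal by auto. apply is_cderiv_C_derive.
    apply (is_cderiv_ext_loc (fun w => mu * beta w)%C b z _ (1 - Cmod z)); [lra| |].
    - intros w Hw. symmetry. apply Eb. now apply (disk_nbhd z).
    - apply holoD_deriv; auto. now apply holoD_scal. }
  rewrite Ed, Eb, !Cmod_mult, Hmu, !Rmult_1_l by auto.
  rewrite (Rmult_comm (1 - Cmod z ^ 2)). eapply Rle_trans; [|exact L].
  assert (B0 : 0 < 1 - Cmod (beta z) ^ 2).
  { assert (S := Sb z Hz). rewrite Eb, Cmod_mult, Hmu, Rmult_1_l in S by auto. generalize (sq_lt_1 _ (Cmod_ge_0 _) S). lra. }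
  apply Rmult_le_compat_r; [lra|]. rewrite Epsi by auto.
  assert (P1 := poisson_near (zeta * (kappa, sigma)) zeta z e0 (U _ (or_introl eq_refl)) Hz0 (W _ (or_introl eq_refl)) e0p Hz ltac:(lra)).
  assert (P2 := poisson_near (zeta * (kappa, (- sigma)%R)) zeta z e0 (U _ (or_intror eq_refl)) Hz0 (W _ (or_intror eq_refl)) e0p Hz ltac:(lra)).
  set (S := (1 - Cmod z ^ 2) / Cmod (zeta * (kappa, sigma) - z) ^ 2 + (1 - Cmod z ^ 2) / Cmod (zeta * (kappa, (- sigma)%R) - z) ^ 2) in *.
  assert (HS : S <= 16 / e0 ^ 2 * Cmod (z - zeta)) by (unfold S; lra).
  assert (X := exp_ineq1_le (- (K * S))). assert (K * S <= K * (16 / e0 ^ 2 * Cmod (z - zeta))) by (apply Rmult_le_compat_l; lra). lra.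
Qed.

(** * Automorphisms of the disk *)

Lemma circle_separation (T : C -> C) (a : C) (r : R) : holoD T ->
  (forall z w, Cmod z < 1 -> Cmod w < 1 -> T z = T w -> z = w) -> Cmod a < 1 -> 0 < r < 1 - Cmod a ->
  exists m, 0 < m /\ forall w, Cmod (w - a) = r -> m <= Cmod (T w - T a).
Proof.
  intros HT Hinj Ha Hr.
  assert (Hin : forall w, Cmod (w - a) = r -> Cmod w < 1) by (intros w Hw; apply (disk_nbhd a); lra).
  destruct (max_on_compact (fun w => Cmod (w - a) = r) (fun w => - Cmod (T w - T a)) 1) as [w0 [Hw0 Hmax]].
  - intros w Hw. left. auto.
  - intros l Hl. destruct (Req_dec (Cmod (l - a)) r) as [|N]; auto. exfalso.
    assert (P : 0 < Rabs (Cmod (l - a) - r)) by (apply Rabs_pos_lt; lra).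
    destruct (Hl _ P) as [z [E Hd]]. rewrite <- E in Hd. rewrite Rabs_minus_sym in Hd.
    assert (A := Cmod_rtriangle_abs (z - a) (l - a)). replace (z - a - (l - a))%C with (z - l)%C in A by ring. lra.
  - exists (a + RtoC r)%C. replace (a + RtoC r - a)%C with (RtoC r) by ring. rewrite Cmod_R. apply Rabs_right. lra.
  - intros w Hw. apply (ccont_ext_loc (fun w => - RtoC (Cmod (T w - T a)))%C _ w 1); [lra|intros; now rewrite RtoC_opp|].
    apply ccont_opp, ccont_Cmod, ccont_minus; [apply holoD_cont; auto|apply ccont_const].
  - exists (Cmod (T w0 - T a)). split.
    + apply Cmod_minus_pos. intros E. assert (X : w0 = a) by (apply Hinj; auto). rewrite X in Hw0.
      replace (a - a)%C with (RtoC 0) in Hw0 by ring. rewrite Cmod_0 in Hw0. lra.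
    + intros w Hw. assert (B := Hmax w Hw). lra.
Qed.

Lemma min_modulus (H : C -> C) (a : C) (R1 r m : R) : holo_on a R1 H -> 0 < r < R1 -> 0 < m ->
  (forall w, Cmod (w - a) < R1 -> H w <> 0) -> (forall w, Cmod (w - a) = r -> m < Cmod (H w)) -> m < Cmod (H a).
Proof.
  intros HH Hr Hm Hn Hc.
  assert (Ha : Cmod (a - a) < R1) by (replace (a - a)%C with (RtoC 0) by ring; rewrite Cmod_0; lra).
  assert (A := strict_max_modulus (fun w => / H w)%C a R1 r (/ m)).
  assert (B : Cmod (/ H a) < / m).
  { apply A; auto.
    - intros w Hw. destruct (HH w Hw) as [l Hl]. eexists. apply is_cderiv_inv; eauto.
    - intros w Hw. rewrite Cmod_inv by (apply Hn; lra). specialize (Hc w Hw). apply Rinv_lt_contravar; auto. apply Rmult_lt_0_compat; lra. }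
  rewrite Cmod_inv in B by auto. assert (P := Cmod_neq0_pos _ (Hn a Ha)).
  apply Rnot_le_lt. intros L. assert (/ m <= / Cmod (H a)) by (now apply Rinv_le_contravar). lra.
Qed.

(** If T'(a) = 0, take b close to a with T'(b) nonzero. Injectivity makes F = (T - T b)/(z - b)
    zero-free, and the separation of T a from the values on a circle about a makes |F| > eps there.
    The minimum principle gives |F a| > eps, while |T b - T a| <= eps |b - a| says the opposite. *)
Lemma injective_deriv_neq (T : C -> C) (a : C) : holoD T ->
  (forall z w, Cmod z < 1 -> Cmod w < 1 -> T z = T w -> z = w) -> Cmod a < 1 -> C_derive T a <> 0.
Proof.
  intros HT Hinj Ha E. set (r := (1 - Cmod a) / 2). assert (Hr : 0 < r < 1 - Cmod a) by (unfold r; lra). clearbody r.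
  destruct (circle_separation T a r HT Hinj Ha Hr) as [m [Hm Hsep]].
  assert (Hne : exists z, Cmod z < 1 /\ C_derive T z <> 0).
  { apply NNPP. intros N. assert (D0 : forall z, Cmod z < 1 -> is_cderiv T z 0).
    { intros z Hz. replace (RtoC 0) with (C_derive T z); [now apply holoD_deriv|]. apply NNPP. intros N'. apply N. now exists z. }
    assert (Hsep' := Hsep (a + RtoC r)%C). replace (a + RtoC r - a)%C with (RtoC r) in Hsep' by ring.
    rewrite Cmod_R, Rabs_right in Hsep' by lra. specialize (Hsep' eq_refl).
    assert (Q : T (a + RtoC r)%C = T a).
    { assert (Z : forall z, Cmod z < 1 -> T z = T 0).
      { intros z Hz. apply (deriv_zero_const T 0 1); [intros w Hw; apply D0; now replace (w - 0)%C with w in Hw by ring|now replace (z - 0)%C with z by ring]. }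
      rewrite (Z a) by auto. apply Z. apply (disk_nbhd a). replace (a + RtoC r - a)%C with (RtoC r) by ring. rewrite Cmod_R, Rabs_right by lra. lra. }
    rewrite Q in Hsep'. replace (T a - T a)%C with (RtoC 0) in Hsep' by ring. rewrite Cmod_0 in Hsep'. lra. }
  destruct (isolated_zeros (C_derive T) a (holoD_C_derive _ HT) Ha Hne) as [d1 [Hd1 Hiso]].
  set (eps := m / (8 * r)). assert (Heps : 0 < eps) by (apply Rdiv_lt_0_compat; lra).
  assert (Der := holoD_deriv T a HT Ha). rewrite E in Der. destruct (Der eps Heps) as [d2 [Hd2 HD]].
  set (t := Rmin (Rmin d1 d2) r / 2).
  assert (Hm0 : 0 < Rmin (Rmin d1 d2) r) by (repeat apply Rmin_pos; lra).
  assert (m1 : Rmin (Rmin d1 d2) r <= d1) by (eapply Rle_trans; [apply Rmin_l|apply Rmin_l]).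
  assert (m2 : Rmin (Rmin d1 d2) r <= d2) by (eapply Rle_trans; [apply Rmin_l|apply Rmin_r]).
  assert (m3 : Rmin (Rmin d1 d2) r <= r) by apply Rmin_r.
  assert (Ht : 0 < t /\ t < d1 /\ t < d2 /\ t < r) by (unfold t; lra). clearbody t.
  set (b := (a + RtoC t)%C). assert (Eb : Cmod (b - a) = t).
  { unfold b. replace (a + RtoC t - a)%C with (RtoC t) by ring. rewrite Cmod_R, Rabs_right; lra. }
  assert (Nb : b <> a). { intros X. rewrite X in Eb. replace (a - a)%C with (RtoC 0) in Eb by ring. rewrite Cmod_0 in Eb. lra. }
  assert (Hb : Cmod b < 1) by (apply (disk_nbhd a); lra). clearbody b.
  assert (Tb : Cmod (T b - T a) <= eps * t).
  { assert (Q := HD b ltac:(lra)). replace (T b - T a - 0 * (b - a))%C with (T b - T a)%C in Q by ring. now rewrite Eb in Q. }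
  destruct (divide_rootD T b HT Hb) as [F [HF [F1 F2]]].
  assert (NF : forall w, Cmod w < 1 -> F w <> 0).
  { intros w Hw X. destruct (classic (w = b)) as [->|N].
    - apply (Hiso b Nb); [lra|]. now rewrite <- F1.
    - apply N. apply Hinj; auto. rewrite F2, X. ring. }
  assert (M : eps < Cmod (F a)).
  { apply (min_modulus F a (1 - Cmod a) r eps); auto.
    - apply holoD_local; auto. lra.
    - intros w Hw. apply NF. now apply (disk_nbhd a).
    - intros w Hw. assert (S := Hsep w Hw).
      assert (Q : Cmod (T w - T b) = Cmod (w - b) * Cmod (F w)) by (rewrite <- Cmod_mult; f_equal; rewrite (F2 w); ring).
      assert (L1 : m - eps * t <= Cmod (T w - T b)).
      { replace (T w - T a)%C with ((T w - T b) + (T b - T a))%C in S by ring.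
        generalize (Cmod_triangle (T w - T b) (T b - T a)). lra. }
      assert (L2 : Cmod (w - b) <= 2 * r).
      { replace (w - b)%C with ((w - a) - (b - a))%C by ring. generalize (Cmod_minus_le (w - a) (b - a)). lra. }
      assert (Em : eps * (8 * r) = m) by (unfold eps; field; lra). assert (P := Cmod_ge_0 (F w)).
      apply Rnot_le_lt. intros L. assert (Cmod (w - b) * Cmod (F w) <= 2 * r * eps) by (apply Rmult_le_compat; auto; apply Cmod_ge_0).
      assert (eps * t <= eps * r) by (apply Rmult_le_compat_l; lra). lra. }
  assert (Q : Cmod (T b - T a) = Cmod (b - a) * Cmod (F a)).
  { rewrite <- Cmod_mult. f_equal. rewrite (F2 a). ring. }
  rewrite Eb in Q. assert (t * eps < t * Cmod (F a)) by (apply Rmult_lt_compat_l; lra). lra.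
Qed.

(** If x lay outside the circle of radius [r1] about a, T - T x would be zero-free inside it; were T
    x within m/2 of T a, the minimum principle would give |T a - T x| > m/2. For x on the circle the
    separation contradicts this directly. *)
Lemma injective_inverse_cont (T : C -> C) (a : C) (r : R) : holoD T ->
  (forall z w, Cmod z < 1 -> Cmod w < 1 -> T z = T w -> z = w) -> Cmod a < 1 -> 0 < r ->
  exists d, 0 < d /\ forall x, Cmod x < 1 -> Cmod (T x - T a) < d -> Cmod (x - a) < r.
Proof.
  intros HT Hinj Ha Hr0. set (r1 := Rmin r ((1 - Cmod a) / 2)).
  assert (Hr : 0 < r1 < 1 - Cmod a).
  { split; [apply Rmin_pos; lra|]. eapply Rle_lt_trans; [apply Rmin_r|lra]. }
  assert (Hrr : r1 <= r) by apply Rmin_l. clearbody r1.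
  destruct (circle_separation T a r1 HT Hinj Ha Hr) as [m [Hm Hsep]].
  exists (m / 2). split; [lra|]. intros x Hx Hd. apply Rlt_le_trans with r1; auto.
  apply Rnot_le_lt. intros [L|L].
  - set (R1 := Rmin (Cmod (x - a)) (1 - Cmod a)).
    assert (HR : r1 < R1) by (apply Rmin_glb_lt; lra).
    assert (R2 : R1 <= Cmod (x - a)) by apply Rmin_l. assert (R3 : R1 <= 1 - Cmod a) by apply Rmin_r. clearbody R1.
    assert (M : m / 2 < Cmod (T a - T x)).
    { apply (min_modulus (fun w => T w - T x)%C a R1 r1 (m / 2)); try lra.
      - apply holoD_local; [|lra]. apply holoD_minus; auto. apply holoD_const.
      - intros w Hw E. apply Cminus_eq0 in E. apply Hinj in E; auto; [subst; lra|apply (disk_nbhd a); lra].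
      - intros w Hw. assert (S := Hsep w Hw). replace (T w - T a)%C with ((T w - T x) + (T x - T a))%C in S by ring.
        generalize (Cmod_triangle (T w - T x) (T x - T a)). lra. }
    rewrite Cmod_sym in M. lra.
  - assert (S := Hsep x (eq_sym L)). lra.
Qed.

(** The Schwarz-Pick lemma for T and for its inverse. An automorphism is given only as a holomorphic
    bijection, so the inverse [S] is chosen pointwise; it is holomorphic because T' does not vanish
    and the inverse is continuous. *)
Lemma automorphism_density (T : C -> C) (w : C) : disk_automorphism T -> Cmod w < 1 ->
  Cmod (C_derive T w) * (1 - Cmod w ^ 2) = 1 - Cmod (T w) ^ 2.
Proof.
  intros [HT0 [HT1 [Hinj Hsur]]] Hw. assert (HT : holoD T) by now apply holoD_holomorphic.
  apply Rle_antisym; [now apply schwarz_pick|].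
  assert (Hex : forall y, exists x, Cmod y < 1 -> Cmod x < 1 /\ T x = y).
  { intros y. destruct (classic (Cmod y < 1)) as [H|H]; [destruct (Hsur y H) as [x Hx]; now exists x|exists 0; tauto]. }
  set (S := fun y => proj1_sig (constructive_indefinite_description _ (Hex y))).
  assert (HS : forall y, Cmod y < 1 -> Cmod (S y) < 1 /\ T (S y) = y).
  { intros y. exact (proj2_sig (constructive_indefinite_description _ (Hex y))). }
  clearbody S.
  assert (SD : forall a, Cmod a < 1 -> is_cderiv S (T a) (/ C_derive T a)).
  { intros a Ha e He. assert (N := injective_deriv_neq T a HT Hinj Ha). set (t := C_derive T a) in *.
    assert (P := Cmod_neq0_pos _ N). set (q := Cmod t) in *.
    assert (Sa : S (T a) = a) by (destruct (HS (T a) (HT1 a Ha)); apply Hinj; auto).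
    set (e1 := Rmin (q / 2) (e * q ^ 2 / 2)).
    assert (He1 : 0 < e1). { assert (0 < q ^ 2) by now apply pow_lt. apply Rmin_pos; [lra|]. nra. }
    assert (E1 : e1 <= q / 2) by apply Rmin_l. assert (E2 : e1 <= e * q ^ 2 / 2) by apply Rmin_r. clearbody e1.
    destruct (holoD_deriv T a HT Ha e1 He1) as [d1 [Hd1 HD]].
    destruct (injective_inverse_cont T a d1 HT Hinj Ha Hd1) as [d2 [Hd2 HC]].
    exists (Rmin d2 (1 - Cmod (T a))). split; [apply Rmin_pos; auto; specialize (HT1 a Ha); unfold unit_disk in HT1; lra|].
    intros y Hy. assert (Y1 : Cmod y < 1) by (apply (disk_nbhd (T a)); eapply Rlt_le_trans; [exact Hy|apply Rmin_r]).
    assert (Y2 : Cmod (y - T a) < d2) by (eapply Rlt_le_trans; [exact Hy|apply Rmin_l]).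
    destruct (HS y Y1) as [X1 X2]. rewrite Sa. set (x := S y) in *. clearbody x. subst y.
    assert (D := HD x (HC x X1 Y2)). fold t in D. set (u := (T x - T a)%C) in *.
    assert (B : Cmod (x - a) * (q / 2) <= Cmod u).
    { assert (Cmod (t * (x - a)) = q * Cmod (x - a)) by apply Cmod_mult.
      assert (Z := Cmod_minus_le u (u - t * (x - a))). replace (u - (u - t * (x - a)))%C with (t * (x - a))%C in Z by ring.
      assert (e1 * Cmod (x - a) <= q / 2 * Cmod (x - a)) by (apply Rmult_le_compat_r; [apply Cmod_ge_0|auto]). lra. }
    replace (x - a - / t * u)%C with (- (/ t * (u - t * (x - a))))%C by (field; auto).
    rewrite Cmod_opp, Cmod_mult, Cmod_inv by auto. fold q.
    apply Rmult_le_reg_l with q; auto. rewrite <- Rmult_assoc, Rinv_r, Rmult_1_l by lra.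
    eapply Rle_trans; [exact D|]. apply Rle_trans with (e * q ^ 2 / 2 * Cmod (x - a)).
    - apply Rmult_le_compat_r; [apply Cmod_ge_0|auto].
    - replace (e * q ^ 2 / 2 * Cmod (x - a)) with (q * e * (Cmod (x - a) * (q / 2))) by field.
      rewrite <- (Rmult_assoc q e). apply Rmult_le_compat_l; [nra|auto]. }
  assert (HSD : holoD S).
  { intros y Hy. destruct (HS y Hy) as [H1 H2]. exists (/ C_derive T (S y))%C. rewrite <- H2 at 1. now apply SD. }
  assert (Q := schwarz_pick S (T w) HSD (fun y Hy => proj1 (HS y Hy)) (HT1 w Hw)).
  assert (N := injective_deriv_neq T w HT Hinj Hw).
  rewrite (is_cderiv_C_derive _ _ _ (SD w Hw)), Cmod_inv in Q by auto.
  replace (S (T w)) with w in Q by (destruct (HS (T w) (HT1 w Hw)); apply Hinj; auto).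
  assert (P := Cmod_neq0_pos _ N).
  apply Rmult_le_reg_l with (/ Cmod (C_derive T w)); [now apply Rinv_0_lt_compat|].
  rewrite <- (Rmult_assoc _ (Cmod (C_derive T w))), Rinv_l, Rmult_1_l by lra. exact Q.
Qed.

(** The balls of the product uniform structure on [C] are squares, hence the comparison constant
    sqrt 2. *)
Lemma locally_Cmod (zeta : C) (P : C -> Prop) : locally zeta P <-> exists d, 0 < d /\ forall w, Cmod (w - zeta) < d -> P w.
Proof.
  split.
  - intros [e He]. exists e. split; [apply cond_pos|]. intros w Hw. apply He. now apply C_NormedModule_mixin_compat1.
  - intros [d [Hd H]]. assert (Hd2 : 0 < d / 2) by lra. exists (mkposreal _ Hd2). intros w Hw. apply H.
    assert (Q := C_NormedModule_mixin_compat2 _ _ _ Hw). eapply Rlt_le_trans; [exact Q|]. simpl.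
    assert (sqrt 2 <= 2). { rewrite <- (sqrt_Rsqr 2) at 2 by lra. apply sqrt_le_1; unfold Rsqr; lra. }
    nra.
Qed.

Theorem theorem1p8 (c : multiset) (B : C -> C)
  (hB : maximal_Blaschke_product c B) (zeta : C)
  (hzeta : Cmod zeta = 1) (hc : ~ closure (support c) zeta) :
  filterlim
    (fun z : C =>
       (1 - Cmod z ^ 2) * (Cmod (C_derive B z) / (1 - Cmod (B z) ^ 2)))
    (within unit_disk (locally zeta)) (locally 1).
Proof.
  destruct hB as [HC [b [T [Hex [HT HBT]]]]].
  assert (Hd : exists d, 0 < d /\ forall z, Cmod (z - zeta) < d -> c z = O).
  { apply NNPP. intros N. apply hc. intros P HP. apply locally_Cmod in HP. destruct HP as [d [Hd HP]].
    apply NNPP. intros N'. apply N. exists d. split; auto. intros z Hz. destruct (c z) eqn:E; auto.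
    exfalso. apply N'. exists z. split; auto. unfold support. lia. }
  destruct Hd as [d [Hd Hcd]].
  destruct (boundary_lower c b zeta d HC Hex hzeta Hd Hcd) as [A [e0 [HA [He0 Hlow]]]].
  destruct (extremal_approximation c b HC Hex) as [Hb [Sb _]].
  apply filterlim_locally. intros eps.
  apply locally_Cmod. assert (Pe := cond_pos eps). exists (Rmin e0 (eps / A)).
  split; [apply Rmin_pos; auto; now apply Rdiv_lt_0_compat|]. intros z Hz Dz. unfold unit_disk in Dz.
  assert (Z1 : Cmod (z - zeta) < e0) by (eapply Rlt_le_trans; [exact Hz|apply Rmin_l]).
  assert (Z2 : Cmod (z - zeta) < eps / A) by (eapply Rlt_le_trans; [exact Hz|apply Rmin_r]).
  assert (Low := Hlow z Dz Z1). assert (Up := schwarz_pick b z Hb Sb Dz).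
  assert (HTD : holoD T) by (apply holoD_holomorphic; apply HT).
  assert (EB : C_derive B z = (C_derive T (b z) * C_derive b z)%C).
  { apply is_cderiv_C_derive. apply (is_cderiv_ext_loc (fun w => T (b w)) B z _ (1 - Cmod z)); [lra| |].
    - intros w Hw. symmetry. apply HBT. now apply (disk_nbhd z).
    - apply is_cderiv_comp; apply holoD_deriv; auto. }
  assert (AD := automorphism_density T (b z) HT (Sb z Dz)).
  assert (Nb : 0 < 1 - Cmod (b z) ^ 2) by (generalize (sq_lt_1 _ (Cmod_ge_0 _) (Sb z Dz)); lra).
  assert (NB : 0 < 1 - Cmod (T (b z)) ^ 2).
  { assert (S := proj1 (proj2 HT) (b z) (Sb z Dz)). generalize (sq_lt_1 _ (Cmod_ge_0 _) S). lra. }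
  (* Conformal invariance: [AD] replaces 1 - |T (b z)|^2 by |T'(b z)| (1 - |b z|^2), and |T'(b z)|
     cancels. Only the extremal function is left to estimate. *)
  assert (E : Cmod (C_derive B z) / (1 - Cmod (B z) ^ 2) = Cmod (C_derive b z) / (1 - Cmod (b z) ^ 2)).
  { rewrite EB, HBT, Cmod_mult by auto. rewrite <- AD. field. split; [lra|]. intros X. rewrite X in AD. lra. }
  rewrite E. set (q := (1 - Cmod z ^ 2) * (Cmod (C_derive b z) / (1 - Cmod (b z) ^ 2))).
  assert (Eq : q * (1 - Cmod (b z) ^ 2) = (1 - Cmod z ^ 2) * Cmod (C_derive b z)) by (unfold q; field; lra).
  assert (Q1 : 1 - A * Cmod (z - zeta) <= q) by (apply Rmult_le_reg_r with (1 - Cmod (b z) ^ 2); auto; lra).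
  assert (Q2 : q <= 1) by (apply Rmult_le_reg_r with (1 - Cmod (b z) ^ 2); auto; lra).
  assert (Q3 : A * Cmod (z - zeta) < eps).
  { apply Rmult_lt_reg_r with (/ A); [now apply Rinv_0_lt_compat|]. replace (A * Cmod (z - zeta) * / A) with (Cmod (z - zeta)) by (field; lra). exact Z2. }
  change (Rabs (q - 1) < eps). apply Rabs_def1; lra.
Qed.
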